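(* Let $(\mathbb{T}_n)$ be a refining sequence of partitions of $[0,1]$. Suppose that $x\in C[0,1]$ satisfies $x(0)=0$ and admits a continuous quadratic variation $\langle x\rangle$ along $(\mathbb{T}_n)$, that $A\in\mathit{CBV}[0,1]$, and that $b\in C([0,1]\times\mathbb{R})$ satisfies both a local Lipschitz condition and a linear growth condition. Suppose moreover that there is an open interval $I\supset[0,1]$ such that $\sigma(t,\xi)$ is defined for $(t,\xi)\in I\times\mathbb{R}$, belongs to $C^2(I\times\mathbb{R})$, and has bounded first derivatives in $t$ and $\xi$. Then: (i) the flow $\phi(\tau,\xi,t)$, i.e. the function with $\phi(\tau,\xi,0)=\xi$ and $\phi_t(\tau,\xi,t)=\sigma(\tau,\phi(\tau,\xi,t))$, is well-defined for all $\tau\in I$ and $\xi,t\in\mathbb{R}$; (ii) $\phi$ and $\phi_t$ are twice continuously differentiable; (iii) for every $z_0\in\mathbb{R}$ the Stieltjes integral equation $$B(t)=z_0+\int_0^t\frac{b(s,\phi(s,B(s),x(s)))}{\phi_\xi(s,B(s),x(s))}\,dA(s)-\int_0^t\frac{\phi_\tau(s,B(s),x(s))}{\phi_\xi(s,B(s),x(s))}\,ds-\frac12\int_0^t\frac{\phi_{tt}(s,B(s),x(s))}{\phi_\xi(s,B(s),x(s))}\,d\langle x\rangle_s,\quad 0\le t\le1,$$ admits a unique continuous solution $B$; (iv) $z(t):=\phi(t,B(t),x(t))$ is the unique solution of the Itô differential equation $dz(t)=\sigma(t,z(t))\,dx(t)+b(t,z(t))\,dA(t)$ with initial condition $z(0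)=z_0$.
   Context: A refining sequence of partitions is an increasing sequence $\mathbb{T}_1\subset\mathbb{T}_2\subset\cdots$ of finite sets $\{t_0,\dots,t_n\}$, $0=t_0<\dots<t_n=1$, with mesh tending to zero. For $s\in\mathbb{T}_n$, $s'$ is the successor of $s$ in $\mathbb{T}_n$ ($s'=1$ if $s=1$). $\langle x\rangle_t:=\lim_n\sum_{s\in\mathbb{T}_n,s\le t}(x(s')-x(s))^2$; $x$ has continuous quadratic variation if this limit exists for all $t$ and is continuous in $t$. $\mathit{CBV}[0,1]$: continuous functions of bounded variation on $[0,1]$. A function $f$ on $[0,1]\times\mathbb{R}$ satisfies a local Lipschitz condition if for each $p>0$ there is $L_p\ge0$ with $|f(t,\xi)-f(t,\zeta)|\le L_p|\xi-\zeta|$ for $\xi,\zeta\in[-p,p]$, $t\in[0,1]$; it satisfies a linear growth condition if $|f(t,\xi)|\le c(1+|\xi|)$ for some $c\ge0$ and all $t,\xi$. Subscripts $\phi_t,\phi_\tau,\phi_\xi,\phi_{tt}$ denote partial derivatives of $\phi(\tau,\xi,t)$. A function $\eta$ on $[0,1]$ is an admissible integrand for $x$ if there exist $n\in\mathbb{N}$, a continuous $\mathbf{A}:[0,1]\to\mathbb{R}^n$ with components in $\mathit{CBV}[0,1]$, an open $U\subset\mathbb{R}^n\times\mathbb{R}$ with $(\mathbf{A}(t),x(t))\in U$ for all $t$, and a $C^1$ function $f:U\to\mathbb{R}$ such that for every $\mathbf a$ in the projection of $U$ onto $\mathbb{R}^n$ the map $\xi\mapsto f(\mathbf a,\xi)$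 is $C^2$ on its domain, and $\eta(t)=\partial_\xi f(\mathbf{A}(t),x(t))$; for such $\eta$ the Föllmer integral $\int_0^t\eta\,dx:=\lim_n\sum_{s\in\mathbb{T}_n,s\le t}\eta(s)(x(s')-x(s))$ exists. A solution of $dz=\sigma(t,z)\,dx+b(t,z)\,dA$, $z(0)=z_0$, is a $z\in C[0,1]$ such that $t\mapsto\sigma(t,z(t))$ is an admissible integrand for $x$ and $z(t)=z_0+\int_0^t\sigma(s,z(s))\,dx(s)+\int_0^tb(s,z(s))\,dA(s)$ for all $t\in[0,1]$. Integrals against $dA$, $ds$, $d\langle x\rangle_s$ are Riemann--Stieltjes integrals. *)

(* Defs.v *)
From Stdlib Require Import Reals Lra List.
From Coquelicot Require Import Coquelicot.
From mathcomp Require Import ssreflect ssrbool eqtype ssrnat fintype.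
Set Implicit Arguments.
Unset Strict Implicit.
Open Scope R_scope.

Fixpoint pairs (l : list R) : list (R * R) :=
  match l with
  | a :: ((b :: _) as l') => (a, b) :: pairs l'
  | _ => nil
  end.

Definition sumR (l : list R) : R := fold_right Rplus 0 l.

(* \sum_{s in l, s <= t} g s s'  (s' = successor of s in l; the last point
   s = 1 has s' = 1, so it would only contribute g 1 1, which is 0 for all
   increments used below; hence only consecutive pairs are summed). *)
Definition sum_le (l : list R) (t : R) (g : R -> R -> R) : R :=
  sumR (map (fun p : R * R => if Rle_dec (fst p) t then g (fst p) (snd p) else 0)
            (pairs l)).

Definition mesh (l : list R) : R :=
  fold_right Rmax 0 (map (fun p : R * R => snd p - fst p) (pairs l)).

Definition partition01 (l : list R) : Prop :=
  hd_error l = Some 0 /\ List.last l 0 = 1 /\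
  List.Forall (fun p : R * R => fst p < snd p) (pairs l).

Definition refining (T : nat -> list R) : Prop :=
  (forall n, partition01 (T n)) /\
  (forall n s, In s (T n) -> In s (T (S n))) /\
  is_lim_seq (fun n => mesh (T n)) 0.

Definition in01 (t : R) : Prop := 0 <= t <= 1.

Definition cont01 (f : R -> R) : Prop :=
  forall t, in01 t -> forall eps, 0 < eps -> exists delta, 0 < delta /\
    forall s, in01 s -> Rabs (s - t) < delta -> Rabs (f s - f t) < eps.

Definition BV01 (f : R -> R) : Prop :=
  exists M, forall l : list R, List.Forall in01 l ->
    List.Forall (fun p : R * R => fst p <= snd p) (pairs l) ->
    sumR (map (fun p : R * R => Rabs (f (snd p) - f (fst p))) (pairs l)) <= M.

Definition CBV01 (f : R -> R) : Prop := cont01 f /\ BV01 f.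

Definition quad_var (T : nat -> list R) (x qv : R -> R) : Prop :=
  (forall t, in01 t ->
     is_lim_seq (fun n => sum_le (T n) t (fun s s' => (x s' - x s) ^ 2)) (qv t))
  /\ cont01 qv.

Fixpoint tagged_part (a b : R) (P : list (R * R * R)) : Prop :=
  match P with
  | nil => a = b
  | (u, xi, v) :: P' => u = a /\ u < v /\ u <= xi <= v /\ tagged_part v b P'
  end.

Definition tmesh_lt (P : list (R * R * R)) (d : R) : Prop :=
  List.Forall (fun q : R * R * R => snd q - fst (fst q) < d) P.

Definition RS_sum (f g : R -> R) (P : list (R * R * R)) : R :=
  sumR (map (fun q : R * R * R => f (snd (fst q)) * (g (snd q) - g (fst (fst q)))) P).

Definition RS_int (f g : R -> R) (a b v : R) : Prop :=
  forall eps, 0 < eps -> exists delta, 0 < delta /\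
    forall P, tagged_part a b P -> tmesh_lt P delta ->
      Rabs (RS_sum f g P - v) < eps.

Definition C2_1 (D : R -> Prop) (f : R -> R) : Prop :=
  forall u, D u ->
    ex_derive f u /\ ex_derive (Derive f) u /\
    continuous (Derive (Derive f)) u.

Definition d1_2 (f : R -> R -> R) a b := Derive (fun u => f u b) a.
Definition d2_2 (f : R -> R -> R) a b := Derive (fun u => f a u) b.

Definition cont2_at (g : R -> R -> R) a b : Prop :=
  forall eps, 0 < eps -> exists delta, 0 < delta /\
    forall a' b', Rabs (a' - a) < delta -> Rabs (b' - b) < delta ->
      Rabs (g a' b' - g a b) < eps.

Definition C1_2 (D : R -> R -> Prop) (f : R -> R -> R) : Prop :=
  forall a b, D a b ->
    ex_derive (fun u => f u b) a /\ ex_derive (fun u => f a u) b /\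
    cont2_at f a b /\ cont2_at (d1_2 f) a b /\ cont2_at (d2_2 f) a b.

Definition C2_2 (D : R -> R -> Prop) (f : R -> R -> R) : Prop :=
  C1_2 D f /\ C1_2 D (d1_2 f) /\ C1_2 D (d2_2 f).

Definition d1_3 (f : R -> R -> R -> R) a b c := Derive (fun u => f u b c) a.
Definition d2_3 (f : R -> R -> R -> R) a b c := Derive (fun u => f a u c) b.
Definition d3_3 (f : R -> R -> R -> R) a b c := Derive (fun u => f a b u) c.

Definition cont3_at (g : R -> R -> R -> R) a b c : Prop :=
  forall eps, 0 < eps -> exists delta, 0 < delta /\
    forall a' b' c', Rabs (a' - a) < delta -> Rabs (b' - b) < delta ->
      Rabs (c' - c) < delta -> Rabs (g a' b' c' - g a b c) < eps.

Definition C1_3 (D : R -> R -> R -> Prop) (f : R -> R -> R -> R) : Prop :=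
  forall a b c, D a b c ->
    ex_derive (fun u => f u b c) a /\ ex_derive (fun u => f a u c) b /\
    ex_derive (fun u => f a b u) c /\
    cont3_at f a b c /\ cont3_at (d1_3 f) a b c /\
    cont3_at (d2_3 f) a b c /\ cont3_at (d3_3 f) a b c.

Definition C2_3 (D : R -> R -> R -> Prop) (f : R -> R -> R -> R) : Prop :=
  C1_3 D f /\ C1_3 D (d1_3 f) /\ C1_3 D (d2_3 f) /\ C1_3 D (d3_3 f).

Definition vpt (n : nat) : Type := (ordinal n -> R) * R.

Definition vball {n : nat} (p : vpt n) (d : R) (q : vpt n) : Prop :=
  (forall i, Rabs ((fst q) i - (fst p) i) < d) /\ Rabs ((snd q) - (snd p)) < d.

Definition vopen {n : nat} (U : vpt n -> Prop) : Prop :=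
  forall p, U p -> exists d, 0 < d /\ forall q, vball p d q -> U q.

Definition vcont_at {n : nat} (g : vpt n -> R) (p : vpt n) : Prop :=
  forall eps, 0 < eps -> exists d, 0 < d /\
    forall q, vball p d q -> Rabs (g q - g p) < eps.

Definition vupd {n : nat} (a : ordinal n -> R) (i : ordinal n) (h : R) :=
  fun j : ordinal n => if j == i then h else a j.

Definition vpd {n : nat} (f : vpt n -> R) (i : ordinal n) (p : vpt n) : R :=
  Derive (fun h => f (vupd (fst p) i h, (snd p))) ((fst p) i).
Definition vpdxi {n : nat} (f : vpt n -> R) (p : vpt n) : R :=
  Derive (fun h => f ((fst p), h)) (snd p).

Definition vC1 {n : nat} (U : vpt n -> Prop) (f : vpt n -> R) : Prop :=
  forall p, U p ->
    (forall i, ex_derive (fun h => f (vupd (fst p) i h, (snd p))) ((fst p) i)) /\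
    ex_derive (fun h => f ((fst p), h)) (snd p) /\
    vcont_at f p /\ (forall i, vcont_at (vpd f i) p) /\ vcont_at (vpdxi f) p.

Definition admissible (x eta : R -> R) : Prop :=
  exists (n : nat) (A : R -> ordinal n -> R) (U : vpt n -> Prop)
         (f : vpt n -> R),
    (forall i, CBV01 (fun t => A t i)) /\
    vopen U /\
    (forall t, in01 t -> U (A t, x t)) /\
    vC1 U f /\
    (forall a : ordinal n -> R, (exists xi, U (a, xi)) ->
       C2_1 (fun xi => U (a, xi)) (fun xi => f (a, xi))) /\
    (forall t, in01 t -> eta t = vpdxi f (A t, x t)).

Definition follmer_int (T : nat -> list R) (eta x : R -> R) (t v : R) : Prop :=
  is_lim_seq (fun n => sum_le (T n) t (fun s s' => eta s * (x s' - x s))) v.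

Definition is_solution (T : nat -> list R) (x A : R -> R)
    (sigma b : R -> R -> R) (z0 : R) (z : R -> R) : Prop :=
  cont01 z /\
  admissible x (fun t => sigma t (z t)) /\
  forall t, in01 t -> exists v w,
    follmer_int T (fun s => sigma s (z s)) x t v /\
    RS_int (fun s => b s (z s)) A 0 t w /\
    z t = z0 + v + w.

Definition solves_B (x A qv : R -> R) (b : R -> R -> R)
    (phi : R -> R -> R -> R) (z0 : R) (B : R -> R) : Prop :=
  cont01 B /\
  forall t, in01 t -> exists v1 v2 v3,
    RS_int (fun s => b s (phi s (B s) (x s)) / d2_3 phi s (B s) (x s))
      A 0 t v1 /\
    RS_int (fun s => d1_3 phi s (B s) (x s) / d2_3 phi s (B s) (x s))
      (fun s => s) 0 t v2 /\
    RS_int (fun s => d3_3 (d3_3 phi) s (B s) (x s) / d2_3 phi s (B s) (x s))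
      qv 0 t v3 /\
    B t = z0 + v1 - v2 - / 2 * v3.

Definition in_I (alpha beta : Rbar) (t : R) : Prop :=
  Rbar_lt alpha t /\ Rbar_lt t beta.

(* Main.v *)
(** Since the first derivatives of [sigma] are bounded, the flow exists globally (Picard)
    and inherits the smoothness of [sigma] (Gronwall). A path [z] is written as
    [z t = phi t (c t) (x t)] with [c t = phi t (z t) (- x t)]. The Stieltjes equation is
    solved by truncation, Picard iteration and Gronwall, relative to an increasing
    right-continuous [al] dominating the increments of [A], [t] and [qv]. If [c] solves it,
    the second order expansion of [phi] along the partitions gives the Ito formula for [z].

    Conversely, if [z] is a solution, the same expansion identifies [c] as soon as [c] is
    Lipschitz relative to such an [al]. This is the difficulty: admissibility gives
    [sigma t (z t) = f_xi (A t, x t)] where [f] is C^2 in [xi] for each parameter, with no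
    uniformity. A Sard-type lemma is used throughout: a continuous [m] with
    [|m s' - m s| <= K |al s' - al s| + N_s (x s' - x s)^2] is Lipschitz relative to [al]
    with a constant depending on [K] only, whatever the [N_s]. Let [S] be the closed set of
    times near which [c] is not Lipschitz. Off [S], the function
    [xi |-> phi t (c t) xi - f (A t, xi)] is critical at [x t], and the lemma shows that
    [m t = z t - f (A t, x t)] is Lipschitz. If [S] is not empty, Baire's theorem gives a
    portion of [S] on which the slices [f_xi (A t, .)] have a common Lipschitz constant;
    then sums along the partitions extend the Lipschitz bound for [m] across this portion,
    and the lemma, applied now to [c], contradicts the definition of [S]. *)

(* The obstacle is uniqueness in (iv): [z] is an arbitrary solution, and nothing relates its
   admissible representation to the flow. All that the equation gives is the convergence of the sums
   of [dz - sigma dx] to a drift, while a single squared increment of [x] is not controlled by the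
   increment of [al] over the same cell. Two devices answer this. First, a Lipschitz bound for [c]
   on an interval improves itself: whatever the given constant, summation along the partitions
   replaces it by [K0]. All good intervals thus share one constant, so bounds reach the bad times
   where such intervals end. Second, quadratic errors with wild constants [N_s] cannot accumulate.
   Otherwise a whole interval of levels would be parametrised by times [tau y] such that distinct
   levels at distance [l] have values of [x] at distance of order at least [sqrt l]; then [m^2]
   levels give [m^2] values about [1 / m] apart in a bounded set, too many for large [m]. Since a
   control [al] is only increasing and right-continuous, nothing is differentiated along it: all
   estimates compare increments up to [o(d al)] and allow [al] to jump. *)
Require Import Defs.
From Stdlib Require Import ZArith Reals List Lra Lia ClassicalEpsilon FunctionalExtensionality.
From Coquelicot Require Import Coquelicot.
From mathcomp Require eqtype fintype.
Import (canonicals, coercions) eqtype fintype.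
Open Scope R_scope.

(** * Compactness and continuity *)

(* [Q u v d] may depend on the scale [d]; this makes the lemma iterable over
   the coordinates of a box, and yields bounds by taking [Q] to be [|g u| <= / d]. *)
Lemma tube (a b : R) (Q : R -> R -> R -> Prop) :
  (forall u v d d', Q u v d -> 0 < d' <= d -> Q u v d') ->
  (forall x, a <= x <= b -> exists d, 0 < d /\ forall u v, a <= u <= b -> a <= v <= b ->
     Rabs (u - x) < d -> Rabs (v - x) < d -> Q u v d) ->
  exists d, 0 < d /\ forall u v, a <= u <= b -> a <= v <= b -> Rabs (u - v) < d -> Q u v d.
Proof.
  intros Hmono Hloc.
  assert (Hd : forall x, exists d, 0 < d /\ (a <= x <= b -> forall u v, a <= u <= b ->
     a <= v <= b -> Rabs (u - x) < d -> Rabs (v - x) < d -> Q u v d)).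
  { intros x. destruct (classic (a <= x <= b)) as [Hx|Hx].
    - destruct (Hloc x Hx) as [d [Hd H]]. exists d; auto.
    - exists 1; split; [lra | tauto]. }
  set (D := fun x => proj1_sig (constructive_indefinite_description _ (Hd x))).
  assert (HD : forall x, 0 < D x /\ (a <= x <= b -> forall u v, a <= u <= b ->
     a <= v <= b -> Rabs (u - x) < D x -> Rabs (v - x) < D x -> Q u v (D x))).
  { intros x. unfold D. apply proj2_sig. }
  assert (Hpos : forall x, 0 < D x / 2) by (intros x; destruct (HD x); lra).
  destruct (compactness_value_1d a b (fun x => mkposreal _ (Hpos x))) as [d Hc].
  exists d; split; [apply cond_pos |].
  intros u v Hu Hv Huv.
  apply NNPP; intros Hn. apply (Hc u Hu). intros [t [Ht [H1 H2]]]. simpl in *.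
  apply Hn. destruct (HD t) as [_ HQ].
  apply Hmono with (D t).
  - apply HQ; auto; apply Rabs_lt_between in H1; apply Rabs_lt_between in Huv; apply Rabs_lt_between;
      pose proof (cond_pos d); lra.
  - pose proof (cond_pos d). specialize (Hpos t). lra.
Qed.

(** [tube] absorbs the coordinates one after another: the radius it gives for the inner coordinates
    is the local radius for the next one. *)
Lemma box3 (a1 a2 b1 b2 c1 c2 : R) (Q : R -> R -> R -> R -> R -> R -> R -> Prop) :
  (forall a b c a' b' c' d d', Q a b c a' b' c' d -> 0 < d' <= d -> Q a b c a' b' c' d') ->
  (forall a b c, a1 <= a <= a2 -> b1 <= b <= b2 -> c1 <= c <= c2 ->
     exists d, 0 < d /\ forall u v w u' v' w',
       Rabs (u - a) < d -> Rabs (v - b) < d -> Rabs (w - c) < d ->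
       Rabs (u' - a) < d -> Rabs (v' - b) < d -> Rabs (w' - c) < d -> Q u v w u' v' w' d) ->
  exists d, 0 < d /\ forall u v w u' v' w',
    a1 <= u <= a2 -> b1 <= v <= b2 -> c1 <= w <= c2 ->
    a1 <= u' <= a2 -> b1 <= v' <= b2 -> c1 <= w' <= c2 ->
    Rabs (u - u') < d -> Rabs (v - v') < d -> Rabs (w - w') < d -> Q u v w u' v' w' d.
Proof.
  intros Hm Hl.
  destruct (tube a1 a2 (fun u u' d => forall v w v' w',
    b1 <= v <= b2 -> c1 <= w <= c2 -> b1 <= v' <= b2 -> c1 <= w' <= c2 ->
    Rabs (v - v') < d -> Rabs (w - w') < d -> Q u v w u' v' w' d)) as [d [Hd H]].
  - intros u u' d d' H Hd v w v' w' ? ? ? ? ? ?. apply Hm with d; [apply H | ]; auto; lra.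
  - intros a Ha.
    destruct (tube b1 b2 (fun v v' d => forall u w u' w',
      Rabs (u - a) < d -> Rabs (u' - a) < d -> c1 <= w <= c2 -> c1 <= w' <= c2 ->
      Rabs (w - w') < d -> Q u v w u' v' w' d)) as [d [Hd H]].
    + intros v v' d d' H Hd u w u' w' ? ? ? ? ?. apply Hm with d; [apply H | ]; auto; lra.
    + intros b Hb.
      destruct (tube c1 c2 (fun w w' d => forall u v u' v',
        Rabs (u - a) < d -> Rabs (u' - a) < d -> Rabs (v - b) < d -> Rabs (v' - b) < d ->
        Q u v w u' v' w' d)) as [d [Hd H]].
      * intros w w' d d' H Hd u v u' v' ? ? ? ?. apply Hm with d; [apply H | ]; auto; lra.
      * intros c Hc. destruct (Hl a b c Ha Hb Hc) as [d [Hd H]].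
        exists d; split; auto.
      * exists d; split; [auto|]. intros v v' Hv Hv' H1 H2 u w u' w' ? ? ? ? ?.
        apply H; auto.
    + exists d; split; [auto|]. intros u u' Hu Hu' H1 H2 v w v' w' ? ? ? ? ? ?.
      apply H; auto.
  - exists d; split; [auto|]. intros u v w u' v' w' ? ? ? ? ? ? ? ? ?.
    apply H; auto.
Qed.

Lemma cont3_uniform (g : R -> R -> R -> R) (a1 a2 b1 b2 c1 c2 : R) :
  (forall a b c, a1 <= a <= a2 -> b1 <= b <= b2 -> c1 <= c <= c2 -> cont3_at g a b c) ->
  forall eps, 0 < eps -> exists d, 0 < d /\ forall u v w u' v' w',
    a1 <= u <= a2 -> b1 <= v <= b2 -> c1 <= w <= c2 ->
    a1 <= u' <= a2 -> b1 <= v' <= b2 -> c1 <= w' <= c2 ->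
    Rabs (u - u') < d -> Rabs (v - v') < d -> Rabs (w - w') < d ->
    Rabs (g u v w - g u' v' w') < eps.
Proof.
  intros Hg eps He.
  apply (box3 a1 a2 b1 b2 c1 c2 (fun u v w u' v' w' _ => Rabs (g u v w - g u' v' w') < eps)).
  - auto.
  - intros a b c Ha Hb Hc. destruct (Hg a b c Ha Hb Hc (eps / 2)) as [d [Hd H]]; [lra|].
    exists d; split; [auto|]. intros.
    assert (Rabs (g u v w - g a b c) < eps / 2) by auto.
    assert (Rabs (g u' v' w' - g a b c) < eps / 2) by auto.
    apply Rabs_lt_between in H6. apply Rabs_lt_between in H7. apply Rabs_lt_between. lra.
Qed.

Lemma cont3_bounded (g : R -> R -> R -> R) (a1 a2 b1 b2 c1 c2 : R) :
  (forall a b c, a1 <= a <= a2 -> b1 <= b <= b2 -> c1 <= c <= c2 -> cont3_at g a b c) ->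
  exists M, 0 < M /\ forall u v w, a1 <= u <= a2 -> b1 <= v <= b2 -> c1 <= w <= c2 ->
    Rabs (g u v w) <= M.
Proof.
  intros Hg.
  destruct (box3 a1 a2 b1 b2 c1 c2 (fun u v w _ _ _ d => Rabs (g u v w) <= / d)) as [d [Hd H]].
  - intros. eapply Rle_trans; [eassumption|]. apply Rinv_le_contravar; lra.
  - intros a b c Ha Hb Hc. destruct (Hg a b c Ha Hb Hc 1) as [d [Hd H]]; [lra|].
    set (M := Rabs (g a b c) + 1).
    assert (HM : 0 < M) by (unfold M; pose proof (Rabs_pos (g a b c)); lra).
    (* A radius below [/ M] turns the local bound [M] into a bound by the inverse of the scale,
       which survives the passage to the uniform radius. *)
    exists (Rmin d (/ M)); split.
    { apply Rmin_pos; auto. now apply Rinv_0_lt_compat. }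
    intros. assert (Hm := Rmin_l d (/ M)).
    assert (Rabs (g u v w - g a b c) < 1) by (apply H; lra).
    assert (Rabs (g u v w) <= M).
    { unfold M. replace (g u v w) with ((g u v w - g a b c) + g a b c) by ring.
      eapply Rle_trans; [apply Rabs_triang|]. lra. }
    eapply Rle_trans; [eassumption|].
    apply Rle_trans with (/ / M); [rewrite Rinv_inv; lra|]. apply Rinv_le_contravar.
    + apply Rmin_pos; auto. now apply Rinv_0_lt_compat.
    + apply Rmin_r.
  - exists (/ d). split; [now apply Rinv_0_lt_compat|].
    intros u v w Hu Hv Hw.
    assert (Hz : forall r, Rabs (r - r) < d).
    { intros r. replace (r - r) with 0 by ring. now rewrite Rabs_R0. }
    apply (H u v w u v w); auto.
Qed.

Lemma cont01_uniform f : cont01 f -> forall eps, 0 < eps -> exists d, 0 < d /\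
  forall s t, in01 s -> in01 t -> Rabs (s - t) < d -> Rabs (f s - f t) < eps.
Proof.
  intros Hf eps He.
  apply (tube 0 1 (fun s t _ => Rabs (f s - f t) < eps)).
  - auto.
  - intros x Hx. destruct (Hf x Hx (eps / 2)) as [d [Hd H]]; [lra|].
    exists d; split; [auto|]. intros u v Hu Hv H1 H2.
    apply H in H1; [|exact Hu]. apply H in H2; [|exact Hv].
    apply Rabs_lt_between in H1. apply Rabs_lt_between in H2. apply Rabs_lt_between. lra.
Qed.

Lemma cont01_bounded f : cont01 f -> exists M, 0 < M /\ forall t, in01 t -> Rabs (f t) <= M.
Proof.
  intros Hf.
  destruct (tube 0 1 (fun s _ d => Rabs (f s) <= / d)) as [d [Hd H]].
  - intros. eapply Rle_trans; [eassumption|]. apply Rinv_le_contravar; lra.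
  - intros x Hx. destruct (Hf x Hx 1) as [d [Hd H]]; [lra|].
    set (M := Rabs (f x) + 1).
    assert (HM : 0 < M) by (unfold M; pose proof (Rabs_pos (f x)); lra).
    assert (HiM := Rinv_0_lt_compat _ HM).
    exists (Rmin d (/ M)); split; [apply Rmin_pos; auto|].
    intros u v Hu Hv H1 H2. assert (Hm := Rmin_l d (/ M)).
    assert (Hu' : Rabs (f u - f x) < 1) by (apply H; [exact Hu | lra]).
    assert (Rabs (f u) <= M).
    { unfold M. replace (f u) with ((f u - f x) + f x) by ring.
      eapply Rle_trans; [apply Rabs_triang|]. lra. }
    eapply Rle_trans; [eassumption|].
    apply Rle_trans with (/ / M); [rewrite Rinv_inv; lra|]. apply Rinv_le_contravar; [apply Rmin_pos; auto | apply Rmin_r].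
  - exists (/ d). split; [now apply Rinv_0_lt_compat|].
    intros t Ht. apply (H t t); auto. replace (t - t) with 0 by ring. now rewrite Rabs_R0.
Qed.

Lemma cont01_plus f g : cont01 f -> cont01 g -> cont01 (fun t => f t + g t).
Proof.
  intros Hf Hg t Ht eps He.
  destruct (Hf t Ht (eps / 2)) as [d [Hd H]]; [lra|].
  destruct (Hg t Ht (eps / 2)) as [d' [Hd' H']]; [lra|].
  exists (Rmin d d'); split; [apply Rmin_pos; auto|]. intros s Hs Hst.
  assert (H1 : Rabs (f s - f t) < eps / 2) by (apply H; auto; eapply Rlt_le_trans; [apply Hst|apply Rmin_l]).
  assert (H2 : Rabs (g s - g t) < eps / 2) by (apply H'; auto; eapply Rlt_le_trans; [apply Hst|apply Rmin_r]).
  apply Rabs_lt_between in H1. apply Rabs_lt_between in H2. apply Rabs_lt_between. lra.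
Qed.

Lemma cont01_id : cont01 (fun t => t).
Proof. intros t Ht eps He. exists eps; auto. Qed.

Lemma cont01_const c : cont01 (fun _ => c).
Proof.
  intros t Ht eps He. exists 1; split; [lra|]. intros. replace (c - c) with 0 by ring.
  now rewrite Rabs_R0.
Qed.

Lemma cont01_scal c f : cont01 f -> cont01 (fun t => c * f t).
Proof.
  intros Hf t Ht eps He.
  assert (Hc : 0 < Rabs c + 1) by (pose proof (Rabs_pos c); lra).
  destruct (Hf t Ht (eps / (Rabs c + 1))) as [d [Hd H]].
  { apply Rdiv_lt_0_compat; auto. }
  exists d; split; auto. intros s Hs Hst. specialize (H s Hs Hst).
  replace (c * f s - c * f t) with (c * (f s - f t)) by ring. rewrite Rabs_mult.
  apply Rle_lt_trans with ((Rabs c) * (eps / (Rabs c + 1))).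
  - apply Rmult_le_compat_l; [apply Rabs_pos | lra].
  - replace eps with ((Rabs c + 1) * (eps / (Rabs c + 1))) at 2 by (field; lra).
    apply Rmult_lt_compat_r; [apply Rdiv_lt_0_compat; auto | lra].
Qed.

Lemma cont01_ext f g : (forall t, in01 t -> f t = g t) -> cont01 f -> cont01 g.
Proof.
  intros He Hf t Ht eps Hp. destruct (Hf t Ht eps Hp) as [d [Hd H]].
  exists d; split; auto. intros s Hs Hst. rewrite <- !He; auto.
Qed.

Lemma cont01_comp3 g u v w : cont01 u -> cont01 v -> cont01 w ->
  (forall t, in01 t -> cont3_at g (u t) (v t) (w t)) ->
  cont01 (fun t => g (u t) (v t) (w t)).
Proof.
  intros Hu Hv Hw Hg t Ht eps He.
  destruct (Hg t Ht eps He) as [d [Hd H]].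
  destruct (Hu t Ht d Hd) as [d1 [Hd1 H1]].
  destruct (Hv t Ht d Hd) as [d2 [Hd2 H2]].
  destruct (Hw t Ht d Hd) as [d3 [Hd3 H3]].
  exists (Rmin d1 (Rmin d2 d3)); split; [repeat apply Rmin_pos; auto|].
  intros s Hs Hst.
  pose proof (Rmin_l d1 (Rmin d2 d3)). pose proof (Rmin_r d1 (Rmin d2 d3)).
  pose proof (Rmin_l d2 d3). pose proof (Rmin_r d2 d3).
  apply H; [apply H1 | apply H2 | apply H3]; auto; lra.
Qed.

(** * Local-to-global comparison along an interval *)

Lemma locally_monotone (H : R -> R) (d p q : R) : 0 < d -> p <= q ->
  (forall s t, p <= s -> s <= t -> t <= q -> t - s < d -> H s <= H t) -> H p <= H q.
Proof.
  intros Hd Hpq Hl.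
  assert (Hn : forall n s, p <= s <= q -> q - s <= INR n * (d / 2) -> H s <= H q).
  { induction n as [|n IH]; intros s Hs Hle.
    - simpl in Hle. replace q with s by lra. lra.
    - rewrite S_INR in Hle. destruct (Rle_dec (q - s) (d / 2)) as [H1|H1].
      + apply Hl; lra.
      + apply Rle_trans with (H (s + d / 2)); [apply Hl; lra | apply IH; lra]. }
  destruct (INR_unbounded ((q - p) / (d / 2))) as [n Hb].
  apply (Hn n p); [lra|].
  apply Rmult_lt_compat_r with (r := d / 2) in Hb; [|lra].
  replace ((q - p) / (d / 2) * (d / 2)) with (q - p) in Hb by (field; lra). lra.
Qed.

(** [G + eps * al - D] increases over short steps, hence over [[p, q]]; then [eps] tends to 0. This
    plays the role of integrating a differential inequality: comparisons up to [o(al)] between near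
    times become exact ones between distant times. *)
Lemma chain (D G al : R -> R) (p q : R) : p <= q ->
  (forall eps, 0 < eps -> exists d, 0 < d /\ forall s t, p <= s -> s <= t -> t <= q ->
     t - s < d -> D t - D s <= G t - G s + eps * (al t - al s)) ->
  D q - D p <= G q - G p.
Proof.
  intros Hpq H. apply le_epsilon. intros e He.
  assert (Ha : 0 < Rabs (al q - al p) + 1) by (pose proof (Rabs_pos (al q - al p)); lra).
  set (eps := e / (Rabs (al q - al p) + 1)).
  assert (Hp : 0 < eps) by (apply Rdiv_lt_0_compat; auto).
  destruct (H eps Hp) as [d [Hd Hl]].
  assert (Hm := locally_monotone (fun t => G t + eps * al t - D t) d p q Hd Hpq).
  simpl in Hm.
  assert (Hq : G p + eps * al p - D p <= G q + eps * al q - D q).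
  { apply Hm. intros s t ? ? ? ?. specialize (Hl s t). lra. }
  assert (eps * (al q - al p) <= e); [|lra].
  apply Rle_trans with (eps * (Rabs (al q - al p) + 1)).
  - apply Rmult_le_compat_l; [lra|]. pose proof (Rle_abs (al q - al p)). lra.
  - unfold eps. right. field. lra.
Qed.

Lemma chain_abs (D G al : R -> R) (p q : R) : p <= q ->
  (forall eps, 0 < eps -> exists d, 0 < d /\ forall s t, p <= s -> s <= t -> t <= q ->
     t - s < d -> Rabs (D t - D s) <= G t - G s + eps * (al t - al s)) ->
  Rabs (D q - D p) <= G q - G p.
Proof.
  intros Hpq H. apply Rabs_le. split.
  - assert (Hc := chain (fun t => - D t) G al p q Hpq). simpl in Hc.
    assert (- D q - - D p <= G q - G p); [|lra]. apply Hc.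
    intros eps He. destruct (H eps He) as [d [Hd Hl]]. exists d; split; auto.
    intros s t ? ? ? ?. specialize (Hl s t). pose proof (Rabs_maj2 (D t - D s)).
    assert (Rabs (D t - D s) <= G t - G s + eps * (al t - al s)) by auto. lra.
  - apply (chain D G al p q Hpq).
    intros eps He. destruct (H eps He) as [d [Hd Hl]]. exists d; split; auto.
    intros s t ? ? ? ?. specialize (Hl s t). pose proof (Rle_abs (D t - D s)).
    assert (Rabs (D t - D s) <= G t - G s + eps * (al t - al s)) by auto. lra.
Qed.

(** * A Baire argument and a Sard-type lemma *)

(** Nested windows. The third hypothesis says that [Z n] is nowhere dense in [S]; the smaller window
    is asked to avoid [Z n] up to its end points, because the limit point is only known to lie in
    the closed windows. *)
Lemma baire (S : R -> Prop) (Z : nat -> R -> Prop) (p q : R) :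
  (forall t, (forall d, 0 < d -> exists s, S s /\ Rabs (s - t) < d) -> S t) ->
  (exists s, S s /\ p < s < q) ->
  (forall n u v, p <= u -> v <= q -> (exists s, S s /\ u < s < v) ->
     exists u' v', u <= u' /\ v' <= v /\ (exists s, S s /\ u' < s < v') /\
       forall s, S s -> u' <= s <= v' -> ~ Z n s) ->
  exists s, S s /\ p <= s <= q /\ forall n, ~ Z n s.
Proof.
  intros Hcl Hne Hst.
  set (ok := fun I : R * R => p <= fst I /\ snd I <= q /\ exists s, S s /\ fst I < s < snd I).
  assert (Hstep : forall n I, exists J, ok I -> ok J /\ fst I <= fst J /\ snd J <= snd I /\
     snd J - fst J <= / INR (n + 1) /\
     forall s, S s -> fst J <= s <= snd J -> ~ Z n s).
  { intros n I. destruct (classic (ok I)) as [HI|HI].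
    - destruct HI as [H1 [H2 [s [Hs Hsi]]]].
      assert (Hn : 0 < / INR (n + 1)).
      { apply Rinv_0_lt_compat, lt_0_INR. lia. }
      (* Before [Z n] is avoided, the window is cut to length at most [/ INR (n + 1)] around a point
         of [S]. The limit is then approached by points of [S], and belongs to [S] by closedness. *)
      set (h := / INR (n + 1) / 2).
      destruct (Hst n (Rmax (fst I) (s - h)) (Rmin (snd I) (s + h))) as [u [v [Hu [Hv [Hs' Hz]]]]].
      + eapply Rle_trans; [apply H1 | apply Rmax_l].
      + eapply Rle_trans; [apply Rmin_l | apply H2].
      + exists s; split; auto. split.
        * apply Rmax_lub_lt; unfold h; lra.
        * apply Rmin_glb_lt; unfold h; lra.
      + exists (u, v). intros _. unfold ok; simpl.
        pose proof (Rmax_l (fst I) (s - h)). pose proof (Rmax_r (fst I) (s - h)).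
        pose proof (Rmin_l (snd I) (s + h)). pose proof (Rmin_r (snd I) (s + h)).
        unfold h in *.
        repeat split; auto; try lra.
    - exists I. tauto. }
  set (next := fun n I => proj1_sig (constructive_indefinite_description _ (Hstep n I))).
  assert (Hnext : forall n I, ok I -> ok (next n I) /\ fst I <= fst (next n I) /\
     snd (next n I) <= snd I /\ snd (next n I) - fst (next n I) <= / INR (n + 1) /\
     forall s, S s -> fst (next n I) <= s <= snd (next n I) -> ~ Z n s).
  { intros n I. unfold next. apply proj2_sig. }
  set (J := fix J n := match n with O => (p, q) | Datatypes.S k => next k (J k) end).
  assert (Hok : forall n, ok (J n)).
  { induction n; simpl.
    - unfold ok; simpl. repeat split; try lra. exact Hne.
    - now apply Hnext. }
  assert (Hmon : forall n k, fst (J n) <= fst (J (n + k)%nat) /\ snd (J (n + k)%nat) <= snd (J n)).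
  { intros n; induction k.
    - rewrite Nat.add_0_r. lra.
    - rewrite Nat.add_succ_r. simpl. destruct (Hnext (n + k)%nat (J (n + k)%nat) (Hok _)) as [_ [H1 [H2 _]]].
      lra. }
  assert (Hord : forall n m, fst (J n) <= snd (J m)).
  { intros n m. destruct (Hmon n m) as [H1 _]. destruct (Hmon m n) as [_ H2].
    rewrite Nat.add_comm in H2. destruct (Hok (n + m)%nat) as [_ [_ [s [_ Hs]]]]. lra. }
  destruct (completeness (fun r => exists n, r = fst (J n))) as [t [Ht1 Ht2]].
  - exists (snd (J 0%nat)). intros r [n ->]. apply Hord.
  - exists (fst (J 0%nat)), 0%nat. reflexivity.
  - assert (Hin : forall n, fst (J n) <= t <= snd (J n)).
    { intros n; split; [apply Ht1; exists n; auto|]. apply Ht2. intros r [m ->]. apply Hord. }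
    assert (HS : S t).
    { apply Hcl. intros d Hd. destruct (archimed_cor1 d Hd) as [N [HN HN0]].
      destruct (Hok (Datatypes.S N)) as [_ [_ [s [Hs Hsi]]]].
      exists s; split; auto.
      pose proof (Hin (Datatypes.S N)). simpl in *.
      destruct (Hnext N (J N) (Hok N)) as [_ [_ [_ [Hlen _]]]].
      assert (/ INR (N + 1) < d).
      { eapply Rle_lt_trans; [|apply HN]. apply Rinv_le_contravar; [now apply lt_0_INR|].
        apply le_INR. lia. }
      apply Rabs_lt_between. lra. }
    exists t; split; auto. split; [apply (Hin 0%nat)|].
    intros n. destruct (Hnext n (J n) (Hok n)) as [_ [_ [_ [_ Hz]]]].
    apply Hz; auto. apply (Hin (Datatypes.S n)).
Qed.

(** Pigeonhole: cut [[-M, M]] into cells of length [e]. Two points in one cell are less than [e]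
    apart, so [c] is injective, and its values are below [K]. *)
Lemma packing (X : nat -> R) (M e : R) (k K : nat) : 0 < e ->
  (forall i, (i < k)%nat -> Rabs (X i) <= M) ->
  (forall i j, (i < k)%nat -> (j < k)%nat -> i <> j -> e <= Rabs (X i - X j)) ->
  2 * M / e < INR K -> (k <= K)%nat.
Proof.
  intros He HM Hs HK.
  set (c := fun i => Z.to_nat (Int_part ((X i + M) / e))).
  assert (Hb : forall i, (i < k)%nat -> 0 <= (X i + M) / e <= 2 * M / e).
  { intros i Hi. specialize (HM i Hi). apply Rabs_le_between in HM. split.
    - apply Rdiv_le_0_compat; lra.
    - apply Rmult_le_compat_r; [left; now apply Rinv_0_lt_compat | lra]. }
  assert (Hz : forall i, (i < k)%nat -> (0 <= Int_part ((X i + M) / e))%Z).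
  { intros i Hi. destruct (base_Int_part ((X i + M) / e)) as [_ H]. destruct (Hb i Hi) as [H0 _].
    assert (-1 < Int_part ((X i + M) / e))%Z; [|lia]. apply lt_IZR. simpl. lra. }
  assert (Hlen : (length (map c (List.seq 0 k)) <= length (List.seq 0 K))%nat).
  { apply NoDup_incl_length.
    - assert (Hinj : forall i j, (i < k)%nat -> (j < k)%nat -> c i = c j -> i = j).
      { intros i j Hi Hj Hc. apply NNPP; intros Hn.
        specialize (Hs i j Hi Hj Hn). unfold c in Hc.
        apply Z2Nat.inj in Hc; auto.
        destruct (base_Int_part ((X i + M) / e)) as [H1 H2].
        destruct (base_Int_part ((X j + M) / e)) as [H3 H4].
        rewrite Hc in H1, H2.
        assert (Hd : Rabs ((X i + M) / e - (X j + M) / e) < 1) by (apply Rabs_lt_between; lra).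
        replace ((X i + M) / e - (X j + M) / e) with ((X i - X j) / e) in Hd by (field; lra).
        unfold Rdiv in Hd. rewrite Rabs_mult in Hd.
        rewrite (Rabs_right (/ e)) in Hd by (left; now apply Rinv_0_lt_compat).
        apply Rmult_lt_compat_r with (r := e) in Hd; auto.
        rewrite Rmult_assoc, Rinv_l in Hd by lra. lra. }
      apply NoDup_map_NoDup_ForallPairs; [|apply seq_NoDup].
      intros i j Hi Hj. apply in_seq in Hi. apply in_seq in Hj. apply Hinj; lia.
    - intros r Hr. apply in_map_iff in Hr. destruct Hr as [i [<- Hi]].
      apply in_seq in Hi. apply in_seq. split; [lia|]. simpl.
      destruct (Hb i) as [H1 H2]; [lia|]. unfold c.
      apply INR_lt. rewrite INR_IZR_INZ, Z2Nat.id by (apply Hz; lia).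
      destruct (base_Int_part ((X i + M) / e)) as [H3 _]. lra. }
  rewrite length_map, !length_seq in Hlen. exact Hlen.
Qed.

(* The function [X] would be inverse to a surjection that is 2-Hoelder near each
   point, so that level sets with a uniform constant are nowhere dense by packing. *)
Lemma no_pointwise_half_holder (X : R -> R) (M a b : R) : a < b ->
  (forall y, a <= y <= b -> Rabs (X y) <= M) ->
  (forall y, a <= y <= b -> exists N, 0 < N /\
     forall y', a <= y' <= b -> Rabs (y' - y) <= N * (X y' - X y) ^ 2) -> False.
Proof.
  intros Hab HM HN.
  set (Z := fun n y => a <= y <= b /\
     forall y', a <= y' <= b -> Rabs (y' - y) <= INR n * (X y' - X y) ^ 2).
  assert (HM0 : 0 <= M) by (eapply Rle_trans; [apply Rabs_pos | apply (HM a); lra]).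
  destruct (baire (fun y => a <= y <= b) Z a b) as [y [Hy [_ Hz]]].
  - intros t Ht. apply NNPP; intros Hn.
    assert (Hd : 0 < Rmax (a - t) (t - b)).
    { apply not_and_or in Hn. destruct Hn as [Hn|Hn]; apply Rnot_le_lt in Hn.
      - eapply Rlt_le_trans; [|apply Rmax_l]; lra.
      - eapply Rlt_le_trans; [|apply Rmax_r]; lra. }
    destruct (Ht _ Hd) as [s [Hs Hst]]. apply Rabs_lt_between in Hst.
    revert Hst. apply Rmax_case_strong; intros; lra.
  - exists ((a + b) / 2). lra.
  - intros n u v Hu Hv [s [Hs Hsuv]].
    apply NNPP; intros Hcon.
    assert (Hd : forall u' v', u <= u' -> u' < v' -> v' <= v -> exists y, u' <= y <= v' /\ Z n y).
    { intros u' v' H1 H2 H3. apply NNPP; intros H4. apply Hcon. exists u', v'.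
      repeat split; auto.
      - exists ((u' + v') / 2). lra.
      - intros y Hy Hy' HZ. apply H4. exists y; auto. }
    (* A point of [Z 0] would coincide with both [a] and [b]. For positive [n] one may divide by
       [INR n]. *)
    destruct (classic (n = 0%nat)) as [->|Hn0].
    { destruct (Hd u v) as [y [Hy [Hy1 Hy2]]]; try lra.
      assert (Ha := Hy2 a). assert (Hb := Hy2 b). simpl in Ha, Hb.
      rewrite Rmult_0_l in Ha, Hb.
      assert (Ha' : Rabs (a - y) <= 0) by (apply Ha; lra).
      assert (Hb' : Rabs (b - y) <= 0) by (apply Hb; lra).
      apply Rabs_le_between in Ha'. apply Rabs_le_between in Hb'. lra. }
    assert (Hn : 0 < INR n) by (apply lt_0_INR; lia).
    set (L := v - u). assert (HL : 0 < L) by (unfold L; lra).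
    (* Take [k = m^2] points of [Z n], one in every other interval of length [l = L / (2 k)]. They
       are at least [l] apart, so their values under [X] are at least [sqrt (l / n) = w / m] apart.
       By packing there are at most [c * m] of them, where [2 * M / w < c], and [m = c + 1] is too
       large. *)
    set (w := sqrt (L / (2 * INR n))).
    assert (Hw2 : w * w = L / (2 * INR n)).
    { unfold w. apply sqrt_sqrt. apply Rdiv_le_0_compat; lra. }
    assert (Hw : 0 < w).
    { unfold w. apply sqrt_lt_R0. apply Rdiv_lt_0_compat; lra. }
    destruct (INR_unbounded (2 * M / w)) as [c Hc].
    set (m := S c). set (k := (m * m)%nat).
    assert (Hm : 0 < INR m) by (apply lt_0_INR; unfold m; lia).
    set (l := L / (2 * INR k)).
    assert (HINRk : INR k = INR m * INR m) by (unfold k; apply mult_INR).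
    assert (Hk : 0 < INR k) by (rewrite HINRk; nra).
    assert (Hl : 0 < l) by (unfold l; apply Rdiv_lt_0_compat; lra).
    assert (HlL : 2 * INR k * l = L) by (unfold l; field; lra).
    assert (Hy : forall i, exists y, (i < k)%nat -> u + 2 * INR i * l <= y <= u + (2 * INR i + 1) * l /\ Z n y).
    { intros i. destruct (le_lt_dec k i) as [H|H].
      - exists 0; intros; lia.
      - destruct (Hd (u + 2 * INR i * l) (u + (2 * INR i + 1) * l)) as [y Hy].
        + pose proof (pos_INR i). nra.
        + nra.
        + assert (H0 : INR (S i) <= INR k) by (apply le_INR; lia).
          rewrite S_INR in H0.
          assert ((2 * INR i + 1) * l <= 2 * INR k * l) by (apply Rmult_le_compat_r; lra).
          unfold L in *. lra.
        + exists y; auto. }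
    set (Y := fun i => proj1_sig (constructive_indefinite_description _ (Hy i))).
    assert (HY : forall i, (i < k)%nat -> u + 2 * INR i * l <= Y i <= u + (2 * INR i + 1) * l /\ Z n (Y i)).
    { intros i. unfold Y. apply proj2_sig. }
    assert (Hkm : (k <= c * m)%nat).
    { apply (packing (fun i => X (Y i)) M (w / INR m)).
      - apply Rdiv_lt_0_compat; auto.
      - intros i Hi. destruct (HY i Hi) as [_ [H _]]. now apply HM.
      - assert (Hlt : forall i j, (i < j)%nat -> (j < k)%nat ->
          w / INR m <= Rabs (X (Y i) - X (Y j))).
        { intros i j Hij Hj. assert (Hi : (i < k)%nat) by lia.
          destruct (HY i Hi) as [Hi1 [Hi2 Hi3]]. destruct (HY j Hj) as [Hj1 [Hj2 Hj3]].
          specialize (Hi3 (Y j) Hj2).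
          assert (Hji : INR i + 1 <= INR j).
          { replace (INR i + 1) with (INR (i + 1)) by (rewrite plus_INR; simpl; lra).
            apply le_INR. lia. }
          assert (Hdist : l <= Rabs (Y j - Y i)).
          { eapply Rle_trans; [|apply Rle_abs].
            assert ((2 * INR i + 2) * l <= 2 * INR j * l) by (apply Rmult_le_compat_r; lra).
            lra. }
          assert (Hsq : (w / INR m) ^ 2 <= (X (Y j) - X (Y i)) ^ 2).
          { apply Rmult_le_reg_l with (INR n); auto.
            apply Rle_trans with l; [|lra]. right.
            replace ((w / INR m) ^ 2) with ((w * w) / (INR m * INR m)) by (field; lra).
            rewrite Hw2. unfold l. rewrite HINRk. field. lra. }
          rewrite Rabs_minus_sym.
          apply Rsqr_incr_0_var; [|apply Rabs_pos]. rewrite <- Rsqr_abs, !Rsqr_pow2.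
          exact Hsq. }
        intros i j Hi Hj Hij. destruct (le_lt_dec i j).
        + apply Hlt; lia.
        + rewrite Rabs_minus_sym. apply Hlt; lia.
      - rewrite mult_INR. replace (2 * M / (w / INR m)) with (2 * M / w * INR m) by (field; lra).
        apply Rmult_lt_compat_r; auto. }
    unfold k, m in Hkm. nia.
  - destruct (HN y Hy) as [N [HN0 HN1]].
    destruct (INR_unbounded N) as [n Hn]. apply (Hz n). split; auto.
    intros y' Hy'. eapply Rle_trans; [apply HN1; auto|].
    apply Rmult_le_compat_r; [apply pow2_ge_0 | lra].
Qed.

Definition incr_on (p q : R) (al : R -> R) : Prop :=
  forall s t, p <= s -> s <= t -> t <= q -> al s <= al t.

Definition cont_on (p q : R) (f : R -> R) : Prop :=
  forall t, p <= t <= q -> forall eps, 0 < eps -> exists d, 0 < d /\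
    forall s, p <= s <= q -> Rabs (s - t) < d -> Rabs (f s - f t) < eps.

(** Otherwise [g = m - 2 K al] grows from [p] to [q]. Between the last passage times [tau y] and
    [tau y'] at two levels, the term in [al] absorbs the part of the hypothesis with constant [K],
    which leaves [|y' - y| <= N (x (tau y') - x (tau y))^2] with [N] depending on [y]. This is what
    [no_pointwise_half_holder] excludes for the bounded function [x (tau y)]. *)
Lemma sard_one_sided (m x al : R -> R) (p q K M : R) : p <= q -> 0 <= K ->
  cont_on p q m -> (forall t, p <= t <= q -> Rabs (x t) <= M) ->
  incr_on p q al ->
  (forall s, p <= s <= q -> exists N, 0 < N /\ forall s', p <= s' <= q ->
     Rabs (m s' - m s) <= K * Rabs (al s' - al s) + N * (x s' - x s) ^ 2) ->
  m q - m p <= 2 * K * (al q - al p).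
Proof.
  intros Hpq HK Hm Hx Hal HN.
  apply Rnot_lt_le; intros Hgt.
  set (g := fun t => m t - 2 * K * al t).
  assert (Hg : g p < g q) by (unfold g; lra).
  (* [tau y] is the last time at which [g] is at most [y] *)
  assert (Htau : forall y, exists t, g p <= y < g q ->
     p <= t <= q /\ g t = y /\ forall t', t < t' <= q -> y < g t').
  { intros y. destruct (classic (g p <= y < g q)) as [Hy|Hy]; [|exists 0; tauto].
    destruct (completeness (fun t => p <= t <= q /\ g t <= y)) as [t [Ht1 Ht2]].
    - exists q. intros t [Ht _]. lra.
    - exists p. lra.
    - exists t. intros _.
      assert (Htp : p <= t) by (apply Ht1; lra).
      assert (Htq : t <= q) by (apply Ht2; intros r [Hr _]; lra).
      assert (Hafter : forall t', t < t' <= q -> y < g t').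
      { intros t' Ht'. apply Rnot_le_lt; intros Hle.
        assert (t' <= t) by (apply Ht1; split; lra). lra. }
      split; [lra|]. split; [|exact Hafter].
      (* As [al] increases and [m] is continuous, [g] can only jump downwards. Hence values at most
         [y] just before [t] give [g t <= y], and values above [y] just after [t] give
         [y <= g t]. *)
      apply Rle_antisym.
      + apply le_epsilon. intros e He.
        destruct (Hm t) with (eps := e) as [d [Hd Hmd]]; [lra | auto |].
        assert (Hs : exists s, p <= s <= t /\ g s <= y /\ t - s < d).
        { apply NNPP; intros Hn.
          assert (t <= t - d); [|lra]. apply Ht2. intros r [Hr Hgr].
          assert (r <= t) by (apply Ht1; split; auto).
          apply Rnot_lt_le; intros Hlt. apply Hn. exists r. repeat split; lra. }
        destruct Hs as [s [Hs [Hgs Hsd]]].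
        assert (Hms : Rabs (m s - m t) < e) by (apply Hmd; [lra|apply Rabs_lt_between; lra]).
        apply Rabs_lt_between in Hms. unfold g in *.
        assert (Hst : 0 <= K * (al t - al s)).
        { apply Rmult_le_pos; auto. assert (al s <= al t) by (apply Hal; lra). lra. }
        lra.
      + destruct (Rle_lt_or_eq_dec t q Htq) as [Hlt|Heq]; [|subst; lra].
        apply le_epsilon. intros e He.
        destruct (Hm t) with (eps := e) as [d [Hd Hmd]]; [lra | lra |].
        set (s := Rmin q (t + d / 2)).
        assert (Hs : t < s <= q).
        { unfold s. split; [apply Rmin_glb_lt; lra | apply Rmin_l]. }
        assert (Hs' : s - t < d) by (pose proof (Rmin_r q (t + d / 2)); fold s in H; lra).
        assert (Hms : Rabs (m s - m t) < e) by (apply Hmd; [lra|apply Rabs_lt_between; lra]).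
        assert (Hal' : 0 <= K * (al s - al t)).
        { apply Rmult_le_pos; auto. assert (al t <= al s) by (apply Hal; lra). lra. }
        specialize (Hafter s Hs). apply Rabs_lt_between in Hms. unfold g in *. lra. }
  set (tau := fun y => proj1_sig (constructive_indefinite_description _ (Htau y))).
  assert (Ht : forall y, g p <= y < g q ->
     p <= tau y <= q /\ g (tau y) = y /\ forall t', tau y < t' <= q -> y < g t').
  { intros y. unfold tau. apply proj2_sig. }
  (* Levels stay away from [g q], where [tau] is unspecified. *)
  set (b := (g p + g q) / 2).
  assert (Hmono : forall y y', g p <= y -> y < y' -> y' <= b -> tau y <= tau y').
  { intros y y' H1 H2 H3. unfold b in *.
    destruct (Ht y) as [Ha [Hb Hc]]; [lra|].
    destruct (Ht y') as [Ha' [Hb' Hc']]; [lra|].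
    apply Rnot_lt_le; intros Hlt. specialize (Hc' (tau y)). lra. }
  apply (no_pointwise_half_holder (fun y => x (tau y)) M (g p) b).
  - unfold b; lra.
  - intros y Hy. apply Hx. apply Ht. unfold b in Hy. lra.
  - intros y Hy. unfold b in *.
    destruct (Ht y) as [Ha [Hb Hc]]; [lra|].
    destruct (HN (tau y) Ha) as [N [HN0 HN1]]. exists N; split; auto.
    intros y' Hy'. destruct (Ht y') as [Ha' [Hb' Hc']]; [lra|].
    specialize (HN1 (tau y') Ha'). unfold g in Hb, Hb'.
    destruct (Rtotal_order y y') as [Hlt|[Heq|Hlt]].
    + assert (Hle : tau y <= tau y') by (apply Hmono; lra).
      assert (Hai : al (tau y) <= al (tau y')) by (apply Hal; lra).
      rewrite (Rabs_right (al _ - al _)) in HN1 by lra.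
      pose proof (Rle_abs (m (tau y') - m (tau y))).
      assert (0 <= K * (al (tau y') - al (tau y))) by (apply Rmult_le_pos; lra).
      rewrite Rabs_right by lra. lra.
    + subst y'. replace (y - y) with 0 by ring. rewrite Rabs_R0.
      apply Rmult_le_pos; [lra | apply pow2_ge_0].
    + assert (Hle : tau y' <= tau y) by (apply Hmono; lra).
      assert (Hai : al (tau y') <= al (tau y)) by (apply Hal; lra).
      rewrite (Rabs_left1 (al _ - al _)) in HN1 by lra.
      pose proof (Rabs_maj2 (m (tau y') - m (tau y))).
      assert (0 <= K * (al (tau y) - al (tau y'))) by (apply Rmult_le_pos; lra).
      rewrite Rabs_left by lra. lra.
Qed.

Lemma sard (m x al : R -> R) (p q K M : R) : p <= q -> 0 <= K ->
  cont_on p q m -> (forall t, p <= t <= q -> Rabs (x t) <= M) ->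
  incr_on p q al ->
  (forall s, p <= s <= q -> exists N, 0 < N /\ forall s', p <= s' <= q ->
     Rabs (m s' - m s) <= K * Rabs (al s' - al s) + N * (x s' - x s) ^ 2) ->
  Rabs (m q - m p) <= 2 * K * (al q - al p).
Proof.
  intros Hpq HK Hm Hx Hal HN. apply Rabs_le. split.
  - assert (H := sard_one_sided (fun t => - m t) x al p q K M Hpq HK).
    simpl in H. assert (- m q - - m p <= 2 * K * (al q - al p)); [|lra]. apply H; auto.
    + intros t Ht eps He. destruct (Hm t Ht eps He) as [d [Hd Hmd]]. exists d; split; auto.
      intros s Hs Hst. replace (- m s - - m t) with (- (m s - m t)) by ring.
      rewrite Rabs_Ropp. auto.
    + intros s Hs. destruct (HN s Hs) as [N [HN0 HN1]]. exists N; split; auto.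
      intros s' Hs'. replace (- m s' - - m s) with (- (m s' - m s)) by ring.
      rewrite Rabs_Ropp. auto.
  - now apply (sard_one_sided m x al p q K M).
Qed.

(** * Sums along partitions *)

Lemma lim_seq_eps (u : nat -> R) (l : R) : is_lim_seq u l <->
  forall eps, 0 < eps -> exists N, forall n, (N <= n)%nat -> Rabs (u n - l) < eps.
Proof.
  rewrite <- is_lim_seq_spec. simpl. unfold eventually. split.
  - intros H eps He. apply (H (mkposreal eps He)).
  - intros H eps. apply (H eps (cond_pos eps)).
Qed.

Lemma pairs_cons a b l : pairs (a :: b :: l) = (a, b) :: pairs (b :: l).
Proof. reflexivity. Qed.

Lemma sum_le_cons a b l t g : sum_le (a :: b :: l) t g =
  (if Rle_dec a t then g a b else 0) + sum_le (b :: l) t g.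
Proof. unfold sum_le, sumR. rewrite pairs_cons. simpl. now destruct (Rle_dec a t). Qed.

Lemma sum_le_mono l t g h :
  (forall r r', In (r, r') (pairs l) -> r <= t -> g r r' <= h r r') ->
  sum_le l t g <= sum_le l t h.
Proof.
  unfold sum_le, sumR. induction (pairs l) as [|[r r'] L IH]; simpl; intros H; [lra|].
  apply Rplus_le_compat.
  - destruct (Rle_dec r t); simpl; [apply H; auto | lra].
  - apply IH. intros. apply H; auto.
Qed.

Lemma sum_le_ext l t g h :
  (forall r r', In (r, r') (pairs l) -> r <= t -> g r r' = h r r') ->
  sum_le l t g = sum_le l t h.
Proof.
  intros H. apply Rle_antisym; apply sum_le_mono; intros; right; [|symmetry]; auto.
Qed.

Lemma sum_le_lin l t a g h :
  sum_le l t (fun r r' => a * g r r' + h r r') = a * sum_le l t g + sum_le l t h.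
Proof.
  unfold sum_le, sumR. induction (pairs l) as [|[r r'] L IH]; simpl; [ring|].
  rewrite IH. destruct (Rle_dec r t); simpl; ring.
Qed.

Lemma sum_le_plus l t g h :
  sum_le l t (fun r r' => g r r' + h r r') = sum_le l t g + sum_le l t h.
Proof.
  rewrite <- (Rmult_1_l (sum_le l t g)), <- sum_le_lin. apply sum_le_ext. intros; ring.
Qed.

Lemma sum_le_scal l t a g : sum_le l t (fun r r' => a * g r r') = a * sum_le l t g.
Proof.
  unfold sum_le, sumR. induction (pairs l) as [|[r r'] L IH]; simpl; [ring|].
  rewrite IH. destruct (Rle_dec r t); simpl; ring.
Qed.

Lemma sum_le_minus l t g h :
  sum_le l t (fun r r' => g r r' - h r r') = sum_le l t g - sum_le l t h.
Proof.
  replace (sum_le l t g - sum_le l t h) with (-1 * sum_le l t h + sum_le l t g) by ring.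
  rewrite <- sum_le_lin. apply sum_le_ext. intros; ring.
Qed.

Lemma sum_le_abs l t g h :
  (forall r r', In (r, r') (pairs l) -> r <= t -> Rabs (g r r') <= h r r') ->
  Rabs (sum_le l t g) <= sum_le l t h.
Proof.
  intros H. apply Rabs_le. split.
  - replace (- sum_le l t h) with (-1 * sum_le l t h) by ring. rewrite <- sum_le_scal.
    apply sum_le_mono. intros r r' H1 H2. specialize (H r r' H1 H2).
    apply Rabs_le_between in H. lra.
  - apply sum_le_mono. intros r r' H1 H2. specialize (H r r' H1 H2).
    apply Rabs_le_between in H. lra.
Qed.

Lemma sum_le_window l s t g : s <= t ->
  sum_le l t (fun r r' => if Rlt_dec s r then g r r' else 0) = sum_le l t g - sum_le l s g.
Proof.
  intros Hst. unfold sum_le, sumR. induction (pairs l) as [|[r r'] L IH]; simpl; [ring|].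
  rewrite IH. destruct (Rle_dec r t), (Rle_dec r s), (Rlt_dec s r); simpl; try lra.
Qed.

Lemma sum_le_window_abs l s t g h : s <= t ->
  (forall r r', In (r, r') (pairs l) -> s < r -> r <= t -> Rabs (g r r') <= h r r') ->
  Rabs (sum_le l t g - sum_le l s g) <= sum_le l t h - sum_le l s h.
Proof.
  intros Hst H. rewrite <- !sum_le_window by auto. apply sum_le_abs.
  intros r r' H1 H2. destruct (Rlt_dec s r); auto. rewrite Rabs_R0. lra.
Qed.

Definition sorted_pairs (l : list R) : Prop :=
  List.Forall (fun p : R * R => fst p < snd p) (pairs l).

Lemma sorted_pairs_bounds l : forall a, sorted_pairs (a :: l) ->
  a <= List.last (a :: l) 0 /\
  forall r r', In (r, r') (pairs (a :: l)) -> a <= r /\ r < r' /\ r' <= List.last (a :: l) 0.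
Proof.
  induction l as [|b l IH]; intros a H.
  - simpl. split; [lra | tauto].
  - unfold sorted_pairs in H. rewrite pairs_cons in H. inversion H as [|p L H1 H2]; subst.
    simpl in H1. destruct (IH b H2) as [IH1 IH2].
    change (List.last (a :: b :: l) 0) with (List.last (b :: l) 0).
    split; [lra|]. intros r r' Hin. rewrite pairs_cons in Hin. destruct Hin as [E|Hin].
    + inversion E; subst. lra.
    + destruct (IH2 r r' Hin). lra.
Qed.

Lemma mesh_nonneg l : 0 <= mesh l.
Proof.
  unfold mesh. induction (pairs l) as [|[r r'] L IH]; simpl; [lra|].
  eapply Rle_trans; [apply IH | apply Rmax_r].
Qed.

Lemma mesh_bound l r r' : In (r, r') (pairs l) -> r' - r <= mesh l.
Proof.
  unfold mesh. induction (pairs l) as [|[u u'] L IH]; simpl; [tauto|].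
  intros [E|H].
  - inversion E; subst. apply Rmax_l.
  - eapply Rle_trans; [now apply IH | apply Rmax_r].
Qed.

Lemma partition01_cons l : partition01 l -> exists l', l = 0 :: l' /\ sorted_pairs l /\
  List.last l 0 = 1.
Proof.
  intros [H1 [H2 H3]]. destruct l as [|a l]; simpl in H1; [discriminate|].
  inversion H1; subst. exists l. auto.
Qed.

Lemma partition01_pair l r r' : partition01 l -> In (r, r') (pairs l) ->
  in01 r /\ in01 r' /\ r < r' /\ r' - r <= mesh l.
Proof.
  intros Hl Hin. assert (Hm := mesh_bound l r r' Hin).
  destruct (partition01_cons l Hl) as [l' [-> [Hs Hlast]]].
  destruct (sorted_pairs_bounds l' 0 Hs) as [_ H]. destruct (H r r' Hin) as [H1 [H2 H3]].
  rewrite Hlast in H3. unfold in01. lra.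
Qed.

(** A pair counts as soon as it starts at or before [t], so the sum ends at the first point [q]
    after [t], or at the last point of the list. That [q] does not depend on [G] allows several sums
    over one partition to be compared. *)
Lemma telescope_aux t l : forall a, sorted_pairs (a :: l) -> a <= t ->
  exists q, a <= q <= List.last (a :: l) 0 /\
    ((t <= q /\ q - t <= mesh (a :: l)) \/ (q = List.last (a :: l) 0 /\ q <= t)) /\
    forall G : R -> R, sum_le (a :: l) t (fun r r' => G r' - G r) = G q - G a.
Proof.
  induction l as [|b l IH]; intros a Hs Hat.
  - exists a. simpl. repeat split; try lra. intros G. unfold sum_le, sumR. simpl. ring.
  - unfold sorted_pairs in Hs. rewrite pairs_cons in Hs. inversion Hs as [|p L H1 H2]; subst.
    simpl in H1. change (List.last (a :: b :: l) 0) with (List.last (b :: l) 0).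
    destruct (sorted_pairs_bounds l b H2) as [Hb1 Hb2].
    destruct (Rle_dec b t) as [Hbt|Hbt].
    + destruct (IH b H2 Hbt) as [q [Hq [Hq' HG]]]. exists q. split; [lra|]. split.
      * destruct Hq' as [[H3 H4]|H3]; [left|right; auto]. split; auto.
        eapply Rle_trans; [apply H4|]. unfold mesh. rewrite pairs_cons. simpl. apply Rmax_r.
      * intros G. rewrite sum_le_cons, HG. destruct (Rle_dec a t); [ring | lra].
    + exists b. split; [lra|]. split.
      * left. split; [lra|]. apply Rle_trans with (b - a); [lra|].
        apply mesh_bound. rewrite pairs_cons. now left.
      * intros G. rewrite sum_le_cons. destruct (Rle_dec a t) as [Ha|Ha]; [|lra].
        replace (sum_le (b :: l) t (fun r r' => G r' - G r)) with (0 * sum_le (b :: l) t (fun _ _ => 0)); [ring|].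
        rewrite <- sum_le_scal. apply sum_le_ext. intros r r' Hin Hr.
        destruct (Hb2 r r' Hin). lra.
Qed.

Lemma telescope l t : partition01 l -> in01 t -> exists q, in01 q /\ t <= q /\ q - t <= mesh l /\
  forall G : R -> R, sum_le l t (fun r r' => G r' - G r) = G q - G 0.
Proof.
  intros Hl [Ht0 Ht1]. destruct (partition01_cons l Hl) as [l' [-> [Hs Hlast]]].
  destruct (telescope_aux t l' 0 Hs Ht0) as [q [Hq [Hq' HG]]]. rewrite Hlast in *.
  exists q. pose proof (mesh_nonneg (0 :: l')).
  repeat split; auto; try lra; destruct Hq' as [H1|[H1 H2]]; lra.
Qed.

Lemma telescope_lim T t G : refining T -> in01 t -> cont01 G ->
  is_lim_seq (fun n => sum_le (T n) t (fun r r' => G r' - G r)) (G t - G 0).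
Proof.
  intros [HT [_ Hm]] Ht HG. apply lim_seq_eps. intros eps He.
  destruct (HG t Ht eps He) as [d [Hd HGd]].
  apply lim_seq_eps with (eps := d) in Hm; auto. destruct Hm as [N HN].
  exists N. intros n Hn. specialize (HN n Hn).
  destruct (telescope (T n) t (HT n) Ht) as [q [Hq [Hq1 [Hq2 Hq3]]]].
  rewrite Hq3. replace (G q - G 0 - (G t - G 0)) with (G q - G t) by ring.
  apply HGd; auto. rewrite Rminus_0_r in HN. pose proof (Rle_abs (mesh (T n))).
  rewrite Rabs_right; lra.
Qed.

Lemma mesh_eventually T d : refining T -> 0 < d -> exists N, forall n, (N <= n)%nat ->
  mesh (T n) < d.
Proof.
  intros [_ [_ Hm]] Hd. apply lim_seq_eps with (eps := d) in Hm; auto.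
  destruct Hm as [N HN]. exists N. intros n Hn. specialize (HN n Hn).
  rewrite Rminus_0_r in HN. pose proof (Rle_abs (mesh (T n))). lra.
Qed.

Lemma quad_var_incr T x qv s t : refining T -> quad_var T x qv -> 0 <= s -> s <= t -> t <= 1 ->
  qv s <= qv t.
Proof.
  intros HT [Hq _] Hs Hst Ht.
  assert (H : Rbar_le (qv s) (qv t)); [|exact H].
  eapply is_lim_seq_le; [|apply (Hq s); split; lra | apply (Hq t); split; lra].
  intros n. cbv beta.
  assert (0 <= sum_le (T n) t (fun r r' => (x r' - x r) ^ 2) - sum_le (T n) s (fun r r' => (x r' - x r) ^ 2)); [|lra].
  eapply Rle_trans; [apply Rabs_pos|].
  apply (sum_le_window_abs (T n) s t (fun r r' => (x r' - x r) ^ 2)); auto.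
  intros. rewrite Rabs_right; [lra|]. apply Rle_ge, pow2_ge_0.
Qed.

(** At time 0 only the first cell is counted, and its length tends to 0. *)
Lemma quad_var_0 T x qv : refining T -> cont01 x -> quad_var T x qv -> qv 0 = 0.
Proof.
  intros HT Hx [Hq _].
  assert (H0 : in01 0) by (unfold in01; lra).
  assert (Hl : is_lim_seq (fun n => sum_le (T n) 0 (fun r r' => (x r' - x r) ^ 2)) 0).
  { apply lim_seq_eps. intros eps He.
    assert (He' : 0 < Rmin 1 eps) by (apply Rmin_pos; lra).
    destruct (Hx 0 H0 (Rmin 1 eps) He') as [d [Hd Hxd]].
    destruct (mesh_eventually T d HT Hd) as [N HN]. exists N. intros n Hn. specialize (HN n Hn).
    destruct HT as [HT _].
    assert (Hp := HT n). pose proof Hp as Hp'.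
    destruct (partition01_cons _ Hp') as [l [El [Hs Hlast]]].
    rewrite El in *. destruct l as [|b l]; [simpl in Hlast; lra|].
    destruct (partition01_pair _ 0 b Hp) as [_ [Hb [Hb0 Hbm]]]; [now left|].
    rewrite sum_le_cons. destruct (Rle_dec 0 0) as [Ha|Ha]; [|lra].
    replace (sum_le (b :: l) 0 (fun r r' => (x r' - x r) ^ 2)) with 0.
    - assert (Hxb : Rabs (x b - x 0) < Rmin 1 eps).
      { apply Hxd; auto. rewrite Rminus_0_r, Rabs_right; lra. }
      pose proof (Rmin_l 1 eps). pose proof (Rmin_r 1 eps).
      replace ((x b - x 0) ^ 2 + 0 - 0) with ((x b - x 0) * (x b - x 0)) by ring.
      rewrite Rabs_mult. pose proof (Rabs_pos (x b - x 0)).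
      apply Rle_lt_trans with (1 * Rabs (x b - x 0)); [|lra].
      apply Rmult_le_compat_r; lra.
    - replace 0 with (0 * sum_le (b :: l) 0 (fun _ _ => 0)) at 1 by ring.
      rewrite <- sum_le_scal. apply sum_le_ext. intros r r' Hin Hr.
      unfold sorted_pairs in Hs. rewrite pairs_cons in Hs. inversion Hs as [|p L H1 H2]; subst.
      destruct (sorted_pairs_bounds l b H2) as [_ Hb2]. destruct (Hb2 r r' Hin). lra. }
  apply is_lim_seq_unique in Hl. specialize (Hq 0 H0). apply is_lim_seq_unique in Hq.
  rewrite Hl in Hq. injection Hq. auto.
Qed.

(* The squared increments of [x] and the increments of its quadratic variation
   define asymptotically the same discrete measure, tested against continuous [h]. *)
Lemma quad_var_weighted T x qv h t : refining T -> cont01 x -> quad_var T x qv -> cont01 h ->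
  in01 t ->
  is_lim_seq (fun n => sum_le (T n) t
    (fun r r' => h r * ((x r' - x r) ^ 2 - (qv r' - qv r)))) 0.
Proof.
  intros HT Hx Hqv Hh Ht.
  assert (Hinc := fun s t => quad_var_incr T x qv s t HT Hqv).
  assert (Hq0 := quad_var_0 T x qv HT Hx Hqv).
  destruct Hqv as [Hq Hqc].
  set (dl := fun r r' => (x r' - x r) ^ 2 - (qv r' - qv r)).
  set (ab := fun r r' => (x r' - x r) ^ 2 + (qv r' - qv r)).
  assert (He : forall t, in01 t -> is_lim_seq (fun n => sum_le (T n) t dl) 0).
  { intros u Hu. apply is_lim_seq_ext with (fun n => sum_le (T n) u (fun r r' => (x r' - x r) ^ 2)
      - sum_le (T n) u (fun r r' => qv r' - qv r)).
    - intros n. symmetry. apply sum_le_minus.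
    - replace (Finite 0) with (Finite (qv u - (qv u - qv 0))) by (f_equal; lra).
      apply is_lim_seq_minus'; [now apply Hq | now apply telescope_lim]. }
  assert (Hab : forall t, in01 t -> is_lim_seq (fun n => sum_le (T n) t ab) (2 * qv t)).
  { intros u Hu. apply is_lim_seq_ext with (fun n => sum_le (T n) u (fun r r' => (x r' - x r) ^ 2)
      + sum_le (T n) u (fun r r' => qv r' - qv r)).
    - intros n. symmetry. apply sum_le_plus.
    - replace (Finite (2 * qv u)) with (Finite (qv u + (qv u - qv 0))) by (f_equal; lra).
      apply is_lim_seq_plus'; [now apply Hq | now apply telescope_lim]. }
  destruct (cont01_bounded h Hh) as [H [HH0 HH]].
  apply lim_seq_eps. intros eps Heps.
  set (w := eps / (4 * (2 * qv t + 1))).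
  assert (Hqt : 0 <= qv t) by (rewrite <- Hq0; apply Hinc; unfold in01 in Ht; lra).
  assert (Hw : 0 < w) by (unfold w; apply Rdiv_lt_0_compat; lra).
  destruct (cont01_uniform h Hh w Hw) as [d [Hd Hhd]].
  destruct (INR_unbounded (t / d)) as [m0 Hm0].
  set (m := S m0).
  assert (Hm : 0 < INR m) by (apply lt_0_INR; unfold m; lia).
  set (e1 := eps / (4 * INR m)).
  assert (He1 : 0 < e1) by (unfold e1; apply Rdiv_lt_0_compat; lra).
  set (pt := fun j => INR j * t / INR m).
  assert (Hpt : forall j, (j <= m)%nat -> 0 <= pt j <= t).
  { intros j Hj. apply le_INR in Hj. pose proof (pos_INR j). unfold pt. destruct Ht.
    split.
    - apply Rdiv_le_0_compat; auto. nra.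
    - apply Rmult_le_reg_r with (INR m); auto. unfold Rdiv. rewrite Rmult_assoc, Rinv_l by lra. nra. }
  assert (Hstep : forall j, pt (S j) - pt j = t / INR m).
  { intros j. unfold pt. rewrite S_INR. field. lra. }
  assert (Htm : t / INR m < d).
  { assert (INR m0 <= INR m) by (apply le_INR; unfold m; lia).
    apply Rmult_lt_reg_r with (INR m); auto. unfold Rdiv. rewrite Rmult_assoc, Rinv_l by lra.
    apply Rmult_lt_compat_r with (r := d) in Hm0; auto. unfold Rdiv in Hm0.
    rewrite Rmult_assoc, Rinv_l in Hm0 by lra. nra. }
  (* The [+ 1] pays for the cell that starts at 0, which is already counted at [pt 0 = 0]. *)
  assert (Hmain : forall j, (j <= m)%nat -> exists N, forall n, (N <= n)%nat ->
    Rabs (sum_le (T n) (pt j) (fun r r' => h r * dl r r')) <=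
      w * sum_le (T n) (pt j) ab + (INR j + 1) * e1).
  { assert (Hwin : forall n s u, in01 s -> in01 u -> s <= u -> u - s < d ->
      Rabs ((sum_le (T n) u (fun r r' => h r * dl r r') - sum_le (T n) s (fun r r' => h r * dl r r'))
       - h s * (sum_le (T n) u dl - sum_le (T n) s dl)) <= w * (sum_le (T n) u ab - sum_le (T n) s ab)).
    { intros n s u Hs Hu Hsu Hd'.
      replace (_ - h s * _) with
        (sum_le (T n) u (fun r r' => h r * dl r r' - h s * dl r r') -
         sum_le (T n) s (fun r r' => h r * dl r r' - h s * dl r r')).
      2: { rewrite !sum_le_minus, !sum_le_scal. ring. }
      rewrite Rmult_minus_distr_l, <- !sum_le_scal.
      apply sum_le_window_abs; auto. intros r r' Hin Hr1 Hr2.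
      destruct (partition01_pair (T n) r r') as [H1 [H2 [H3 H4]]]; auto.
      { apply HT. }
      replace (h r * dl r r' - h s * dl r r') with ((h r - h s) * dl r r') by ring.
      rewrite Rabs_mult. apply Rmult_le_compat; try apply Rabs_pos.
      - left. apply Hhd; auto. rewrite Rabs_right; lra.
      - unfold dl, ab. pose proof (pow2_ge_0 (x r' - x r)).
        assert (qv r <= qv r') by (unfold in01 in *; apply Hinc; lra).
        apply Rabs_le. lra. }
    assert (H01 : in01 0) by (unfold in01; lra).
    induction j as [|j IH]; intros Hj.
    - assert (Hz : pt 0%nat = 0) by (unfold pt; simpl; unfold Rdiv; ring).
      rewrite Hz.
      specialize (He 0 H01). apply lim_seq_eps with (eps := e1 / (H + 1)) in He.
      2: { apply Rdiv_lt_0_compat; lra. }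
      destruct He as [N HN]. exists N. intros n Hn. specialize (HN n Hn).
      rewrite Rminus_0_r in HN.
      assert (Hsum : sum_le (T n) 0 (fun r r' => h r * dl r r') = h 0 * sum_le (T n) 0 dl).
      { rewrite <- sum_le_scal. apply sum_le_ext. intros r r' Hin Hr.
        destruct (partition01_pair (T n) r r') as [[H1 _] _]; auto; [apply HT|].
        replace r with 0 by lra. reflexivity. }
      rewrite Hsum, Rabs_mult.
      assert (0 <= sum_le (T n) 0 ab).
      { eapply Rle_trans; [apply Rabs_pos|]. apply sum_le_abs with (g := dl). intros r r' Hin Hr.
        destruct (partition01_pair (T n) r r') as [H1 [H2 [H3 H4]]]; auto; [apply HT|].
        unfold dl, ab. pose proof (pow2_ge_0 (x r' - x r)).
        assert (qv r <= qv r') by (unfold in01 in *; apply Hinc; lra).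
        apply Rabs_le. lra. }
      apply Rle_trans with (e1).
      + apply Rle_trans with (H * (e1 / (H + 1))).
        * apply Rmult_le_compat; try apply Rabs_pos; [now apply HH | lra].
        * apply Rmult_le_reg_r with (H + 1); [lra|].
          replace (H * (e1 / (H + 1)) * (H + 1)) with (H * e1) by (field; lra). nra.
      + simpl. nra.
    - destruct IH as [N1 HN1]; [lia|].
      assert (Hj1 := Hpt j). assert (Hj2 := Hpt (S j)). assert (Hs := Hstep j).
      assert (Hpj : in01 (pt j)) by (unfold in01 in *; destruct Hj1; [lia|lra]).
      assert (Hpj' : in01 (pt (S j))) by (unfold in01 in *; destruct Hj2; [lia|lra]).
      assert (He2 : 0 < e1 / (2 * (H + 1))) by (apply Rdiv_lt_0_compat; lra).
      pose proof (He _ Hpj) as L1. apply lim_seq_eps with (eps := e1 / (2 * (H + 1))) in L1; auto.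
      pose proof (He _ Hpj') as L2. apply lim_seq_eps with (eps := e1 / (2 * (H + 1))) in L2; auto.
      destruct L1 as [N2 HN2]. destruct L2 as [N3 HN3].
      exists (N1 + N2 + N3)%nat. intros n Hn.
      specialize (HN1 n ltac:(lia)). specialize (HN2 n ltac:(lia)). specialize (HN3 n ltac:(lia)).
      assert (0 <= t / INR m) by (unfold in01 in Ht; apply Rdiv_le_0_compat; lra).
      assert (Hw' := Hwin n (pt j) (pt (S j)) Hpj Hpj' ltac:(lra) ltac:(lra)).
      rewrite Rminus_0_r in HN2, HN3.
      set (a1 := sum_le (T n) (pt (S j)) (fun r r' => h r * dl r r')) in *.
      set (a0 := sum_le (T n) (pt j) (fun r r' => h r * dl r r')) in *.
      set (b1 := sum_le (T n) (pt (S j)) dl) in *. set (b0 := sum_le (T n) (pt j) dl) in *.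
      assert (Hhb : Rabs (h (pt j) * (b1 - b0)) <= e1).
      { rewrite Rabs_mult. apply Rle_trans with (H * (e1 / (H + 1))).
        - apply Rmult_le_compat; try apply Rabs_pos; [now apply HH|].
          replace (e1 / (H + 1)) with (e1 / (2 * (H + 1)) + e1 / (2 * (H + 1))) by (field; lra).
          apply Rabs_lt_between in HN2. apply Rabs_lt_between in HN3. apply Rabs_le. lra.
        - apply Rmult_le_reg_r with (H + 1); [lra|].
          replace (H * (e1 / (H + 1)) * (H + 1)) with (H * e1) by (field; lra). nra. }
      rewrite S_INR. apply Rabs_le_between in Hw'. apply Rabs_le_between in HN1.
      apply Rabs_le_between in Hhb. apply Rabs_le. lra. }
  destruct (Hmain m) as [N HN]; [lia|].
  assert (Hptm : pt m = t) by (unfold pt; field; lra).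
  rewrite Hptm in HN.
  assert (L := Hab t Ht). apply lim_seq_eps with (eps := 1) in L; [|lra].
  destruct L as [N' HN']. exists (N + N')%nat. intros n Hn.
  specialize (HN n ltac:(lia)). specialize (HN' n ltac:(lia)).
  rewrite Rminus_0_r. eapply Rle_lt_trans; [apply HN|].
  apply Rabs_lt_between in HN'.
  assert (w * sum_le (T n) t ab <= eps / 4).
  { apply Rle_trans with (w * (2 * qv t + 1)); [apply Rmult_le_compat_l; lra|].
    unfold w. right. field. lra. }
  assert ((INR m + 1) * e1 <= eps / 2); [|lra].
  apply Rle_trans with (2 * INR m * e1).
  - apply Rmult_le_compat_r; [lra|]. unfold m. rewrite S_INR. pose proof (pos_INR m0). lra.
  - unfold e1. right. field. lra.
Qed.

(** * Stieltjes integrals as additive interval functions *)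

Definition dominates (al g : R -> R) : Prop :=
  forall s t, 0 <= s -> s <= t -> t <= 1 -> Rabs (g t - g s) <= al t - al s.

(** Sums along a partition overshoot [t] to the next partition point, so this one-sided continuity
    of a control is what their limits require. *)
Definition rcont01 (al : R -> R) : Prop :=
  forall t, 0 <= t < 1 -> forall eps, 0 < eps -> exists d, 0 < d /\
    forall s, t <= s <= 1 -> s - t < d -> al s - al t < eps.

(* [has_differential al om J] expresses [dJ = om] up to [o(d al)]; in this form the
   integral of [om s t = f s * (g t - g s)] is both a Riemann-Stieltjes integral
   and the limit of sums along any partitions. *)
Definition has_differential (al : R -> R) (om : R -> R -> R) (J : R -> R) : Prop :=
  forall eps, 0 < eps -> exists d, 0 < d /\ forall s t, 0 <= s -> s <= t -> t <= 1 ->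
    t - s < d -> Rabs (J t - J s - om s t) <= eps * (al t - al s).

Lemma dominates_incr al g : dominates al g -> incr_on 0 1 al.
Proof.
  intros H s t Hs Hst Ht. specialize (H s t Hs Hst Ht). pose proof (Rabs_pos (g t - g s)). lra.
Qed.

(** The differentials are compared over short steps and the errors [eps * al] disappear by
    [chain_abs]. [D] serves exponential bounds in a Picard iteration, [E] uniform ones. *)
Lemma has_differential_diff al om om' D E J J' t : in01 t ->
  (forall s t, 0 <= s -> s <= t -> t <= 1 -> Rabs (om s t - om' s t) <= D t - D s + E * (al t - al s)) ->
  has_differential al om J -> has_differential al om' J' -> J 0 = J' 0 ->
  Rabs (J t - J' t) <= D t - D 0 + E * (al t - al 0).
Proof.
  intros Ht Hom HJ HJ' H0.
  assert (H := chain_abs (fun t => J t - J' t) (fun t => D t + E * al t) al 0 t (proj1 Ht)).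
  cbv beta in H. replace (J t - J' t) with (J t - J' t - (J 0 - J' 0)) by lra.
  eapply Rle_trans; [apply H|lra].
  intros eps He. destruct (HJ (eps / 2)) as [d [Hd H1]]; [lra|].
  destruct (HJ' (eps / 2)) as [d' [Hd' H2]]; [lra|].
  exists (Rmin d d'). split; [now apply Rmin_pos|].
  intros s u Hs Hsu Hu Hd''. destruct Ht as [_ Ht].
  specialize (H1 s u Hs Hsu ltac:(lra) ltac:(eapply Rlt_le_trans; [apply Hd''|apply Rmin_l])).
  specialize (H2 s u Hs Hsu ltac:(lra) ltac:(eapply Rlt_le_trans; [apply Hd''|apply Rmin_r])).
  specialize (Hom s u Hs Hsu ltac:(lra)).
  apply Rabs_le_between in H1. apply Rabs_le_between in H2. apply Rabs_le_between in Hom.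
  apply Rabs_le. lra.
Qed.

Lemma has_differential_unique al om J J' t : in01 t ->
  has_differential al om J -> has_differential al om J' -> J 0 = J' 0 -> J t = J' t.
Proof.
  intros Ht HJ HJ' H0.
  assert (H := has_differential_diff al om om (fun _ => 0) 0 J J' t Ht).
  assert (Rabs (J t - J' t) <= 0).
  { eapply Rle_trans; [apply H; auto|lra]. intros. replace (om s t0 - om s t0) with 0 by ring.
    rewrite Rabs_R0. lra. }
  apply Rabs_le_between in H1. lra.
Qed.

Lemma has_differential_plus al om om' J J' :
  has_differential al om J -> has_differential al om' J' ->
  has_differential al (fun s t => om s t + om' s t) (fun t => J t + J' t).
Proof.
  intros H H' eps He. destruct (H (eps / 2)) as [d [Hd H1]]; [lra|].
  destruct (H' (eps / 2)) as [d' [Hd' H2]]; [lra|].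
  exists (Rmin d d'). split; [now apply Rmin_pos|].
  intros s u Hs Hsu Hu Hd''.
  specialize (H1 s u Hs Hsu Hu ltac:(eapply Rlt_le_trans; [apply Hd''|apply Rmin_l])).
  specialize (H2 s u Hs Hsu Hu ltac:(eapply Rlt_le_trans; [apply Hd''|apply Rmin_r])).
  apply Rabs_le_between in H1. apply Rabs_le_between in H2. apply Rabs_le. lra.
Qed.

Lemma has_differential_scal al om J c : has_differential al om J ->
  has_differential al (fun s t => c * om s t) (fun t => c * J t).
Proof.
  intros H eps He.
  assert (Hc : 0 < Rabs c + 1) by (pose proof (Rabs_pos c); lra).
  destruct (H (eps / (Rabs c + 1))) as [d [Hd H1]]; [now apply Rdiv_lt_0_compat|].
  exists d; split; auto. intros s t Hs Hst Ht Hd'. specialize (H1 s t Hs Hst Ht Hd').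
  replace (c * J t - c * J s - c * om s t) with (c * (J t - J s - om s t)) by ring.
  rewrite Rabs_mult.
  apply Rle_trans with ((Rabs c + 1) * (eps / (Rabs c + 1) * (al t - al s))).
  - apply Rmult_le_compat; try apply Rabs_pos; lra.
  - right. field. lra.
Qed.

Lemma has_differential_ext al om om' J J' :
  (forall s t, 0 <= s -> s <= t -> t <= 1 -> om s t = om' s t) ->
  (forall t, in01 t -> J t = J' t) -> has_differential al om J -> has_differential al om' J'.
Proof.
  intros H1 H2 H eps He. destruct (H eps He) as [d [Hd Hl]]. exists d; split; auto.
  intros s t Hs Hst Ht Hd'. rewrite <- H1 by auto.
  rewrite <- !H2 by (unfold in01; lra). auto.
Qed.

Lemma has_differential_weaken al al' om J :
  (forall s t, 0 <= s -> s <= t -> t <= 1 -> al t - al s <= al' t - al' s) ->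
  has_differential al om J -> has_differential al' om J.
Proof.
  intros Ha H eps He. destruct (H eps He) as [d [Hd Hl]]. exists d; split; auto.
  intros s t Hs Hst Ht Hd'. eapply Rle_trans; [now apply Hl|].
  apply Rmult_le_compat_l; [lra | now apply Ha].
Qed.

(** [al] may jump, so a bound by its increments gives no continuity by itself. The error is made
    small through the total increment [al 1 - al 0], and the rest comes from the smallness of
    [om]. *)
Lemma has_differential_cont al om J : incr_on 0 1 al ->
  (forall eps, 0 < eps -> exists d, 0 < d /\ forall s t, 0 <= s -> s <= t -> t <= 1 ->
     t - s < d -> Rabs (om s t) < eps) ->
  has_differential al om J -> cont01 J.
Proof.
  intros Ha Hom HJ t Ht eps He.
  set (e := eps / (2 * (al 1 - al 0 + 1))).
  assert (Ha01 : al 0 <= al 1) by (apply Ha; lra).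
  destruct (HJ e) as [d [Hd H1]]; [unfold e; apply Rdiv_lt_0_compat; lra|].
  destruct (Hom (eps / 2)) as [d' [Hd' H2]]; [lra|].
  assert (He' : e * (al 1 - al 0) < eps / 2).
  { unfold e. apply Rmult_lt_reg_r with (2 * (al 1 - al 0 + 1)); [lra|].
    replace (eps / (2 * (al 1 - al 0 + 1)) * (al 1 - al 0) * (2 * (al 1 - al 0 + 1)))
      with (eps * (al 1 - al 0)) by (field; lra). nra. }
  assert (Hp : 0 < e) by (unfold e; apply Rdiv_lt_0_compat; lra).
  assert (Hmain : forall s t, 0 <= s -> s <= t -> t <= 1 -> t - s < Rmin d d' ->
    Rabs (J t - J s) < eps).
  { intros s u Hs Hsu Hu Hlt.
    specialize (H1 s u Hs Hsu Hu ltac:(eapply Rlt_le_trans; [apply Hlt|apply Rmin_l])).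
    specialize (H2 s u Hs Hsu Hu ltac:(eapply Rlt_le_trans; [apply Hlt|apply Rmin_r])).
    assert (e * (al u - al s) <= e * (al 1 - al 0)).
    { apply Rmult_le_compat_l; [lra|].
      assert (al 0 <= al s) by (apply Ha; lra). assert (al u <= al 1) by (apply Ha; lra). lra. }
    apply Rabs_le_between in H1. apply Rabs_lt_between in H2. apply Rabs_lt_between. lra. }
  exists (Rmin d d'); split; [now apply Rmin_pos|].
  intros s Hs Hst. unfold in01 in *. destruct (Rle_dec s t).
  - rewrite Rabs_minus_sym. apply Hmain; try lra. rewrite Rabs_left1 in Hst; lra.
  - apply Hmain; try lra. rewrite Rabs_right in Hst; lra.
Qed.

Lemma stieltjes_small f g : cont01 f -> cont01 g ->
  forall eps, 0 < eps -> exists d, 0 < d /\ forall s t, 0 <= s -> s <= t -> t <= 1 ->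
     t - s < d -> Rabs (f s * (g t - g s)) < eps.
Proof.
  intros Hf Hg eps He. destruct (cont01_bounded f Hf) as [M [HM Hb]].
  destruct (cont01_uniform g Hg (eps / M)) as [d [Hd H]]; [now apply Rdiv_lt_0_compat|].
  exists d; split; auto. intros s t Hs Hst Ht Hd'.
  rewrite Rabs_mult. apply Rle_lt_trans with (M * Rabs (g t - g s)).
  - apply Rmult_le_compat_r; [apply Rabs_pos|]. apply Hb. unfold in01; lra.
  - assert (Rabs (g t - g s) < eps / M).
    { apply H; unfold in01; try lra. rewrite Rabs_right; lra. }
    apply Rmult_lt_compat_l with (r := M) in H0; auto.
    replace (M * (eps / M)) with eps in H0 by (field; lra). exact H0.
Qed.

Lemma Rabs_le_prod a b c d : Rabs a <= c -> Rabs b <= d -> Rabs (a * b) <= c * d.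
Proof. intros. rewrite Rabs_mult. apply Rmult_le_compat; auto using Rabs_pos. Qed.

Section StepIntegrals.

Variables (f g al : R -> R) (n : nat).
Hypothesis n_pos : (0 < n)%nat.
Hypothesis dom : dominates al g.

Let p (k : nat) : R := INR k / INR n.
Let cut (t : R) (k : nat) : R := Rmin t (p k).

(** The integral over [[0, t]] of the step function equal to [f (p j)] between [p j] and [p (S j)],
    restricted to the first [k] steps; [cut] stops the increments of [g] at time [t]. *)
Fixpoint step_int (k : nat) (t : R) : R :=
  match k with
  | O => 0
  | S k => step_int k t + f (p k) * (g (cut t (S k)) - g (cut t k))
  end.

(** A step contributes to the increment only if it meets the interval from [s] to [t]. Its left end
    [p k] is then within [d] of [s]: it lies before [t], and at most one step length before [s]. *)
Lemma step_int_estimate w d : 0 <= w ->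
  (forall s t, in01 s -> in01 t -> Rabs (s - t) < d -> Rabs (f s - f t) <= w) ->
  / INR n < d ->
  forall s t, 0 <= s -> s <= t -> t <= 1 -> t - s < d ->
  Rabs (step_int n t - step_int n s - f s * (g t - g s)) <= w * (al t - al s).
Proof.
  intros Hw Hf Hn s t Hs Hst Ht Hd.
  assert (Hn0 : 0 < INR n) by now apply lt_0_INR.
  assert (Hk : forall k, (k <= n)%nat ->
    Rabs (step_int k t - step_int k s - f s * (g (cut t k) - g (cut s k)))
      <= w * (al (cut t k) - al (cut s k))).
  { assert (Hp : forall k, (k <= n)%nat -> 0 <= p k <= 1).
    { intros k Hk. apply le_INR in Hk. pose proof (pos_INR k). unfold p. split.
      - apply Rdiv_le_0_compat; lra.
      - apply Rmult_le_reg_r with (INR n); auto. unfold Rdiv.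
        rewrite Rmult_assoc, Rinv_l; lra. }
    assert (HpS : forall k, p (S k) = p k + / INR n).
    { intros k. unfold p. rewrite S_INR. field. lra. }
    assert (Hinv : 0 < / INR n) by now apply Rinv_0_lt_compat.
    induction k as [|k IH]; intros Hk.
    - simpl. unfold cut, p. simpl. unfold Rdiv. rewrite Rmult_0_l.
      rewrite !Rmin_right by lra. replace (0 - 0 - f s * (g 0 - g 0)) with 0 by ring.
      rewrite Rabs_R0. lra.
    - specialize (IH ltac:(lia)). simpl.
      assert (H1 := Hp k ltac:(lia)). assert (H2 := Hp (S k) Hk). specialize (HpS k).
      set (a := step_int k t) in *. set (b := step_int k s) in *.
      assert (Hterm : Rabs ((f (p k) - f s) * ((g (cut t (S k)) - g (cut t k)) - (g (cut s (S k)) - g (cut s k))))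
        <= w * ((al (cut t (S k)) - al (cut t k)) - (al (cut s (S k)) - al (cut s k)))).
      { unfold cut.
        destruct (Rle_dec t (p k)) as [Htp|Htp].
        { rewrite !Rmin_left by lra. replace (_ - _ - _) with 0 by ring.
          rewrite Rmult_0_r, Rabs_R0. lra. }
        destruct (Rle_dec (p (S k)) s) as [Hsp|Hsp].
        { rewrite !Rmin_right by lra. replace (_ - _ - _) with 0 by ring.
          rewrite Rmult_0_r, Rabs_R0. lra. }
        apply Rnot_le_lt in Htp. apply Rnot_le_lt in Hsp.
        assert (Hm := Rmin_l t (p (S k))).
        assert (Hfp : Rabs (f (p k) - f s) <= w).
        { apply Hf; unfold in01; try lra. apply Rabs_lt_between. lra. }
        rewrite (Rmin_right t (p k)), (Rmin_left s (p (S k))) by lra.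
        apply Rabs_le_prod; auto.
        destruct (Rle_dec s (p k)) as [Hsk|Hsk].
        - rewrite (Rmin_left s (p k)) by lra.
          replace (g (Rmin t (p (S k))) - g (p k) - (g s - g s)) with (g (Rmin t (p (S k))) - g (p k)) by ring.
          replace (al (Rmin t (p (S k))) - al (p k) - (al s - al s)) with (al (Rmin t (p (S k))) - al (p k)) by ring.
          apply dom; try lra. apply Rmin_glb; lra.
        - apply Rnot_le_lt in Hsk. rewrite (Rmin_right s (p k)) by lra.
          replace (_ - _ - (g s - g (p k))) with (g (Rmin t (p (S k))) - g s) by ring.
          replace (_ - _ - (al s - al (p k))) with (al (Rmin t (p (S k))) - al s) by ring.
          apply dom; try lra. apply Rmin_glb; lra. }
      apply Rabs_le_between in IH. apply Rabs_le_between in Hterm.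
      apply Rabs_le. lra. }
  specialize (Hk n (Nat.le_refl n)). unfold cut, p in Hk.
  replace (INR n / INR n) with 1 in Hk by (field; lra).
  rewrite !Rmin_left in Hk by lra. exact Hk.
Qed.

Lemma step_int_0 k : step_int k 0 = 0.
Proof.
  induction k as [|k IH]; simpl; [reflexivity|].
  assert (Hn0 : 0 < INR n) by now apply lt_0_INR.
  assert (forall j, 0 <= p j) by (intros j; unfold p; apply Rdiv_le_0_compat; [apply pos_INR|auto]).
  rewrite IH. unfold cut. rewrite !Rmin_left by auto. ring.
Qed.

End StepIntegrals.

Lemma cauchy_lim (u : nat -> R) : (forall eps, 0 < eps -> exists N, forall n m, (N <= n)%nat ->
  (N <= m)%nat -> Rabs (u n - u m) < eps) -> is_lim_seq u (real (Lim_seq u)).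
Proof.
  intros H. apply Lim_seq_correct'. apply ex_lim_seq_cauchy_corr.
  intros eps. destruct (H eps (cond_pos eps)) as [N HN]. exists N. auto.
Qed.

Lemma lim_le_const (u : nat -> R) l c C N : is_lim_seq u (Finite l) ->
  (forall n, (N <= n)%nat -> Rabs (u n - c) <= C) -> Rabs (l - c) <= C.
Proof.
  intros Hl Hu. apply le_epsilon. intros e He. apply lim_seq_eps with (eps := e) in Hl; auto.
  destruct Hl as [M HM]. specialize (HM (N + M)%nat ltac:(lia)). specialize (Hu (N + M)%nat ltac:(lia)).
  apply Rabs_lt_between in HM. apply Rabs_le_between in Hu. apply Rabs_le. lra.
Qed.

(** For large [n] the step integrals satisfy the required estimate with a common [d]. Comparing two
    of them over short steps shows that they form a Cauchy sequence, and the estimate passes to the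
    limit. *)
Lemma stieltjes_exists f g al : cont01 f -> dominates al g ->
  exists J, J 0 = 0 /\ has_differential al (fun s t => f s * (g t - g s)) J.
Proof.
  intros Hf Hdom. set (Jn := fun n t => step_int f g (S n) (S n) t).
  assert (Hinc := dominates_incr al g Hdom).
  assert (Hu : forall w, 0 < w -> exists d N, 0 < d /\ forall n, (N <= n)%nat ->
    forall s t, 0 <= s -> s <= t -> t <= 1 -> t - s < d ->
    Rabs (Jn n t - Jn n s - f s * (g t - g s)) <= w * (al t - al s)).
  { intros w Hw. destruct (cont01_uniform f Hf w Hw) as [d [Hd H]].
    destruct (archimed_cor1 d Hd) as [N [HN HN0]]. exists d, N. split; auto.
    intros n Hn. apply step_int_estimate with (d := d); auto; try lia; try lra.
    - intros s t ? ? ?. left. auto.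
    - eapply Rle_lt_trans; [|apply HN]. apply Rinv_le_contravar; [now apply lt_0_INR|].
      apply le_INR. lia. }
  assert (H0 : forall n, Jn n 0 = 0) by (intros n; apply step_int_0; lia).
  assert (Hal : al 0 <= al 1) by (apply Hinc; lra).
  set (J := fun t => real (Lim_seq (fun n => Jn n t))).
  assert (HJ : forall t, in01 t -> is_lim_seq (fun n => Jn n t) (J t)).
  { intros t Ht. apply cauchy_lim. intros eps He.
    destruct (Hu (eps / (4 * (al 1 - al 0 + 1)))) as [d [N [Hd HN]]].
    { apply Rdiv_lt_0_compat; lra. }
    exists N. intros n m Hn Hm.
    set (w := eps / (4 * (al 1 - al 0 + 1))) in *.
    assert (Hloc : forall sg, sg = 1 \/ sg = -1 ->
       sg * (Jn n t - Jn m t) <= 2 * w * (al t - al 0)).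
    { intros sg Hsg.
      assert (L := locally_monotone (fun t => 2 * w * al t - sg * (Jn n t - Jn m t)) d 0 t Hd (proj1 Ht)).
      cbv beta in L. rewrite !H0 in L.
      assert (2 * w * al 0 - sg * (0 - 0) <= 2 * w * al t - sg * (Jn n t - Jn m t)); [apply L|lra].
      intros s u Hs Hsu Hu' Hd'. destruct Ht.
      assert (A := HN n Hn s u ltac:(lra) Hsu ltac:(lra) Hd').
      assert (B := HN m Hm s u ltac:(lra) Hsu ltac:(lra) Hd').
      apply Rabs_le_between in A. apply Rabs_le_between in B.
      destruct Hsg as [-> | ->]; lra. }
    assert (L1 := Hloc 1 ltac:(auto)). assert (L2 := Hloc (-1) ltac:(auto)).
    assert (2 * w * (al t - al 0) <= eps / 2).
    { apply Rle_trans with (2 * w * (al 1 - al 0 + 1)).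
      - apply Rmult_le_compat_l; [unfold w; left; apply Rmult_lt_0_compat; [lra|apply Rdiv_lt_0_compat; lra]|].
        assert (al t <= al 1) by (apply Hinc; unfold in01 in Ht; lra). lra.
      - unfold w. right. field. lra. }
    apply Rabs_lt_between. lra. }
  exists J. split.
  - unfold J. rewrite (Lim_seq_ext _ (fun _ => 0)) by (intros; apply H0). now rewrite Lim_seq_const.
  - intros eps He. destruct (Hu eps He) as [d [N [Hd HN]]]. exists d; split; auto.
    intros s t Hs Hst Ht Hd'.
    apply (lim_le_const (fun n => Jn n t - Jn n s) _ _ _ N).
    + apply is_lim_seq_minus'; apply HJ; unfold in01; lra.
    + intros n Hn. apply HN; auto.
Qed.

(** On each cell, moving the tag to the left end costs [w] times the increment of [al], and so does
    replacing the term by the increment of [J]; these increments telescope. *)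
Lemma RS_of_differential f g al J t : cont01 f -> dominates al g ->
  has_differential al (fun s t => f s * (g t - g s)) J -> in01 t ->
  RS_int f g 0 t (J t - J 0).
Proof.
  intros Hf Hdom HJ Ht eps He.
  assert (Hinc := dominates_incr al g Hdom).
  assert (Hal : al 0 <= al 1) by (apply Hinc; lra).
  set (w := eps / (4 * (al 1 - al 0 + 1))).
  assert (Hw : 0 < w) by (unfold w; apply Rdiv_lt_0_compat; lra).
  destruct (HJ w Hw) as [d [Hd H1]].
  destruct (cont01_uniform f Hf w Hw) as [d' [Hd' H2]].
  exists (Rmin d d'). split; [now apply Rmin_pos|].
  intros P HP Hm.
  assert (HPle : forall P a b, tagged_part a b P -> a <= b).
  { induction P0 as [|[[u xi] v] P0 IH]; simpl; intros a b HPP; [lra|].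
    destruct HPP as [-> [H3 [H4 H5]]]. apply IH in H5. lra. }
  assert (Hind : forall P a b, 0 <= a -> b <= 1 -> tagged_part a b P -> tmesh_lt P (Rmin d d') ->
    Rabs (RS_sum f g P - (J b - J a)) <= 2 * w * (al b - al a)).
  { clear P HP Hm. induction P as [|[[u xi] v] P IH]; intros a b Ha Hb HP Hm.
    - simpl in HP. subst. unfold RS_sum, sumR. simpl.
      replace (0 - (J b - J b)) with 0 by ring. rewrite Rabs_R0. lra.
    - assert (Hab := HPle _ _ _ HP). simpl in HP. destruct HP as [-> [H3 [H4 H5]]].
      assert (Hvb := HPle _ _ _ H5). unfold tmesh_lt in Hm.
      inversion Hm as [|q Q Hq HQ]; subst. simpl in Hq.
      specialize (IH v b ltac:(lra) Hb H5 HQ).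
      change (RS_sum f g ((a, xi, v) :: P)) with (f xi * (g v - g a) + RS_sum f g P).
      assert (Hmd := Rmin_l d d'). assert (Hmd' := Rmin_r d d').
      specialize (H1 a v Ha ltac:(lra) ltac:(lra) ltac:(lra)).
      assert (Hfx : Rabs ((f xi - f a) * (g v - g a)) <= w * (al v - al a)).
      { apply Rabs_le_prod; [left; apply H2; unfold in01; try lra; apply Rabs_lt_between; lra|].
        apply Hdom; lra. }
      apply Rabs_le_between in IH. apply Rabs_le_between in H1. apply Rabs_le_between in Hfx.
      apply Rabs_le. lra. }
  eapply Rle_lt_trans; [apply Hind; auto; unfold in01 in Ht; lra|].
  apply Rle_lt_trans with (eps / 2); [|lra].
  apply Rle_trans with (2 * w * (al 1 - al 0 + 1)).
  - apply Rmult_le_compat_l; [lra|].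
    assert (al t <= al 1) by (apply Hinc; unfold in01 in Ht; lra). lra.
  - unfold w. right. field. lra.
Qed.

Lemma fine_partition a b d : 0 < d -> a <= b -> exists P, tagged_part a b P /\ tmesh_lt P d.
Proof.
  intros Hd Hab.
  assert (Hn : forall n s, s <= b -> b - s <= INR n * (d / 2) -> exists P, tagged_part s b P /\ tmesh_lt P d).
  { induction n as [|n IH]; intros s Hs Hle.
    - simpl in Hle. exists nil. split; [simpl; lra | constructor].
    - rewrite S_INR in Hle. destruct (Rle_dec (b - s) (d / 2)) as [H1|H1].
      + destruct (Rle_lt_or_eq_dec s b Hs) as [H2|H2].
        * exists ((s, s, b) :: nil). split; simpl; [repeat split; lra|].
          constructor; [simpl; lra | constructor].
        * exists nil. split; [exact H2 | constructor].
      + destruct (IH (s + d / 2)) as [P [HP Hm]]; [lra | lra |].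
        exists ((s, s, s + d / 2) :: P). split; simpl; [repeat split; auto; lra|].
        constructor; [simpl; lra | auto]. }
  destruct (INR_unbounded ((b - a) / (d / 2))) as [n Hb].
  apply (Hn n a); [lra|].
  apply Rmult_lt_compat_r with (r := d / 2) in Hb; [|lra].
  replace ((b - a) / (d / 2) * (d / 2)) with (b - a) in Hb by (field; lra). lra.
Qed.

Lemma RS_unique f g a b v w : a <= b -> RS_int f g a b v -> RS_int f g a b w -> v = w.
Proof.
  intros Hab Hv Hw. apply cond_eq. intros eps He.
  destruct (Hv (eps / 2)) as [d [Hd H1]]; [lra|].
  destruct (Hw (eps / 2)) as [d' [Hd' H2]]; [lra|].
  destruct (fine_partition a b (Rmin d d')) as [P [HP Hm]]; [now apply Rmin_pos | auto |].
  assert (Hl : forall e, Rmin d d' <= e -> tmesh_lt P e).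
  { intros e Hle. unfold tmesh_lt in *. eapply Forall_impl; [|apply Hm]. simpl. intros. lra. }
  specialize (H1 P HP (Hl _ (Rmin_l d d'))). specialize (H2 P HP (Hl _ (Rmin_r d d'))).
  apply Rabs_lt_between in H1. apply Rabs_lt_between in H2. apply Rabs_lt_between. lra.
Qed.

(** Suited to a control with jumps: a step with increment [h] multiplies [u] by at most
    [1 + L * h <= exp (L * h)], so [u * exp (- L * al)] decreases up to [o(al)]. *)
Lemma gronwall (u al : R -> R) (L p q : R) : p <= q -> 0 <= L -> incr_on p q al ->
  (forall t, p <= t <= q -> 0 <= u t) ->
  (forall eps, 0 < eps -> exists d, 0 < d /\ forall s t, p <= s -> s <= t -> t <= q -> t - s < d ->
     u t <= u s + (L * u s + eps) * (al t - al s)) ->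
  u q <= u p * exp (L * (al q - al p)).
Proof.
  intros Hpq HL Ha Hu H.
  set (v := fun t => u t * exp (- (L * (al t - al p)))).
  assert (Hc : v q - v p <= 0 - 0).
  { apply (chain v (fun _ => 0) al p q Hpq). intros eps He.
    destruct (H eps He) as [d [Hd Hl]]. exists d; split; auto.
    intros s t Hs Hst Ht Hd'. specialize (Hl s t Hs Hst Ht Hd').
    assert (Has : al p <= al s) by (apply Ha; lra).
    assert (Hat : al s <= al t) by (apply Ha; lra).
    set (h := al t - al s) in *.
    assert (Hu' : u t <= u s * exp (L * h) + eps * h).
    { pose proof (exp_ineq1_le (L * h)). specialize (Hu s ltac:(lra)). nra. }
    unfold v.
    replace (- (L * (al t - al p))) with (- (L * (al s - al p)) + - (L * h)) by (unfold h; ring).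
    rewrite exp_plus.
    assert (E1 : exp (L * h) * exp (- (L * h)) = 1).
    { rewrite <- exp_plus, Rplus_opp_r. apply exp_0. }
    assert (Hle1 : forall r, 0 <= r -> 0 < exp (- r) <= 1).
    { intros r Hr. split; [apply exp_pos|]. rewrite <- exp_0.
      destruct (Rle_lt_or_eq_dec 0 r Hr) as [Hlt|Heq]; [left; apply exp_increasing; lra|].
      rewrite <- Heq, Ropp_0. lra. }
    assert (E2 := Hle1 (L * (al s - al p)) ltac:(apply Rmult_le_pos; lra)).
    assert (E3 := Hle1 (L * h) ltac:(apply Rmult_le_pos; unfold h; lra)).
    set (a := exp (- (L * (al s - al p)))) in *. set (b := exp (- (L * h))) in *.
    assert (Hh : 0 <= h) by (unfold h; lra).
    assert (u t * (a * b) <= u s * a + eps * h * (a * b)).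
    { replace (u s * a) with (u s * a * (exp (L * h) * b)) by (rewrite E1; ring).
      replace (u s * a * (exp (L * h) * b) + eps * h * (a * b)) with
        ((u s * exp (L * h) + eps * h) * (a * b)) by ring.
      apply Rmult_le_compat_r; auto. apply Rmult_le_pos; lra. }
    assert (a * b <= 1) by (rewrite <- (Rmult_1_l 1); apply Rmult_le_compat; lra).
    assert (eps * h * (a * b) <= eps * h * 1).
    { apply Rmult_le_compat_l; auto. apply Rmult_le_pos; lra. }
    lra. }
  unfold v in Hc. replace (al p - al p) with 0 in Hc by ring.
  rewrite Rmult_0_r, Ropp_0, exp_0, Rmult_1_r in Hc.
  assert (E : exp (L * (al q - al p)) * exp (- (L * (al q - al p))) = 1).
  { rewrite <- exp_plus, Rplus_opp_r. apply exp_0. }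
  replace (u q) with (u q * exp (- (L * (al q - al p))) * exp (L * (al q - al p))).
  - apply Rmult_le_compat_r; [left; apply exp_pos | lra].
  - rewrite Rmult_assoc, (Rmult_comm (exp _) (exp _)), E. ring.
Qed.

(** Picard iteration in a norm weighted by an exponential of [al]. The Lipschitz hypothesis compares
    the forms through the values of [B] and [B'] at the left end [s] only, so one comparison gives a
    contraction on all of [[0, 1]]. *)
Lemma stieltjes_equation (al : R -> R) (Om : (R -> R) -> R -> R -> R) (L z0 : R) :
  incr_on 0 1 al -> 0 < L ->
  (forall B, cont01 B -> exists J, J 0 = 0 /\ cont01 J /\ has_differential al (Om B) J) ->
  (forall B B' s t, 0 <= s -> s <= t -> t <= 1 ->
     Rabs (Om B s t - Om B' s t) <= L * Rabs (B s - B' s) * (al t - al s)) ->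
  exists B, B 0 = z0 /\ cont01 B /\ has_differential al (Om B) B.
Proof.
  intros Ha HL HJ HLip.
  assert (HPsi : forall B, exists J, cont01 B -> J 0 = z0 /\ cont01 J /\ has_differential al (Om B) J).
  { intros B. destruct (classic (cont01 B)) as [HB|HB]; [|exists B; tauto].
    destruct (HJ B HB) as [J [J0 [Jc Jd]]]. exists (fun t => z0 + J t). intros _.
    split; [lra|]. split; [apply cont01_plus; auto; apply cont01_const|].
    intros eps He. destruct (Jd eps He) as [d [Hd H]]. exists d; split; auto.
    intros s t Hs Hst Ht Hd'. replace (z0 + J t - (z0 + J s)) with (J t - J s) by ring. auto. }
  set (Psi := fun B => proj1_sig (constructive_indefinite_description _ (HPsi B))).
  assert (HP : forall B, cont01 B -> Psi B 0 = z0 /\ cont01 (Psi B) /\ has_differential al (Om B) (Psi B)).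
  { intros B. unfold Psi. apply proj2_sig. }
  set (Bn := fix Bn n := match n with O => (fun _ : R => z0) | S n => Psi (Bn n) end).
  assert (HBc : forall n, cont01 (Bn n)).
  { induction n; [apply cont01_const | now apply HP]. }
  assert (HB0 : forall n, Bn n 0 = z0) by (destruct n; [reflexivity | now apply HP]).
  assert (Hincr : forall s t, 0 <= s -> s <= t -> t <= 1 -> al s <= al t) by (intros; apply Ha; lra).
  (* The factor 2 in the weight makes the operator contract by [1 / 2]. From [1 + r <= exp r], a
     step of the weight dominates [2 * L * ex s] times the step of [al], even across a jump. *)
  set (ex := fun t => exp (2 * L * (al t - al 0))).
  assert (Hex : forall s t, 0 <= s -> s <= t -> t <= 1 -> 2 * L * ex s * (al t - al s) <= ex t - ex s).
  { intros s t Hs Hst Ht. unfold ex.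
    replace (2 * L * (al t - al 0)) with (2 * L * (al s - al 0) + 2 * L * (al t - al s)) by ring.
    rewrite exp_plus. pose proof (exp_ineq1_le (2 * L * (al t - al s))).
    pose proof (exp_pos (2 * L * (al s - al 0))).
    assert (exp (2 * L * (al s - al 0)) * (1 + 2 * L * (al t - al s)) <=
       exp (2 * L * (al s - al 0)) * exp (2 * L * (al t - al s))) by (apply Rmult_le_compat_l; lra).
    lra. }
  assert (Hex0 : ex 0 = 1) by (unfold ex; rewrite Rminus_diag, Rmult_0_r; apply exp_0).
  assert (Hexpos : forall t, 0 < ex t) by (intros; apply exp_pos).
  assert (Hexmono : forall t, in01 t -> 1 <= ex t <= ex 1).
  { intros t [Ht0 Ht1]. assert (A := Hex 0 t (Rle_refl 0) Ht0 Ht1). assert (B := Hex t 1 Ht0 Ht1 (Rle_refl 1)).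
    rewrite Hex0 in A. pose proof (Hincr 0 t (Rle_refl 0) Ht0 Ht1). pose proof (Hincr t 1 Ht0 Ht1 (Rle_refl 1)).
    pose proof (Hexpos t).
    assert (0 <= 2 * L * 1 * (al t - al 0)) by (apply Rmult_le_pos; lra).
    assert (0 <= 2 * L * ex t * (al 1 - al t)) by (apply Rmult_le_pos; [apply Rmult_le_pos|]; lra). lra. }
  destruct (cont01_bounded (fun t => Bn 1%nat t + -1 * Bn 0%nat t)) as [C [HC0 HC]].
  { apply cont01_plus; auto. apply cont01_scal. auto. }
  assert (Hgeo : forall n t, in01 t -> Rabs (Bn (S n) t - Bn n t) <= C * (/ 2) ^ n * ex t).
  { induction n as [|n IH]; intros t Ht.
    - simpl pow. rewrite Rmult_1_r. apply Rle_trans with (C * 1).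
      + rewrite Rmult_1_r. replace (Bn 1%nat t - Bn 0%nat t) with (Bn 1%nat t + -1 * Bn 0%nat t) by ring. auto.
      + apply Rmult_le_compat_l; [lra|]. now apply Hexmono.
    - apply Rle_trans with (C * (/ 2) ^ S n * ex t - C * (/ 2) ^ S n * ex 0 + 0 * (al t - al 0)).
      + apply (has_differential_diff al (Om (Bn (S n))) (Om (Bn n)) (fun t => C * (/ 2) ^ S n * ex t) 0
          (Bn (S (S n))) (Bn (S n)) t Ht).
        * intros s u Hs Hsu Hu. eapply Rle_trans; [now apply HLip|].
          specialize (IH s ltac:(unfold in01; lra)). specialize (Hex s u Hs Hsu Hu).
          specialize (Hincr s u Hs Hsu Hu).
          apply Rle_trans with (L * (C * (/ 2) ^ n * ex s) * (al u - al s)).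
          { apply Rmult_le_compat_r; [lra|]. apply Rmult_le_compat_l; lra. }
          simpl pow. assert (0 <= C * (/ 2) ^ n / 2).
          { apply Rmult_le_pos; [|lra]. apply Rmult_le_pos; [lra|]. apply pow_le. lra. }
          assert (C * (/ 2) ^ n / 2 * (2 * L * ex s * (al u - al s)) <= C * (/ 2) ^ n / 2 * (ex u - ex s))
            by (apply Rmult_le_compat_l; auto).
          lra.
        * apply HP; auto.
        * apply HP; auto.
        * rewrite !HB0; auto.
      + assert (0 <= C * (/ 2) ^ S n * ex 0); [|lra].
        apply Rmult_le_pos; [apply Rmult_le_pos; [lra|apply pow_le; lra]|left; auto]. }
  (* Sum of the geometric series of ratio [1 / 2] with first term [C], times the largest value of
     the weight. *)
  set (K := 2 * C * ex 1).
  assert (HK : 0 < K) by (unfold K; apply Rmult_lt_0_compat; [lra | auto]).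
  assert (Hcau : forall n k t, in01 t -> Rabs (Bn (n + k)%nat t - Bn n t) <= K * (/ 2) ^ n).
  { intros n k t Ht.
    assert (Hs : Rabs (Bn (n + k)%nat t - Bn n t) <= K * ((/ 2) ^ n - (/ 2) ^ (n + k))).
    { induction k as [|k IH].
      - rewrite Nat.add_0_r, !Rminus_diag, Rabs_R0. lra.
      - rewrite Nat.add_succ_r.
        replace (Bn (S (n + k)) t - Bn n t) with
          ((Bn (S (n + k)) t - Bn (n + k)%nat t) + (Bn (n + k)%nat t - Bn n t)) by ring.
        eapply Rle_trans; [apply Rabs_triang|]. specialize (Hgeo (n + k)%nat t Ht).
        assert (C * (/ 2) ^ (n + k) * ex t <= K * ((/ 2) ^ (n + k) - (/ 2) ^ S (n + k))).
        { simpl pow. unfold K.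
          replace (2 * C * ex 1 * ((/ 2) ^ (n + k) - / 2 * (/ 2) ^ (n + k))) with
            (C * (/ 2) ^ (n + k) * ex 1) by field.
          apply Rmult_le_compat_l; [|now apply Hexmono].
          apply Rmult_le_pos; [lra | apply pow_le; lra]. }
        lra. }
    eapply Rle_trans; [apply Hs|]. apply Rmult_le_compat_l; [lra|].
    assert (0 <= (/ 2) ^ (n + k)) by (apply pow_le; lra). lra. }
  assert (Hpow : forall eps, 0 < eps -> exists N, forall n, (N <= n)%nat -> (/ 2) ^ n < eps).
  { intros eps He. destruct (pow_lt_1_zero (/ 2)) with (y := eps) as [N HN]; auto.
    { rewrite Rabs_right; lra. }
    exists N. intros n Hn. specialize (HN n Hn). rewrite Rabs_right in HN; auto.
    apply Rle_ge, pow_le. lra. }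
  set (B := fun t => real (Lim_seq (fun n => Bn n t))).
  assert (HB : forall t, in01 t -> is_lim_seq (fun n => Bn n t) (B t)).
  { intros t Ht. apply cauchy_lim. intros eps He.
    destruct (Hpow (eps / (2 * K))) as [N HN]; [apply Rdiv_lt_0_compat; lra|].
    exists N. intros n m Hn Hm.
    assert (HNN : K * (/ 2) ^ N < eps / 2).
    { specialize (HN N (Nat.le_refl N)). apply Rmult_lt_compat_l with (r := K) in HN; auto.
      replace (K * (eps / (2 * K))) with (eps / 2) in HN by (field; lra). exact HN. }
    assert (A1 := Hcau N (n - N)%nat t Ht). assert (A2 := Hcau N (m - N)%nat t Ht).
    replace (N + (n - N))%nat with n in A1 by lia. replace (N + (m - N))%nat with m in A2 by lia.
    apply Rabs_le_between in A1. apply Rabs_le_between in A2. apply Rabs_lt_between. lra. }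
  assert (HBn : forall n t, in01 t -> Rabs (B t - Bn n t) <= K * (/ 2) ^ n).
  { intros n t Ht. apply (lim_le_const (fun k => Bn k t) _ _ _ n); auto.
    intros k Hk. replace k with (n + (k - n))%nat by lia. auto. }
  assert (HBcont : cont01 B).
  { intros t Ht eps He.
    destruct (Hpow (eps / (4 * K))) as [N HN]; [apply Rdiv_lt_0_compat; lra|].
    specialize (HN N (Nat.le_refl N)). apply Rmult_lt_compat_l with (r := K) in HN; auto.
    replace (K * (eps / (4 * K))) with (eps / 4) in HN by (field; lra).
    destruct (HBc N t Ht (eps / 4)) as [d [Hd H]]; [lra|]. exists d; split; auto.
    intros s Hs Hst. specialize (H s Hs Hst). assert (A1 := HBn N s Hs). assert (A2 := HBn N t Ht).
    apply Rabs_lt_between in H. apply Rabs_le_between in A1. apply Rabs_le_between in A2.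
    apply Rabs_lt_between. lra. }
  destruct (HP B HBcont) as [P0 [Pc Pd]].
  assert (Hfix : forall t, in01 t -> Psi B t = B t).
  { intros t Ht. apply cond_eq. intros eps He.
    set (M := K * (L * (al 1 - al 0) + 1)).
    assert (Hal := Hincr 0 1 ltac:(lra) ltac:(lra) ltac:(lra)).
    assert (HL' : 0 <= L * (al 1 - al 0)) by (apply Rmult_le_pos; lra).
    assert (HM : 0 < M) by (unfold M; apply Rmult_lt_0_compat; lra).
    destruct (Hpow (eps / M)) as [N HN]; [apply Rdiv_lt_0_compat; lra|].
    specialize (HN N (Nat.le_refl N)). apply Rmult_lt_compat_l with (r := M) in HN; auto.
    replace (M * (eps / M)) with eps in HN by (field; lra).
    assert (A1 := HBn (S N) t Ht).
    assert (A2 := has_differential_diff al (Om B) (Om (Bn N)) (fun _ => 0) (L * (K * (/ 2) ^ N))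
      (Psi B) (Bn (S N)) t Ht).
    assert (A3 : Rabs (Psi B t - Bn (S N) t) <= 0 - 0 + L * (K * (/ 2) ^ N) * (al t - al 0)).
    { apply A2; auto.
      - intros s u Hs Hsu Hu. eapply Rle_trans; [now apply HLip|].
        rewrite Rminus_diag, Rplus_0_l. apply Rmult_le_compat_r.
        + specialize (Hincr s u Hs Hsu Hu). lra.
        + apply Rmult_le_compat_l; [lra|]. apply HBn. unfold in01; lra.
      - apply HP; auto.
      - rewrite HB0. auto. }
    assert (Hp : 0 < (/ 2) ^ N) by (apply pow_lt; lra).
    assert (L * (K * (/ 2) ^ N) * (al t - al 0) <= L * (K * (/ 2) ^ N) * (al 1 - al 0)).
    { destruct Ht. apply Rmult_le_compat_l; [|pose proof (Hincr t 1 ltac:(lra) ltac:(lra) ltac:(lra)); lra].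
      apply Rmult_le_pos; [lra|]. apply Rmult_le_pos; lra. }
    assert (K * (/ 2) ^ S N <= K * (/ 2) ^ N).
    { apply Rmult_le_compat_l; [lra|]. simpl. lra. }
    unfold M in HN.
    apply Rabs_le_between in A1. apply Rabs_le_between in A3. apply Rabs_lt_between. lra. }
  exists B. split; [rewrite <- Hfix; [auto | unfold in01; lra]|]. split; auto.
  apply has_differential_ext with (Om B) (Psi B); auto.
Qed.

(** * Functions of bounded variation *)

Definition var_sum (g : R -> R) (l : list R) : R :=
  sumR (map (fun p : R * R => Rabs (g (snd p) - g (fst p))) (pairs l)).

Definition chain01 (l : list R) : Prop :=
  List.Forall in01 l /\ List.Forall (fun p : R * R => fst p <= snd p) (pairs l).

Lemma var_sum_cons g a b l : var_sum g (a :: b :: l) = Rabs (g b - g a) + var_sum g (b :: l).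
Proof. unfold var_sum, sumR. rewrite pairs_cons. reflexivity. Qed.

Lemma var_sum_nonneg g l : 0 <= var_sum g l.
Proof.
  unfold var_sum, sumR. induction (pairs l) as [|p L IH]; simpl; [lra|].
  pose proof (Rabs_pos (g (snd p) - g (fst p))). lra.
Qed.

Lemma chain01_cons a b l : in01 a -> a <= b -> chain01 (b :: l) -> chain01 (a :: b :: l).
Proof.
  intros Ha Hab [H1 H2]. split; [constructor; auto|]. rewrite pairs_cons. constructor; auto.
Qed.

(** [V t] is the variation over [[t, 1]]. Measured from the right end, it yields right-continuity at
    once: in a list that nearly attains [V t], the head [t] may be moved to a slightly larger [s] at
    the cost of one small increment of [g]. *)
Lemma CBV_dominated g : CBV01 g -> exists al, dominates al g /\ rcont01 al.
Proof.
  intros [Hc [M HM]].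
  assert (HV : forall t, exists V, in01 t -> is_lub (fun r => exists l, chain01 (t :: l) /\ r = var_sum g (t :: l)) V).
  { intros t. destruct (classic (in01 t)) as [Ht|Ht]; [|exists 0; tauto].
    destruct (completeness (fun r => exists l, chain01 (t :: l) /\ r = var_sum g (t :: l))) as [V HV].
    - exists M. intros r [l [[H1 H2] ->]]. apply HM; auto.
    - exists (var_sum g (t :: nil)), nil. split; auto. split; [constructor; auto | constructor].
    - exists V. auto. }
  set (V := fun t => proj1_sig (constructive_indefinite_description _ (HV t))).
  assert (Hl : forall t, in01 t -> is_lub (fun r => exists l, chain01 (t :: l) /\ r = var_sum g (t :: l)) (V t)).
  { intros t. unfold V. apply proj2_sig. }
  assert (Hpos : forall t, in01 t -> 0 <= V t).
  { intros t Ht. apply Rle_trans with (var_sum g (t :: nil)); [apply var_sum_nonneg|].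
    apply (Hl t Ht). exists nil. split; auto. split; [constructor; auto | constructor]. }
  exists (fun t => - V t). split.
  - intros s t Hs Hst Ht.
    assert (Hs1 : in01 s) by (unfold in01; lra). assert (Ht1 : in01 t) by (unfold in01; lra).
    assert (V t <= V s - Rabs (g t - g s)); [|lra].
    apply (Hl t Ht1). intros r [l [Hch ->]].
    assert (var_sum g (s :: t :: l) <= V s).
    { apply (Hl s Hs1). exists (t :: l). split; auto. apply chain01_cons; auto. }
    rewrite var_sum_cons in H. lra.
  - intros t Ht eps He.
    assert (Ht1 : in01 t) by (unfold in01; lra).
    assert (Hex : exists l, chain01 (t :: l) /\ V t - eps / 2 < var_sum g (t :: l)).
    { apply NNPP; intros Hn.
      assert (V t <= V t - eps / 2); [|lra]. apply (Hl t Ht1). intros r [l [Hch ->]].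
      apply Rnot_lt_le; intros Hlt. apply Hn. exists l; auto. }
    destruct Hex as [l [Hch Hsum]].
    (* The list may repeat [t] at its head, which would block the move; the induction drops the
       repetitions. *)
    assert (Hind : forall l, chain01 (t :: l) -> V t - eps / 2 < var_sum g (t :: l) ->
      exists d, 0 < d /\ forall s, t < s <= 1 -> s - t < d -> V t - eps < V s).
    { clear l Hch Hsum. induction l as [|b l IH]; intros Hch Hsum.
      - exists 1. split; [lra|]. intros s Hs _. unfold var_sum, sumR in Hsum. simpl in Hsum.
        assert (0 <= V s) by (apply Hpos; unfold in01; lra). lra.
      - destruct Hch as [H1 H2]. rewrite pairs_cons in H2.
        apply Forall_cons_iff in H1. destruct H1 as [_ H1].
        apply Forall_cons_iff in H2. simpl in H2. destruct H2 as [H2 H3].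
        rewrite var_sum_cons in Hsum.
        destruct (Rle_lt_or_eq_dec t b H2) as [Hlt|Heq].
        + destruct (Hc t Ht1 (eps / 2)) as [d [Hd Hgd]]; [lra|].
          exists (Rmin d (b - t)). split; [apply Rmin_pos; lra|].
          intros s Hs Hst. pose proof (Rmin_l d (b - t)). pose proof (Rmin_r d (b - t)).
          assert (Hs1 : in01 s) by (unfold in01; lra).
          assert (Hv : var_sum g (s :: b :: l) <= V s).
          { apply (Hl s Hs1). exists (b :: l). split; auto. apply chain01_cons; auto; [lra|split; auto]. }
          rewrite var_sum_cons in Hv.
          assert (Hgs : Rabs (g s - g t) < eps / 2) by (apply Hgd; auto; rewrite Rabs_right; lra).
          assert (Rabs (g b - g t) <= Rabs (g b - g s) + Rabs (g s - g t)).
          { replace (g b - g t) with ((g b - g s) + (g s - g t)) by ring. apply Rabs_triang. }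
          lra.
        + subst b. rewrite Rminus_diag, Rabs_R0, Rplus_0_l in Hsum.
          apply IH; auto. split; auto. }
    destruct (Hind l Hch Hsum) as [d [Hd H]]. exists d; split; auto.
    intros s Hs Hst. destruct (Rle_lt_or_eq_dec t s (proj1 Hs)) as [Hlt|Heq].
    + specialize (H s ltac:(lra) Hst). lra.
    + subst. lra.
Qed.

Lemma dominated_BV al g : dominates al g -> BV01 g.
Proof.
  intros Hd. exists (al 1 - al 0). intros l H1 H2.
  assert (Hinc := dominates_incr al g Hd).
  assert (H01 : al 0 <= al 1) by (apply Hinc; lra).
  change (var_sum g l <= al 1 - al 0).
  assert (Hind : forall l a, chain01 (a :: l) -> var_sum g (a :: l) <= al 1 - al a).
  { clear l H1 H2. induction l as [|b l IH]; intros a [H1 H2].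
    - unfold var_sum, sumR. simpl. apply Forall_cons_iff in H1. destruct H1 as [[Ha Ha'] _].
      assert (al a <= al 1) by (apply Hinc; lra). lra.
    - rewrite pairs_cons in H2. apply Forall_cons_iff in H1. destruct H1 as [Ha H1].
      apply Forall_cons_iff in H2. simpl in H2. destruct H2 as [H2 H3].
      rewrite var_sum_cons. specialize (IH b (conj H1 H3)).
      apply Forall_cons_iff in H1. destruct H1 as [Hb _]. unfold in01 in *.
      specialize (Hd a b ltac:(lra) H2 ltac:(lra)). lra. }
  destruct l as [|a l]; [unfold var_sum, sumR; simpl; lra|].
  specialize (Hind l a (conj H1 H2)). apply Forall_cons_iff in H1. destruct H1 as [[Ha Ha'] _].
  assert (al 0 <= al a) by (apply Hinc; lra). lra.
Qed.

(** * Scalar autonomous equations *)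

Lemma Rabs_between_dist (c a b x d : R) : Rmin a b <= c <= Rmax a b ->
  Rabs (a - x) < d -> Rabs (b - x) < d -> Rabs (c - x) < d.
Proof.
  intros Hc Ha Hb. apply Rabs_lt_between in Ha. apply Rabs_lt_between in Hb.
  apply Rabs_lt_between. revert Hc. apply Rmin_case; apply Rmax_case; intros; lra.
Qed.

Lemma is_derive_cont_pt f x l : is_derive f x l -> continuity_pt f x.
Proof.
  intros H. apply continuity_pt_filterlim. apply (ex_derive_continuous f x). now exists l.
Qed.

Lemma mean_value (f df : R -> R) (a b : R) :
  (forall x, Rmin a b <= x <= Rmax a b -> is_derive f x (df x)) ->
  exists c, Rmin a b <= c <= Rmax a b /\ f b - f a = df c * (b - a).
Proof.
  intros H. apply MVT_gen.
  - intros x Hx. apply H. lra.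
  - intros x Hx. eapply is_derive_cont_pt. apply H. lra.
Qed.

Lemma derive_nonneg_le (f df : R -> R) (a b : R) : a <= b ->
  (forall x, a <= x <= b -> is_derive f x (df x)) -> (forall x, a <= x <= b -> 0 <= df x) ->
  f a <= f b.
Proof.
  intros Hab Hd Hp. destruct (mean_value f df a b) as [c [Hc E]].
  - rewrite Rmin_left, Rmax_right by auto. auto.
  - rewrite Rmin_left, Rmax_right in Hc by auto.
    assert (0 <= df c * (b - a)) by (apply Rmult_le_pos; [auto | lra]). lra.
Qed.

Lemma exp_mono a b : a <= b -> exp a <= exp b.
Proof.
  intros H. destruct (Rle_lt_or_eq_dec a b H) as [Hlt| ->]; [left; now apply exp_increasing | lra].
Qed.

Lemma is_derive_mirror (f : R -> R) (x l : R) : is_derive f (- x) l ->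
  is_derive (fun u => f (- u)) x (- l).
Proof.
  intros H. evar_last.
  - apply (is_derive_comp f (fun u => - u)); [apply H | auto_derive; auto; reflexivity].
  - unfold scal; simpl; unfold mult; simpl. ring.
Qed.

Lemma exp_growth_pos (D D' : R -> R) (K m t : R) : 0 < m -> 0 <= t -> D 0 = 0 ->
  (forall u, 0 <= u <= t -> is_derive D u (D' u)) ->
  (forall u, 0 <= u <= t -> Rabs (D' u) <= K * exp (m * u)) ->
  Rabs (D t) <= K / m * exp (m * t).
Proof.
  intros Hm Ht H0 HD HK.
  assert (HK0 : 0 <= K / m).
  { specialize (HK 0 ltac:(lra)). rewrite Rmult_0_r, exp_0 in HK. pose proof (Rabs_pos (D' 0)).
    apply Rdiv_le_0_compat; lra. }
  assert (E0 : forall u, is_derive (fun u => K / m * exp (m * u)) u (K * exp (m * u))).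
  { intros u. auto_derive; auto. field. lra. }
  assert (H1 : K / m * exp (m * 0) - D 0 <= K / m * exp (m * t) - D t).
  { apply (derive_nonneg_le (fun u => K / m * exp (m * u) - D u) (fun u => K * exp (m * u) - D' u) 0 t); auto.
    - intros u Hu. apply (is_derive_minus (V := R_NormedModule)); auto.
    - intros u Hu. specialize (HK u Hu). apply Rabs_le_between in HK. lra. }
  assert (H2 : K / m * exp (m * 0) + D 0 <= K / m * exp (m * t) + D t).
  { apply (derive_nonneg_le (fun u => K / m * exp (m * u) + D u) (fun u => K * exp (m * u) + D' u) 0 t); auto.
    - intros u Hu. apply (is_derive_plus (V := R_NormedModule)); auto.
    - intros u Hu. specialize (HK u Hu). apply Rabs_le_between in HK. lra. }
  rewrite Rmult_0_r, exp_0, H0 in *. apply Rabs_le. lra.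
Qed.

Lemma exp_growth (D D' : R -> R) (K m : R) : 0 < m -> D 0 = 0 ->
  (forall u, is_derive D u (D' u)) ->
  (forall u, Rabs (D' u) <= K * exp (m * Rabs u)) ->
  forall t, Rabs (D t) <= K / m * exp (m * Rabs t).
Proof.
  intros Hm H0 HD HK t. destruct (Rle_dec 0 t) as [Ht|Ht].
  - rewrite (Rabs_right t) by lra. apply (exp_growth_pos D D'); auto.
    intros u Hu. specialize (HK u). rewrite (Rabs_right u) in HK; lra.
  - rewrite (Rabs_left t) by lra. replace (D t) with (D (- (- t))) by (f_equal; ring).
    apply (exp_growth_pos (fun u => D (- u)) (fun u => - D' (- u))); auto; try lra.
    + now rewrite Ropp_0.
    + intros u Hu. apply is_derive_mirror. auto.
    + intros u Hu. rewrite Rabs_Ropp. specialize (HK (- u)).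
      rewrite Rabs_Ropp, (Rabs_right u) in HK by lra. exact HK.
Qed.

Lemma is_derive_primitive (f : R -> R) (t : R) : (forall u, continuous f u) ->
  is_derive (fun t => RInt f 0 t) t (f t).
Proof.
  intros Hf. apply (is_derive_RInt f _ 0).
  - apply filter_forall. intros u. apply (RInt_correct (V := R_CompleteNormedModule)).
    apply ex_RInt_continuous. intros z _. apply Hf.
  - apply Hf.
Qed.

(** Picard iteration on the whole line with weight [exp (2 * M * Rabs t)]. Integration gains the
    factor [/ (2 * M)] against the Lipschitz constant [M], so the iteration converges globally and
    no local solutions have to be continued. *)
Lemma autonomous_ode (s : R -> R) (M xi : R) : 0 < M ->
  (forall y y', Rabs (s y - s y') <= M * Rabs (y - y')) ->
  exists y : R -> R, y 0 = xi /\ forall t, is_derive y t (s (y t)).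
Proof.
  intros HM Hs.
  assert (Hsc : forall u, continuous s u).
  { intros u. apply continuity_pt_filterlim. intros eps He. exists (eps / M).
    split; [now apply Rdiv_lt_0_compat|]. intros v [_ Hv]. simpl in *. unfold R_dist in *.
    eapply Rle_lt_trans; [apply Hs|]. apply Rmult_lt_compat_l with (r := M) in Hv; auto.
    replace (M * (eps / M)) with eps in Hv by (field; lra). exact Hv. }
  set (yn := fix yn n := match n with
    | O => (fun _ : R => xi)
    | S n => fun t => xi + RInt (fun u => s (yn n u)) 0 t end).
  assert (Hsy : forall y : R -> R, (forall t, continuous y t) -> forall t, continuous (fun u => s (y u)) t).
  { intros y Hy t. apply (continuous_comp y s); auto. }
  assert (Hpr : forall y : R -> R, (forall t, continuous y t) -> forall t,
     is_derive (fun t => xi + RInt (fun u => s (y u)) 0 t) t (s (y t))).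
  { intros y Hy t. replace (s (y t)) with (0 + s (y t)) by ring.
    apply (is_derive_plus (V := R_NormedModule)); [apply (is_derive_const (V := R_NormedModule))|].
    apply (is_derive_primitive (fun u => s (y u))). now apply Hsy. }
  assert (Hc : forall n t, continuous (yn n) t).
  { induction n; intros t; [apply continuous_const|].
    apply (ex_derive_continuous (yn (S n)) t). eexists. simpl. apply Hpr. auto. }
  assert (Hd : forall n t, is_derive (yn (S n)) t (s (yn n t))) by (intros; simpl; apply Hpr; auto).
  assert (H0 : forall n, yn n 0 = xi).
  { destruct n; simpl; auto. rewrite RInt_point. unfold zero; simpl. ring. }
  (* The difference of the first two iterates has derivative [s xi]; [exp_growth] with rate [2 * M]
     gives this constant. *)
  set (C := Rabs (s xi) / (2 * M)).
  assert (HC : 0 <= C) by (apply Rdiv_le_0_compat; [apply Rabs_pos | lra]).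
  assert (Hgeo : forall n t, Rabs (yn (S n) t - yn n t) <= C * (/ 2) ^ n * exp (2 * M * Rabs t)).
  { induction n as [|n IH]; intros t.
    - rewrite pow_O, Rmult_1_r. unfold C.
      apply (exp_growth (fun t => yn 1%nat t - yn 0%nat t) (fun _ => s xi)); try lra.
      + rewrite !H0. ring.
      + intros u. replace (s xi) with (s xi - 0) by ring.
        apply (is_derive_minus (V := R_NormedModule)); [apply (Hd 0%nat)|apply (is_derive_const (V := R_NormedModule))].
      + intros u. assert (1 <= exp (2 * M * Rabs u)).
        { rewrite <- exp_0. apply exp_mono. apply Rmult_le_pos; [lra | apply Rabs_pos]. }
        rewrite <- (Rmult_1_r (Rabs (s xi))) at 1. apply Rmult_le_compat_l; auto. apply Rabs_pos.
    - replace (C * (/ 2) ^ S n) with (M * (C * (/ 2) ^ n) / (2 * M)) by (simpl; field; lra).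
      apply (exp_growth (fun t => yn (S (S n)) t - yn (S n) t) (fun u => s (yn (S n) u) - s (yn n u))); try lra.
      + rewrite !H0. ring.
      + intros u. apply (is_derive_minus (V := R_NormedModule)); apply Hd.
      + intros u. eapply Rle_trans; [apply Hs|]. rewrite (Rmult_assoc M).
        apply Rmult_le_compat_l; [lra|]. apply IH. }
  assert (Hcau : forall n k t, Rabs (yn (n + k)%nat t - yn n t) <= 2 * C * (/ 2) ^ n * exp (2 * M * Rabs t)).
  { intros n k t.
    assert (He := exp_pos (2 * M * Rabs t)). set (ex := exp (2 * M * Rabs t)) in *.
    assert (Hs' : Rabs (yn (n + k)%nat t - yn n t) <= 2 * C * ((/ 2) ^ n - (/ 2) ^ (n + k)) * ex).
    { induction k as [|k IH].
      - rewrite Nat.add_0_r, !Rminus_diag, Rabs_R0. lra.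
      - rewrite Nat.add_succ_r.
        replace (yn (S (n + k)) t - yn n t) with
          ((yn (S (n + k)) t - yn (n + k)%nat t) + (yn (n + k)%nat t - yn n t)) by ring.
        eapply Rle_trans; [apply Rabs_triang|]. specialize (Hgeo (n + k)%nat t). fold ex in Hgeo.
        simpl pow. lra. }
    eapply Rle_trans; [apply Hs'|]. apply Rmult_le_compat_r; [lra|].
    apply Rmult_le_compat_l; [lra|].
    assert (0 <= (/ 2) ^ (n + k)) by (apply pow_le; lra). lra. }
  assert (Hpow : forall K eps, 0 < eps -> exists N, forall n, (N <= n)%nat -> K * (/ 2) ^ n < eps).
  { intros K eps He.
    assert (HK : 0 < Rabs K + 1) by (pose proof (Rabs_pos K); lra).
    destruct (pow_lt_1_zero (/ 2)) with (y := eps / (Rabs K + 1)) as [N HN].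
    { rewrite Rabs_right; lra. }
    { now apply Rdiv_lt_0_compat. }
    exists N. intros n Hn. specialize (HN n Hn).
    assert (Hp : 0 < (/ 2) ^ n) by (apply pow_lt; lra). rewrite Rabs_right in HN by lra.
    apply Rle_lt_trans with ((Rabs K + 1) * (/ 2) ^ n).
    - apply Rmult_le_compat_r; [lra|]. pose proof (Rle_abs K). lra.
    - apply Rmult_lt_compat_l with (r := Rabs K + 1) in HN; auto.
      replace ((Rabs K + 1) * (eps / (Rabs K + 1))) with eps in HN by (field; lra). exact HN. }
  set (y := fun t => real (Lim_seq (fun n => yn n t))).
  assert (Hy : forall t, is_lim_seq (fun n => yn n t) (y t)).
  { intros t. apply cauchy_lim. intros eps He.
    destruct (Hpow (2 * C * exp (2 * M * Rabs t)) (eps / 2)) as [N HN]; [lra|].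
    exists N. intros n m Hn Hm. specialize (HN N (Nat.le_refl N)).
    assert (A1 := Hcau N (n - N)%nat t). assert (A2 := Hcau N (m - N)%nat t).
    replace (N + (n - N))%nat with n in A1 by lia. replace (N + (m - N))%nat with m in A2 by lia.
    apply Rabs_le_between in A1. apply Rabs_le_between in A2. apply Rabs_lt_between. lra. }
  assert (Hyn : forall n t, Rabs (y t - yn n t) <= 2 * C * (/ 2) ^ n * exp (2 * M * Rabs t)).
  { intros n t. apply (lim_le_const (fun k => yn k t) _ _ _ n); auto.
    intros k Hk. replace k with (n + (k - n))%nat by lia. auto. }
  assert (Hyc : forall t, continuous y t).
  { intros t. apply continuity_pt_filterlim. intros eps He.
    destruct (Hpow (2 * C * exp (2 * M * (Rabs t + 1))) (eps / 4)) as [N HN]; [lra|].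
    specialize (HN N (Nat.le_refl N)).
    assert (HcN := Hc N t). apply continuity_pt_filterlim in HcN.
    destruct (HcN (eps / 4)) as [d [Hd' H]]; [lra|].
    exists (Rmin d 1). split; [apply Rmin_pos; lra|]. intros v [HDv Hv]. simpl in *. unfold R_dist in *.
    pose proof (Rmin_l d 1). pose proof (Rmin_r d 1).
    assert (Hyv : Rabs (yn N v - yn N t) < eps / 4) by (apply H; split; auto; lra).
    assert (Hb : forall r, Rabs (r - t) < 1 -> Rabs (y r - yn N r) <= eps / 4).
    { intros r Hr. eapply Rle_trans; [apply Hyn|].
      apply Rle_trans with (2 * C * exp (2 * M * (Rabs t + 1)) * (/ 2) ^ N); [|lra].
      rewrite (Rmult_assoc (2 * C)), (Rmult_assoc (2 * C) (exp _)), (Rmult_comm (_ ^ N)).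
      apply Rmult_le_compat_l; [lra|]. apply Rmult_le_compat_r; [apply pow_le; lra|].
      apply exp_mono. apply Rmult_le_compat_l; [lra|].
      replace r with ((r - t) + t) by ring. eapply Rle_trans; [apply Rabs_triang|]. lra. }
    assert (A1 := Hb v ltac:(lra)). assert (A2 := Hb t ltac:(rewrite Rminus_diag, Rabs_R0; lra)).
    apply Rabs_le_between in A1. apply Rabs_le_between in A2. apply Rabs_lt_between in Hyv.
    apply Rabs_lt_between. lra. }
  assert (Hfix : forall t, y t = xi + RInt (fun u => s (y u)) 0 t).
  { intros t. symmetry. apply cond_eq. intros eps He.
    destruct (Hpow (3 * C * exp (2 * M * Rabs t)) eps He) as [N HN].
    specialize (HN N (Nat.le_refl N)).
    assert (A1 := Hyn (S N) t).
    assert (A2 : Rabs (xi + RInt (fun u => s (y u)) 0 t - yn (S N) t) <=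
      M * (2 * C * (/ 2) ^ N) / (2 * M) * exp (2 * M * Rabs t)).
    { apply (exp_growth (fun t => xi + RInt (fun u => s (y u)) 0 t - yn (S N) t)
        (fun u => s (y u) - s (yn N u))); try lra.
      - rewrite H0, RInt_point. unfold zero; simpl. ring.
      - intros u. apply (is_derive_minus (V := R_NormedModule)); [apply Hpr; auto | apply Hd].
      - intros u. eapply Rle_trans; [apply Hs|]. rewrite (Rmult_assoc M).
        apply Rmult_le_compat_l; [lra|]. apply Hyn. }
    replace (M * (2 * C * (/ 2) ^ N) / (2 * M)) with (C * (/ 2) ^ N) in A2 by (field; lra).
    assert (He' := exp_pos (2 * M * Rabs t)). simpl pow in A1.
    assert (0 < (/ 2) ^ N) by (apply pow_lt; lra).
    apply Rabs_le_between in A1. apply Rabs_le_between in A2. apply Rabs_lt_between. lra. }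
  exists y. split.
  - rewrite Hfix, RInt_point. unfold zero; simpl. ring.
  - intros t. apply (is_derive_ext (fun t => xi + RInt (fun u => s (y u)) 0 t)).
    + intros u. symmetry. apply Hfix.
    + apply Hpr. auto.
Qed.

(* Monotonicity of [(u^2 + e^2) exp(-2(M+1)t)]. *)
Lemma ode_gronwall_pos (u u' : R -> R) (M e t : R) : 0 <= M -> 0 <= e -> 0 <= t ->
  (forall v, 0 <= v <= t -> is_derive u v (u' v)) ->
  (forall v, 0 <= v <= t -> Rabs (u' v) <= M * Rabs (u v) + e) ->
  Rabs (u t) <= (Rabs (u 0) + e) * exp ((M + 1) * t).
Proof.
  intros HM He Ht Hd Hb.
  set (q := fun v => - ((u v ^ 2 + e ^ 2) * exp (- (2 * (M + 1)) * v))).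
  assert (Hq : q 0 <= q t).
  { apply (derive_nonneg_le q (fun v => - ((2 * u' v * u v - 2 * (M + 1) * (u v ^ 2 + e ^ 2)) * exp (- (2 * (M + 1)) * v)))); auto.
    - intros v Hv. unfold q. specialize (Hd v Hv). auto_derive.
      + now exists (u' v).
      + replace (Derive (fun x => u x) v) with (u' v) by (symmetry; now apply is_derive_unique). ring.
    - intros v Hv. specialize (Hb v Hv). assert (Hex := exp_pos (- (2 * (M + 1)) * v)).
      set (ex := exp (- (2 * (M + 1)) * v)) in *.
      assert (u' v * u v <= (M * Rabs (u v) + e) * Rabs (u v)).
      { eapply Rle_trans; [apply Rle_abs|]. rewrite Rabs_mult. apply Rmult_le_compat_r; auto. apply Rabs_pos. }
      assert (Hsq : Rabs (u v) * Rabs (u v) = u v * u v) by (rewrite <- Rabs_mult, Rabs_right; auto; apply Rle_ge, Rle_0_sqr).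
      assert (0 <= (Rabs (u v) - e) ^ 2) by apply pow2_ge_0.
      assert (0 <= M * (e * e)) by (apply Rmult_le_pos; auto; nra).
      assert (2 * u' v * u v - 2 * (M + 1) * (u v ^ 2 + e ^ 2) <= 0) by nra.
      nra. }
  unfold q in Hq. rewrite Rmult_0_r, exp_0 in Hq.
  assert (E : exp (- (2 * (M + 1)) * t) * (exp ((M + 1) * t)) ^ 2 = 1).
  { rewrite <- Rsqr_pow2. unfold Rsqr. rewrite <- !exp_plus.
    replace (- (2 * (M + 1)) * t + ((M + 1) * t + (M + 1) * t)) with 0 by ring. apply exp_0. }
  assert (Hex := exp_pos ((M + 1) * t)). assert (Hex' := exp_pos (- (2 * (M + 1)) * t)).
  set (ex := exp ((M + 1) * t)) in *. set (ex' := exp (- (2 * (M + 1)) * t)) in *.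
  assert (Hsq : u t ^ 2 <= ((Rabs (u 0) + e) * ex) ^ 2).
  { assert (Hu0 : Rabs (u 0) ^ 2 = u 0 ^ 2) by (rewrite RPow_abs, Rabs_right; auto; apply Rle_ge, pow2_ge_0).
    pose proof (Rabs_pos (u 0)).
    assert (Hle : (u t ^ 2 + e ^ 2) * ex' * ex ^ 2 <= (u 0 ^ 2 + e ^ 2) * 1 * ex ^ 2).
    { apply Rmult_le_compat_r; [apply pow2_ge_0|]. lra. }
    replace ((u t ^ 2 + e ^ 2) * ex' * ex ^ 2) with (u t ^ 2 + e ^ 2) in Hle
      by (rewrite Rmult_assoc, E; ring).
    replace (((Rabs (u 0) + e) * ex) ^ 2) with ((Rabs (u 0) ^ 2 + 2 * Rabs (u 0) * e + e ^ 2) * ex ^ 2) by ring.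
    rewrite Hu0.
    assert (0 <= Rabs (u 0) * e * ex ^ 2) by (apply Rmult_le_pos; [apply Rmult_le_pos; auto | apply pow2_ge_0]).
    assert (0 <= e ^ 2) by apply pow2_ge_0. lra. }
  apply Rsqr_incr_0_var.
  - rewrite <- Rsqr_abs, !Rsqr_pow2. exact Hsq.
  - apply Rmult_le_pos; [|lra]. pose proof (Rabs_pos (u 0)). lra.
Qed.

Lemma ode_gronwall (u u' : R -> R) (M e t : R) : 0 <= M -> 0 <= e ->
  (forall v, Rabs v <= Rabs t -> is_derive u v (u' v)) ->
  (forall v, Rabs v <= Rabs t -> Rabs (u' v) <= M * Rabs (u v) + e) ->
  Rabs (u t) <= (Rabs (u 0) + e) * exp ((M + 1) * Rabs t).
Proof.
  intros HM He Hd Hb. destruct (Rle_dec 0 t) as [Ht|Ht].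
  - rewrite (Rabs_right t) in * by lra. apply (ode_gronwall_pos u u'); auto.
    + intros v Hv. apply Hd. rewrite Rabs_right; lra.
    + intros v Hv. apply Hb. rewrite Rabs_right; lra.
  - rewrite (Rabs_left t) in * by lra. replace (u t) with (u (- (- t))) by (f_equal; ring).
    replace (u 0) with (u (- 0)) by (f_equal; ring).
    apply (ode_gronwall_pos (fun v => u (- v)) (fun v => - u' (- v))); auto; try lra.
    + intros v Hv. apply is_derive_mirror. apply Hd. rewrite Rabs_Ropp, Rabs_right; lra.
    + intros v Hv. rewrite Rabs_Ropp. apply Hb. rewrite Rabs_Ropp, Rabs_right; lra.
Qed.

(** * Functions of three variables of class C^1 *)

Ltac conjs := repeat match goal with |- _ /\ _ => split end.

Definition curry3 (g : R -> R -> R -> R) (p : R * R * R) : R :=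
  g (fst (fst p)) (snd (fst p)) (snd p).

Lemma cont3_continuous g a b c : cont3_at g a b c <-> continuous (curry3 g) ((a, b), c).
Proof.
  unfold continuous. rewrite filterlim_locally. unfold curry3. simpl. split.
  - intros H eps. destruct (H eps (cond_pos eps)) as [d [Hd Hg]].
    exists (mkposreal d Hd). intros [[a' b'] c'] [[Ha Hb] Hc]. simpl in *.
    apply Hg; assumption.
  - intros H eps He. destruct (H (mkposreal eps He)) as [d Hg]. simpl in Hg.
    exists d. split; [apply cond_pos|]. intros a' b' c' Ha Hb Hc.
    apply (Hg ((a', b'), c')). repeat split; assumption.
Qed.

Lemma cont3_ext g h a b c :
  (exists d, 0 < d /\ forall a' b' c', Rabs (a' - a) < d -> g a' b' c' = h a' b' c') ->
  cont3_at g a b c -> cont3_at h a b c.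
Proof.
  intros [d [Hd E]] H eps He. destruct (H eps He) as [d' [Hd' Hg]].
  exists (Rmin d d'). split; [now apply Rmin_pos|]. intros a' b' c' Ha Hb Hc.
  pose proof (Rmin_l d d'). pose proof (Rmin_r d d').
  rewrite <- !E; [apply Hg; lra | rewrite Rminus_diag, Rabs_R0; lra | lra].
Qed.

Lemma cont3_plus g h a b c : cont3_at g a b c -> cont3_at h a b c ->
  cont3_at (fun a b c => g a b c + h a b c) a b c.
Proof.
  rewrite !cont3_continuous. intros H1 H2.
  apply (continuous_plus (V := R_NormedModule) (curry3 g) (curry3 h)); auto.
Qed.

Lemma cont3_mult g h a b c : cont3_at g a b c -> cont3_at h a b c ->
  cont3_at (fun a b c => g a b c * h a b c) a b c.
Proof.
  rewrite !cont3_continuous. intros H1 H2.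
  apply (continuous_mult (K := R_AbsRing) (curry3 g) (curry3 h)); auto.
Qed.

Lemma cont3_comp (h : R -> R) g a b c : cont3_at g a b c -> continuous h (g a b c) ->
  cont3_at (fun a b c => h (g a b c)) a b c.
Proof.
  rewrite !cont3_continuous. intros H1 H2.
  apply (continuous_comp (curry3 g) h); auto.
Qed.

Lemma cont3_comp2 (h : R -> R -> R) g a b c : cont3_at g a b c -> cont2_at h a (g a b c) ->
  cont3_at (fun a b c => h a (g a b c)) a b c.
Proof.
  intros Hg Hh eps He. destruct (Hh eps He) as [d [Hd H]].
  destruct (Hg d Hd) as [d' [Hd' H']]. exists (Rmin d d'). split; [now apply Rmin_pos|].
  intros a' b' c' Ha Hb Hc. pose proof (Rmin_l d d'). pose proof (Rmin_r d d').
  apply H; [lra | apply H'; lra].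
Qed.

Lemma cont3_slice g a b c : cont3_at g a b c -> continuous (g a b) c.
Proof.
  intros H. apply continuity_pt_filterlim. intros eps He. destruct (H eps He) as [d [Hd Hg]].
  exists d. split; auto. intros c' [_ Hc]. apply Hg; auto; rewrite Rminus_diag, Rabs_R0; lra.
Qed.

Definition open_pred (D : R -> Prop) : Prop :=
  forall a, D a -> exists d, 0 < d /\ forall a', Rabs (a' - a) < d -> D a'.

(** The partial derivatives are arguments, so that the rules below compute those of compound
    functions and can be applied again to the result. [D] restricts the first variable alone, since
    the flow is global in the other two. *)
Definition has_C1_3 (D : R -> Prop) (f f1 f2 f3 : R -> R -> R -> R) : Prop :=
  forall a b c, D a ->
    is_derive (fun u => f u b c) a (f1 a b c) /\
    is_derive (fun u => f a u c) b (f2 a b c) /\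
    is_derive (fun u => f a b u) c (f3 a b c) /\
    cont3_at f a b c /\ cont3_at f1 a b c /\ cont3_at f2 a b c /\ cont3_at f3 a b c.

(** [g] has to agree with [f] over [D] only, so it may itself be one of the functions [d1_3],
    [d2_3], [d3_3] of the flow; this is how second order regularity in terms of [Derive] is
    reached. *)
Lemma has_C1_3_sound D f f1 f2 f3 g : open_pred D -> has_C1_3 D f f1 f2 f3 ->
  (forall a b c, D a -> g a b c = f a b c) ->
  C1_3 (fun a _ _ => D a) g /\
  (forall a b c, D a -> d1_3 g a b c = f1 a b c /\ d2_3 g a b c = f2 a b c /\
     d3_3 g a b c = f3 a b c).
Proof.
  intros HD Hf E.
  assert (Hder : forall a b c, D a -> is_derive (fun u => g u b c) a (f1 a b c) /\
    is_derive (fun u => g a u c) b (f2 a b c) /\ is_derive (fun u => g a b u) c (f3 a b c)).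
  { intros a b c Ha. destruct (Hf a b c Ha) as [H1 [H2 [H3 _]]].
    destruct (HD a Ha) as [d [Hd HDd]]. conjs.
    - apply is_derive_ext_loc with (fun u => f u b c); auto.
      exists (mkposreal d Hd). intros u Hu. symmetry. apply E. apply HDd. exact Hu.
    - apply is_derive_ext with (fun u => f a u c); auto. intros; symmetry; auto.
    - apply is_derive_ext with (fun u => f a b u); auto. intros; symmetry; auto. }
  assert (Heq : forall a b c, D a -> d1_3 g a b c = f1 a b c /\ d2_3 g a b c = f2 a b c /\
     d3_3 g a b c = f3 a b c).
  { intros a b c Ha. destruct (Hder a b c Ha) as [H1 [H2 H3]].
    conjs; now apply is_derive_unique. }
  split; auto. intros a b c Ha. destruct (Hder a b c Ha) as [H1 [H2 H3]].
  destruct (Hf a b c Ha) as [_ [_ [_ [C0 [C1 [C2 C3]]]]]].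
  destruct (HD a Ha) as [d [Hd HDd]].
  assert (Hx : forall h k, cont3_at h a b c -> (forall a b c, D a -> k a b c = h a b c) ->
    cont3_at k a b c).
  { intros h k Hh Hk. apply cont3_ext with h; auto. exists d. split; auto. intros. symmetry. auto. }
  conjs; try (eexists; eassumption).
  - now apply Hx with f.
  - apply Hx with f1; auto. intros. now apply Heq.
  - apply Hx with f2; auto. intros. now apply Heq.
  - apply Hx with f3; auto. intros. now apply Heq.
Qed.

Lemma has_C1_3_mult D f f1 f2 f3 g g1 g2 g3 : has_C1_3 D f f1 f2 f3 -> has_C1_3 D g g1 g2 g3 ->
  has_C1_3 D (fun a b c => f a b c * g a b c)
    (fun a b c => f1 a b c * g a b c + f a b c * g1 a b c)
    (fun a b c => f2 a b c * g a b c + f a b c * g2 a b c)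
    (fun a b c => f3 a b c * g a b c + f a b c * g3 a b c).
Proof.
  intros Hf Hg a b c Ha. destruct (Hf a b c Ha) as [X1 [X2 [X3 [C0 [C1 [C2 C3]]]]]].
  destruct (Hg a b c Ha) as [Y1 [Y2 [Y3 [D0 [D1 [D2 D3]]]]]].
  split; [apply (is_derive_mult (fun u => f u b c) (fun u => g u b c)); auto; intros; apply Rmult_comm|].
  split; [apply (is_derive_mult (fun u => f a u c) (fun u => g a u c)); auto; intros; apply Rmult_comm|].
  split; [apply (is_derive_mult (fun u => f a b u) (fun u => g a b u)); auto; intros; apply Rmult_comm|].
  conjs; repeat first [apply cont3_plus | apply cont3_mult]; auto.
Qed.

Lemma has_C1_3_plus D f f1 f2 f3 g g1 g2 g3 : has_C1_3 D f f1 f2 f3 -> has_C1_3 D g g1 g2 g3 ->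
  has_C1_3 D (fun a b c => f a b c + g a b c) (fun a b c => f1 a b c + g1 a b c)
    (fun a b c => f2 a b c + g2 a b c) (fun a b c => f3 a b c + g3 a b c).
Proof.
  intros Hf Hg a b c Ha. destruct (Hf a b c Ha) as [X1 [X2 [X3 [C0 [C1 [C2 C3]]]]]].
  destruct (Hg a b c Ha) as [Y1 [Y2 [Y3 [D0 [D1 [D2 D3]]]]]].
  split; [apply (is_derive_plus (V := R_NormedModule) (fun u => f u b c) (fun u => g u b c)); auto|].
  split; [apply (is_derive_plus (V := R_NormedModule) (fun u => f a u c) (fun u => g a u c)); auto|].
  split; [apply (is_derive_plus (V := R_NormedModule) (fun u => f a b u) (fun u => g a b u)); auto|].
  conjs; apply cont3_plus; auto.
Qed.

Lemma has_C1_3_comp D (h h' : R -> R) f f1 f2 f3 : has_C1_3 D f f1 f2 f3 ->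
  (forall a b c, D a -> is_derive h (f a b c) (h' (f a b c)) /\ continuous h' (f a b c)) ->
  has_C1_3 D (fun a b c => h (f a b c)) (fun a b c => h' (f a b c) * f1 a b c)
    (fun a b c => h' (f a b c) * f2 a b c) (fun a b c => h' (f a b c) * f3 a b c).
Proof.
  intros Hf Hh a b c Ha. destruct (Hf a b c Ha) as [X1 [X2 [X3 [C0 [C1 [C2 C3]]]]]].
  destruct (Hh a b c Ha) as [Hd Hc].
  assert (Hcomp : forall (k : R -> R) u l, is_derive k u l -> is_derive h (k u) (h' (f a b c)) ->
     is_derive (fun v => h (k v)) u (h' (f a b c) * l)).
  { intros k u l Hk Hhk. evar_last; [apply (is_derive_comp h k); eassumption|].
    unfold scal; simpl; unfold mult; simpl. ring. }
  split; [apply (Hcomp (fun u => f u b c)); auto|].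
  split; [apply (Hcomp (fun u => f a u c)); auto|].
  split; [apply (Hcomp (fun u => f a b u)); auto|].
  conjs; try apply cont3_mult; auto; apply cont3_comp; auto.
  apply (ex_derive_continuous h). eexists; eassumption.
Qed.

(** Both points move near the base point while the coefficients are taken at [(a, b)]. The increment
    is split at [(a, b')], and each part is a mean value with nearly constant slope. *)
Lemma strict_differential D f a0 b0 : open_pred D -> C1_2 (fun t _ => D t) f -> D a0 ->
  forall w, 0 < w -> exists d, 0 < d /\ forall a a' b b',
    Rabs (a - a0) < d -> Rabs (a' - a0) < d -> Rabs (b - b0) < d -> Rabs (b' - b0) < d ->
    Rabs (f a' b' - f a b - d1_2 f a b * (a' - a) - d2_2 f a b * (b' - b))
      <= w * (Rabs (a' - a) + Rabs (b' - b)).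
Proof.
  intros HD Hf Ha0 w Hw. destruct (Hf a0 b0 Ha0) as [_ [_ [_ [H1 H2]]]].
  destruct (H1 (w / 2)) as [e1 [He1 K1]]; [lra|].
  destruct (H2 (w / 2)) as [e2 [He2 K2]]; [lra|].
  destruct (HD a0 Ha0) as [e3 [He3 K3]].
  exists (Rmin e1 (Rmin e2 e3)). split; [repeat apply Rmin_pos; auto|].
  intros a a' b b' Ha Ha' Hb Hb'.
  pose proof (Rmin_l e1 (Rmin e2 e3)). pose proof (Rmin_r e1 (Rmin e2 e3)).
  pose proof (Rmin_l e2 e3). pose proof (Rmin_r e2 e3).
  set (d := Rmin e1 (Rmin e2 e3)) in *.
  destruct (mean_value (fun u => f u b') (fun u => d1_2 f u b') a a') as [p [Hp Ep]].
  { intros u Hu. apply Derive_correct. apply (Hf u b'). apply K3.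
    apply Rlt_le_trans with d; [|lra]. apply (Rabs_between_dist u a a'); auto. }
  destruct (mean_value (fun u => f a u) (fun u => d2_2 f a u) b b') as [q [Hq Eq]].
  { intros u Hu. apply Derive_correct. apply (Hf a u). apply K3. lra. }
  assert (Hpd := Rabs_between_dist p a a' a0 d Hp Ha Ha').
  assert (Hqd := Rabs_between_dist q b b' b0 d Hq Hb Hb').
  replace (f a' b' - f a b - d1_2 f a b * (a' - a) - d2_2 f a b * (b' - b)) with
    ((d1_2 f p b' - d1_2 f a b) * (a' - a) + (d2_2 f a q - d2_2 f a b) * (b' - b)) by (simpl in *; lra).
  eapply Rle_trans; [apply Rabs_triang|]. rewrite !Rabs_mult.
  assert (A1 : Rabs (d1_2 f p b' - d1_2 f a b) <= w).
  { assert (B1 := K1 p b' ltac:(lra) ltac:(lra)). assert (B2 := K1 a b ltac:(lra) ltac:(lra)).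
    apply Rabs_lt_between in B1. apply Rabs_lt_between in B2. apply Rabs_le. lra. }
  assert (A2 : Rabs (d2_2 f a q - d2_2 f a b) <= w).
  { assert (B1 := K2 a q ltac:(lra) ltac:(lra)). assert (B2 := K2 a b ltac:(lra) ltac:(lra)).
    apply Rabs_lt_between in B1. apply Rabs_lt_between in B2. apply Rabs_le. lra. }
  pose proof (Rabs_pos (a' - a)). pose proof (Rabs_pos (b' - b)).
  rewrite Rmult_plus_distr_l. apply Rplus_le_compat; apply Rmult_le_compat_r; auto.
Qed.

Lemma chain_rule_2 D f (g h : R -> R) t g' h' : open_pred D -> C1_2 (fun t _ => D t) f ->
  D (g t) -> is_derive g t g' -> is_derive h t h' ->
  is_derive (fun u => f (g u) (h u)) t (d1_2 f (g t) (h t) * g' + d2_2 f (g t) (h t) * h').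
Proof.
  intros HD Hf Ht Hg Hh. apply is_derive_Reals.
  apply (derivable_pt_lim_comp_2d f g h); try now apply is_derive_Reals.
  intros eps. destruct (strict_differential D f (g t) (h t) HD Hf Ht (eps / 2)) as [d [Hd H]].
  { pose proof (cond_pos eps). lra. }
  exists (mkposreal d Hd). intros u v Hu Hv. simpl in *.
  replace (f u v - f (g t) (h t) - (d1_2 f (g t) (h t) * (u - g t) + d2_2 f (g t) (h t) * (v - h t)))
    with (f u v - f (g t) (h t) - d1_2 f (g t) (h t) * (u - g t) - d2_2 f (g t) (h t) * (v - h t)) by ring.
  assert (Hz : forall r, Rabs (r - r) < d) by (intros; rewrite Rminus_diag, Rabs_R0; auto).
  eapply Rle_trans; [apply H; auto|].
  pose proof (Rmax_l (Rabs (u - g t)) (Rabs (v - h t))).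
  pose proof (Rmax_r (Rabs (u - g t)) (Rabs (v - h t))).
  pose proof (cond_pos eps).
  apply Rle_trans with (eps / 2 * (2 * Rmax (Rabs (u - g t)) (Rabs (v - h t)))).
  - apply Rmult_le_compat_l; lra.
  - right. field.
Qed.

Lemma has_C1_3_comp2 D h f f1 f2 f3 : open_pred D -> C1_2 (fun t _ => D t) h ->
  has_C1_3 D f f1 f2 f3 ->
  has_C1_3 D (fun a b c => h a (f a b c))
    (fun a b c => d1_2 h a (f a b c) + d2_2 h a (f a b c) * f1 a b c)
    (fun a b c => d2_2 h a (f a b c) * f2 a b c)
    (fun a b c => d2_2 h a (f a b c) * f3 a b c).
Proof.
  intros HD Hh Hf a b c Ha. destruct (Hf a b c Ha) as [X1 [X2 [X3 [C0 [C1 [C2 C3]]]]]].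
  destruct (Hh a (f a b c) Ha) as [_ [_ [K0 [K1 K2]]]].
  assert (Hid : is_derive (fun u : R => u) a 1) by apply is_derive_Reals, derivable_pt_lim_id.
  assert (Hcst : forall t, is_derive (fun _ : R => a) t 0) by (intros; apply (is_derive_const (V := R_NormedModule))).
  split.
  { evar_last; [apply (chain_rule_2 D h (fun u => u) (fun u => f u b c)); eauto|]. simpl. ring. }
  split.
  { evar_last; [apply (chain_rule_2 D h (fun _ => a) (fun u => f a u c)); eauto|]. simpl. ring. }
  split.
  { evar_last; [apply (chain_rule_2 D h (fun _ => a) (fun u => f a b u)); eauto|]. simpl. ring. }
  conjs.
  - now apply cont3_comp2.
  - apply cont3_plus; [now apply cont3_comp2|]. apply cont3_mult; auto. now apply cont3_comp2.
  - apply cont3_mult; auto. now apply cont3_comp2.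
  - apply cont3_mult; auto. now apply cont3_comp2.
Qed.

Lemma ex_RInt_slice g a b c1 c2 : (forall c, cont3_at g a b c) -> ex_RInt (g a b) c1 c2.
Proof.
  intros H. apply (ex_RInt_continuous (V := R_CompleteNormedModule)). intros z _.
  now apply cont3_slice.
Qed.

(** Uniformity over a compact range of the last variable, as required for integrals depending on
    parameters. *)
Lemma cont3_tube g a b T : (forall c, cont3_at g a b c) -> forall eps, 0 < eps ->
  exists d, 0 < d /\ forall a' b' c, Rabs (a' - a) < d -> Rabs (b' - b) < d -> - T <= c <= T ->
    Rabs (g a' b' c - g a b c) < eps.
Proof.
  intros Hg eps He.
  destruct (tube (- T) T (fun c _ d => forall a' b', Rabs (a' - a) < d -> Rabs (b' - b) < d ->
    Rabs (g a' b' c - g a b c) < eps)) as [d [Hd H]].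
  - intros u v d d' H Hd a' b' Ha Hb. apply H; lra.
  - intros c Hc. destruct (Hg c (eps / 2)) as [d [Hd H]]; [lra|]. exists d; split; auto.
    intros u v _ _ Hu _ a' b' Ha Hb.
    assert (A1 := H a' b' u Ha Hb Hu).
    assert (Hz : forall r, Rabs (r - r) < d) by (intros; rewrite Rminus_diag, Rabs_R0; auto).
    assert (A2 := H a b u (Hz _) (Hz _) Hu).
    apply Rabs_lt_between in A1. apply Rabs_lt_between in A2. apply Rabs_lt_between. lra.
  - exists d; split; auto. intros a' b' c Ha Hb Hc. apply (H c c); auto.
    rewrite Rminus_diag, Rabs_R0. auto.
Qed.

Lemma RInt_bound (f : R -> R) (a b K : R) : ex_RInt f a b ->
  (forall x, Rmin a b <= x <= Rmax a b -> Rabs (f x) <= K) -> Rabs (RInt f a b) <= K * Rabs (b - a).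
Proof.
  intros Hex Hf. destruct (Rle_dec a b) as [Hab|Hab].
  - rewrite Rmin_left, Rmax_right in Hf by auto.
    eapply Rle_trans; [apply (abs_RInt_le_const f a b K); auto|].
    rewrite Rabs_right by lra. lra.
  - rewrite Rmin_right, Rmax_left in Hf by lra.
    rewrite <- (opp_RInt_swap (V := R_CompleteNormedModule)) by (now apply ex_RInt_swap).
    unfold opp; simpl. rewrite Rabs_Ropp.
    eapply Rle_trans; [apply (abs_RInt_le_const f b a K); auto; [lra | now apply ex_RInt_swap]|].
    rewrite Rabs_left by lra. lra.
Qed.

Lemma cont3_RInt D g : open_pred D -> (forall a b c, D a -> cont3_at g a b c) ->
  forall a b c, D a -> cont3_at (fun a b c => RInt (g a b) 0 c) a b c.
Proof.
  intros HD Hg a b c Ha eps He.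
  set (T := Rabs c + 1). assert (HT : 1 <= T) by (unfold T; pose proof (Rabs_pos c); lra).
  destruct (cont3_tube g a b T (fun c => Hg a b c Ha) (eps / (2 * T))) as [d [Hd H]].
  { apply Rdiv_lt_0_compat; lra. }
  destruct (HD a Ha) as [d1 [Hd1 HD1]].
  assert (Hex : forall a' b' c1 c2, D a' -> ex_RInt (g a' b') c1 c2).
  { intros. apply ex_RInt_slice. auto. }
  assert (Hcc : continuous (fun c => RInt (g a b) 0 c) c).
  { apply (ex_derive_continuous (fun c => RInt (g a b) 0 c)). eexists. apply is_derive_primitive.
    intros u. apply cont3_slice. auto. }
  apply continuity_pt_filterlim in Hcc. destruct (Hcc (eps / 2)) as [d2 [Hd2 H2]]; [lra|].
  exists (Rmin (Rmin d d1) (Rmin d2 1)). split; [repeat apply Rmin_pos; lra|].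
  intros a' b' c' Ha' Hb' Hc'.
  pose proof (Rmin_l (Rmin d d1) (Rmin d2 1)). pose proof (Rmin_r (Rmin d d1) (Rmin d2 1)).
  pose proof (Rmin_l d d1). pose proof (Rmin_r d d1). pose proof (Rmin_l d2 1). pose proof (Rmin_r d2 1).
  assert (A1 : Rabs (RInt (g a b) 0 c' - RInt (g a b) 0 c) < eps / 2).
  { destruct (Req_dec c' c) as [->|Hne]; [rewrite Rminus_diag, Rabs_R0; lra|].
    apply H2. split; [split; [exact I | auto]|]. simpl. unfold R_dist. lra. }
  assert (HDa' : D a') by (apply HD1; lra).
  assert (A2 : Rabs (RInt (g a' b') 0 c' - RInt (g a b) 0 c') <= eps / (2 * T) * Rabs (c' - 0)).
  { rewrite <- (RInt_minus (V := R_CompleteNormedModule)) by (apply Hex; auto).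
    apply RInt_bound.
    - apply (ex_RInt_minus (V := R_NormedModule)); apply Hex; auto.
    - intros u Hu. left. apply H; try lra. apply Rabs_lt_between in Hc'.
      assert (Hcb : - T <= c' <= T).
      { unfold T. pose proof (Rle_abs c). pose proof (Rabs_maj2 c). lra. }
      revert Hu. apply Rmin_case; apply Rmax_case; intros; lra. }
  assert (A3 : eps / (2 * T) * Rabs (c' - 0) <= eps / 2).
  { apply Rle_trans with (eps / (2 * T) * T); [|right; field; lra].
    apply Rmult_le_compat_l; [left; apply Rdiv_lt_0_compat; lra|].
    rewrite Rminus_0_r. unfold T. replace c' with ((c' - c) + c) by ring.
    eapply Rle_trans; [apply Rabs_triang|]. lra. }
  apply Rabs_le_between in A2. apply Rabs_lt_between in A1. apply Rabs_lt_between. lra.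
Qed.

Lemma is_derive_RInt_bounded (G : R -> R -> R) (G1 : R -> R) (u0 c r : R) : 0 < r ->
  (forall u, Rabs (u - u0) < r -> ex_RInt (G u) 0 c) -> ex_RInt G1 0 c ->
  (forall eps, 0 < eps -> exists d, 0 < d /\ forall u v, Rabs (u - u0) < d ->
     Rmin 0 c <= v <= Rmax 0 c ->
     Rabs (G u v - G u0 v - G1 v * (u - u0)) <= eps * Rabs (u - u0)) ->
  is_derive (fun u => RInt (G u) 0 c) u0 (RInt G1 0 c).
Proof.
  intros Hr Hex Hex1 H. apply is_derive_Reals. intros eps Heps.
  assert (Hc : 0 < Rabs c + 1) by (pose proof (Rabs_pos c); lra).
  destruct (H (eps / (Rabs c + 1))) as [d [Hd Hb]].
  { apply Rdiv_lt_0_compat; auto. }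
  assert (Hdr : 0 < Rmin d r) by (apply Rmin_pos; auto).
  exists (mkposreal _ Hdr). intros h Hh Hlt. simpl in Hlt.
  pose proof (Rmin_l d r). pose proof (Rmin_r d r).
  assert (Hu : u0 + h - u0 = h) by ring.
  assert (Hex0 : ex_RInt (G u0) 0 c) by (apply Hex; rewrite Rminus_diag, Rabs_R0; auto).
  assert (Hexu : ex_RInt (G (u0 + h)) 0 c) by (apply Hex; rewrite Hu; lra).
  assert (Hd1 : ex_RInt (fun v => minus (G (u0 + h) v) (G u0 v)) 0 c)
    by (apply (ex_RInt_minus (V := R_NormedModule)); auto).
  assert (Hd2 : ex_RInt (fun v => scal h (G1 v)) 0 c)
    by (apply (ex_RInt_scal (V := R_NormedModule)); auto).
  assert (E : RInt (fun v => minus (minus (G (u0 + h) v) (G u0 v)) (scal h (G1 v))) 0 c =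
    RInt (G (u0 + h)) 0 c - RInt (G u0) 0 c - h * RInt G1 0 c).
  { rewrite (RInt_minus (V := R_CompleteNormedModule) (fun v => minus (G (u0 + h) v) (G u0 v))) by auto.
    rewrite (RInt_minus (V := R_CompleteNormedModule) (G (u0 + h))) by auto.
    rewrite (RInt_scal (V := R_CompleteNormedModule) G1) by auto. reflexivity. }
  assert (B : Rabs (RInt (G (u0 + h)) 0 c - RInt (G u0) 0 c - h * RInt G1 0 c) <=
    eps / (Rabs c + 1) * Rabs h * Rabs c).
  { rewrite <- E. rewrite <- (Rminus_0_r c) at 3. apply RInt_bound.
    - apply (ex_RInt_minus (V := R_NormedModule)); auto.
    - intros v Hv.
      change (Rabs (G (u0 + h) v - G u0 v - h * G1 v) <= eps / (Rabs c + 1) * Rabs h).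
      replace (G (u0 + h) v - G u0 v - h * G1 v) with
        (G (u0 + h) v - G u0 v - G1 v * (u0 + h - u0)) by ring.
      rewrite <- Hu at 3. apply Hb; auto. rewrite Hu. lra. }
  assert (Hah : 0 < Rabs h) by now apply Rabs_pos_lt.
  replace ((RInt (G (u0 + h)) 0 c - RInt (G u0) 0 c) / h - RInt G1 0 c) with
    ((RInt (G (u0 + h)) 0 c - RInt (G u0) 0 c - h * RInt G1 0 c) / h) by (field; auto).
  unfold Rdiv at 1. rewrite Rabs_mult, Rabs_inv.
  apply Rmult_lt_reg_r with (Rabs h); auto. rewrite Rmult_assoc, Rinv_l, Rmult_1_r by lra.
  eapply Rle_lt_trans; [apply B|].
  replace (eps / (Rabs c + 1) * Rabs h * Rabs c) with ((eps / (Rabs c + 1) * Rabs c) * Rabs h) by ring.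
  apply Rmult_lt_compat_r; auto.
  apply Rmult_lt_reg_r with (Rabs c + 1); auto.
  replace (eps / (Rabs c + 1) * Rabs c * (Rabs c + 1)) with (eps * Rabs c) by (field; lra).
  apply Rmult_lt_compat_l; lra.
Qed.

Lemma has_C1_3_RInt D g g1 g2 g3 : open_pred D -> has_C1_3 D g g1 g2 g3 ->
  has_C1_3 D (fun a b c => RInt (g a b) 0 c) (fun a b c => RInt (g1 a b) 0 c)
    (fun a b c => RInt (g2 a b) 0 c) g.
Proof.
  intros HD Hg a b c Ha.
  assert (C0 : forall a b c, D a -> cont3_at g a b c) by (intros; now apply Hg).
  assert (C1 : forall a b c, D a -> cont3_at g1 a b c) by (intros; now apply Hg).
  assert (C2 : forall a b c, D a -> cont3_at g2 a b c) by (intros; now apply Hg).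
  destruct (HD a Ha) as [r [Hr HDr]].
  assert (Hc : forall v, Rmin 0 c <= v <= Rmax 0 c -> - Rabs c <= v <= Rabs c).
  { intros v. pose proof (Rle_abs c). pose proof (Rabs_maj2 c). pose proof (Rabs_pos c).
    apply Rmin_case; apply Rmax_case; intros; lra. }
  assert (Hz : forall (d r : R), 0 < d -> Rabs (r - r) < d) by (intros; rewrite Rminus_diag, Rabs_R0; auto).
  split.
  { apply (is_derive_RInt_bounded (fun u v => g u b v) (fun v => g1 a b v) a c r Hr).
    - intros u Hu. apply ex_RInt_slice. intros; apply C0; auto.
    - apply ex_RInt_slice. auto.
    - intros eps He. destruct (cont3_tube g1 a b (Rabs c) (fun c => C1 a b c Ha) eps He) as [d [Hd H]].
      exists (Rmin d r). split; [now apply Rmin_pos|]. intros u v Hu Hv.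
      pose proof (Rmin_l d r). pose proof (Rmin_r d r).
      destruct (mean_value (fun u => g u b v) (fun u => g1 u b v) a u) as [q [Hq E]].
      { intros w Hw. apply Hg. apply HDr. apply (Rabs_between_dist w a u); auto. lra. }
      rewrite E. replace (g1 q b v * (u - a) - g1 a b v * (u - a)) with ((g1 q b v - g1 a b v) * (u - a)) by ring.
      rewrite Rabs_mult. apply Rmult_le_compat_r; [apply Rabs_pos|]. left. apply H; auto.
      apply Rlt_le_trans with (Rmin d r); [|auto]. apply (Rabs_between_dist q a u); auto.
      apply Hz. now apply Rmin_pos. }
  split.
  { apply (is_derive_RInt_bounded (fun u v => g a u v) (fun v => g2 a b v) b c 1 Rlt_0_1).
    - intros u Hu. apply ex_RInt_slice. auto.
    - apply ex_RInt_slice. auto.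
    - intros eps He. destruct (cont3_tube g2 a b (Rabs c) (fun c => C2 a b c Ha) eps He) as [d [Hd H]].
      exists d. split; auto. intros u v Hu Hv.
      destruct (mean_value (fun u => g a u v) (fun u => g2 a u v) b u) as [q [Hq E]].
      { intros w Hw. apply Hg. auto. }
      rewrite E. replace (g2 a q v * (u - b) - g2 a b v * (u - b)) with ((g2 a q v - g2 a b v) * (u - b)) by ring.
      rewrite Rabs_mult. apply Rmult_le_compat_r; [apply Rabs_pos|]. left. apply H; auto.
      apply (Rabs_between_dist q b u); auto. }
  split.
  { apply (is_derive_primitive (g a b)). intros u. apply cont3_slice. auto. }
  conjs; auto; now apply (cont3_RInt D).
Qed.

(** * The flow *)

Section Flow.

Variables (D : R -> Prop) (sigma : R -> R -> R) (M : R).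
Hypothesis D_open : open_pred D.
Hypothesis sigma_C2 : C2_2 (fun t _ => D t) sigma.
Hypothesis M_pos : 0 < M.
Hypothesis sigma_bound : forall t y, D t -> Rabs (d1_2 sigma t y) <= M /\ Rabs (d2_2 sigma t y) <= M.

Lemma sigma_lip tau y y' : D tau -> Rabs (sigma tau y - sigma tau y') <= M * Rabs (y - y').
Proof.
  intros Ht. destruct sigma_C2 as [C1 _].
  destruct (mean_value (fun u => sigma tau u) (fun u => d2_2 sigma tau u) y' y) as [c [_ E]].
  { intros u _. apply Derive_correct. now apply (C1 tau u). }
  simpl in E. rewrite E, Rabs_mult. apply Rmult_le_compat_r; [apply Rabs_pos|].
  now apply sigma_bound.
Qed.

(** A whole ball around [tau] is assumed to lie in [D] because the mean value theorem visits the
    times between [tau] and [tau']. *)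
Lemma sigma_lip_time tau r tau' y : (forall a, Rabs (a - tau) < r -> D a) -> Rabs (tau' - tau) < r ->
  Rabs (sigma tau' y - sigma tau y) <= M * Rabs (tau' - tau).
Proof.
  intros HD Ht. destruct sigma_C2 as [C1 _].
  assert (Hr : 0 < r) by (pose proof (Rabs_pos (tau' - tau)); lra).
  assert (Hin : forall c, Rmin tau tau' <= c <= Rmax tau tau' -> D c).
  { intros c Hc. apply HD. apply (Rabs_between_dist c tau tau'); auto.
    rewrite Rminus_diag, Rabs_R0; auto. }
  destruct (mean_value (fun u => sigma u y) (fun u => d1_2 sigma u y) tau tau') as [c [Hc E]].
  { intros u Hu. apply Derive_correct. now apply (C1 u y), Hin. }
  simpl in E. rewrite E, Rabs_mult. apply Rmult_le_compat_r; [apply Rabs_pos|].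
  now apply sigma_bound, Hin.
Qed.

Lemma flow_unique tau (y y' : R -> R) : D tau -> y 0 = y' 0 ->
  (forall t, is_derive y t (sigma tau (y t))) -> (forall t, is_derive y' t (sigma tau (y' t))) ->
  forall t, y t = y' t.
Proof.
  intros Ht H0 Hy Hy' t.
  assert (H : Rabs (y t - y' t) <= (Rabs (y 0 - y' 0) + 0) * exp ((M + 1) * Rabs t)).
  { apply (ode_gronwall (fun t => y t - y' t) (fun t => sigma tau (y t) - sigma tau (y' t))); try lra.
    - intros v _. apply (is_derive_minus (V := R_NormedModule)); auto.
    - intros v _. rewrite Rplus_0_r. now apply sigma_lip. }
  rewrite H0, Rminus_diag, Rabs_R0, Rplus_0_l, Rmult_0_l in H.
  apply Rabs_le_between in H. lra.
Qed.

Lemma flow_exists : exists phi : R -> R -> R -> R, forall tau xi, D tau ->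
  phi tau xi 0 = xi /\ forall t, is_derive (phi tau xi) t (sigma tau (phi tau xi t)).
Proof.
  assert (H : forall tau xi, exists y : R -> R, D tau ->
     y 0 = xi /\ forall t, is_derive y t (sigma tau (y t))).
  { intros tau xi. destruct (classic (D tau)) as [Ht|Ht]; [|exists (fun _ => 0); tauto].
    destruct (autonomous_ode (sigma tau) M xi M_pos) as [y Hy].
    - intros. now apply sigma_lip.
    - exists y; auto. }
  exists (fun tau xi => proj1_sig (constructive_indefinite_description _ (H tau xi))).
  intros tau xi Ht. apply (proj2_sig (constructive_indefinite_description _ (H tau xi))). exact Ht.
Qed.

Variable phi : R -> R -> R -> R.
Hypothesis phi_flow : forall tau xi, D tau ->
  phi tau xi 0 = xi /\ forall t, is_derive (phi tau xi) t (sigma tau (phi tau xi t)).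

Lemma flow_group tau xi t u : D tau -> phi tau (phi tau xi t) u = phi tau xi (t + u).
Proof.
  intros Ht. revert u. apply (flow_unique tau _ (fun u => phi tau xi (t + u)) Ht).
  - rewrite Rplus_0_r. now apply phi_flow.
  - intros u. now apply phi_flow.
  - intros u. evar_last.
    + apply (is_derive_comp (phi tau xi) (fun u => t + u)); [now apply phi_flow|].
      auto_derive; auto; reflexivity.
    + unfold scal; simpl; unfold mult; simpl. ring.
Qed.

Lemma flow_lip tau r tau' xi xi' t : (forall a, Rabs (a - tau) < r -> D a) -> Rabs (tau' - tau) < r ->
  Rabs (phi tau' xi' t - phi tau xi t) <=
    (Rabs (xi' - xi) + M * Rabs (tau' - tau)) * exp ((M + 1) * Rabs t).
Proof.
  intros HD Ht.
  assert (Hr : 0 < r) by (pose proof (Rabs_pos (tau' - tau)); lra).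
  assert (Dt : D tau) by (apply HD; rewrite Rminus_diag, Rabs_R0; auto).
  assert (Dt' : D tau') by auto.
  destruct (phi_flow tau xi Dt) as [E0 H0]. destruct (phi_flow tau' xi' Dt') as [E1 H1].
  replace (Rabs (xi' - xi)) with (Rabs (phi tau' xi' 0 - phi tau xi 0)) by (rewrite E0, E1; reflexivity).
  apply (ode_gronwall (fun t => phi tau' xi' t - phi tau xi t)
    (fun t => sigma tau' (phi tau' xi' t) - sigma tau (phi tau xi t))); try lra.
  - apply Rmult_le_pos; [lra | apply Rabs_pos].
  - intros v _. apply (is_derive_minus (V := R_NormedModule)); auto.
  - intros v _. assert (A1 := sigma_lip tau' (phi tau' xi' v) (phi tau xi v) Dt').
    assert (A2 := sigma_lip_time tau r tau' (phi tau xi v) HD Ht).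
    replace (sigma tau' (phi tau' xi' v) - sigma tau (phi tau xi v)) with
      ((sigma tau' (phi tau' xi' v) - sigma tau' (phi tau xi v)) +
       (sigma tau' (phi tau xi v) - sigma tau (phi tau xi v))) by ring.
    eapply Rle_trans; [apply Rabs_triang|]. lra.
Qed.

Lemma flow_cont tau xi t : D tau -> cont3_at phi tau xi t.
Proof.
  intros Ht eps He. destruct (D_open tau Ht) as [r [Hr HD]].
  assert (Hc : continuous (phi tau xi) t).
  { apply (ex_derive_continuous (phi tau xi)). eexists. now apply phi_flow. }
  apply continuity_pt_filterlim in Hc. destruct (Hc (eps / 2)) as [d [Hd H]]; [lra|].
  assert (Hex := exp_pos ((M + 1) * (Rabs t + 1))).
  set (ex := exp ((M + 1) * (Rabs t + 1))) in *.
  set (e := eps / (4 * (1 + M) * ex)).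
  assert (He' : 0 < e) by (unfold e; apply Rdiv_lt_0_compat; auto; apply Rmult_lt_0_compat; lra).
  exists (Rmin (Rmin r d) (Rmin 1 e)). split; [repeat apply Rmin_pos; lra|].
  intros tau' xi' t' H1 H2 H3.
  pose proof (Rmin_l (Rmin r d) (Rmin 1 e)). pose proof (Rmin_r (Rmin r d) (Rmin 1 e)).
  pose proof (Rmin_l r d). pose proof (Rmin_r r d). pose proof (Rmin_l 1 e). pose proof (Rmin_r 1 e).
  assert (A1 : Rabs (phi tau xi t' - phi tau xi t) < eps / 2).
  { destruct (Req_dec t' t) as [->|Hne]; [rewrite Rminus_diag, Rabs_R0; lra|].
    apply H. split; [split; [exact I | auto]|]. simpl. unfold R_dist. lra. }
  assert (A2 := flow_lip tau r tau' xi xi' t' HD ltac:(lra)).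
  assert (A3 : (Rabs (xi' - xi) + M * Rabs (tau' - tau)) * exp ((M + 1) * Rabs t') <= (e + M * e) * ex).
  { apply Rmult_le_compat.
    - apply Rplus_le_le_0_compat; [apply Rabs_pos | apply Rmult_le_pos; [lra | apply Rabs_pos]].
    - left; apply exp_pos.
    - apply Rplus_le_compat; [lra|]. apply Rmult_le_compat_l; lra.
    - apply exp_mono. apply Rmult_le_compat_l; [lra|].
      replace t' with ((t' - t) + t) by ring. eapply Rle_trans; [apply Rabs_triang|]. lra. }
  assert (A4 : (e + M * e) * ex = eps / 4) by (unfold e; field; lra).
  apply Rabs_lt_between in A1. apply Rabs_le_between in A2. apply Rabs_lt_between. lra.
Qed.

(** Solution of the linearised equation [v' = sigma_xi v], [v 0 = 1] along the trajectory. The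
    exponential form makes its positivity evident and its regularity a matter of the rules for
    integrals. *)
Definition flow_dxi (a b c : R) : R :=
  exp (RInt (fun v => d2_2 sigma a (phi a b v)) 0 c).
(** Variation of constants for [v' = sigma_xi v + sigma_tau], [v 0 = 0], the equation obtained by
    differentiating the flow equation in [tau]. *)
Definition flow_dtau (a b c : R) : R :=
  flow_dxi a b c * RInt (fun v => d1_2 sigma a (phi a b v) * / flow_dxi a b v) 0 c.
Definition flow_dt (a b c : R) : R := sigma a (phi a b c).

Lemma flow_dxi_pos a b c : 0 < flow_dxi a b c.
Proof. apply exp_pos. Qed.

Lemma sigma1_cont a b c : D a -> cont3_at (fun a b c => d1_2 sigma a (phi a b c)) a b c.
Proof. intros Ha. apply cont3_comp2; [now apply flow_cont|]. now apply sigma_C2. Qed.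

Lemma sigma2_cont a b c : D a -> cont3_at (fun a b c => d2_2 sigma a (phi a b c)) a b c.
Proof. intros Ha. apply cont3_comp2; [now apply flow_cont|]. now apply sigma_C2. Qed.

Lemma flow_dxi_cont a b c : D a -> cont3_at flow_dxi a b c.
Proof.
  intros Ha. apply (cont3_comp exp).
  - apply (cont3_RInt D (fun a b c => d2_2 sigma a (phi a b c))); auto.
    intros. now apply sigma2_cont.
  - apply (ex_derive_continuous exp). auto_derive. auto.
Qed.

Lemma flow_dxi_inv_cont a b c : D a -> cont3_at (fun a b c => / flow_dxi a b c) a b c.
Proof.
  intros Ha. apply (cont3_comp Rinv); [now apply flow_dxi_cont|].
  apply (ex_derive_continuous Rinv). pose proof (flow_dxi_pos a b c). auto_derive. lra.
Qed.

Lemma flow_dtau_integrand_cont a b c : D a ->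
  cont3_at (fun a b c => d1_2 sigma a (phi a b c) * / flow_dxi a b c) a b c.
Proof.
  intros Ha. apply cont3_mult; [now apply sigma1_cont | now apply flow_dxi_inv_cont].
Qed.

Lemma flow_dtau_cont a b c : D a -> cont3_at flow_dtau a b c.
Proof.
  intros Ha. apply cont3_mult; [now apply flow_dxi_cont|].
  apply (cont3_RInt D (fun a b c => d1_2 sigma a (phi a b c) * / flow_dxi a b c)); auto.
  intros. now apply flow_dtau_integrand_cont.
Qed.

Lemma flow_dxi_ode a b c : D a ->
  is_derive (flow_dxi a b) c (d2_2 sigma a (phi a b c) * flow_dxi a b c).
Proof.
  intros Ha. unfold flow_dxi at 1. evar_last.
  - apply (is_derive_comp exp (fun c => RInt (fun v => d2_2 sigma a (phi a b v)) 0 c)).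
    + apply is_derive_Reals, derivable_pt_lim_exp.
    + apply (is_derive_primitive (fun v => d2_2 sigma a (phi a b v))).
      intros u. apply (cont3_slice (fun a b c => d2_2 sigma a (phi a b c))). now apply sigma2_cont.
  - unfold scal; simpl; unfold mult; simpl. reflexivity.
Qed.

Lemma flow_dtau_ode a b c : D a ->
  is_derive (flow_dtau a b) c (d2_2 sigma a (phi a b c) * flow_dtau a b c + d1_2 sigma a (phi a b c)).
Proof.
  intros Ha. unfold flow_dtau at 1. evar_last.
  - apply (is_derive_mult (flow_dxi a b)
      (fun c => RInt (fun v => d1_2 sigma a (phi a b v) * / flow_dxi a b v) 0 c)).
    + now apply flow_dxi_ode.
    + apply (is_derive_primitive (fun v => d1_2 sigma a (phi a b v) * / flow_dxi a b v)).
      intros u. apply (cont3_slice (fun a b c => d1_2 sigma a (phi a b c) * / flow_dxi a b c)).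
      now apply flow_dtau_integrand_cont.
    + intros; apply Rmult_comm.
  - unfold flow_dtau, plus; simpl; unfold mult; simpl. pose proof (flow_dxi_pos a b c). field. lra.
Qed.

Lemma flow_dxi_0 a b : flow_dxi a b 0 = 1.
Proof. unfold flow_dxi. rewrite RInt_point. apply exp_0. Qed.

Lemma flow_dtau_0 a b : flow_dtau a b 0 = 0.
Proof. unfold flow_dtau. rewrite RInt_point. unfold zero; simpl. ring. Qed.

(* The error of the linear approximation solves a linear equation with a small
   source term. *)
Lemma flow_differential tau xi t w : D tau -> 0 < w -> exists d, 0 < d /\ forall tau' xi',
  Rabs (tau' - tau) < d -> Rabs (xi' - xi) < d ->
  Rabs (phi tau' xi' t - phi tau xi t - flow_dxi tau xi t * (xi' - xi) - flow_dtau tau xi t * (tau' - tau))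
    <= w * (Rabs (tau' - tau) + Rabs (xi' - xi)).
Proof.
  intros Ht Hw. destruct (D_open tau Ht) as [r [Hr HD]].
  set (T := Rabs t). set (ex := exp ((M + 1) * T)).
  assert (Hex : 1 <= ex).
  { unfold ex. apply Rle_trans with (exp 0); [rewrite exp_0; lra|]. apply exp_mono. apply Rmult_le_pos; [lra | apply Rabs_pos]. }
  (* By [flow_lip], the displacement of the parameters plus that of the trajectory is at most [C]
     times [|tau' - tau| + |xi' - xi|]. The Gronwall factor is [ex], whence [w1 = w / (C * ex)]. *)
  set (C := 1 + (1 + M) * ex).
  assert (HC : 1 <= C) by (unfold C; assert (0 <= (1 + M) * ex) by (apply Rmult_le_pos; lra); lra).
  set (w1 := w / (C * ex)).
  assert (Hw1 : 0 < w1) by (unfold w1; apply Rdiv_lt_0_compat; auto; apply Rmult_lt_0_compat; lra).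
  (* One radius for the linearisation of [sigma] along the whole trajectory up to time [t]. *)
  destruct (tube (- T) T (fun v _ d => forall tau' y', Rabs (tau' - tau) < d ->
     Rabs (y' - phi tau xi v) < d ->
     Rabs (sigma tau' y' - sigma tau (phi tau xi v) - d1_2 sigma tau (phi tau xi v) * (tau' - tau)
       - d2_2 sigma tau (phi tau xi v) * (y' - phi tau xi v))
      <= w1 * (Rabs (tau' - tau) + Rabs (y' - phi tau xi v)))) as [d [Hd H]].
  - intros u v d d' H Hd tau' y' H1 H2. apply H; lra.
  - intros v Hv.
    destruct (strict_differential D sigma tau (phi tau xi v) D_open (proj1 sigma_C2) Ht w1 Hw1) as [e [He K]].
    assert (Hc := cont3_slice _ _ _ _ (flow_cont tau xi v Ht)). apply continuity_pt_filterlim in Hc.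
    destruct (Hc (e / 2)) as [d [Hd H]]; [lra|].
    exists (Rmin d (e / 2)). split; [apply Rmin_pos; lra|].
    intros u _ _ _ Hu _ tau' y' H1 H2. pose proof (Rmin_l d (e / 2)). pose proof (Rmin_r d (e / 2)).
    assert (A : Rabs (phi tau xi u - phi tau xi v) < e / 2).
    { destruct (Req_dec u v) as [->|Hne]; [rewrite Rminus_diag, Rabs_R0; lra|].
      apply H. split; [split; [exact I | auto]|]. simpl. unfold R_dist. lra. }
    apply K; try lra.
    + rewrite Rminus_diag, Rabs_R0. lra.
    + apply Rabs_lt_between in A. apply Rabs_lt_between in H2. apply Rabs_lt_between. lra.
  - set (L := (1 + M) * ex).
    assert (HL : 1 <= L).
    { unfold L. assert (1 * 1 <= (1 + M) * ex) by (apply Rmult_le_compat; lra). lra. }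
    exists (Rmin (Rmin r d) (d / (2 * L))).
    split; [repeat apply Rmin_pos; auto; apply Rdiv_lt_0_compat; lra|].
    intros tau' xi' H1 H2.
    pose proof (Rmin_l (Rmin r d) (d / (2 * L))). pose proof (Rmin_r (Rmin r d) (d / (2 * L))).
    pose proof (Rmin_l r d). pose proof (Rmin_r r d).
    set (N := Rabs (tau' - tau) + Rabs (xi' - xi)).
    assert (HN : 0 <= N) by (unfold N; pose proof (Rabs_pos (tau' - tau)); pose proof (Rabs_pos (xi' - xi)); lra).
    assert (Hdist : forall v, Rabs v <= T -> Rabs (phi tau' xi' v - phi tau xi v) <= L * N).
    { intros v Hv. eapply Rle_trans; [apply (flow_lip tau r tau' xi xi' v HD); lra|].
      unfold L. rewrite Rmult_assoc, (Rmult_comm ex), <- Rmult_assoc. apply Rmult_le_compat.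
      - apply Rplus_le_le_0_compat; [apply Rabs_pos | apply Rmult_le_pos; [lra | apply Rabs_pos]].
      - left; apply exp_pos.
      - unfold N. pose proof (Rabs_pos (tau' - tau)). pose proof (Rabs_pos (xi' - xi)). nra.
      - apply exp_mono. apply Rmult_le_compat_l; lra. }
    assert (HNd : L * N < d).
    { apply Rlt_le_trans with (L * (2 * (d / (2 * L)))); [apply Rmult_lt_compat_l; unfold N; lra|].
      right. field. lra. }
    assert (Dt' : D tau') by (apply HD; lra).
    destruct (phi_flow tau xi Ht) as [E0 F0]. destruct (phi_flow tau' xi' Dt') as [E1 F1].
    set (u := fun v => phi tau' xi' v - phi tau xi v - flow_dxi tau xi v * (xi' - xi)
       - flow_dtau tau xi v * (tau' - tau)).
    assert (Hu : Rabs (u t) <= (Rabs (u 0) + w1 * (C * N)) * exp ((M + 1) * Rabs t)).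
    { apply (ode_gronwall u (fun v => sigma tau' (phi tau' xi' v) - sigma tau (phi tau xi v)
         - d2_2 sigma tau (phi tau xi v) * flow_dxi tau xi v * (xi' - xi)
         - (d2_2 sigma tau (phi tau xi v) * flow_dtau tau xi v + d1_2 sigma tau (phi tau xi v)) * (tau' - tau))); try lra.
      - apply Rmult_le_pos; [lra|]. apply Rmult_le_pos; lra.
      - intros v _. unfold u.
        assert (Hs : forall (g : R -> R) l k, is_derive g v l -> is_derive (fun v => g v * k) v (l * k)).
        { intros g l k Hg. evar_last; [apply (is_derive_mult g (fun _ => k)); [apply Hg | |]|].
          - apply (is_derive_const (V := R_NormedModule)).
          - intros; apply Rmult_comm.
          - unfold plus, zero; simpl; unfold mult; simpl. ring. }
        apply (is_derive_minus (V := R_NormedModule)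
          (fun v => phi tau' xi' v - phi tau xi v - flow_dxi tau xi v * (xi' - xi))).
        + apply (is_derive_minus (V := R_NormedModule) (fun v => phi tau' xi' v - phi tau xi v)).
          * apply (is_derive_minus (V := R_NormedModule)); auto.
          * apply Hs. now apply flow_dxi_ode.
        + apply Hs. now apply flow_dtau_ode.
      - intros v Hv. fold T in Hv.
        assert (Hvd := Hdist v Hv).
        assert (Hvi : - T <= v <= T) by now apply Rabs_le_between.
        assert (K := H v v Hvi Hvi ltac:(rewrite Rminus_diag, Rabs_R0; auto) tau' (phi tau' xi' v) ltac:(lra) ltac:(lra)).
        set (R0 := sigma tau' (phi tau' xi' v) - sigma tau (phi tau xi v)
           - d1_2 sigma tau (phi tau xi v) * (tau' - tau)
           - d2_2 sigma tau (phi tau xi v) * (phi tau' xi' v - phi tau xi v)) in *.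
        replace (_ - _ - _ - _) with (d2_2 sigma tau (phi tau xi v) * u v + R0) by (unfold u, R0; ring).
        eapply Rle_trans; [apply Rabs_triang|]. apply Rplus_le_compat.
        + rewrite Rabs_mult. apply Rmult_le_compat_r; [apply Rabs_pos|]. now apply sigma_bound.
        + eapply Rle_trans; [apply K|]. apply Rmult_le_compat_l; [lra|].
          unfold C. fold L. unfold N in *. pose proof (Rabs_pos (xi' - xi)). lra. }
    assert (Hu0 : u 0 = 0).
    { unfold u. rewrite E0, E1, flow_dxi_0, flow_dtau_0. ring. }
    rewrite Hu0, Rabs_R0, Rplus_0_l in Hu. fold T ex in Hu.
    eapply Rle_trans; [apply Hu|]. right. unfold w1. field. lra.
Qed.

Lemma is_derive_of_estimate (f : R -> R) (x l r : R) : 0 < r ->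
  (forall w, 0 < w -> exists d, 0 < d /\ forall x', Rabs (x' - x) < d ->
     Rabs (f x' - f x - l * (x' - x)) <= w * Rabs (x' - x)) -> is_derive f x l.
Proof.
  intros Hr H. apply is_derive_Reals. intros eps He.
  destruct (H (eps / 2)) as [d [Hd K]]; [lra|]. exists (mkposreal d Hd). intros h Hh Hlt. simpl in Hlt.
  assert (Hu : x + h - x = h) by ring.
  specialize (K (x + h)). rewrite Hu in K. specialize (K Hlt).
  assert (Hah : 0 < Rabs h) by now apply Rabs_pos_lt.
  replace ((f (x + h) - f x) / h - l) with ((f (x + h) - f x - l * h) / h) by (field; auto).
  unfold Rdiv. rewrite Rabs_mult, Rabs_inv.
  apply Rmult_lt_reg_r with (Rabs h); auto. rewrite Rmult_assoc, Rinv_l, Rmult_1_r by lra.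
  eapply Rle_lt_trans; [apply K|]. apply Rmult_lt_compat_r; lra.
Qed.

Lemma flow_has_C1 : has_C1_3 D phi flow_dtau flow_dxi flow_dt.
Proof.
  intros a b c Ha. conjs.
  - apply (is_derive_of_estimate _ _ _ 1 Rlt_0_1). intros w Hw.
    destruct (flow_differential a b c w Ha Hw) as [d [Hd H]]. exists d; split; auto.
    intros a' Ha'. specialize (H a' b Ha'). rewrite Rminus_diag, Rabs_R0, Rmult_0_r, Rminus_0_r, Rplus_0_r in H.
    auto.
  - apply (is_derive_of_estimate _ _ _ 1 Rlt_0_1). intros w Hw.
    destruct (flow_differential a b c w Ha Hw) as [d [Hd H]]. exists d; split; auto.
    intros b' Hb'. specialize (H a b'). rewrite Rminus_diag, Rabs_R0, Rmult_0_r, Rminus_0_r, Rplus_0_l in H.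
    auto.
  - now apply phi_flow.
  - now apply flow_cont.
  - now apply flow_dtau_cont.
  - now apply flow_dxi_cont.
  - apply cont3_comp2; [now apply flow_cont|]. now apply sigma_C2.
Qed.

(** The closed formulas for [flow_dxi] and [flow_dtau] are built by exponential, inverse, product
    and integral from the first derivatives of [sigma] along the flow. These are C^1 now that
    [flow_has_C1] is known, so the rules differentiate once more. *)
Lemma flow_second_order : exists X1 X2 X3 T1 T2 T3,
  has_C1_3 D flow_dxi X1 X2 X3 /\ has_C1_3 D flow_dtau T1 T2 T3.
Proof.
  assert (HC := flow_has_C1). destruct sigma_C2 as [_ [S1 S2]].
  assert (K2 := has_C1_3_comp2 D (d2_2 sigma) phi _ _ _ D_open S2 HC).
  assert (K1 := has_C1_3_comp2 D (d1_2 sigma) phi _ _ _ D_open S1 HC).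
  assert (I2 := has_C1_3_RInt D _ _ _ _ D_open K2).
  assert (X := has_C1_3_comp D exp exp _ _ _ _ I2).
  assert (Hexp : forall a b c : R, D a -> is_derive exp (RInt (fun u => d2_2 sigma a (phi a b u)) 0 c)
      (exp (RInt (fun u => d2_2 sigma a (phi a b u)) 0 c)) /\
      continuous exp (RInt (fun u => d2_2 sigma a (phi a b u)) 0 c)).
  { intros. split; [apply is_derive_Reals, derivable_pt_lim_exp|].
    apply (ex_derive_continuous exp). auto_derive. auto. }
  specialize (X Hexp). change (has_C1_3 D flow_dxi
    (fun a b c => flow_dxi a b c * RInt (fun v => d1_2 (d2_2 sigma) a (phi a b v) +
       d2_2 (d2_2 sigma) a (phi a b v) * flow_dtau a b v) 0 c)
    (fun a b c => flow_dxi a b c * RInt (fun v => d2_2 (d2_2 sigma) a (phi a b v) * flow_dxi a b v) 0 c)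
    (fun a b c => flow_dxi a b c * d2_2 sigma a (phi a b c))) in X.
  assert (Xi := has_C1_3_comp D Rinv (fun u => - / (u ^ 2)) _ _ _ _ X).
  assert (Hinv : forall a b c : R, D a -> is_derive Rinv (flow_dxi a b c) (- / (flow_dxi a b c ^ 2)) /\
    continuous (fun u => - / (u ^ 2)) (flow_dxi a b c)).
  { intros a b c Ha. pose proof (flow_dxi_pos a b c). split.
    - auto_derive; [lra|]. field. lra.
    - apply (ex_derive_continuous (fun u => - / (u ^ 2))). auto_derive. 
      assert (0 < flow_dxi a b c * (flow_dxi a b c * 1)) by (apply Rmult_lt_0_compat; lra). lra. }
  specialize (Xi Hinv).
  assert (IT := has_C1_3_RInt D _ _ _ _ D_open (has_C1_3_mult D _ _ _ _ _ _ _ _ K1 Xi)).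
  assert (TT := has_C1_3_mult D _ _ _ _ _ _ _ _ X IT).
  do 6 eexists. split; [exact X | exact TT].
Qed.

Definition flow_dtau_dt (a b c : R) : R :=
  d1_2 sigma a (phi a b c) + d2_2 sigma a (phi a b c) * flow_dtau a b c.
Definition flow_dxi_dt (a b c : R) : R := d2_2 sigma a (phi a b c) * flow_dxi a b c.
Definition flow_dtt (a b c : R) : R := d2_2 sigma a (phi a b c) * flow_dt a b c.

Lemma flow_dt_has_C1 : has_C1_3 D flow_dt flow_dtau_dt flow_dxi_dt flow_dtt.
Proof. exact (has_C1_3_comp2 D sigma phi _ _ _ D_open (proj1 sigma_C2) flow_has_C1). Qed.

Lemma flow_dt_second_order : exists X1 X2 X3 T1 T2 T3 S1 S2 S3,
  has_C1_3 D flow_dtau_dt T1 T2 T3 /\ has_C1_3 D flow_dxi_dt X1 X2 X3 /\ has_C1_3 D flow_dtt S1 S2 S3.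
Proof.
  assert (HC := flow_has_C1). assert (HS := flow_dt_has_C1).
  destruct flow_second_order as [X1 [X2 [X3 [T1 [T2 [T3 [HX HT]]]]]]].
  destruct sigma_C2 as [_ [S1 S2]].
  assert (K2 := has_C1_3_comp2 D (d2_2 sigma) phi _ _ _ D_open S2 HC).
  assert (K1 := has_C1_3_comp2 D (d1_2 sigma) phi _ _ _ D_open S1 HC).
  do 9 eexists. split; [|split].
  - exact (has_C1_3_plus D _ _ _ _ _ _ _ _ K1 (has_C1_3_mult D _ _ _ _ _ _ _ _ K2 HT)).
  - exact (has_C1_3_mult D _ _ _ _ _ _ _ _ K2 HX).
  - exact (has_C1_3_mult D _ _ _ _ _ _ _ _ K2 HS).
Qed.

Lemma flow_derivatives a b c : D a ->
  d1_3 phi a b c = flow_dtau a b c /\ d2_3 phi a b c = flow_dxi a b c /\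
  d3_3 phi a b c = flow_dt a b c /\ d3_3 (d3_3 phi) a b c = flow_dtt a b c.
Proof.
  intros Ha.
  destruct (has_C1_3_sound D phi _ _ _ phi D_open flow_has_C1) as [_ E]; [auto|].
  destruct (has_C1_3_sound D flow_dt _ _ _ (d3_3 phi) D_open flow_dt_has_C1) as [_ E'].
  { intros; now apply E. }
  destruct (E a b c Ha) as [E1 [E2 E3]]. conjs; auto. now apply E'.
Qed.

Lemma flow_C2 : C2_3 (fun tau _ _ => D tau) phi /\ C2_3 (fun tau _ _ => D tau) (d3_3 phi).
Proof.
  assert (HD := flow_derivatives).
  destruct flow_second_order as [X1 [X2 [X3 [T1 [T2 [T3 [HX HT]]]]]]].
  destruct flow_dt_second_order as [Y1 [Y2 [Y3 [U1 [U2 [U3 [V1 [V2 [V3 [HU [HY HV]]]]]]]]]]].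
  assert (K : C1_3 (fun a _ _ => D a) (d3_3 phi) /\ (forall a b c, D a ->
     d1_3 (d3_3 phi) a b c = flow_dtau_dt a b c /\ d2_3 (d3_3 phi) a b c = flow_dxi_dt a b c /\
     d3_3 (d3_3 phi) a b c = flow_dtt a b c)).
  { apply (has_C1_3_sound D flow_dt); auto using flow_dt_has_C1. intros; now apply HD. }
  destruct K as [K1 K2].
  split; (split; [|split; [|split]]).
  - now apply (has_C1_3_sound D phi _ _ _ phi D_open flow_has_C1).
  - apply (has_C1_3_sound D flow_dtau _ _ _ _ D_open HT). intros; now apply HD.
  - apply (has_C1_3_sound D flow_dxi _ _ _ _ D_open HX). intros; now apply HD.
  - exact K1.
  - exact K1.
  - apply (has_C1_3_sound D flow_dtau_dt _ _ _ _ D_open HU). intros a b c Ha. exact (proj1 (K2 a b c Ha)).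
  - apply (has_C1_3_sound D flow_dxi_dt _ _ _ _ D_open HY). intros a b c Ha. exact (proj1 (proj2 (K2 a b c Ha))).
  - apply (has_C1_3_sound D flow_dtt _ _ _ _ D_open HV). intros a b c Ha. exact (proj2 (proj2 (K2 a b c Ha))).
Qed.

(** Together with the next two bounds, this gives the linear growth of the coefficients in the
    equation for [B]. *)
Lemma flow_growth tau xi t C : D tau -> Rabs (sigma tau 0) <= C ->
  Rabs (phi tau xi t) <= (Rabs xi + C) * exp ((M + 1) * Rabs t).
Proof.
  intros Ht HC. destruct (phi_flow tau xi Ht) as [E H].
  replace (Rabs xi) with (Rabs (phi tau xi 0)) by (rewrite E; reflexivity).
  apply (ode_gronwall (phi tau xi) (fun v => sigma tau (phi tau xi v))); try lra; auto.
  - eapply Rle_trans; [apply Rabs_pos | apply HC].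
  - intros v _. assert (A := sigma_lip tau (phi tau xi v) 0 Ht). rewrite Rminus_0_r in A.
    replace (sigma tau (phi tau xi v)) with ((sigma tau (phi tau xi v) - sigma tau 0) + sigma tau 0) by ring.
    eapply Rle_trans; [apply Rabs_triang|]. lra.
Qed.

Lemma flow_dtau_bound tau xi t : D tau -> Rabs (flow_dtau tau xi t) <= M * exp ((M + 1) * Rabs t).
Proof.
  intros Ht.
  replace M with (Rabs (flow_dtau tau xi 0) + M) at 1 by (rewrite flow_dtau_0, Rabs_R0; ring).
  apply (ode_gronwall (flow_dtau tau xi) (fun v => d2_2 sigma tau (phi tau xi v) * flow_dtau tau xi v
    + d1_2 sigma tau (phi tau xi v))); try lra.
  - intros v _. now apply flow_dtau_ode.
  - intros v _. eapply Rle_trans; [apply Rabs_triang|]. rewrite Rabs_mult.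
    apply Rplus_le_compat; [|now apply sigma_bound].
    apply Rmult_le_compat_r; [apply Rabs_pos | now apply sigma_bound].
Qed.

Lemma flow_dxi_bounds tau xi t : D tau ->
  exp (- (M * Rabs t)) <= flow_dxi tau xi t <= exp (M * Rabs t).
Proof.
  intros Ht.
  assert (B : Rabs (RInt (fun v => d2_2 sigma tau (phi tau xi v)) 0 t) <= M * Rabs (t - 0)).
  { apply RInt_bound.
    - apply (ex_RInt_slice (fun a b c => d2_2 sigma a (phi a b c))). intros; now apply sigma2_cont.
    - intros; now apply sigma_bound. }
  rewrite Rminus_0_r in B. apply Rabs_le_between in B.
  unfold flow_dxi. split; apply exp_mono; lra.
Qed.

End Flow.

(** * Regularity of the transformed solution *)

(** Continuity is only relative to [[0, 1]], so [f] is first composed with the projection [cl] of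
    the line onto this interval. *)
Lemma ivt_cont01 (f : R -> R) (a b y : R) : cont01 f -> 0 <= a -> a <= b -> b <= 1 ->
  Rmin (f a) (f b) <= y <= Rmax (f a) (f b) -> exists t, a <= t <= b /\ f t = y.
Proof.
  intros Hf Ha Hab Hb Hy.
  set (cl := fun t => Rmax 0 (Rmin 1 t)).
  assert (Hcl : forall t, in01 (cl t)).
  { intros t. unfold cl, in01. split; [apply Rmax_l|]. apply Rmax_lub; [lra | apply Rmin_l]. }
  assert (Hid : forall t, in01 t -> cl t = t).
  { intros t [H0 H1]. unfold cl. rewrite Rmin_right, Rmax_right; lra. }
  assert (Hlip : forall s t, Rabs (cl s - cl t) <= Rabs (s - t)).
  { intros s t. unfold cl.
    apply Rabs_le. pose proof (Rle_abs (s - t)). pose proof (Rabs_maj2 (s - t)).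
    unfold Rmax, Rmin. repeat destruct Rle_dec; lra. }
  assert (Hc : continuity (fun t => f (cl t))).
  { intros t. intros eps He. destruct (Hf (cl t) (Hcl t) eps He) as [d [Hd H]].
    exists d. split; auto. intros s [_ Hs]. simpl in *. unfold R_dist in *.
    apply H; auto. eapply Rle_lt_trans; [apply Hlip | exact Hs]. }
  destruct (IVT_gen (fun t => f (cl t)) a b y Hc) as [t [Ht E]].
  - rewrite !Hid by (unfold in01; lra). exact Hy.
  - rewrite Rmin_left, Rmax_right in Ht by auto. exists t. split; auto.
    rewrite Hid in E; auto. unfold in01; lra.
Qed.

Lemma closed_first (S : R -> Prop) (a b : R) :
  (forall t, (forall d, 0 < d -> exists s, S s /\ Rabs (s - t) < d) -> S t) ->
  (exists s, S s /\ a <= s <= b) ->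
  exists v, S v /\ a <= v <= b /\ forall t, a <= t < v -> ~ S t.
Proof.
  intros Hcl [s [Hs Hsi]].
  destruct (completeness (fun r => a <= - r /\ S (- r))) as [w [Hw1 Hw2]].
  - exists (- a). intros r [Hr _]. lra.
  - exists (- s). rewrite Ropp_involutive. split; [lra | auto].
  - assert (Hwa : w <= - a) by (apply Hw2; intros r [Hr _]; lra).
    assert (Hws : - s <= w) by (apply Hw1; rewrite Ropp_involutive; split; [lra | auto]).
    exists (- w). split; [|split; [lra|]].
    + apply Hcl. intros d Hd. apply NNPP; intros Hn.
      assert (w <= w - d); [|lra]. apply Hw2. intros r [Hr1 Hr2].
      assert (r <= w) by (apply Hw1; auto).
      apply Rnot_lt_le; intros Hlt. apply Hn. exists (- r). split; auto. apply Rabs_lt_between. lra.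
    + intros t Ht HSt. assert (- t <= w); [|lra]. apply Hw1. rewrite Ropp_involutive. split; [lra | auto].
Qed.

(* Near [t1], the path [eta] is a slice derivative [F s (x s)] of the functions
   [fA s = f (A s, .)]; the slice-wise Lipschitz constants [N] of [F s] need not be
   uniform in [s], since [f] is only C^2 in its last variable for each fixed value
   of the others. *)
Definition chart (x eta al : R -> R) (K t1 d : R) : Prop :=
  exists (x0 rho : R) (fA F : R -> R -> R), 0 < rho /\
    (forall s, in01 s -> Rabs (s - t1) < d ->
       Rabs (x s - x0) < rho /\ F s (x s) = eta s /\ Rabs (fA s (x s)) <= K /\
       (forall xi, Rabs (xi - x0) < rho -> is_derive (fA s) xi (F s xi)) /\
       (forall xi, Rabs (xi - x0) < rho -> forall eps, 0 < eps -> exists e, 0 < e /\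
          forall s', in01 s' -> Rabs (s' - s) < e -> Rabs (F s' xi - F s xi) < eps) /\
       (forall eps, 0 < eps -> exists e, 0 < e /\
          forall s', in01 s' -> Rabs (s' - s) < e -> Rabs (fA s' (x s') - fA s (x s)) < eps) /\
       (exists N r, 0 < N /\ 0 < r /\ forall xi xi',
          Rabs (xi - x0) < rho -> Rabs (xi' - x0) < rho -> Rabs (xi - x s) < r -> Rabs (xi' - x s) < r ->
          Rabs (F s xi' - F s xi) <= N * Rabs (xi' - xi))) /\
    (forall s s' xi, in01 s -> in01 s' -> Rabs (s - t1) < d -> Rabs (s' - t1) < d -> s <= s' ->
       Rabs (xi - x0) < rho -> Rabs (fA s' xi - fA s xi) <= K * (al s' - al s)).

Section Regularity.

Variables (T : nat -> list R) (x qv al c : R -> R) (p pt : R -> R -> R -> R) (g : R -> R).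
Variables (K k1 X P : R).
Hypothesis HT : refining T.
Hypothesis Hx : cont01 x.
Hypothesis Hqv : quad_var T x qv.
Hypothesis Hal : incr_on 0 1 al.
Hypothesis Hrc : rcont01 al.
Hypothesis Hal_t : forall s t, 0 <= s -> s <= t -> t <= 1 -> t - s <= al t - al s.
Hypothesis Hal_q : forall s t, 0 <= s -> s <= t -> t <= 1 -> qv t - qv s <= al t - al s.
Hypothesis Hc : cont01 c.
Hypothesis HX : forall t, in01 t -> Rabs (x t) <= X.
Hypothesis HP : forall t, in01 t -> Rabs (c t) <= P.
Hypothesis HK : 0 < K.
Hypothesis Hk1 : 0 < k1.
Hypothesis H1 : forall s s' u u' xi, in01 s -> in01 s' -> Rabs u <= P -> Rabs u' <= P ->
  Rabs xi <= X -> Rabs (p s' u' xi - p s u xi) <= K * (Rabs (s' - s) + Rabs (u' - u)).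
Hypothesis H2 : forall s u xi xi', in01 s -> Rabs u <= P -> Rabs xi <= X -> Rabs xi' <= X ->
  Rabs (p s u xi' - p s u xi - pt s u xi * (xi' - xi)) <= K * (xi' - xi) ^ 2.
Hypothesis H3 : forall s u u' xi, in01 s -> Rabs u <= P -> Rabs u' <= P -> Rabs xi <= X ->
  k1 * Rabs (u' - u) <= Rabs (p s u' xi - p s u xi).
Hypothesis H4 : forall s s' u u' xi, in01 s -> in01 s' -> Rabs u <= P -> Rabs u' <= P ->
  Rabs xi <= X -> Rabs (pt s' u' xi - pt s u xi) <= K * (Rabs (s' - s) + Rabs (u' - u)).
Hypothesis H4' : forall s u xi xi', in01 s -> Rabs u <= P -> Rabs xi <= X -> Rabs xi' <= X ->
  Rabs (pt s u xi' - pt s u xi) <= K * Rabs (xi' - xi).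
Hypothesis H5 : forall w, 0 < w -> exists d, 0 < d /\ forall s r r', in01 s -> in01 r -> in01 r' ->
  Rabs (r - s) < d -> Rabs (r' - s) < d ->
  Rabs (p r (c r') (x r') - p r (c r) (x r') - g s * (c r' - c r)) <= w * Rabs (c r' - c r).
Hypothesis Hg : forall s, in01 s -> k1 <= g s.
Hypothesis H6 : forall s u xi, in01 s -> is_derive (p s u) xi (pt s u xi).

Let z (t : R) : R := p t (c t) (x t).
Let eta (t : R) : R := pt t (c t) (x t).
(** The part of the increment of [z] that is not carried by [dx]. For a solution its sums converge
    to the drift integral, which is Lipschitz relative to [al]; this is [HTn], the form in which the
    equation enters the section. *)
Let kap (r r' : R) : R := z r' - z r - eta r * (x r' - x r).

Hypothesis HTn : forall s t, in01 s -> in01 t -> s <= t -> forall eps, 0 < eps ->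
  exists N, forall n, (N <= n)%nat ->
  Rabs (sum_le (T n) t kap - sum_le (T n) s kap) <= K * (al t - al s) + eps.

(** Squared increments of [x] sum up to increments of [qv], which [al] dominates, so a cellwise
    bound becomes a bound in [al] alone. Right-continuity of [al] pays for the overshoot past [t].
    The threshold is chosen before [h]. *)
Lemma window_sum s t C C' : 0 <= s -> s <= t -> t <= 1 -> 0 <= C -> 0 <= C' ->
  forall eps, 0 < eps -> exists N, forall n, (N <= n)%nat -> forall h,
  (forall r r', In (r, r') (pairs (T n)) -> s < r -> r <= t ->
     Rabs (h r r') <= C * (al r' - al r) + C' * (x r' - x r) ^ 2) ->
  Rabs (sum_le (T n) t h - sum_le (T n) s h) <= (C + C') * (al t - al s) + eps.
Proof.
  intros Hs Hst Ht HC HC' eps He.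
  assert (Hs1 : in01 s) by (unfold in01; lra). assert (Ht1 : in01 t) by (unfold in01; lra).
  set (e := eps / (4 * (C + C' + 1))).
  assert (He' : 0 < e) by (unfold e; apply Rdiv_lt_0_compat; lra).
  assert (Hr : exists d, 0 < d /\ forall q, t <= q <= 1 -> q - t < d -> al q - al t < e).
  { destruct (Rle_lt_or_eq_dec t 1 Ht) as [Hlt|Heq].
    - apply Hrc; auto; lra.
    - exists 1. split; [lra|]. intros q Hq _. replace q with t by lra. lra. }
  destruct Hr as [d [Hd Hald]].
  destruct (mesh_eventually T d HT Hd) as [N1 HN1].
  destruct Hqv as [Hq _].
  assert (L1 := Hq s Hs1). assert (L2 := Hq t Ht1).
  apply lim_seq_eps with (eps := e) in L1; auto. apply lim_seq_eps with (eps := e) in L2; auto.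
  destruct L1 as [N2 HN2]. destruct L2 as [N3 HN3].
  exists (N1 + N2 + N3)%nat. intros n Hn h Hh.
  specialize (HN1 n ltac:(lia)). specialize (HN2 n ltac:(lia)). specialize (HN3 n ltac:(lia)).
  eapply Rle_trans; [apply (sum_le_window_abs (T n) s t h
    (fun r r' => C * (al r' - al r) + C' * (x r' - x r) ^ 2) Hst Hh)|].
  rewrite !sum_le_lin, !sum_le_scal.
  destruct (telescope (T n) t) as [qt [Hqt [Hqt1 [Hqt2 Hqt3]]]]; auto; [apply HT|].
  destruct (telescope (T n) s) as [qs [Hqs [Hqs1 [Hqs2 Hqs3]]]]; auto; [apply HT|].
  rewrite Hqt3, Hqs3.
  assert (A1 : al qt - al t < e) by (apply Hald; unfold in01 in Hqt; lra).
  assert (A2 : al s <= al qs) by (apply Hal; unfold in01 in Hqs; lra).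
  assert (A3 := Hal_q s t Hs Hst Ht).
  apply Rabs_lt_between in HN2. apply Rabs_lt_between in HN3.
  assert (A4 : C * (al qt - al 0 - (al qs - al 0)) <= C * (al t - al s + e))
    by (apply Rmult_le_compat_l; lra).
  set (Q1 := sum_le (T n) t (fun r r' => (x r' - x r) ^ 2)) in *.
  set (Q0 := sum_le (T n) s (fun r r' => (x r' - x r) ^ 2)) in *.
  assert (A5 : C' * (Q1 - Q0) <= C' * (al t - al s + 2 * e)) by (apply Rmult_le_compat_l; lra).
  assert (A6 : (C + 2 * C') * e <= eps).
  { apply Rle_trans with (4 * (C + C' + 1) * e); [apply Rmult_le_compat_r; lra|].
    unfold e. right. field. lra. }
  lra.
Qed.

Lemma window_telescope s t G : in01 s -> in01 t -> cont01 G -> forall eps, 0 < eps ->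
  exists N, forall n, (N <= n)%nat ->
  Rabs ((sum_le (T n) t (fun r r' => G r' - G r) - sum_le (T n) s (fun r r' => G r' - G r))
    - (G t - G s)) <= eps.
Proof.
  intros Hs Ht HG eps He.
  assert (L1 := telescope_lim T s G HT Hs HG). assert (L2 := telescope_lim T t G HT Ht HG).
  apply lim_seq_eps with (eps := eps / 2) in L1; [|lra].
  apply lim_seq_eps with (eps := eps / 2) in L2; [|lra].
  destruct L1 as [N2 HN2]. destruct L2 as [N3 HN3]. exists (N2 + N3)%nat. intros n Hn.
  specialize (HN2 n ltac:(lia)). specialize (HN3 n ltac:(lia)).
  apply Rabs_lt_between in HN2. apply Rabs_lt_between in HN3. apply Rabs_le. lra.
Qed.

(** * Lipschitz bounds relative to the control, and their universal constant *)

Definition lip_on (a b L : R) : Prop := forall s t, a <= s -> s <= t -> t <= b ->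
  Rabs (c t - c s) <= L * (al t - al s).

(** Room for the costs in [lip_universal], per unit of [al]: [K + 1] for the cells, [K] for the
    quadratic variation and [K] from [HTn], divided by the lower bound [k1] of the slope [g]. The
    constant of the assumed local bound does not enter. *)
Let K0 : R := (4 * K + 2) / k1.

Lemma K0_pos : 0 < K0.
Proof. unfold K0. apply Rdiv_lt_0_compat; lra. Qed.

Lemma al_incr s t : 0 <= s -> s <= t -> t <= 1 -> al s <= al t.
Proof. intros. apply Hal; lra. Qed.

(** At [b] the control can only jump upwards, so the bound passes to the limit from the left. *)
Lemma c_extend a b L f : 0 <= a -> a < b -> b <= 1 -> 0 <= L -> cont_on a b f ->
  (forall t, a <= t < b -> Rabs (f t - f a) <= L * (al t - al a)) ->
  Rabs (f b - f a) <= L * (al b - al a).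
Proof.
  intros Ha Hab Hb HL Hf H. apply le_epsilon. intros e He.
  destruct (Hf b ltac:(lra) e He) as [d [Hd Hfd]].
  set (t := Rmax a (b - d / 2)).
  assert (Hta : a <= t) by apply Rmax_l. assert (Htd : b - d / 2 <= t) by apply Rmax_r.
  assert (Htb : t < b) by (apply Rmax_lub_lt; lra).
  assert (A := Hfd t ltac:(lra) ltac:(apply Rabs_lt_between; lra)).
  assert (B := H t ltac:(lra)).
  assert (L * (al t - al a) <= L * (al b - al a)).
  { apply Rmult_le_compat_l; auto. assert (al t <= al b) by (apply al_incr; lra). lra. }
  apply Rabs_lt_between in A. apply Rabs_le_between in B. apply Rabs_le. lra.
Qed.

Lemma cont01_on f a b : cont01 f -> 0 <= a -> b <= 1 -> cont_on a b f.
Proof.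
  intros Hf Ha Hb t Ht eps He. destruct (Hf t ltac:(unfold in01; lra) eps He) as [d [Hd H]].
  exists d; split; auto. intros s Hs. apply H. unfold in01; lra.
Qed.

(** Apart from the effect of the increment of [c] at frozen time and space, the term linear in the
    increment of [x] cancels and only a time increment and a square remain. *)
Lemma kap_main r r' : in01 r -> in01 r' -> r <= r' ->
  Rabs (kap r r' - (p r (c r') (x r') - p r (c r) (x r'))) <=
    K * (al r' - al r) + K * (x r' - x r) ^ 2.
Proof.
  intros Hr Hr' Hrr'.
  assert (A1 := H1 r r' (c r') (c r') (x r') Hr Hr' (HP _ Hr') (HP _ Hr') (HX _ Hr')).
  assert (A2 := H2 r (c r) (x r) (x r') Hr (HP _ Hr) (HX _ Hr) (HX _ Hr')).
  rewrite Rminus_diag, Rabs_R0, Rplus_0_r in A1.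
  assert (A3 : r' - r <= al r' - al r) by (apply Hal_t; unfold in01 in *; lra).
  rewrite (Rabs_right (r' - r)) in A1 by lra.
  assert (A4 : K * (r' - r) <= K * (al r' - al r)) by (apply Rmult_le_compat_l; lra).
  unfold kap, z, eta.
  apply Rabs_le_between in A1. apply Rabs_le_between in A2. apply Rabs_le. lra.
Qed.

(* Summing along the partitions turns any local Lipschitz bound on [c] into one
   with a constant that does not depend on the interval. *)
Lemma lip_universal a b L : 0 <= a -> a <= b -> b <= 1 -> 0 <= L -> lip_on a b L -> lip_on a b K0.
Proof.
  intros Ha Hab Hb HL HLip.
  (* The linearisation error [w * |c r' - c r|] is then at most the increment of [al] over the cell;
     this removes [L] from the result. *)
  set (w := / (L + 1)).
  assert (Hw : 0 < w) by (apply Rinv_0_lt_compat; lra).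
  destruct (H5 w Hw) as [d [Hd Hd5]].
  (* The end [t] is kept below [b]: the last cell reaches beyond [t], and the assumed bound must
     still apply to it. *)
  assert (Hloc0 : forall s t, a <= s -> s <= t -> t < b -> t - s < d / 2 ->
    Rabs (c t - c s) <= K0 * (al t - al s)).
  { intros s t Hs Hst Ht Hts.
    assert (Hs1 : in01 s) by (unfold in01; lra). assert (Ht1 : in01 t) by (unfold in01; lra).
    assert (Hgs := Hg s Hs1).
    assert (Hmain : k1 * Rabs (c t - c s) <= (4 * K + 2) * (al t - al s)).
    { apply le_epsilon. intros e He.
      assert (Hgpos : 0 < g s) by lra.
      destruct (mesh_eventually T (Rmin (d / 2) (b - t)) HT) as [N1 HN1]; [apply Rmin_pos; lra|].
      destruct (window_sum s t (K + 1) K ltac:(lra) Hst ltac:(lra) ltac:(lra) ltac:(lra) (e / 4) ltac:(lra)) as [N2 HN2].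
      destruct (window_telescope s t c Hs1 Ht1 Hc (e / (4 * g s))) as [N3 HN3];
        [apply Rdiv_lt_0_compat; lra|].
      destruct (HTn s t Hs1 Ht1 Hst (e / 4)) as [N4 HN4]; [lra|].
      set (n := (N1 + N2 + N3 + N4)%nat).
      specialize (HN1 n ltac:(lia)). specialize (HN2 n ltac:(lia)).
      specialize (HN3 n ltac:(lia)). specialize (HN4 n ltac:(lia)).
      pose proof (Rmin_l (d / 2) (b - t)). pose proof (Rmin_r (d / 2) (b - t)).
      specialize (HN2 (fun r r' => kap r r' - g s * (c r' - c r))).
      rewrite !sum_le_minus, !(sum_le_scal _ _ (g s) (fun r r' => c r' - c r)) in HN2.
      assert (HN2' : Rabs (sum_le (T n) t kap - g s * sum_le (T n) t (fun r r' => c r' - c r) -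
        (sum_le (T n) s kap - g s * sum_le (T n) s (fun r r' => c r' - c r)))
        <= (K + 1 + K) * (al t - al s) + e / 4).
      { apply HN2. intros r r' Hin Hr1 Hr2.
        destruct (partition01_pair (T n) r r') as [Hr [Hr' [Hrr' Hm]]]; auto; [apply HT|].
        assert (B1 := kap_main r r' Hr Hr' ltac:(lra)).
        assert (B2 := Hd5 s r r' Hs1 Hr Hr' ltac:(apply Rabs_lt_between; lra) ltac:(apply Rabs_lt_between; lra)).
        assert (B3 := HLip r r' ltac:(lra) ltac:(lra) ltac:(lra)).
        assert (B5 : al r <= al r') by (apply al_incr; unfold in01 in *; lra).
        assert (B4 : w * Rabs (c r' - c r) <= 1 * (al r' - al r)).
        { apply Rle_trans with (w * (L * (al r' - al r))); [apply Rmult_le_compat_l; lra|].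
          rewrite <- Rmult_assoc. apply Rmult_le_compat_r; [lra|].
          unfold w. apply Rmult_le_reg_l with (L + 1); [lra|].
          rewrite <- Rmult_assoc, Rinv_r; lra. }
        apply Rabs_le_between in B1. apply Rabs_le_between in B2. apply Rabs_le. lra. }
      set (S1 := sum_le (T n) t kap) in *. set (S0 := sum_le (T n) s kap) in *.
      set (C1 := sum_le (T n) t (fun r r' => c r' - c r)) in *.
      set (C0 := sum_le (T n) s (fun r r' => c r' - c r)) in *.
      assert (B6 : g s * Rabs (C1 - C0 - (c t - c s)) <= e / 4).
      { apply Rle_trans with (g s * (e / (4 * g s))); [apply Rmult_le_compat_l; lra|].
        right. field. lra. }
      rewrite <- (Rabs_right (g s)), <- Rabs_mult in B6 by lra.
      assert (B7 : k1 * Rabs (c t - c s) <= Rabs (g s * (c t - c s))).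
      { rewrite Rabs_mult, (Rabs_right (g s)) by lra. apply Rmult_le_compat_r; [apply Rabs_pos|lra]. }
      eapply Rle_trans; [apply B7|].
      assert (B8 : al s <= al t) by (apply al_incr; lra).
      apply Rabs_le_between in HN2'. apply Rabs_le_between in HN4. apply Rabs_le_between in B6.
      assert (0 <= K * (al t - al s)) by (apply Rmult_le_pos; lra).
      apply Rabs_le. lra. }
    unfold K0. apply Rmult_le_reg_l with k1; auto.
    replace (k1 * ((4 * K + 2) / k1 * (al t - al s))) with ((4 * K + 2) * (al t - al s)) by (field; lra).
    exact Hmain. }
  assert (Hloc : forall s t, a <= s -> s <= t -> t <= b -> t - s < d / 2 ->
    Rabs (c t - c s) <= K0 * (al t - al s)).
  { intros s t Hs Hst Ht Hts.
    destruct (Rle_lt_or_eq_dec s t Hst) as [Hlt|Heq].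
    - apply c_extend; try lra; [left; apply K0_pos | apply cont01_on; auto; lra|].
      intros u Hu. apply Hloc0; lra.
    - subst. rewrite !Rminus_diag, Rabs_R0, Rmult_0_r. lra. }
  intros s t Hs Hst Ht.
  assert (Hch := chain_abs c (fun t => K0 * al t) al s t Hst). cbv beta in Hch.
  rewrite Rmult_minus_distr_l. apply Hch. intros eps He. exists (d / 2). split; [lra|].
  intros u v Hu Huv Hv Hd'. assert (B := Hloc u v ltac:(lra) Huv ltac:(lra) Hd').
  assert (al u <= al v) by (apply al_incr; lra).
  assert (0 <= eps * (al v - al u)) by (apply Rmult_le_pos; lra). lra.
Qed.

Definition loc_lip (t : R) : Prop := exists d L, 0 < d /\ 0 <= L /\ forall s u, in01 s -> in01 u ->
  s <= u -> Rabs (s - t) < d -> Rabs (u - t) < d -> Rabs (c u - c s) <= L * (al u - al s).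

(** The local constants have no common bound; [lip_universal] replaces each by [K0] before the
    pieces are joined. *)
Lemma lip_of_loc a b : 0 <= a -> a <= b -> b <= 1 -> (forall t, a <= t <= b -> loc_lip t) ->
  lip_on a b K0.
Proof.
  intros Ha Hab Hb Hl.
  destruct (tube a b (fun u v _ => u <= v -> Rabs (c v - c u) <= K0 * (al v - al u))) as [d [Hd H]].
  - auto.
  - intros t Ht. destruct (Hl t Ht) as [d [L [Hd [HL Hlip]]]].
    exists (d / 2). split; [lra|]. intros u v Hu Hv H1' H2' Huv.
    apply Rabs_lt_between in H1'. apply Rabs_lt_between in H2'.
    assert (HU : lip_on u v K0).
    { apply lip_universal with L; try lra. intros s s' Hs Hss' Hs'.
      apply Hlip; unfold in01; try lra; apply Rabs_lt_between; lra. }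
    apply HU; lra.
  - intros s t Hs Hst Ht.
    assert (Hch := chain_abs c (fun t => K0 * al t) al s t Hst). cbv beta in Hch.
    rewrite Rmult_minus_distr_l. apply Hch. intros eps He. exists d. split; [lra|].
    intros u v Hu Huv Hv Hd'.
    assert (B := H u v ltac:(lra) ltac:(lra) ltac:(apply Rabs_lt_between; lra) Huv).
    assert (al u <= al v) by (apply al_incr; lra).
    assert (0 <= eps * (al v - al u)) by (apply Rmult_le_pos; lra). lra.
Qed.

(** The end point [b] may itself be a bad time; this will be used up to the first bad time of a
    cell. *)
Lemma lip_of_loc_open a b : 0 <= a -> a <= b -> b <= 1 -> (forall t, a <= t < b -> loc_lip t) ->
  lip_on a b K0.
Proof.
  intros Ha Hab Hb Hl s t Hs Hst Ht.
  destruct (Rle_lt_or_eq_dec s t Hst) as [Hlt|Heq].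
  - apply c_extend; try lra; [left; apply K0_pos | apply cont01_on; auto; lra|].
    intros u Hu. apply (lip_of_loc s u); try lra. intros v Hv. apply Hl. lra.
  - subst. rewrite !Rminus_diag, Rabs_R0, Rmult_0_r. lra.
Qed.

Let S (t : R) : Prop := in01 t /\ ~ loc_lip t.

Lemma S_closed t : (forall d, 0 < d -> exists s, S s /\ Rabs (s - t) < d) -> S t.
Proof.
  intros H. split.
  - unfold in01. split; apply le_epsilon; intros e He; destruct (H e He) as [s [[[H0 H0'] _] Hs]];
      apply Rabs_lt_between in Hs; lra.
  - intros [d [L [Hd [HL Hlip]]]]. destruct (H (d / 2)) as [s [[Hs Hns] Hst]]; [lra|].
    apply Hns. exists (d / 2), L. split; [lra|]. split; auto.
    intros u v Hu Hv Huv H1' H2'. apply Hlip; auto;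
      apply Rabs_lt_between in Hst; apply Rabs_lt_between in H1'; apply Rabs_lt_between in H2';
      apply Rabs_lt_between; lra.
Qed.

(** * Crossing the bad times inside one chart *)

Section Chart.

Variables (j1 j2 x0 rho : R) (fA F : R -> R -> R).
Hypothesis Hj : 0 <= j1 /\ j1 < j2 /\ j2 <= 1.
Hypothesis Hrho : 0 < rho.
Hypothesis Hxj : forall s, j1 <= s <= j2 -> Rabs (x s - x0) < rho.
Hypothesis A1 : forall s s' xi, j1 <= s -> s <= s' -> s' <= j2 -> Rabs (xi - x0) < rho ->
  Rabs (fA s' xi - fA s xi) <= K * (al s' - al s).
Hypothesis A2 : forall s xi, j1 <= s <= j2 -> Rabs (xi - x0) < rho -> is_derive (fA s) xi (F s xi).
Hypothesis A3 : forall s, j1 <= s <= j2 -> F s (x s) = eta s.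
Hypothesis A4 : forall s, j1 <= s <= j2 -> exists N r, 0 < N /\ 0 < r /\ forall xi xi',
  Rabs (xi - x0) < rho -> Rabs (xi' - x0) < rho -> Rabs (xi - x s) < r -> Rabs (xi' - x s) < r ->
  Rabs (F s xi' - F s xi) <= N * Rabs (xi' - xi).
Hypothesis A6 : cont_on j1 j2 (fun s => fA s (x s)).
Hypothesis A7 : forall s, j1 <= s <= j2 -> Rabs (fA s (x s)) <= K.

Let m (t : R) : R := z t - fA t (x t).
(** Lipschitz constant in time, relative to [al], of [p t (c t) xi - fA t xi] on a good interval:
    [K] from [fA], [K] from the time argument of [p] and [K * K0] through [c]. *)
Let Km : R := K * (2 + K0).

Lemma Km_pos : 0 < Km.
Proof. unfold Km. pose proof K0_pos. apply Rmult_lt_0_compat; lra. Qed.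

Lemma z_cont : cont01 z.
Proof.
  intros t Ht eps He.
  destruct (Hc t Ht (eps / (6 * K))) as [d1 [Hd1 B1]]; [apply Rdiv_lt_0_compat; lra|].
  set (M := Rabs (eta t) + K * (2 * X) + 1).
  assert (HXp : 0 <= X) by (eapply Rle_trans; [apply Rabs_pos | apply (HX t Ht)]).
  assert (HM : 0 < M).
  { unfold M. pose proof (Rabs_pos (eta t)). assert (0 <= K * (2 * X)) by (apply Rmult_le_pos; lra). lra. }
  destruct (Hx t Ht (eps / (2 * M))) as [d2 [Hd2 B2]]; [apply Rdiv_lt_0_compat; lra|].
  assert (He6 : 0 < eps / (6 * K)) by (apply Rdiv_lt_0_compat; lra).
  exists (Rmin (eps / (6 * K)) (Rmin d1 d2)). split; [repeat apply Rmin_pos; auto|].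
  intros s Hs Hst. pose proof (Rmin_l (eps / (6 * K)) (Rmin d1 d2)).
  pose proof (Rmin_r (eps / (6 * K)) (Rmin d1 d2)). pose proof (Rmin_l d1 d2). pose proof (Rmin_r d1 d2).
  specialize (B1 s Hs ltac:(lra)). specialize (B2 s Hs ltac:(lra)).
  assert (C1 := H1 t s (c t) (c s) (x s) Ht Hs (HP _ Ht) (HP _ Hs) (HX _ Hs)).
  assert (C2 := H2 t (c t) (x t) (x s) Ht (HP _ Ht) (HX _ Ht) (HX _ Hs)).
  assert (C3 : K * (Rabs (s - t) + Rabs (c s - c t)) < eps / 2).
  { apply Rlt_le_trans with (K * (eps / (6 * K) + eps / (6 * K))).
    - apply Rmult_lt_compat_l; lra.
    - apply Rle_trans with (eps / 3); [right; field; lra | lra]. }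
  fold (eta t) in C2.
  assert (C4 : Rabs (eta t * (x s - x t)) + K * (x s - x t) ^ 2 <= M * Rabs (x s - x t)).
  { rewrite Rabs_mult. replace ((x s - x t) ^ 2) with (Rabs (x s - x t) * Rabs (x s - x t)).
    2: { rewrite <- Rabs_mult, Rabs_right; [ring|]. apply Rle_ge, Rle_0_sqr. }
    assert (Rabs (x s - x t) <= 2 * X).
    { assert (U := HX s Hs). assert (V := HX t Ht). apply Rabs_le_between in U. apply Rabs_le_between in V.
      apply Rabs_le. lra. }
    pose proof (Rabs_pos (x s - x t)). unfold M.
    assert (K * (Rabs (x s - x t) * Rabs (x s - x t)) <= K * (2 * X * Rabs (x s - x t))).
    { apply Rmult_le_compat_l; [lra|]. apply Rmult_le_compat_r; lra. }
    lra. }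
  assert (C5 : M * Rabs (x s - x t) < eps / 2).
  { apply Rlt_le_trans with (M * (eps / (2 * M))); [apply Rmult_lt_compat_l; lra|]. right. field. lra. }
  unfold z.
  replace (p s (c s) (x s) - p t (c t) (x t)) with
    ((p s (c s) (x s) - p t (c t) (x s)) + (p t (c t) (x s) - p t (c t) (x t) - eta t * (x s - x t))
      + eta t * (x s - x t)) by ring.
  eapply Rle_lt_trans; [apply Rabs_triang|].
  eapply Rle_lt_trans; [apply Rplus_le_compat_r, Rabs_triang|]. lra.
Qed.

Lemma m_cont : cont_on j1 j2 m.
Proof.
  intros t Ht eps He.
  destruct (cont01_on z j1 j2 z_cont ltac:(lra) ltac:(lra) t Ht (eps / 2)) as [d1 [Hd1 B1]]; [lra|].
  destruct (A6 t Ht (eps / 2)) as [d2 [Hd2 B2]]; [lra|].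
  exists (Rmin d1 d2). split; [now apply Rmin_pos|]. intros s Hs Hst.
  specialize (B1 s Hs ltac:(eapply Rlt_le_trans; [apply Hst | apply Rmin_l])).
  specialize (B2 s Hs ltac:(eapply Rlt_le_trans; [apply Hst | apply Rmin_r])).
  cbv beta in B2. unfold m. apply Rabs_lt_between in B1. apply Rabs_lt_between in B2.
  apply Rabs_lt_between. lra.
Qed.

Lemma j_in01 s : j1 <= s <= j2 -> in01 s.
Proof. unfold in01. lra. Qed.

(* [Phi s xi = p s (c s) xi - fA s xi] is critical at [x s]. *)
Lemma slice_critical s : j1 <= s <= j2 -> exists N r, 0 < N /\ 0 < r /\ forall xi,
  Rabs (xi - x0) < rho -> Rabs (xi - x s) < r -> Rabs (fA s xi - fA s (x s) - eta s * (xi - x s))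
   <= N * (xi - x s) ^ 2.
Proof.
  intros Hs. destruct (A4 s Hs) as [N [r [HN [Hr H]]]]. exists N, r. split; auto. split; auto.
  intros xi Hxi Hxr.
  destruct (mean_value (fA s) (F s) (x s) xi) as [q [Hq E]].
  { intros u Hu. apply A2; auto. apply (Rabs_between_dist u (x s) xi); auto. }
  rewrite E, <- (A3 s Hs).
  replace (F s q * (xi - x s) - F s (x s) * (xi - x s)) with ((F s q - F s (x s)) * (xi - x s)) by ring.
  assert (Hz : Rabs (x s - x s) < r) by (rewrite Rminus_diag, Rabs_R0; auto).
  assert (B := H (x s) q (Hxj s Hs) ltac:(apply (Rabs_between_dist q (x s) xi); auto) Hz
    ltac:(apply (Rabs_between_dist q (x s) xi); auto)).
  assert (Hqx : Rabs (q - x s) <= Rabs (xi - x s)).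
  { unfold Rabs. revert Hq. apply Rmin_case; apply Rmax_case; intros; repeat destruct Rcase_abs; lra. }
  rewrite Rabs_mult. replace ((xi - x s) ^ 2) with (Rabs (xi - x s) * Rabs (xi - x s)).
  2: { rewrite <- Rabs_mult, Rabs_right; [ring|]. apply Rle_ge, Rle_0_sqr. }
  rewrite <- Rmult_assoc. apply Rmult_le_compat_r; [apply Rabs_pos|].
  eapply Rle_trans; [apply B|]. apply Rmult_le_compat_l; lra.
Qed.

Lemma al_abs s t C f : 0 <= C -> j1 <= s <= j2 -> j1 <= t <= j2 ->
  (forall u v, j1 <= u -> u <= v -> v <= j2 -> Rabs (f v - f u) <= C * (al v - al u)) ->
  Rabs (f t - f s) <= C * Rabs (al t - al s).
Proof.
  intros HC Hs Ht H. destruct (Rle_dec s t) as [Hst|Hst].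
  - eapply Rle_trans; [apply H; lra|]. apply Rmult_le_compat_l; auto. apply Rle_abs.
  - rewrite Rabs_minus_sym, (Rabs_minus_sym (al t)). eapply Rle_trans; [apply H; lra|].
    apply Rmult_le_compat_l; auto. apply Rle_abs.
Qed.

Lemma fA_al s s' xi : j1 <= s <= j2 -> j1 <= s' <= j2 -> Rabs (xi - x0) < rho ->
  Rabs (fA s' xi - fA s xi) <= K * Rabs (al s' - al s).
Proof.
  intros Hs Hs' Hxi. apply (al_abs s s' K (fun t => fA t xi)); auto; try lra.
Qed.

Lemma time_al s s' : j1 <= s <= j2 -> j1 <= s' <= j2 -> Rabs (s' - s) <= Rabs (al s' - al s).
Proof.
  intros Hs Hs'. rewrite <- (Rmult_1_l (Rabs (al s' - al s))).
  apply (al_abs s s' 1 (fun t => t)); auto; try lra. intros u v Hu Huv Hv.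
  rewrite Rabs_right by lra. rewrite Rmult_1_l. apply Hal_t; lra.
Qed.

Lemma lip_abs a b L s s' : 0 <= L -> 0 <= a -> b <= 1 -> lip_on a b L ->
  a <= s <= b -> a <= s' <= b -> Rabs (c s' - c s) <= L * Rabs (al s' - al s).
Proof.
  intros HL Ha Hb H Hs Hs'. destruct (Rle_dec s s') as [Hst|Hst].
  - eapply Rle_trans; [apply H; lra|]. apply Rmult_le_compat_l; auto. apply Rle_abs.
  - rewrite Rabs_minus_sym, (Rabs_minus_sym (al s')). eapply Rle_trans; [apply H; lra|].
    apply Rmult_le_compat_l; auto. apply Rle_abs.
Qed.

Lemma Phi_time a b s s' xi : j1 <= a -> b <= j2 -> lip_on a b K0 -> a <= s <= b -> a <= s' <= b ->
  Rabs xi <= X -> Rabs (xi - x0) < rho ->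
  Rabs ((p s' (c s') xi - fA s' xi) - (p s (c s) xi - fA s xi)) <= Km * Rabs (al s' - al s).
Proof.
  intros Ha Hb Hlip Hs Hs' HxX Hxi.
  assert (Hs1 : in01 s) by (apply j_in01; lra). assert (Hs1' : in01 s') by (apply j_in01; lra).
  assert (B1 := H1 s s' (c s) (c s') xi Hs1 Hs1' (HP _ Hs1) (HP _ Hs1') HxX).
  assert (B2 := fA_al s s' xi ltac:(lra) ltac:(lra) Hxi).
  assert (B3 := time_al s s' ltac:(lra) ltac:(lra)).
  assert (B4 := lip_abs a b K0 s s' ltac:(left; apply K0_pos) ltac:(lra) ltac:(lra) Hlip Hs Hs').
  assert (B5 : K * (Rabs (s' - s) + Rabs (c s' - c s)) <= K * ((1 + K0) * Rabs (al s' - al s))).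
  { apply Rmult_le_compat_l; lra. }
  unfold Km. apply Rabs_le_between in B1. apply Rabs_le_between in B2. apply Rabs_le. lra.
Qed.

(** Where [x] has moved by at least [r], any bounded quantity is a multiple of the squared
    increment. Thus the hypothesis of [sard] has to be verified only for small increments of [x]. *)
Lemma square_absorb B r d e : 0 <= B -> 0 < r -> r <= Rabs d -> Rabs e <= B ->
  Rabs e <= B / r ^ 2 * d ^ 2.
Proof.
  intros HB Hr Hd He. eapply Rle_trans; [apply He|].
  assert (r ^ 2 <= d ^ 2).
  { rewrite <- (pow2_abs d). apply pow_incr. lra. }
  assert (0 < r ^ 2) by (apply pow_lt; auto).
  apply Rmult_le_reg_r with (r ^ 2); auto.
  replace (B / r ^ 2 * d ^ 2 * r ^ 2) with (B * d ^ 2) by (field; lra).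
  apply Rmult_le_compat_l; auto.
Qed.

Lemma m_bounded s : j1 <= s <= j2 -> forall s', j1 <= s' <= j2 ->
  exists B, 0 <= B /\ forall u v, j1 <= u <= j2 -> j1 <= v <= j2 -> Rabs (m v - m u) <= B.
Proof.
  intros Hs s' Hs'. destruct (cont01_bounded z z_cont) as [Z [HZ HZb]].
  exists (2 * (Z + K)). split; [lra|]. intros u v Hu Hv.
  assert (B1 := HZb u (j_in01 u Hu)). assert (B2 := HZb v (j_in01 v Hv)).
  assert (B3 := A7 u Hu). assert (B4 := A7 v Hv). unfold m.
  apply Rabs_le_between in B1. apply Rabs_le_between in B2.
  apply Rabs_le_between in B3. apply Rabs_le_between in B4. apply Rabs_le. lra.
Qed.

(** The increment of [m] splits into a change of time at fixed [xi = x s'], bounded with [Km], and a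
    displacement from the critical point [x s] in the slice at [s], which is quadratic with an
    uncontrolled constant. [sard] removes the latter. *)
Lemma m_lip a b : j1 <= a -> a <= b -> b <= j2 -> lip_on a b K0 ->
  Rabs (m b - m a) <= 2 * Km * (al b - al a).
Proof.
  intros Ha Hab Hb Hlip.
  apply (sard m x al a b Km X Hab); [left; apply Km_pos | | | |].
  - intros t Ht eps He. destruct (m_cont t ltac:(lra) eps He) as [d [Hd H]].
    exists d; split; auto. intros s Hs. apply H. lra.
  - intros t Ht. apply HX. apply j_in01. lra.
  - intros s t Hs Hst Ht. apply al_incr; lra.
  - intros s Hs.
    destruct (slice_critical s ltac:(lra)) as [N [r [HN [Hr HNr]]]].
    destruct (m_bounded a ltac:(lra) a ltac:(lra)) as [B [HB HBm]].
    assert (HBr : 0 <= B / r ^ 2) by (apply Rdiv_le_0_compat; auto; apply pow_lt; auto).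
    (* [N] and [K] are the quadratic remainders of [fA s] and of [p]; the last term covers the times
       at which [x] is at distance [r] or more from [x s]. *)
    exists (N + K + B / r ^ 2). split; [lra|]. intros s' Hs'.
    assert (Hs1 : in01 s) by (apply j_in01; lra). assert (Hs1' : in01 s') by (apply j_in01; lra).
    assert (Hsq : 0 <= (x s' - x s) ^ 2) by apply pow2_ge_0.
    assert (HKm : 0 <= Km * Rabs (al s' - al s)).
    { apply Rmult_le_pos; [left; apply Km_pos | apply Rabs_pos]. }
    destruct (Rlt_le_dec (Rabs (x s' - x s)) r) as [Hlt|Hge].
    + assert (B1 := Phi_time a b s s' (x s') Ha Hb Hlip Hs Hs' (HX _ Hs1') (Hxj s' ltac:(lra))).
      assert (B2 := HNr (x s') (Hxj s' ltac:(lra)) Hlt).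
      assert (B3 := H2 s (c s) (x s) (x s') Hs1 (HP _ Hs1) (HX _ Hs1) (HX _ Hs1')).
      fold (eta s) in B3.
      assert (0 <= B / r ^ 2 * (x s' - x s) ^ 2) by (apply Rmult_le_pos; auto).
      unfold m, z. apply Rabs_le_between in B1. apply Rabs_le_between in B2.
      apply Rabs_le_between in B3. apply Rabs_le. lra.
    + assert (B1 := square_absorb B r (x s' - x s) (m s' - m s) HB Hr Hge (HBm s s' ltac:(lra) ltac:(lra))).
      assert (0 <= (N + K) * (x s' - x s) ^ 2) by (apply Rmult_le_pos; [lra | auto]). lra.
Qed.

Lemma kap_good r r' : in01 r -> in01 r' -> r <= r' -> lip_on r r' K0 ->
  Rabs (kap r r') <= (K * (2 + K0)) * (al r' - al r) + K * (x r' - x r) ^ 2.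
Proof.
  intros Hr Hr' Hrr' Hlip. assert (B1 := kap_main r r' Hr Hr' Hrr').
  assert (B2 := H1 r r (c r) (c r') (x r') Hr Hr (HP _ Hr) (HP _ Hr') (HX _ Hr')).
  rewrite Rminus_diag, Rabs_R0, Rplus_0_l in B2.
  assert (B3 := Hlip r r' ltac:(lra) Hrr' ltac:(lra)).
  assert (B4 : K * Rabs (c r' - c r) <= K * (K0 * (al r' - al r))) by (apply Rmult_le_compat_l; lra).
  assert (B5 : al r <= al r') by (apply al_incr; unfold in01 in *; lra).
  assert (0 <= K * (al r' - al r)) by (apply Rmult_le_pos; lra).
  apply Rabs_le_between in B1. apply Rabs_le_between in B2. apply Rabs_le. lra.
Qed.

Variables (N r0 : R).
Hypothesis HN : 0 < N.
Hypothesis Hr0 : 0 < r0.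
Hypothesis HSN : forall s xi xi', S s -> j1 <= s <= j2 ->
  Rabs (xi - x0) < rho -> Rabs (xi' - x0) < rho -> Rabs (xi - x s) < r0 -> Rabs (xi' - x s) < r0 ->
  Rabs (F s xi' - F s xi) <= N * Rabs (xi' - xi).

(** The slope error is a sum [d + e], with square at most [2 d^2 + 2 e^2]. Here [d^2] is bounded
    with [16 * (N + K) * Km], and [e] with [K * (1 + K0)], one of its two factors [al v - al r]
    being replaced by the total increment of [al]. *)
Let Kd : R := 32 * (N + K) * Km + 2 * (K * (1 + K0)) ^ 2 * (al 1 - al 0).

(* At a bad time [v], the slope error of the path just before [v] is controlled:
   were it large, [Phi v] would vary along the path more than [m] can. *)
Lemma bad_slope r v : j1 <= r -> r <= v -> v <= j2 -> S v -> lip_on r v K0 ->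
  Rabs (x r - x v) < r0 ->
  (F v (x r) - eta r) ^ 2 <= Kd * (al v - al r).
Proof.
  intros Hr Hrv Hv HSv Hlip Hxr.
  assert (Hr1 : in01 r) by (apply j_in01; lra). assert (Hv1 : in01 v) by (apply j_in01; lra).
  assert (Halrv : al r <= al v) by (apply al_incr; lra).
  set (dal := al v - al r) in *.
  (* Mismatch of the two slopes in the slice at [v]: it vanishes at [x v] and has Lipschitz constant
     [N + K] between [x r] and [x v], since [v] is a bad time. *)
  set (D := fun xi => F v xi - pt v (c v) xi).
  assert (HNK : 0 < N + K) by lra.
  assert (HKm := Km_pos). assert (HK0 := K0_pos).
  assert (HD0 : D (x v) = 0) by (unfold D; rewrite A3 by lra; unfold eta; ring).
  assert (Hseg : forall q, Rmin (x r) (x v) <= q <= Rmax (x r) (x v) ->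
     Rabs (q - x0) < rho /\ Rabs (q - x v) < r0 /\ Rabs q <= X).
  { intros q Hq. split; [|split].
    - apply (Rabs_between_dist q (x r) (x v)); auto; apply Hxj; lra.
    - apply (Rabs_between_dist q (x r) (x v)); auto. rewrite Rminus_diag, Rabs_R0; auto.
    - assert (U := HX r Hr1). assert (V := HX v Hv1). apply Rabs_le_between in U.
      apply Rabs_le_between in V. apply Rabs_le. revert Hq.
      apply Rmin_case; apply Rmax_case; intros; lra. }
  assert (HDlip : forall q q', Rmin (x r) (x v) <= q <= Rmax (x r) (x v) ->
     Rmin (x r) (x v) <= q' <= Rmax (x r) (x v) -> Rabs (D q' - D q) <= (N + K) * Rabs (q' - q)).
  { intros q q' Hq Hq'. destruct (Hseg q Hq) as [U1 [U2 U3]]. destruct (Hseg q' Hq') as [V1 [V2 V3]].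
    assert (B1 := HSN v q q' HSv ltac:(lra) U1 V1 U2 V2).
    assert (B2 := H4' v (c v) q q' Hv1 (HP _ Hv1) U3 V3).
    unfold D. apply Rabs_le_between in B1. apply Rabs_le_between in B2. apply Rabs_le. lra. }
  assert (Hends : Rmin (x r) (x v) <= x r <= Rmax (x r) (x v) /\ Rmin (x r) (x v) <= x v <= Rmax (x r) (x v)).
  { repeat split; auto using Rmin_l, Rmin_r, Rmax_l, Rmax_r. }
  destruct Hends as [Hend1 Hend2].
  set (d := D (x r)).
  assert (Hdx : Rabs d <= (N + K) * Rabs (x r - x v)).
  { assert (B := HDlip (x v) (x r) Hend2 Hend1). rewrite HD0, Rminus_0_r in B. exact B. }
  assert (Hd2 : d ^ 2 <= 16 * (N + K) * Km * dal).
  (* Within distance [h] of [x r], the mismatch stays at least [|d| / 2], so the slice function at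
     [v] changes by at least [|d| * h / 2 = d^2 / (4 * (N + K))] over this distance. As
     [|d| <= (N + K) * |x r - x v|], such a displacement fits between [x r] and [x v]. *)
  { set (h := Rabs d / (2 * (N + K))).
    assert (Hh0 : 0 <= h) by (unfold h; apply Rdiv_le_0_compat; [apply Rabs_pos | lra]).
    assert (HNh : (N + K) * h = Rabs d / 2) by (unfold h; field; lra).
    assert (Hh : h <= Rabs (x r - x v)).
    { apply Rmult_le_reg_l with (N + K); auto. rewrite HNh. pose proof (Rabs_pos d). lra. }
    set (y := if Rle_dec (x r) (x v) then x r + h else x r - h).
    assert (Hy : Rmin (x r) (x v) <= y <= Rmax (x r) (x v) /\ Rabs (y - x r) = h).
    { unfold y. destruct (Rle_dec (x r) (x v)) as [Hle|Hle].
      - rewrite Rmin_left, Rmax_right by auto. rewrite Rabs_left1 in Hh by lra. split; [lra|].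
        rewrite Rabs_right; lra.
      - rewrite Rmin_right, Rmax_left by lra. rewrite Rabs_right in Hh by lra. split; [lra|].
        rewrite Rabs_left1; lra. }
    destruct Hy as [Hy Hyh].
    (* The path itself visits [y] no later than [v]. So the change of the slice function is that of
       [m] from [r] to [t2], up to two shifts in time to [v]: at most [2 + 1 + 1 = 4] times
       [Km * dal]. *)
    destruct (ivt_cont01 x r v y Hx ltac:(lra) Hrv ltac:(lra) Hy) as [t2 [Ht2 Ex]].
    destruct (mean_value (fun xi => p v (c v) xi - fA v xi) (fun xi => pt v (c v) xi - F v xi) (x r) y)
      as [q [Hq E]].
    { intros u Hu. assert (Hu' : Rmin (x r) (x v) <= u <= Rmax (x r) (x v)).
      { revert Hu Hy. unfold Rmin, Rmax. repeat destruct Rle_dec; lra. }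
      destruct (Hseg u Hu') as [U1 [U2 U3]].
      apply (is_derive_minus (V := R_NormedModule)); [now apply H6 | apply A2; auto; lra]. }
    assert (Hq' : Rmin (x r) (x v) <= q <= Rmax (x r) (x v)).
    { revert Hq Hy. unfold Rmin, Rmax. repeat destruct Rle_dec; lra. }
    assert (Hqr : Rabs (q - x r) <= h).
    { rewrite <- Hyh. unfold Rabs. revert Hq. apply Rmin_case; apply Rmax_case; intros;
        repeat destruct Rcase_abs; lra. }
    assert (HDq : Rabs d / 2 <= Rabs (D q)).
    { assert (B := HDlip (x r) q Hend1 Hq'). fold d in B.
      assert ((N + K) * Rabs (q - x r) <= Rabs d / 2).
      { rewrite <- HNh. apply Rmult_le_compat_l; lra. }
      assert (Rabs d <= Rabs (D q - d) + Rabs (D q)).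
      { replace d with (D q - (D q - d)) at 1 by ring. unfold Rminus at 1.
        eapply Rle_trans; [apply Rabs_triang|]. rewrite Rabs_Ropp. lra. }
      lra. }
    assert (HPsi : Rabs d / 2 * h <= Rabs ((p v (c v) y - fA v y) - (p v (c v) (x r) - fA v (x r)))).
    { rewrite E, Rabs_mult, Hyh. apply Rmult_le_compat_r; auto.
      replace (pt v (c v) q - F v q) with (- D q) by (unfold D; ring). rewrite Rabs_Ropp. auto. }
    destruct (Hseg y Hy) as [Y1 [Y2 Y3]]. destruct (Hseg (x r) Hend1) as [X1 [X2 X3]].
    assert (B1 := Phi_time r v t2 v y Hr Hv Hlip ltac:(lra) ltac:(lra) Y3 Y1).
    assert (B2 := Phi_time r v r v (x r) Hr Hv Hlip ltac:(lra) ltac:(lra) X3 X1).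
    assert (Hlip' : lip_on r t2 K0) by (intros s t ? ? ?; apply Hlip; lra).
    assert (B3 := m_lip r t2 Hr ltac:(lra) ltac:(lra) Hlip').
    assert (Hat : al r <= al t2) by (apply al_incr; lra).
    assert (Hat' : al t2 <= al v) by (apply al_incr; lra).
    assert (C1 : Km * Rabs (al v - al t2) <= Km * dal).
    { apply Rmult_le_compat_l; [lra|]. unfold dal. rewrite Rabs_right; lra. }
    assert (C2 : Km * Rabs (al v - al r) <= Km * dal).
    { apply Rmult_le_compat_l; [lra|]. unfold dal. rewrite Rabs_right; lra. }
    assert (C3 : 2 * Km * (al t2 - al r) <= 2 * Km * dal).
    { apply Rmult_le_compat_l; [lra|]. unfold dal. lra. }
    assert (HPsi2 : Rabs ((p v (c v) y - fA v y) - (p v (c v) (x r) - fA v (x r))) <= 4 * Km * dal).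
    { unfold m, z in B3. rewrite Ex in B3.
      apply Rabs_le_between in B1. apply Rabs_le_between in B2. apply Rabs_le_between in B3.
      apply Rabs_le. lra. }
    assert (Hfin : Rabs d / 2 * h * (4 * (N + K)) = d ^ 2).
    { rewrite <- (pow2_abs d). unfold h. field. lra. }
    rewrite <- Hfin.
    apply Rle_trans with (4 * Km * dal * (4 * (N + K))); [apply Rmult_le_compat_r; lra | right; ring]. }
  assert (Hdd : Rabs (F v (x r) - eta r - d) <= K * (1 + K0) * dal).
  { unfold d, D, eta. replace (_ - _ - _) with (pt v (c v) (x r) - pt r (c r) (x r)) by ring.
    eapply Rle_trans; [apply H4; auto|].
    rewrite Rmult_assoc. apply Rmult_le_compat_l; [lra|].
    assert (B1 := time_al r v ltac:(lra) ltac:(lra)).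
    rewrite (Rabs_right (al v - al r)) in B1 by lra.
    assert (B2 := Hlip r v ltac:(lra) Hrv ltac:(lra)). fold dal in B1, B2. lra. }
  set (e := F v (x r) - eta r - d) in *.
  replace (F v (x r) - eta r) with (d + e) by (unfold e; ring).
  assert (Hdal : dal <= al 1 - al 0).
  { unfold dal. assert (al 0 <= al r) by (apply al_incr; lra). assert (al v <= al 1) by (apply al_incr; lra). lra. }
  assert (Hdal0 : 0 <= dal) by (unfold dal; lra).
  assert (He2 : e ^ 2 <= (K * (1 + K0)) ^ 2 * (al 1 - al 0) * dal).
  { rewrite <- (pow2_abs e). apply Rle_trans with ((K * (1 + K0) * dal) ^ 2).
    - apply pow_incr. split; [apply Rabs_pos | auto].
    - rewrite Rpow_mult_distr. rewrite Rmult_assoc. apply Rmult_le_compat_l; [apply pow2_ge_0|].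
      simpl. rewrite Rmult_1_r. apply Rmult_le_compat_r; auto. }
  apply Rle_trans with (2 * d ^ 2 + 2 * e ^ 2).
  - assert (0 <= (d - e) ^ 2) by apply pow2_ge_0. lra.
  - unfold Kd. lra.
Qed.

(** [Kc] and [Kx] cover both cases of [cell_estimate]: [K + Kd] and [N + 1] with a bad time in the
    cell, [3 * Km] and [K] without. *)
Let Kc : R := 2 * K + Kd + 4 * Km.
Let Kx : R := N + 1 + K.

Lemma Kd_nonneg : 0 <= Kd.
Proof.
  unfold Kd. pose proof Km_pos. assert (al 0 <= al 1) by (apply al_incr; lra).
  apply Rplus_le_le_0_compat.
  - apply Rmult_le_pos; [|lra]. lra.
  - apply Rmult_le_pos; [|lra]. apply Rmult_le_pos; [lra | apply pow2_ge_0].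
Qed.

(** The increment of [z] cancels, and what remains is the remainder of [fA] along the cell with
    slope [eta r]. If the cell contains a bad time, it is expanded in the slice at the first one,
    [v]: there the constant [N] is uniform, [bad_slope] compares the slopes, and the product of
    slope error and increment is split into squares. Otherwise [m_lip] and [kap_good] bound the two
    terms separately. *)
Lemma cell_estimate r r' : j1 <= r -> r < r' -> r' <= j2 ->
  (forall s t, r <= s <= r' -> r <= t <= r' -> Rabs (x s - x t) < r0) ->
  Rabs ((m r' - m r) - kap r r') <= Kc * (al r' - al r) + Kx * (x r' - x r) ^ 2.
Proof.
  intros Hr Hrr' Hr' Hosc.
  assert (Hr1 : in01 r) by (apply j_in01; lra). assert (Hr1' : in01 r') by (apply j_in01; lra).
  assert (Hai : al r <= al r') by (apply al_incr; lra).
  assert (HKd := Kd_nonneg). assert (HKm := Km_pos).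
  assert (Hsq : 0 <= (x r' - x r) ^ 2) by apply pow2_ge_0.
  destruct (classic (exists s, S s /\ r <= s <= r')) as [Hbad|Hgood].
  - destruct (closed_first S r r' S_closed Hbad) as [v [HSv [Hv Hfirst]]].
    assert (Hlip : lip_on r v K0).
    { apply lip_of_loc_open; try lra. intros t Ht. apply NNPP; intros Hn. apply (Hfirst t Ht).
      split; auto. unfold in01; lra. }
    assert (B1 := bad_slope r v Hr ltac:(lra) ltac:(lra) HSv Hlip (Hosc r v ltac:(lra) ltac:(lra))).
    assert (Hav : al r <= al v) by (apply al_incr; lra).
    assert (Hav' : al v <= al r') by (apply al_incr; lra).
    set (d := F v (x r) - eta r) in *.
    assert (B2 := A1 v r' (x r') ltac:(lra) ltac:(lra) Hr' (Hxj r' ltac:(lra))).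
    assert (B3 := A1 r v (x r) Hr ltac:(lra) ltac:(lra) (Hxj r ltac:(lra))).
    destruct (mean_value (fA v) (F v) (x r) (x r')) as [q [Hq E]].
    { intros u Hu. apply A2; [lra|]. apply (Rabs_between_dist u (x r) (x r')); auto; apply Hxj; lra. }
    assert (Hq0 : Rabs (q - x0) < rho) by (apply (Rabs_between_dist q (x r) (x r')); auto; apply Hxj; lra).
    assert (Hqv' : Rabs (q - x v) < r0) by (apply (Rabs_between_dist q (x r) (x r')); auto; apply Hosc; lra).
    assert (B4 := HSN v (x r) q HSv ltac:(lra) (Hxj r ltac:(lra)) Hq0 (Hosc r v ltac:(lra) ltac:(lra)) Hqv').
    assert (Hqr : Rabs (q - x r) <= Rabs (x r' - x r)).
    { unfold Rabs. revert Hq. apply Rmin_case; apply Rmax_case; intros; repeat destruct Rcase_abs; lra. }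
    assert (B5 : Rabs ((F v q - F v (x r)) * (x r' - x r)) <= N * (x r' - x r) ^ 2).
    { rewrite Rabs_mult. rewrite <- (pow2_abs (x r' - x r)).
      replace (N * Rabs (x r' - x r) ^ 2) with (N * Rabs (x r' - x r) * Rabs (x r' - x r)) by ring.
      apply Rmult_le_compat_r; [apply Rabs_pos|]. eapply Rle_trans; [apply B4|].
      apply Rmult_le_compat_l; lra. }
    assert (B6 : Rabs (d * (x r' - x r)) <= d ^ 2 + (x r' - x r) ^ 2).
    { rewrite Rabs_mult, <- (pow2_abs d), <- (pow2_abs (x r' - x r)).
      set (a := Rabs d). set (b := Rabs (x r' - x r)).
      assert (0 <= (a - b) ^ 2) by apply pow2_ge_0.
      assert (0 <= a * b) by (apply Rmult_le_pos; apply Rabs_pos). lra. }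
    assert (B7 : Kd * (al v - al r) <= Kd * (al r' - al r)) by (apply Rmult_le_compat_l; lra).
    assert (B8 : K * (al r' - al v) + K * (al v - al r) = K * (al r' - al r)) by ring.
    assert (B9 : 0 <= Km * (al r' - al r)) by (apply Rmult_le_pos; lra).
    assert (B10 : 0 <= K * (al r' - al r)) by (apply Rmult_le_pos; lra).
    assert (B11 : 0 <= K * (x r' - x r) ^ 2) by (apply Rmult_le_pos; lra).
    assert (E' : (m r' - m r) - kap r r' = - ((fA r' (x r') - fA v (x r')) + (F v q - F v (x r)) * (x r' - x r)
      + d * (x r' - x r) + (fA v (x r) - fA r (x r)))).
    { unfold m, kap, d. simpl in E. replace (fA v (x r')) with (fA v (x r) + F v q * (x r' - x r)) by lra. ring. }
    rewrite E', Rabs_Ropp. unfold Kc, Kx.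
    apply Rabs_le_between in B2. apply Rabs_le_between in B3. apply Rabs_le_between in B5.
    apply Rabs_le_between in B6. apply Rabs_le. lra.
  - assert (Hlip : lip_on r r' K0).
    { apply lip_of_loc; try lra. intros t Ht. apply NNPP; intros Hn. apply Hgood. exists t.
      split; auto. split; auto. unfold in01; lra. }
    assert (B1 := m_lip r r' Hr ltac:(lra) Hr' Hlip).
    assert (B2 := kap_good r r' Hr1 Hr1' ltac:(lra) Hlip). fold Km in B2.
    assert (B9 : 0 <= Km * (al r' - al r)) by (apply Rmult_le_pos; lra).
    assert (B10 : 0 <= K * (al r' - al r)) by (apply Rmult_le_pos; lra).
    assert (B12 : 0 <= Kd * (al r' - al r)) by (apply Rmult_le_pos; lra).
    assert (B11 : 0 <= N * (x r' - x r) ^ 2) by (apply Rmult_le_pos; lra).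
    unfold Kc, Kx. apply Rabs_le_between in B1. apply Rabs_le_between in B2. apply Rabs_le. lra.
Qed.

Let K4 : R := K + Kc + Kx.

(** Over a window the increments of [m] telescope, those of [m] minus [kap] are bounded cell by
    cell, and the sum of [kap] by [HTn]; bad times no longer matter. *)
Lemma m_lip_all a b : j1 <= a -> a <= b -> b <= j2 -> Rabs (m b - m a) <= K4 * (al b - al a).
Proof.
  revert a b. assert (HKd := Kd_nonneg). assert (HKm := Km_pos).
  assert (HKc : 0 <= Kc) by (unfold Kc; lra). assert (HKx : 0 <= Kx) by (unfold Kx; lra).
  (* For [b < j2] the cell straddling [b] still lies in the chart; [c_extend] then adds the end
     point. *)
  assert (Hlt : forall a b, j1 <= a -> a <= b -> b < j2 -> Rabs (m b - m a) <= K4 * (al b - al a)).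
  { intros a0 b Ha Hab Hb. apply le_epsilon. intros e He.
    assert (Ha1 : in01 a0) by (apply j_in01; lra). assert (Hb1 : in01 b) by (apply j_in01; lra).
    destruct (cont01_uniform x Hx r0 Hr0) as [d0 [Hd0 Hxu]].
    destruct (HTn a0 b Ha1 Hb1 Hab (e / 4)) as [N1 HN1]; [lra|].
    destruct (window_sum a0 b Kc Kx ltac:(lra) Hab ltac:(lra) HKc HKx (e / 4) ltac:(lra)) as [N2 HN2].
    (* [m] is only defined meaningfully on the chart, so its telescoping sums are
       evaluated directly *)
    destruct (m_cont a0 ltac:(lra) (e / 4)) as [da [Hda Hma]]; [lra|].
    destruct (m_cont b ltac:(lra) (e / 4)) as [db [Hdb Hmb]]; [lra|].
    destruct (mesh_eventually T (Rmin (Rmin d0 (j2 - b)) (Rmin da db)) HT) as [N3 HN3].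
    { repeat apply Rmin_pos; auto; lra. }
    set (n := (N1 + N2 + N3)%nat). specialize (HN1 n ltac:(lia)). specialize (HN2 n ltac:(lia)).
    specialize (HN3 n ltac:(lia)).
    pose proof (Rmin_l (Rmin d0 (j2 - b)) (Rmin da db)). pose proof (Rmin_r (Rmin d0 (j2 - b)) (Rmin da db)).
    pose proof (Rmin_l d0 (j2 - b)). pose proof (Rmin_r d0 (j2 - b)).
    pose proof (Rmin_l da db). pose proof (Rmin_r da db).
    destruct (telescope (T n) b) as [qb [Hqb [Hqb1 [Hqb2 Hqb3]]]]; auto; [apply HT|].
    destruct (telescope (T n) a0) as [qa [Hqa [Hqa1 [Hqa2 Hqa3]]]]; auto; [apply HT|].
    specialize (HN2 (fun r r' => (m r' - m r) - kap r r')).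
    rewrite !(sum_le_minus _ _ (fun r r' => m r' - m r) kap), Hqb3, Hqa3 in HN2.
    assert (HN2' : Rabs (m qb - m 0 - sum_le (T n) b kap - (m qa - m 0 - sum_le (T n) a0 kap))
      <= (Kc + Kx) * (al b - al a0) + e / 4).
    { apply HN2. intros r r' Hin Hr1 Hr2.
      destruct (partition01_pair (T n) r r') as [Hr [Hr' [Hrr' Hm]]]; auto; [apply HT|].
      apply cell_estimate; try lra. intros s t Hs Ht.
      apply Hxu; unfold in01 in *; try lra. apply Rabs_lt_between. lra. }
    assert (C1 := Hma qa ltac:(lra) ltac:(apply Rabs_lt_between; lra)).
    assert (C2 := Hmb qb ltac:(lra) ltac:(apply Rabs_lt_between; lra)).
    unfold K4. apply Rabs_le_between in HN1. apply Rabs_le_between in HN2'.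
    apply Rabs_lt_between in C1. apply Rabs_lt_between in C2. apply Rabs_le. lra. }
  intros a b Ha Hab Hb. destruct (Rle_lt_or_eq_dec b j2 Hb) as [Hb'|Hb']; [now apply Hlt|].
  destruct (Rle_lt_or_eq_dec a b Hab) as [Hab'|Hab'].
  - apply c_extend; try lra.
    + unfold K4. lra.
    + intros t Ht eps He. destruct (m_cont t ltac:(lra) eps He) as [d [Hd H]].
      exists d; split; auto. intros s Hs. apply H. lra.
    + intros t Ht. apply Hlt; lra.
  - subst. rewrite !Rminus_diag, Rabs_R0, Rmult_0_r. lra.
Qed.

(** By [H3], the increment of [c] is controlled by that of [p] at frozen time and space, hence by
    the increment of [m], a change of time and the quadratic error in the slice at [s]. Away from
    bad times the constant of this error is still not uniform, so [sard] is required once more. *)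
Lemma c_lip_chart : exists L, 0 <= L /\ lip_on j1 j2 L.
Proof.
  assert (HKd := Kd_nonneg). assert (HKm := Km_pos).
  assert (HK4 : 0 <= K4) by (unfold K4, Kc, Kx; lra).
  set (L := (K4 + 2 * K) / k1).
  assert (HL : 0 <= L) by (unfold L; apply Rdiv_le_0_compat; lra).
  exists (2 * L). split; [lra|]. intros a b Ha Hab Hb.
  apply (sard c x al a b L X Hab HL).
  - apply cont01_on; auto; lra.
  - intros t Ht. apply HX. apply j_in01. lra.
  - intros s t Hs Hst Ht. apply al_incr; lra.
  - intros s Hs.
    destruct (slice_critical s ltac:(lra)) as [N' [r [HN' [Hr HNr]]]].
    assert (HP0 : 0 <= P) by (eapply Rle_trans; [apply Rabs_pos | apply (HP s); apply j_in01; lra]).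
    assert (HBr : 0 <= 2 * P / r ^ 2) by (apply Rdiv_le_0_compat; [lra|apply pow_lt; auto]).
    assert (HNk : 0 < (N' + K) / k1) by (apply Rdiv_lt_0_compat; lra).
    exists ((N' + K) / k1 + 2 * P / r ^ 2). split; [lra|]. intros s' Hs'.
    assert (Hs1 : in01 s) by (apply j_in01; lra). assert (Hs1' : in01 s') by (apply j_in01; lra).
    assert (Hsq : 0 <= (x s' - x s) ^ 2) by apply pow2_ge_0.
    destruct (Rlt_le_dec (Rabs (x s' - x s)) r) as [Hlt|Hge].
    + assert (B1 := al_abs s s' K4 m HK4 ltac:(lra) ltac:(lra) m_lip_all).
      assert (B2 := HNr (x s') (Hxj s' ltac:(lra)) Hlt).
      assert (B3 := H2 s (c s) (x s) (x s') Hs1 (HP _ Hs1) (HX _ Hs1) (HX _ Hs1')).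
      fold (eta s) in B3.
      assert (B4 := fA_al s s' (x s') ltac:(lra) ltac:(lra) (Hxj s' ltac:(lra))).
      assert (B5 := H1 s s' (c s') (c s') (x s') Hs1 Hs1' (HP _ Hs1') (HP _ Hs1') (HX _ Hs1')).
      rewrite (Rminus_diag (c s')), Rabs_R0, Rplus_0_r in B5.
      assert (B6 := time_al s s' ltac:(lra) ltac:(lra)).
      assert (B7 : K * Rabs (s' - s) <= K * Rabs (al s' - al s)) by (apply Rmult_le_compat_l; lra).
      assert (B8 := H3 s (c s) (c s') (x s') Hs1 (HP _ Hs1) (HP _ Hs1') (HX _ Hs1')).
      assert (B9 : Rabs (p s (c s') (x s') - p s (c s) (x s')) <=
        (K4 + 2 * K) * Rabs (al s' - al s) + (N' + K) * (x s' - x s) ^ 2).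
      { unfold m, z in B1. apply Rabs_le_between in B1. apply Rabs_le_between in B2.
        apply Rabs_le_between in B3. apply Rabs_le_between in B4. apply Rabs_le_between in B5.
        apply Rabs_le. lra. }
      assert (B10 : 0 <= 2 * P / r ^ 2 * (x s' - x s) ^ 2) by (apply Rmult_le_pos; auto).
      apply Rle_trans with (L * Rabs (al s' - al s) + (N' + K) / k1 * (x s' - x s) ^ 2); [|lra].
      apply Rmult_le_reg_l with k1; auto. unfold L.
      replace (k1 * ((K4 + 2 * K) / k1 * Rabs (al s' - al s) + (N' + K) / k1 * (x s' - x s) ^ 2))
        with ((K4 + 2 * K) * Rabs (al s' - al s) + (N' + K) * (x s' - x s) ^ 2) by (field; lra).
      lra.
    + assert (Hcb : Rabs (c s' - c s) <= 2 * P).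
      { assert (U := HP s Hs1). assert (V := HP s' Hs1'). apply Rabs_le_between in U.
        apply Rabs_le_between in V. apply Rabs_le. lra. }
      assert (B1 := square_absorb (2 * P) r (x s' - x s) (c s' - c s) ltac:(lra) Hr Hge Hcb).
      assert (0 <= (N' + K) / k1 * (x s' - x s) ^ 2) by (apply Rmult_le_pos; lra).
      assert (0 <= L * Rabs (al s' - al s)) by (apply Rmult_le_pos; auto; apply Rabs_pos). lra.
Qed.

End Chart.

(* Baire's theorem on the closed set [S] of bad times yields a portion of [S] with
   a uniform slice-wise Lipschitz constant, hence a good time in [S]. *)
Theorem c_lipschitz :
  (forall t1, in01 t1 -> exists d, 0 < d /\ chart x eta al K t1 d) ->
  exists L, 0 <= L /\ lip_on 0 1 L.
Proof.
  intros Hchart. exists K0. split; [left; apply K0_pos|].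
  apply lip_of_loc; try lra. intros t1 Ht1. apply NNPP; intros Hbad.
  destruct (Hchart t1 Ht1) as [d [Hd [x0 [rho [fA [F [Hrho [Hpt Htime]]]]]]]].
  (* One index bounds both the Lipschitz constant and the inverse of the radius on which it
     holds. *)
  set (E := fun n s => forall xi xi',
     Rabs (xi - x0) < rho -> Rabs (xi' - x0) < rho ->
     Rabs (xi - x s) < / INR (n + 1) -> Rabs (xi' - x s) < / INR (n + 1) ->
     Rabs (F s xi' - F s xi) <= INR n * Rabs (xi' - xi)).
  assert (Hport : exists n u v, t1 - d < u /\ v < t1 + d /\ (exists s, S s /\ u < s < v) /\
    forall s, S s -> u < s < v -> E n s).
  { apply NNPP; intros Hno.
    destruct (baire S E (t1 - d / 2) (t1 + d / 2) S_closed) as [s [HSs [Hs HE]]].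
    - exists t1. split; [split; auto | lra].
    (* [E n] is closed in [S], since [F] is continuous in time at fixed [xi] and [x] is continuous.
       If it met every smaller window around a point of [S], it would hold on the whole portion,
       against [Hno]. *)
    - intros n u v Hu Hv Hne. apply NNPP; intros Hcon.
      apply Hno. exists n, u, v. split; [lra|]. split; [lra|]. split; auto.
      intros s HSs Hs xi xi' Hxi Hxi' Hxs Hxs'.
      assert (Hs1 : in01 s) by apply HSs.
      assert (Hsd : Rabs (s - t1) < d) by (apply Rabs_lt_between; lra).
      destruct (Hpt s Hs1 Hsd) as [_ [_ [_ [_ [HFc _]]]]].
      apply le_epsilon. intros e He.
      destruct (HFc xi Hxi (e / 2)) as [e1 [He1 B1]]; [lra|].
      destruct (HFc xi' Hxi' (e / 2)) as [e2 [He2 B2]]; [lra|].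
      (* The strict radius condition at [s] leaves this margin, so it still holds at the nearby time
         [s']. *)
      set (gap := / INR (n + 1) - Rmax (Rabs (xi - x s)) (Rabs (xi' - x s))).
      assert (Hgap : 0 < gap) by (unfold gap; revert Hxs Hxs'; apply Rmax_case; lra).
      destruct (Hx s Hs1 gap Hgap) as [e3 [He3 B3]].
      set (e4 := Rmin (Rmin e1 e2) (Rmin e3 (Rmin (s - u) (v - s)))).
      assert (He4 : 0 < e4) by (unfold e4; repeat apply Rmin_pos; auto; lra).
      assert (Hle : e4 <= e1 /\ e4 <= e2 /\ e4 <= e3 /\ e4 <= s - u /\ e4 <= v - s).
      { unfold e4. pose proof (Rmin_l (Rmin e1 e2) (Rmin e3 (Rmin (s - u) (v - s)))).
        pose proof (Rmin_r (Rmin e1 e2) (Rmin e3 (Rmin (s - u) (v - s)))).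
        pose proof (Rmin_l e1 e2). pose proof (Rmin_r e1 e2).
        pose proof (Rmin_l e3 (Rmin (s - u) (v - s))). pose proof (Rmin_r e3 (Rmin (s - u) (v - s))).
        pose proof (Rmin_l (s - u) (v - s)). pose proof (Rmin_r (s - u) (v - s)). lra. }
      assert (Hex : exists s', S s' /\ s - e4 / 2 <= s' <= s + e4 / 2 /\ E n s').
      { apply NNPP; intros Hn. apply Hcon. exists (s - e4 / 2), (s + e4 / 2).
        split; [lra|]. split; [lra|]. split; [exists s; split; auto; lra|].
        intros s' HS' Hs' HE'. apply Hn. exists s'. auto. }
      destruct Hex as [s' [HS' [Hs' HE']]].
      assert (Hs1' : in01 s') by apply HS'.
      assert (Hss : Rabs (s' - s) < e4) by (apply Rabs_lt_between; lra).
      specialize (B1 s' Hs1' ltac:(lra)). specialize (B2 s' Hs1' ltac:(lra)).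
      specialize (B3 s' Hs1' ltac:(lra)).
      assert (Hnear : forall y, Rabs (y - x s) <= Rmax (Rabs (xi - x s)) (Rabs (xi' - x s)) ->
         Rabs (y - x s') < / INR (n + 1)).
      { intros y Hy. replace (y - x s') with ((y - x s) + - (x s' - x s)) by ring.
        eapply Rle_lt_trans; [apply Rabs_triang|]. rewrite Rabs_Ropp. unfold gap in B3. lra. }
      assert (B4 := HE' xi xi' Hxi Hxi' (Hnear xi (Rmax_l _ _)) (Hnear xi' (Rmax_r _ _))).
      apply Rabs_lt_between in B1. apply Rabs_lt_between in B2. apply Rabs_le_between in B4.
      apply Rabs_le. lra.
    - assert (Hs1 : in01 s) by apply HSs.
      assert (Hsd : Rabs (s - t1) < d) by (apply Rabs_lt_between; lra).
      destruct (Hpt s Hs1 Hsd) as [_ [_ [_ [_ [_ [_ [N [r [HN [Hr H]]]]]]]]]].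
      destruct (INR_unbounded N) as [n1 Hn1]. destruct (archimed_cor1 r Hr) as [n2 [Hn2 Hn2']].
      apply (HE (n1 + n2)%nat). intros xi xi' Hxi Hxi' Hxs Hxs'.
      assert (Hri : / INR (n1 + n2 + 1) <= / INR n2).
      { apply Rinv_le_contravar; [now apply lt_0_INR | apply le_INR; lia]. }
      eapply Rle_trans; [apply H; auto; lra|].
      apply Rmult_le_compat_r; [apply Rabs_pos|]. rewrite plus_INR. pose proof (pos_INR n2). lra. }
  destruct Hport as [n [u [v [Hu [Hv [[s0 [HS0 Hs0]] HE]]]]]].
  set (e := Rmin (s0 - u) (v - s0) / 2).
  assert (He : 0 < e) by (unfold e; assert (0 < Rmin (s0 - u) (v - s0)) by (apply Rmin_pos; lra); lra).
  assert (Hue : u < s0 - e /\ s0 + e < v).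
  { unfold e. pose proof (Rmin_l (s0 - u) (v - s0)). pose proof (Rmin_r (s0 - u) (v - s0)).
    assert (0 < Rmin (s0 - u) (v - s0)) by (apply Rmin_pos; lra). lra. }
  destruct HS0 as [Hs01 Hns0].
  set (j1 := Rmax 0 (s0 - e)). set (j2 := Rmin 1 (s0 + e)).
  assert (Hj : 0 <= j1 /\ j1 < j2 /\ j2 <= 1 /\ s0 - e <= j1 /\ j2 <= s0 + e).
  { unfold j1, j2, in01 in *. unfold Rmax, Rmin. repeat destruct Rle_dec; lra. }
  assert (Hjd : forall s, j1 <= s <= j2 -> in01 s /\ Rabs (s - t1) < d).
  { intros s Hs. split; [unfold in01; lra | apply Rabs_lt_between; lra]. }
  destruct (c_lip_chart j1 j2 x0 rho fA F) with (N := INR n + 1) (r0 := / INR (n + 1)) as [L [HL Hlip]].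
  - lra.
  - intros s Hs. destruct (Hjd s Hs). now apply Hpt.
  - intros s s' xi Hs Hss Hs' Hxi. destruct (Hjd s ltac:(lra)). destruct (Hjd s' ltac:(lra)).
    now apply Htime.
  - intros s xi Hs Hxi. destruct (Hjd s Hs). now apply Hpt.
  - intros s Hs. destruct (Hjd s Hs). now apply Hpt.
  - intros s Hs. destruct (Hjd s Hs). now apply Hpt.
  - intros s Hs eps Heps. destruct (Hjd s Hs) as [Hs1 Hs2].
    destruct (Hpt s Hs1 Hs2) as [_ [_ [_ [_ [_ [Hfc _]]]]]].
    destruct (Hfc eps Heps) as [e' [He' H]]. exists e'. split; auto. intros s' Hs'.
    apply H. now apply Hjd.
  - intros s Hs. destruct (Hjd s Hs). now apply Hpt.
  - pose proof (pos_INR n). lra.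
  - apply Rinv_0_lt_compat, lt_0_INR. lia.
  - intros s xi xi' HSs Hs Hxi Hxi' Hxs Hxs'.
    eapply Rle_trans; [apply (HE s HSs); auto; lra|].
    apply Rmult_le_compat_r; [apply Rabs_pos | lra].
  - apply Hns0. exists e, L. split; auto. split; auto. intros s w Hs Hw Hsw Hse Hwe.
    apply Rabs_lt_between in Hse. apply Rabs_lt_between in Hwe.
    apply Hlip; auto; unfold j1, j2, in01 in *; unfold Rmax, Rmin; repeat destruct Rle_dec; lra.
Qed.

End Regularity.

(** * Charts of admissible integrands *)

Lemma ordinal_list n : exists l : list (fintype.ordinal n), forall i, In i l.
Proof.
  exists (fintype.ord_enum n). intros i. assert (H := fintype.mem_ord_enum i). revert H.
  induction (fintype.ord_enum n) as [|j l IH]; [discriminate|].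
  rewrite seq.in_cons. destruct (eqtype.eqP (x := i) (y := j)) as [->|Hne]; [now left|].
  simpl. intros H. right. now apply IH.
Qed.

Lemma vupd_same n (a : fintype.ordinal n -> R) i h : vupd a i h i = h.
Proof. unfold vupd. now rewrite eqtype.eqxx. Qed.

Lemma vupd_other n (a : fintype.ordinal n -> R) i j h : j <> i -> vupd a i h j = a j.
Proof. unfold vupd. now destruct (eqtype.eqP (x := j) (y := i)). Qed.

Lemma vupd_vupd n (a : fintype.ordinal n -> R) i h h' : vupd (vupd a i h) i h' = vupd a i h'.
Proof.
  apply functional_extensionality. intros j. unfold vupd.
  now destruct (eqtype.eqP (x := j) (y := i)).
Qed.

Lemma vupd_id n (a : fintype.ordinal n -> R) i : vupd a i (a i) = a.
Proof.
  apply functional_extensionality. intros j. unfold vupd.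
  now destruct (eqtype.eqP (x := j) (y := i)) as [->|].
Qed.

Lemma list_radius {I : Type} (l : list I) (Q : I -> R -> Prop) :
  (forall i d d', Q i d -> 0 < d' <= d -> Q i d') -> (forall i, exists d, 0 < d /\ Q i d) ->
  exists d, 0 < d /\ forall i, In i l -> Q i d.
Proof.
  intros Hm H. induction l as [|i l [d [Hd IH]]].
  - exists 1. split; [lra|]. simpl. tauto.
  - destruct (H i) as [d' [Hd' HQ]]. exists (Rmin d d'). split; [now apply Rmin_pos|].
    intros j [<-|Hj].
    + apply Hm with d'; auto. split; [now apply Rmin_pos | apply Rmin_r].
    + apply Hm with d; auto. split; [now apply Rmin_pos | apply Rmin_l].
Qed.

Definition list_sum {I : Type} (h : I -> R) (l : list I) : R :=
  fold_right (fun i acc => h i + acc) 0 l.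

Lemma list_sum_le {I : Type} (h k : I -> R) (l : list I) :
  (forall i, In i l -> h i <= k i) -> list_sum h l <= list_sum k l.
Proof.
  induction l as [|i l IH]; simpl; intros H; [lra|].
  apply Rplus_le_compat; [apply H; auto | apply IH; auto].
Qed.

Lemma list_sum_minus {I : Type} (h k : I -> R) (l : list I) :
  list_sum (fun i => h i - k i) l = list_sum h l - list_sum k l.
Proof. induction l as [|i l IH]; simpl; [lra | rewrite IH; lra]. Qed.

Lemma list_sum_elem {I : Type} (h : I -> R) (l : list I) : (forall i, 0 <= h i) ->
  forall i, In i l -> h i <= list_sum h l.
Proof.
  intros Hp. assert (H0 : forall l, 0 <= list_sum h l).
  { induction l0; simpl; [lra|]. specialize (Hp a). lra. }
  induction l as [|j l IH]; simpl; [tauto|]. intros i [->|Hi].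
  - specialize (H0 l). lra.
  - specialize (IH i Hi). specialize (Hp j). lra.
Qed.

Lemma list_sum_control {I : Type} (al : I -> R -> R) (l : list I) :
  (forall i, incr_on 0 1 (al i)) -> (forall i, rcont01 (al i)) ->
  incr_on 0 1 (fun t => list_sum (fun i => al i t) l) /\
  rcont01 (fun t => list_sum (fun i => al i t) l).
Proof.
  intros Hi Hr. split.
  - intros s t Hs Hst Ht. apply list_sum_le. intros i _. now apply Hi.
  - intros t Ht. induction l as [|i l IH]; simpl; intros eps He.
    + exists 1. split; [lra|]. intros. lra.
    + destruct (IH (eps / 2)) as [d [Hd H]]; [lra|].
      destruct (Hr i t Ht (eps / 2)) as [d' [Hd' H']]; [lra|].
      exists (Rmin d d'). split; [now apply Rmin_pos|]. intros s Hs Hst.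
      assert (A := H s Hs ltac:(eapply Rlt_le_trans; [apply Hst | apply Rmin_l])).
      assert (B := H' s Hs ltac:(eapply Rlt_le_trans; [apply Hst | apply Rmin_r])). lra.
Qed.

Section Admissible.

Variables (n : nat) (A : R -> fintype.ordinal n -> R) (U : vpt n -> Prop) (f : vpt n -> R).
Variables (l : list (fintype.ordinal n)).
Hypothesis Hl : forall i, In i l.
Hypothesis HU : vopen U.
Hypothesis Hf : vC1 U f.
Hypothesis Hf2 : forall a : fintype.ordinal n -> R, (exists xi, U (a, xi)) ->
  C2_1 (fun xi => U (a, xi)) (fun xi => f (a, xi)).

(** The coordinates in [l'] are changed one at a time, each change being a mean value in a single
    variable inside the ball; functions that agree outside the empty list are equal. *)
Lemma coordinate_lip (q : vpt n) (d M : R) : 0 <= M ->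
  (forall q', vball q d q' -> U q' /\ forall i, Rabs (vpd f i q') <= M) ->
  forall xi, Rabs (xi - snd q) < d ->
  forall (l' : list (fintype.ordinal n)) a a',
  (forall i, Rabs (a i - fst q i) < d) -> (forall i, Rabs (a' i - fst q i) < d) ->
  (forall i, ~ In i l' -> a i = a' i) ->
  Rabs (f (a', xi) - f (a, xi)) <= M * list_sum (fun i => Rabs (a' i - a i)) l'.
Proof.
  intros HM Hball xi Hxi. induction l' as [|i l' IH]; intros a a' Ha Ha' Hag; simpl.
  - assert (E : a = a') by (apply functional_extensionality; intros j; apply Hag; auto).
    rewrite E, Rminus_diag, Rabs_R0. lra.
  - set (b := vupd a i (a' i)).
    assert (Hb : forall j, Rabs (b j - fst q j) < d).
    { intros j. unfold b. destruct (classic (j = i)) as [->|Hne].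
      - rewrite vupd_same. auto.
      - rewrite vupd_other by auto. auto. }
    assert (B1 : Rabs (f (a', xi) - f (b, xi)) <= M * list_sum (fun j => Rabs (a' j - b j)) l').
    { apply IH; auto. intros j Hj. unfold b. destruct (classic (j = i)) as [->|Hne].
      - now rewrite vupd_same.
      - rewrite vupd_other by auto. apply Hag. intros [E|E]; [now apply Hne | auto]. }
    assert (B2 : list_sum (fun j => Rabs (a' j - b j)) l' <= list_sum (fun j => Rabs (a' j - a j)) l').
    { apply list_sum_le. intros j _. unfold b. destruct (classic (j = i)) as [->|Hne].
      - rewrite vupd_same, Rminus_diag, Rabs_R0. apply Rabs_pos.
      - rewrite vupd_other by auto. lra. }
    assert (B3 : Rabs (f (b, xi) - f (a, xi)) <= M * Rabs (a' i - a i)).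
    { assert (Hin : forall h, Rmin (a i) (a' i) <= h <= Rmax (a i) (a' i) -> vball q d (vupd a i h, xi)).
      { intros h Hh. split; simpl; auto. intros j. destruct (classic (j = i)) as [->|Hne].
        - rewrite vupd_same. apply (Rabs_between_dist h (a i) (a' i)); auto.
        - rewrite vupd_other by auto. auto. }
      assert (Hfun : forall h, (fun h' => f (vupd (fst (vupd a i h, xi)) i h', snd (vupd a i h, xi)))
        = (fun h' => f (vupd a i h', xi))).
      { intros h. apply functional_extensionality. intros h'. simpl. now rewrite vupd_vupd. }
      destruct (mean_value (fun h => f (vupd a i h, xi)) (fun h => vpd f i (vupd a i h, xi)) (a i) (a' i))
        as [h [Hh E]].
      { intros h Hh. destruct (Hball _ (Hin h Hh)) as [HUh _]. destruct (Hf _ HUh) as [Hex _].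
        specialize (Hex i). rewrite Hfun in Hex. simpl in Hex. rewrite vupd_same in Hex.
        unfold vpd. rewrite Hfun. simpl. rewrite vupd_same. now apply Derive_correct. }
      simpl in E. rewrite vupd_id in E. unfold b. rewrite E, Rabs_mult.
      apply Rmult_le_compat_r; [apply Rabs_pos|]. now apply Hball, Hin. }
    assert (B4 : M * list_sum (fun j => Rabs (a' j - b j)) l' <= M * list_sum (fun j => Rabs (a' j - a j)) l')
      by now apply Rmult_le_compat_l.
    replace (f (a', xi) - f (a, xi)) with ((f (a', xi) - f (b, xi)) + (f (b, xi) - f (a, xi))) by ring.
    eapply Rle_trans; [apply Rabs_triang|]. lra.
Qed.

Variables (x eta al : R -> R) (ali : fintype.ordinal n -> R -> R).
Hypothesis Hx : cont01 x.
Hypothesis HA : forall i, cont01 (fun t => A t i).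
Hypothesis HAx : forall t, in01 t -> U (A t, x t).
Hypothesis Heta : forall t, in01 t -> eta t = vpdxi f (A t, x t).
Hypothesis Hdom : forall i, dominates (ali i) (fun t => A t i).
Hypothesis Hal : forall s t, 0 <= s -> s <= t -> t <= 1 ->
  list_sum (fun i => ali i t - ali i s) l <= al t - al s.

Lemma A_near t e : in01 t -> 0 < e -> exists d, 0 < d /\ forall s, in01 s -> Rabs (s - t) < d ->
  (forall i, Rabs (A s i - A t i) < e) /\ Rabs (x s - x t) < e.
Proof.
  intros Ht He.
  destruct (list_radius l (fun i d => forall s, in01 s -> Rabs (s - t) < d -> Rabs (A s i - A t i) < e))
    as [d [Hd H]].
  - intros i d d' H Hd s Hs Hst. apply H; auto. lra.
  - intros i. apply (HA i t Ht e He).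
  - destruct (Hx t Ht e He) as [d' [Hd' H']]. exists (Rmin d d'). split; [now apply Rmin_pos|].
    intros s Hs Hst. pose proof (Rmin_l d d'). pose proof (Rmin_r d d'). split.
    + intros i. apply H; auto. lra.
    + apply H'; auto. lra.
Qed.

(** Joint C^1 regularity near [(A t1, x t1)] gives the uniform data of the chart; the C^2 slices
    give only a Lipschitz constant near [x s] that depends on [s]. Larger constants and smaller
    radii are included for the sake of the compactness argument that follows. *)
Lemma admissible_local_chart t1 : in01 t1 -> exists K d, 0 < K /\ 0 < d /\
  forall K' d', K <= K' -> 0 < d' <= d -> chart x eta al K' t1 d'.
Proof.
  intros Ht1. set (q := (A t1, x t1)).
  destruct (Hf q (HAx t1 Ht1)) as [_ [_ [C0 [C1 _]]]].
  destruct (HU q (HAx t1 Ht1)) as [d0 [Hd0 HU0]].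
  destruct (C0 1 Rlt_0_1) as [d1 [Hd1 B1]].
  assert (Hmono : forall d d' q', d' <= d -> vball q d' q' -> vball q d q').
  { intros d d' q' Hd [V1 V2]. split; [intros i; specialize (V1 i); lra | lra]. }
  destruct (list_radius l (fun i d => forall q', vball q d q' -> Rabs (vpd f i q' - vpd f i q) < 1))
    as [d2 [Hd2 B2]].
  { intros i d d' H Hd q' Hq'. apply H. apply Hmono with d'; auto; lra. }
  { intros i. apply (C1 i 1 Rlt_0_1). }
  set (rho := Rmin d0 (Rmin d1 d2)).
  assert (Hrho : 0 < rho) by (unfold rho; repeat apply Rmin_pos; auto).
  assert (Hle : rho <= d0 /\ rho <= d1 /\ rho <= d2).
  { unfold rho. pose proof (Rmin_l d0 (Rmin d1 d2)). pose proof (Rmin_r d0 (Rmin d1 d2)).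
    pose proof (Rmin_l d1 d2). pose proof (Rmin_r d1 d2). lra. }
  (* A single bound for all parameter derivatives on the ball: each varies there by less than 1. *)
  set (M := list_sum (fun i => Rabs (vpd f i q)) l + 1).
  assert (HM : forall i, Rabs (vpd f i q) + 1 <= M).
  { intros i. unfold M. apply Rplus_le_compat_r.
    apply (list_sum_elem (fun i => Rabs (vpd f i q))); auto. intros; apply Rabs_pos. }
  assert (HM0 : 0 <= M).
  { unfold M. assert (0 <= list_sum (fun i => Rabs (vpd f i q)) l); [|lra].
    clear. induction l; simpl; [lra|]. pose proof (Rabs_pos (vpd f a q)). lra. }
  assert (Hball : forall q', vball q rho q' -> U q' /\ forall i, Rabs (vpd f i q') <= M).
  { intros q' Hq'. split; [apply HU0, Hmono with rho; auto; lra|].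
    intros i. assert (B := B2 i (Hl i) q' (Hmono d2 rho q' ltac:(lra) Hq')).
    specialize (HM i). replace (vpd f i q') with ((vpd f i q' - vpd f i q) + vpd f i q) by ring.
    eapply Rle_trans; [apply Rabs_triang|]. lra. }
  destruct (A_near t1 rho Ht1 Hrho) as [d3 [Hd3 B3]].
  exists (M + Rabs (f q) + 1), d3. split; [pose proof (Rabs_pos (f q)); lra|]. split; auto.
  intros K' d' HK' Hd'. pose proof (Rabs_pos (f q)).
  exists (x t1), rho, (fun s xi => f (A s, xi)), (fun s xi => vpdxi f (A s, xi)).
  split; auto. split.
  - intros s Hs Hst. destruct (B3 s Hs ltac:(lra)) as [HAs Hxs].
    assert (HUs : forall xi, Rabs (xi - x t1) < rho -> U (A s, xi)).
    { intros xi Hxi. apply Hball. split; simpl; auto. }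
    split; [auto|]. split; [symmetry; auto|]. split; [|split; [|split; [|split]]].
    + assert (B : Rabs (f (A s, x s) - f q) < 1).
      { apply B1. apply Hmono with rho; [lra|]. split; simpl; auto. }
      replace (f (A s, x s)) with ((f (A s, x s) - f q) + f q) by ring.
      eapply Rle_trans; [apply Rabs_triang|]. lra.
    + intros xi Hxi. destruct (Hf _ (HUs xi Hxi)) as [_ [Hex _]]. now apply Derive_correct.
    + intros xi Hxi eps He. destruct (Hf _ (HUs xi Hxi)) as [_ [_ [_ [_ Hc]]]].
      destruct (Hc eps He) as [e [He' B]]. destruct (A_near s e Hs He') as [d [Hd B']].
      exists d. split; auto. intros s' Hs' Hss. apply B. split; simpl; [now apply B'|].
      now rewrite Rminus_diag, Rabs_R0.
    + intros eps He. destruct (Hf _ (HAx s Hs)) as [_ [_ [Hc _]]].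
      destruct (Hc eps He) as [e [He' B]]. destruct (A_near s e Hs He') as [d [Hd B']].
      exists d. split; auto. intros s' Hs' Hss. apply B. split; simpl; now apply B'.
    + assert (HC2 := Hf2 (A s) (ex_intro _ (x s) (HAx s Hs))).
      destruct (HC2 (x s) (HAx s Hs)) as [_ [_ Hcc]].
      apply continuity_pt_filterlim in Hcc. destruct (Hcc 1 Rlt_0_1) as [r [Hr B]].
      set (D2 := Derive (Derive (fun xi => f (A s, xi)))) in *.
      exists (Rabs (D2 (x s)) + 1), r. split; [pose proof (Rabs_pos (D2 (x s))); lra|]. split; auto.
      intros xi xi' Hxi Hxi' Hr1 Hr2.
      destruct (mean_value (Derive (fun xi => f (A s, xi))) D2 xi xi') as [y [Hy E]].
      { intros u Hu. apply Derive_correct. apply HC2. apply HUs.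
        apply (Rabs_between_dist u xi xi'); auto. }
      change (vpdxi f (A s, xi') - vpdxi f (A s, xi)) with
        (Derive (fun xi => f (A s, xi)) xi' - Derive (fun xi => f (A s, xi)) xi).
      rewrite E, Rabs_mult. apply Rmult_le_compat_r; [apply Rabs_pos|].
      assert (Hyr := Rabs_between_dist y xi xi' (x s) r Hy Hr1 Hr2).
      destruct (Req_dec y (x s)) as [->|Hne]; [lra|].
      assert (B' : Rabs (D2 y - D2 (x s)) < 1).
      { apply B. split; [split; [exact I | auto]|exact Hyr]. }
      replace (D2 y) with ((D2 y - D2 (x s)) + D2 (x s)) by ring.
      eapply Rle_trans; [apply Rabs_triang|]. lra.
  - intros s s' xi Hs Hs' Hst Hst' Hss Hxi.
    destruct (B3 s Hs ltac:(lra)) as [HAs _]. destruct (B3 s' Hs' ltac:(lra)) as [HAs' _].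
    assert (B := coordinate_lip q rho M HM0 Hball xi Hxi l (A s) (A s') HAs HAs'
      ltac:(intros i Hi; exfalso; apply Hi; auto)).
    eapply Rle_trans; [apply B|].
    assert (B' : list_sum (fun i => Rabs (A s' i - A s i)) l <= al s' - al s).
    { apply Rle_trans with (list_sum (fun i => ali i s' - ali i s) l).
      - apply list_sum_le. intros i _. apply Hdom; unfold in01 in *; lra.
      - apply Hal; unfold in01 in *; lra. }
    apply Rmult_le_compat; try lra.
    clear. induction l; simpl; [lra|]. pose proof (Rabs_pos (A s' a - A s a)). lra.
Qed.

Lemma admissible_charts : exists K d, 0 < K /\ 0 < d /\
  forall K' t1, K <= K' -> in01 t1 -> chart x eta al K' t1 d.
Proof.
  (* Through [/ d <= K'] the scale also limits the constant, so one compactness argument makes both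
     the radius and the constant uniform. *)
  destruct (tube 0 1 (fun t _ d => forall K', / d <= K' -> chart x eta al K' t d)) as [d [Hd H]].
  - intros t _ d d' H Hd K' HK'.
    assert (Hi : / d <= / d') by (apply Rinv_le_contravar; lra).
    destruct (H K' ltac:(lra)) as [x0 [rho [fA [F [Hrho [Hp Ht]]]]]].
    exists x0, rho, fA, F. split; auto. split.
    + intros s Hs Hst. apply Hp; auto. lra.
    + intros s s' xi Hs Hs' H1 H2. apply Ht; auto; lra.
  - intros t1 Ht1. destruct (admissible_local_chart t1 Ht1) as [K [d [HK [Hd H]]]].
    assert (HiK := Rinv_0_lt_compat K HK).
    exists (Rmin (d / 2) (/ K)). split; [apply Rmin_pos; lra|].
    intros u v Hu _ Hut _ K' HK'.
    pose proof (Rmin_l (d / 2) (/ K)). pose proof (Rmin_r (d / 2) (/ K)).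
    assert (Hpos : 0 < Rmin (d / 2) (/ K)) by (apply Rmin_pos; lra).
    set (e := Rmin (d / 2) (/ K)) in *.
    assert (HKK : K <= K').
    { apply Rle_trans with (/ e); auto. rewrite <- (Rinv_inv K). apply Rinv_le_contravar; auto. }
    destruct (H K' d HKK ltac:(lra)) as [x0 [rho [fA [F [Hrho [Hp Ht]]]]]].
    assert (Htri : forall s, Rabs (s - u) < e -> Rabs (s - t1) < d).
    { intros s Hs. apply Rabs_lt_between in Hs. apply Rabs_lt_between in Hut. apply Rabs_lt_between. lra. }
    exists x0, rho, fA, F. split; auto.
  - exists (/ d), d. split; [now apply Rinv_0_lt_compat|]. split; auto.
    intros K' t1 HK' Ht1. apply (H t1 t1); auto. now rewrite Rminus_diag, Rabs_R0.
Qed.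

End Admissible.

(** * Stieltjes integral equations with locally Lipschitz coefficients *)

Definition clamp (P u : R) : R := Rmax (- P) (Rmin P u).

Lemma clamp_bound P u : 0 <= P -> Rabs (clamp P u) <= P.
Proof. intros HP. apply Rabs_le. unfold clamp, Rmax, Rmin. repeat destruct Rle_dec; lra. Qed.

Lemma clamp_le P u : 0 <= P -> Rabs (clamp P u) <= Rabs u.
Proof.
  intros HP. apply Rabs_le. pose proof (Rle_abs u). pose proof (Rabs_maj2 u).
  unfold clamp, Rmax, Rmin. repeat destruct Rle_dec; lra.
Qed.

Lemma clamp_lip P u v : Rabs (clamp P u - clamp P v) <= Rabs (u - v).
Proof.
  apply Rabs_le. pose proof (Rle_abs (u - v)). pose proof (Rabs_maj2 (u - v)).
  unfold clamp, Rmax, Rmin. repeat destruct Rle_dec; lra.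
Qed.

Lemma clamp_id P u : Rabs u <= P -> clamp P u = u.
Proof.
  intros H. apply Rabs_le_between in H. unfold clamp, Rmax, Rmin. repeat destruct Rle_dec; lra.
Qed.

Lemma cont01_clamp P f : cont01 f -> cont01 (fun t => clamp P (f t)).
Proof.
  intros Hf t Ht eps He. destruct (Hf t Ht eps He) as [d [Hd H]]. exists d; split; auto.
  intros s Hs Hst. eapply Rle_lt_trans; [apply clamp_lip | auto].
Qed.

Section ThreeTerms.

Variables (g1 g2 g3 al1 al2 al3 : R -> R) (G1 G2 G3 : R -> R -> R).

Definition al123 (t : R) : R := al1 t + al2 t + al3 t.
Definition form123 (B : R -> R) (s t : R) : R :=
  G1 s (B s) * (g1 t - g1 s) + G2 s (B s) * (g2 t - g2 s) + G3 s (B s) * (g3 t - g3 s).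

Hypothesis c1 : cont01 g1.
Hypothesis c2 : cont01 g2.
Hypothesis c3 : cont01 g3.
Hypothesis d1 : dominates al1 g1.
Hypothesis d2 : dominates al2 g2.
Hypothesis d3 : dominates al3 g3.

Lemma al123_incr : incr_on 0 1 al123.
Proof.
  intros s t Hs Hst Ht. unfold al123.
  assert (al1 s <= al1 t) by (apply (dominates_incr al1 g1); auto).
  assert (al2 s <= al2 t) by (apply (dominates_incr al2 g2); auto).
  assert (al3 s <= al3 t) by (apply (dominates_incr al3 g3); auto). lra.
Qed.

Lemma al123_parts s t : 0 <= s -> s <= t -> t <= 1 ->
  0 <= al1 t - al1 s /\ 0 <= al2 t - al2 s /\ 0 <= al3 t - al3 s.
Proof.
  intros Hs Hst Ht.
  assert (al1 s <= al1 t) by (apply (dominates_incr al1 g1); auto).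
  assert (al2 s <= al2 t) by (apply (dominates_incr al2 g2); auto).
  assert (al3 s <= al3 t) by (apply (dominates_incr al3 g3); auto). lra.
Qed.

Lemma integrals123 f1 f2 f3 : cont01 f1 -> cont01 f2 -> cont01 f3 ->
  exists J1 J2 J3, J1 0 = 0 /\ J2 0 = 0 /\ J3 0 = 0 /\
   has_differential al1 (fun s t => f1 s * (g1 t - g1 s)) J1 /\
   has_differential al2 (fun s t => f2 s * (g2 t - g2 s)) J2 /\
   has_differential al3 (fun s t => f3 s * (g3 t - g3 s)) J3 /\
   has_differential al123 (fun s t => f1 s * (g1 t - g1 s) + f2 s * (g2 t - g2 s) + f3 s * (g3 t - g3 s))
     (fun t => J1 t + J2 t + J3 t).
Proof.
  intros Hf1 Hf2 Hf3.
  destruct (stieltjes_exists f1 g1 al1 Hf1 d1) as [J1 [Z1 D1]].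
  destruct (stieltjes_exists f2 g2 al2 Hf2 d2) as [J2 [Z2 D2]].
  destruct (stieltjes_exists f3 g3 al3 Hf3 d3) as [J3 [Z3 D3]].
  exists J1, J2, J3. do 6 (split; auto).
  apply (has_differential_plus al123 (fun s t => f1 s * (g1 t - g1 s) + f2 s * (g2 t - g2 s))).
  - apply has_differential_plus.
    + apply has_differential_weaken with al1; auto. intros s t Hs Hst Ht.
      destruct (al123_parts s t Hs Hst Ht). unfold al123. lra.
    + apply has_differential_weaken with al2; auto. intros s t Hs Hst Ht.
      destruct (al123_parts s t Hs Hst Ht). unfold al123. lra.
  - apply has_differential_weaken with al3; auto. intros s t Hs Hst Ht.
    destruct (al123_parts s t Hs Hst Ht). unfold al123. lra.
Qed.

Lemma form123_small f1 f2 f3 : cont01 f1 -> cont01 f2 -> cont01 f3 ->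
  forall eps, 0 < eps -> exists d, 0 < d /\ forall s t, 0 <= s -> s <= t -> t <= 1 -> t - s < d ->
    Rabs (f1 s * (g1 t - g1 s) + f2 s * (g2 t - g2 s) + f3 s * (g3 t - g3 s)) < eps.
Proof.
  intros Hf1 Hf2 Hf3 eps He.
  destruct (stieltjes_small f1 g1 Hf1 c1 (eps / 3)) as [e1 [He1 B1]]; [lra|].
  destruct (stieltjes_small f2 g2 Hf2 c2 (eps / 3)) as [e2 [He2 B2]]; [lra|].
  destruct (stieltjes_small f3 g3 Hf3 c3 (eps / 3)) as [e3 [He3 B3]]; [lra|].
  exists (Rmin e1 (Rmin e2 e3)). split; [repeat apply Rmin_pos; auto|].
  intros s t Hs Hst Ht Hd. pose proof (Rmin_l e1 (Rmin e2 e3)). pose proof (Rmin_r e1 (Rmin e2 e3)).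
  pose proof (Rmin_l e2 e3). pose proof (Rmin_r e2 e3).
  specialize (B1 s t Hs Hst Ht ltac:(lra)). specialize (B2 s t Hs Hst Ht ltac:(lra)).
  specialize (B3 s t Hs Hst Ht ltac:(lra)).
  apply Rabs_lt_between in B1. apply Rabs_lt_between in B2. apply Rabs_lt_between in B3.
  apply Rabs_lt_between. lra.
Qed.

Lemma form_bound s t h1 h2 h3 C : 0 <= s -> s <= t -> t <= 1 ->
  Rabs h1 <= C -> Rabs h2 <= C -> Rabs h3 <= C ->
  Rabs (h1 * (g1 t - g1 s) + h2 * (g2 t - g2 s) + h3 * (g3 t - g3 s)) <= C * (al123 t - al123 s).
Proof.
  intros Hs Hst Ht H1 H2 H3.
  assert (B1 := Rabs_le_prod _ _ _ _ H1 (d1 s t Hs Hst Ht)).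
  assert (B2 := Rabs_le_prod _ _ _ _ H2 (d2 s t Hs Hst Ht)).
  assert (B3 := Rabs_le_prod _ _ _ _ H3 (d3 s t Hs Hst Ht)).
  unfold al123. apply Rabs_le_between in B1. apply Rabs_le_between in B2.
  apply Rabs_le_between in B3. apply Rabs_le. lra.
Qed.

Hypothesis Gc : forall B, cont01 B -> cont01 (fun s => G1 s (B s)) /\ cont01 (fun s => G2 s (B s)) /\
  cont01 (fun s => G3 s (B s)).
Hypothesis Gl : forall P, 0 < P -> exists L, 0 < L /\ forall s u v, in01 s -> Rabs u <= P -> Rabs v <= P ->
  Rabs (G1 s u - G1 s v) <= L * Rabs (u - v) /\ Rabs (G2 s u - G2 s v) <= L * Rabs (u - v) /\
  Rabs (G3 s u - G3 s v) <= L * Rabs (u - v).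
Hypothesis Gg : exists C, 0 < C /\ forall s u, in01 s ->
  Rabs (G1 s u) <= C * (1 + Rabs u) /\ Rabs (G2 s u) <= C * (1 + Rabs u) /\
  Rabs (G3 s u) <= C * (1 + Rabs u).

(** Truncating [B] at [P] makes the coefficients globally Lipschitz. Truncation does not increase
    absolute values, so the growth bound persists and Gronwall gives [|B| <= P] with the very [P]
    chosen for the truncation, which is therefore inactive. *)
Lemma equation_exists z0 : exists B, B 0 = z0 /\ cont01 B /\ has_differential al123 (form123 B) B.
Proof.
  destruct Gg as [C [HC HCg]].
  set (P := (1 + Rabs z0) * exp (C * (al123 1 - al123 0))).
  assert (HP : 0 < P).
  { unfold P. apply Rmult_lt_0_compat; [pose proof (Rabs_pos z0); lra | apply exp_pos]. }
  destruct (Gl P HP) as [L [HL HLip]].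
  set (cl := fun (B : R -> R) s => clamp P (B s)).
  destruct (stieltjes_equation al123 (fun B => form123 (cl B)) L z0 al123_incr HL) as [B [HB0 [HBc HBd]]].
  - intros B HB. assert (Hcl : cont01 (cl B)) by now apply cont01_clamp.
    destruct (Gc _ Hcl) as [H1 [H2 H3]].
    destruct (integrals123 _ _ _ H1 H2 H3) as [J1 [J2 [J3 [Z1 [Z2 [Z3 [_ [_ [_ D]]]]]]]]].
    exists (fun t => J1 t + J2 t + J3 t). split; [lra|]. split; [|exact D].
    eapply has_differential_cont; [apply al123_incr | | exact D].
    apply form123_small; auto.
  - intros B B' s t Hs Hst Ht.
    assert (Hs1 : in01 s) by (unfold in01; lra).
    destruct (HLip s (cl B s) (cl B' s) Hs1) as [B1 [B2 B3]];
      try (apply clamp_bound; lra).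
    unfold form123.
    replace (_ - _) with ((G1 s (cl B s) - G1 s (cl B' s)) * (g1 t - g1 s)
      + (G2 s (cl B s) - G2 s (cl B' s)) * (g2 t - g2 s)
      + (G3 s (cl B s) - G3 s (cl B' s)) * (g3 t - g3 s)) by ring.
    assert (Hc := clamp_lip P (B s) (B' s)).
    assert (L * Rabs (cl B s - cl B' s) <= L * Rabs (B s - B' s)).
    { apply Rmult_le_compat_l; [lra | exact Hc]. }
    apply form_bound; auto; lra.
  - exists B. split; auto. split; auto.
    assert (Hbound : forall t, in01 t -> Rabs (B t) <= P).
    { intros t Ht. destruct Ht as [Ht0 Ht1].
      assert (Hgr := gronwall (fun t => 1 + Rabs (B t)) al123 C 0 t Ht0 ltac:(lra)).
      cbv beta in Hgr. rewrite HB0 in Hgr.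
      assert (1 + Rabs (B t) <= (1 + Rabs z0) * exp (C * (al123 t - al123 0))).
      { apply Hgr.
        - intros u v Hu Huv Hv. apply al123_incr; lra.
        - intros u _. pose proof (Rabs_pos (B u)). lra.
        - intros eps He. destruct (HBd eps He) as [d [Hd H]]. exists d; split; auto.
          intros s u Hs Hsu Hu Hd'. specialize (H s u Hs Hsu ltac:(lra) Hd').
          assert (Hs1 : in01 s) by (unfold in01; lra).
          destruct (HCg s (cl B s) Hs1) as [B1 [B2 B3]].
          assert (Hcb : Rabs (cl B s) <= Rabs (B s)) by (apply clamp_le; lra).
          assert (HCB : C * (1 + Rabs (cl B s)) <= C * (1 + Rabs (B s))) by (apply Rmult_le_compat_l; lra).
          assert (Hf : Rabs (form123 (cl B) s u) <= C * (1 + Rabs (B s)) * (al123 u - al123 s)).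
          { apply form_bound; auto; lra. }
          assert (Rabs (B u) <= Rabs (B s) + Rabs (form123 (cl B) s u) + Rabs (B u - B s - form123 (cl B) s u)).
          { replace (B u) with (B s + form123 (cl B) s u + (B u - B s - form123 (cl B) s u)) at 1 by ring.
            eapply Rle_trans; [apply Rabs_triang|]. apply Rplus_le_compat_r. apply Rabs_triang. }
          lra. }
      assert (Hm : (1 + Rabs z0) * exp (C * (al123 t - al123 0)) <= P).
      { unfold P. apply Rmult_le_compat_l; [pose proof (Rabs_pos z0); lra|]. apply exp_mono.
        apply Rmult_le_compat_l; [lra|]. assert (al123 t <= al123 1) by (apply al123_incr; lra). lra. }
      lra. }
    apply (has_differential_ext al123 (form123 (cl B)) (form123 B) B B); auto.
    intros s t Hs Hst Ht. unfold form123, cl. rewrite clamp_id; auto.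
    apply Hbound. unfold in01; lra.
Qed.

Lemma equation_unique al B B' :
  (forall s t, 0 <= s -> s <= t -> t <= 1 -> al123 t - al123 s <= al t - al s) ->
  cont01 B -> cont01 B' ->
  has_differential al (form123 B) B -> has_differential al (form123 B') B' -> B 0 = B' 0 ->
  forall t, in01 t -> B t = B' t.
Proof.
  intros Hal HBc HBc' HB HB' H0 t Ht.
  destruct (cont01_bounded B HBc) as [P1 [HP1 HPb1]].
  destruct (cont01_bounded B' HBc') as [P2 [HP2 HPb2]].
  destruct (Gl (P1 + P2)) as [L [HL HLip]]; [lra|].
  assert (Hali : incr_on 0 1 al).
  { intros u v Hu Huv Hv. specialize (Hal u v Hu Huv Hv). assert (al123 u <= al123 v) by (apply al123_incr; auto). lra. }
  assert (Hgr := gronwall (fun t => Rabs (B t - B' t)) al L 0 t (proj1 Ht) ltac:(lra)).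
  cbv beta in Hgr. rewrite H0, Rminus_diag, Rabs_R0, Rmult_0_l in Hgr.
  assert (Rabs (B t - B' t) <= 0).
  { destruct Ht as [Ht0 Ht1]. apply Hgr.
    - intros u v Hu Huv Hv. apply Hali; lra.
    - intros; apply Rabs_pos.
    - intros eps He. destruct (HB (eps / 2)) as [e1 [He1 B1]]; [lra|].
      destruct (HB' (eps / 2)) as [e2 [He2 B2]]; [lra|].
      exists (Rmin e1 e2). split; [now apply Rmin_pos|]. intros s u Hs Hsu Hu Hd.
      specialize (B1 s u Hs Hsu ltac:(lra) ltac:(eapply Rlt_le_trans; [apply Hd | apply Rmin_l])).
      specialize (B2 s u Hs Hsu ltac:(lra) ltac:(eapply Rlt_le_trans; [apply Hd | apply Rmin_r])).
      assert (Hs1 : in01 s) by (unfold in01; lra).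
      destruct (HLip s (B s) (B' s) Hs1) as [L1 [L2 L3]].
      { specialize (HPb1 s Hs1). lra. }
      { specialize (HPb2 s Hs1). lra. }
      assert (Hf : Rabs (form123 B s u - form123 B' s u) <= L * Rabs (B s - B' s) * (al123 u - al123 s)).
      { unfold form123.
        replace (_ - _) with ((G1 s (B s) - G1 s (B' s)) * (g1 u - g1 s)
          + (G2 s (B s) - G2 s (B' s)) * (g2 u - g2 s)
          + (G3 s (B s) - G3 s (B' s)) * (g3 u - g3 s)) by ring.
        apply form_bound; auto; lra. }
      assert (Hf' : L * Rabs (B s - B' s) * (al123 u - al123 s) <= L * Rabs (B s - B' s) * (al u - al s)).
      { apply Rmult_le_compat_l; [|apply Hal; lra]. apply Rmult_le_pos; [lra | apply Rabs_pos]. }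
      assert (Hd1 : Rabs ((B u - B' u) - (B s - B' s)) <= L * Rabs (B s - B' s) * (al u - al s) + eps * (al u - al s)).
      { apply Rabs_le_between in B1. apply Rabs_le_between in B2. apply Rabs_le_between in Hf.
        apply Rabs_le. lra. }
      replace (B u - B' u) with ((B s - B' s) + ((B u - B' u) - (B s - B' s))) by ring.
      eapply Rle_trans; [apply Rabs_triang|]. lra. }
  apply Rabs_le_between in H. lra.
Qed.

End ThreeTerms.

(** * Sums along the partitions *)

(** The total masses of the increments of [al] and of the squared increments of [x] stay bounded. *)
Lemma small_errors_sum T (al : R -> R) (h : R -> R -> R) x qv t :
  refining T -> quad_var T x qv -> incr_on 0 1 al -> in01 t ->
  (forall eps, 0 < eps -> exists d, 0 < d /\ forall r r', in01 r -> in01 r' -> r < r' -> r' - r < d ->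
     Rabs (h r r') <= eps * (al r' - al r) + eps * (x r' - x r) ^ 2) ->
  is_lim_seq (fun n => sum_le (T n) t h) 0.
Proof.
  intros HT [Hq _] Hal Ht Hh. apply lim_seq_eps. intros eps He.
  assert (Ha : al 0 <= al 1) by (apply Hal; lra).
  set (Q := Rabs (qv t) + 1). assert (HQ : 1 <= Q) by (unfold Q; pose proof (Rabs_pos (qv t)); lra).
  set (e := eps / (2 * (al 1 - al 0 + Q))).
  assert (He' : 0 < e) by (unfold e; apply Rdiv_lt_0_compat; lra).
  destruct (Hh e He') as [d [Hd H]].
  destruct (mesh_eventually T d HT Hd) as [N1 HN1].
  assert (L := Hq t Ht). apply lim_seq_eps with (eps := 1) in L; [|lra]. destruct L as [N2 HN2].
  exists (N1 + N2)%nat. intros n Hn. specialize (HN1 n ltac:(lia)). specialize (HN2 n ltac:(lia)).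
  rewrite Rminus_0_r. eapply Rle_lt_trans.
  - apply (sum_le_abs (T n) t h (fun r r' => e * (al r' - al r) + e * (x r' - x r) ^ 2)).
    intros r r' Hin Hr. destruct (partition01_pair (T n) r r') as [H1 [H2 [H3 H4]]]; auto; [apply HT|].
    apply H; auto. lra.
  - rewrite sum_le_lin, sum_le_scal.
    destruct (telescope (T n) t) as [q [Hq1 [_ [_ Hq2]]]]; auto; [apply HT|]. rewrite Hq2.
    assert (al q <= al 1) by (apply Hal; unfold in01 in Hq1; lra).
    set (Q1 := sum_le (T n) t (fun r r' => (x r' - x r) ^ 2)) in *.
    apply Rabs_lt_between in HN2. pose proof (Rle_abs (qv t)).
    assert (A1 : e * (al q - al 0) <= e * (al 1 - al 0)) by (apply Rmult_le_compat_l; lra).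
    assert (A2 : e * Q1 <= e * Q) by (apply Rmult_le_compat_l; unfold Q; lra).
    assert (A3 : e * (al 1 - al 0 + Q) = eps / 2) by (unfold e; field; lra). lra.
Qed.

Lemma sum_differential T al om J x qv t : refining T -> quad_var T x qv -> incr_on 0 1 al -> in01 t ->
  cont01 J -> has_differential al om J ->
  is_lim_seq (fun n => sum_le (T n) t om) (J t - J 0).
Proof.
  intros HT Hq Hal Ht HJ HD.
  assert (L := small_errors_sum T al (fun r r' => J r' - J r - om r r') x qv t HT Hq Hal Ht).
  assert (L' : is_lim_seq (fun n => sum_le (T n) t (fun r r' => J r' - J r - om r r')) 0).
  { apply L. intros eps He. destruct (HD eps He) as [d [Hd H]]. exists d; split; auto.
    intros r r' Hr Hr' Hrr' Hd'. unfold in01 in *. specialize (H r r' ltac:(lra) ltac:(lra) ltac:(lra) Hd').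
    assert (0 <= eps * (x r' - x r) ^ 2) by (apply Rmult_le_pos; [lra | apply pow2_ge_0]). lra. }
  apply is_lim_seq_ext with (fun n => sum_le (T n) t (fun r r' => J r' - J r) -
    sum_le (T n) t (fun r r' => J r' - J r - om r r')).
  - intros n. rewrite <- sum_le_minus. apply sum_le_ext. intros; ring.
  - replace (J t - J 0) with (J t - J 0 - 0) by ring.
    apply is_lim_seq_minus'; auto. now apply telescope_lim.
Qed.

Lemma has_differential_bound al om J C s t : 0 <= s -> s <= t -> t <= 1 ->
  (forall u v, 0 <= u -> u <= v -> v <= 1 -> Rabs (om u v) <= C * (al v - al u)) ->
  has_differential al om J -> Rabs (J t - J s) <= C * (al t - al s).
Proof.
  intros Hs Hst Ht Hom HJ.
  assert (H := chain_abs J (fun t => C * al t) al s t Hst). cbv beta in H.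
  rewrite Rmult_minus_distr_l. apply H. intros eps He. destruct (HJ eps He) as [d [Hd B]].
  exists d; split; auto. intros u v Hu Huv Hv Hd'.
  specialize (B u v ltac:(lra) Huv ltac:(lra) Hd'). specialize (Hom u v ltac:(lra) Huv ltac:(lra)).
  apply Rabs_le_between in B. apply Rabs_le_between in Hom. apply Rabs_le. lra.
Qed.

(** * Lipschitz bounds and second order expansion on a box *)

Definition in_box (P X s u xi : R) : Prop := in01 s /\ Rabs u <= P /\ Rabs xi <= X.

Lemma box_between P c a b : Rabs a <= P -> Rabs b <= P -> Rmin a b <= c <= Rmax a b -> Rabs c <= P.
Proof.
  intros Ha Hb. apply Rabs_le_between in Ha. apply Rabs_le_between in Hb.
  intros Hc. apply Rabs_le. revert Hc. apply Rmin_case; apply Rmax_case; intros; lra.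
Qed.

Lemma in01_between c a b : in01 a -> in01 b -> Rmin a b <= c <= Rmax a b -> in01 c.
Proof. unfold in01. intros Ha Hb. apply Rmin_case; apply Rmax_case; intros; lra. Qed.

Lemma box_bounded D P X f : (forall t, in01 t -> D t) -> (forall a b c, D a -> cont3_at f a b c) ->
  exists K, 0 < K /\ forall s u xi, in_box P X s u xi -> Rabs (f s u xi) <= K.
Proof.
  intros HD Hf. destruct (cont3_bounded f 0 1 (- P) P (- X) X) as [K [HK H]].
  - intros a b c Ha _ _. apply Hf, HD. exact Ha.
  - exists K. split; auto. intros s u xi [Hs [Hu Hxi]]. apply H; [exact Hs | |];
      now apply Rabs_le_between.
Qed.

Lemma box_lipschitz D P X f f1 f2 f3 : (forall t, in01 t -> D t) -> has_C1_3 D f f1 f2 f3 ->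
  exists K, 0 < K /\ forall s u xi s' u' xi', in_box P X s u xi -> in_box P X s' u' xi' ->
    Rabs (f s' u' xi' - f s u xi) <= K * (Rabs (s' - s) + Rabs (u' - u) + Rabs (xi' - xi)).
Proof.
  intros HD Hf.
  destruct (box_bounded D P X f1 HD) as [K1 [HK1 B1]]; [intros; now apply Hf|].
  destruct (box_bounded D P X f2 HD) as [K2 [HK2 B2]]; [intros; now apply Hf|].
  destruct (box_bounded D P X f3 HD) as [K3 [HK3 B3]]; [intros; now apply Hf|].
  exists (K1 + K2 + K3). split; [lra|].
  intros s u xi s' u' xi' [Hs [Hu Hxi]] [Hs' [Hu' Hxi']].
  destruct (mean_value (fun v => f v u' xi') (fun v => f1 v u' xi') s s') as [q1 [Hq1 E1]].
  { intros v Hv. apply Hf, HD. now apply (in01_between v s s'). }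
  destruct (mean_value (fun v => f s v xi') (fun v => f2 s v xi') u u') as [q2 [Hq2 E2]].
  { intros v Hv. now apply Hf, HD. }
  destruct (mean_value (fun v => f s u v) (fun v => f3 s u v) xi xi') as [q3 [Hq3 E3]].
  { intros v Hv. now apply Hf, HD. }
  replace (f s' u' xi' - f s u xi) with (f1 q1 u' xi' * (s' - s) + f2 s q2 xi' * (u' - u)
    + f3 s u q3 * (xi' - xi)) by (simpl in *; lra).
  assert (A1 : Rabs (f1 q1 u' xi' * (s' - s)) <= K1 * Rabs (s' - s)).
  { rewrite Rabs_mult. apply Rmult_le_compat_r; [apply Rabs_pos|]. apply B1.
    split; [now apply (in01_between q1 s s') | auto]. }
  assert (A2 : Rabs (f2 s q2 xi' * (u' - u)) <= K2 * Rabs (u' - u)).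
  { rewrite Rabs_mult. apply Rmult_le_compat_r; [apply Rabs_pos|]. apply B2.
    split; auto. split; auto. now apply (box_between P q2 u u'). }
  assert (A3 : Rabs (f3 s u q3 * (xi' - xi)) <= K3 * Rabs (xi' - xi)).
  { rewrite Rabs_mult. apply Rmult_le_compat_r; [apply Rabs_pos|]. apply B3.
    split; auto. split; auto. now apply (box_between X q3 xi xi'). }
  pose proof (Rabs_pos (s' - s)). pose proof (Rabs_pos (u' - u)). pose proof (Rabs_pos (xi' - xi)).
  assert (0 <= K1 * Rabs (u' - u)) by (apply Rmult_le_pos; lra).
  assert (0 <= K1 * Rabs (xi' - xi)) by (apply Rmult_le_pos; lra).
  assert (0 <= K2 * Rabs (s' - s)) by (apply Rmult_le_pos; lra).
  assert (0 <= K2 * Rabs (xi' - xi)) by (apply Rmult_le_pos; lra).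
  assert (0 <= K3 * Rabs (s' - s)) by (apply Rmult_le_pos; lra).
  assert (0 <= K3 * Rabs (u' - u)) by (apply Rmult_le_pos; lra).
  eapply Rle_trans; [apply Rabs_triang|].
  eapply Rle_trans; [apply Rplus_le_compat_r, Rabs_triang|]. lra.
Qed.

Lemma Rabs_between_le (c a b : R) : Rmin a b <= c <= Rmax a b -> Rabs (c - a) <= Rabs (b - a).
Proof.
  unfold Rabs. apply Rmin_case; apply Rmax_case; intros; repeat destruct Rcase_abs; lra.
Qed.

(** Increments of time and of [c] are of order [al], so first order suffices for them, and
    evaluating [f1] and [f2] at displaced points costs only their oscillation. In [x] alone the
    expansion goes to second order. *)
Lemma ito_increment D f f1 f2 f3 f13 f23 f33 al x c L :
  (forall t, in01 t -> D t) -> has_C1_3 D f f1 f2 f3 -> has_C1_3 D f3 f13 f23 f33 ->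
  cont01 x -> cont01 c -> 0 <= L ->
  (forall s t, 0 <= s -> s <= t -> t <= 1 -> t - s <= al t - al s) ->
  dominates (fun t => L * al t) c ->
  forall eps, 0 < eps -> exists d, 0 < d /\ forall r r', in01 r -> in01 r' -> r < r' -> r' - r < d ->
    Rabs (f r' (c r') (x r') - f r (c r) (x r) - (f1 r (c r) (x r) * (r' - r)
      + f2 r (c r) (x r) * (c r' - c r) + f3 r (c r) (x r) * (x r' - x r)
      + / 2 * f33 r (c r) (x r) * (x r' - x r) ^ 2))
    <= eps * (al r' - al r) + eps * (x r' - x r) ^ 2.
Proof.
  intros HD Hf Hf3 Hx Hc HL Hal Hdom eps He.
  destruct (cont01_bounded x Hx) as [X [HX0 HX]]. destruct (cont01_bounded c Hc) as [P [HP0 HP]].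
  set (e := eps / (L + 1)).
  assert (He' : 0 < e) by (unfold e; apply Rdiv_lt_0_compat; lra).
  assert (Hee : e <= eps /\ e * L <= eps).
  { unfold e. split; apply Rmult_le_reg_r with (L + 1); try lra.
    - replace (eps / (L + 1) * (L + 1)) with eps by (field; lra). nra.
    - replace (eps / (L + 1) * L * (L + 1)) with (eps * L) by (field; lra). nra. }
  assert (Hunif : forall g, (forall a b c, D a -> cont3_at g a b c) -> forall w, 0 < w ->
    exists d, 0 < d /\ forall s u v s' u' v', in_box P X s u v -> in_box P X s' u' v' ->
      Rabs (s - s') < d -> Rabs (u - u') < d -> Rabs (v - v') < d -> Rabs (g s u v - g s' u' v') < w).
  { intros g Hg w Hw. assert (Hg' : forall a b c0, 0 <= a <= 1 -> - P <= b <= P -> - X <= c0 <= X -> cont3_at g a b c0).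
    { intros a b c0 Ha _ _. apply Hg, HD. exact Ha. }
    destruct (cont3_uniform g 0 1 (- P) P (- X) X Hg' w Hw) as [d [Hd H]].
    exists d. split; auto. intros s u v s' u' v' [A1 [A2 A3]] [B1 [B2 B3]] ? ? ?.
    apply H; auto; now apply Rabs_le_between. }
  destruct (Hunif f1 ltac:(intros; now apply Hf) (e / 2) ltac:(lra)) as [d1 [Hd1 U1]].
  destruct (Hunif f2 ltac:(intros; now apply Hf) (e / 2) ltac:(lra)) as [d2 [Hd2 U2]].
  destruct (Hunif f33 ltac:(intros; now apply Hf3) e He') as [d3 [Hd3 U3]].
  set (d0 := Rmin d1 (Rmin d2 d3)).
  assert (Hd0 : 0 < d0) by (unfold d0; repeat apply Rmin_pos; auto).
  assert (Hd0' : d0 <= d1 /\ d0 <= d2 /\ d0 <= d3).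
  { unfold d0. pose proof (Rmin_l d1 (Rmin d2 d3)). pose proof (Rmin_r d1 (Rmin d2 d3)).
    pose proof (Rmin_l d2 d3). pose proof (Rmin_r d2 d3). lra. }
  destruct (cont01_uniform x Hx d0 Hd0) as [e1 [He1 X1]].
  destruct (cont01_uniform c Hc d0 Hd0) as [e2 [He2 C1]].
  exists (Rmin d0 (Rmin e1 e2)). split; [repeat apply Rmin_pos; auto|].
  intros r r' Hr Hr' Hrr' Hd.
  pose proof (Rmin_l d0 (Rmin e1 e2)). pose proof (Rmin_r d0 (Rmin e1 e2)).
  pose proof (Rmin_l e1 e2). pose proof (Rmin_r e1 e2).
  assert (Hrd : Rabs (r' - r) < d0) by (rewrite Rabs_right; lra).
  assert (Hxd : Rabs (x r' - x r) < d0) by (apply X1; auto; rewrite Rabs_right; lra).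
  assert (Hcd : Rabs (c r' - c r) < d0) by (apply C1; auto; rewrite Rabs_right; lra).
  assert (Hdc : Rabs (c r' - c r) <= L * (al r' - al r)).
  { unfold in01 in *. specialize (Hdom r r' ltac:(lra) ltac:(lra) ltac:(lra)). cbv beta in Hdom. lra. }
  assert (Hdt : r' - r <= al r' - al r) by (unfold in01 in *; apply Hal; lra).
  assert (HD' : D r) by auto.
  assert (Hbox : in_box P X r (c r) (x r)) by (repeat split; auto; apply Hr).
  destruct (mean_value (fun v => f v (c r') (x r')) (fun v => f1 v (c r') (x r')) r r') as [q1 [Hq1 E1]].
  { intros v Hv. apply Hf, HD. now apply (in01_between v r r'). }
  destruct (mean_value (fun v => f r v (x r')) (fun v => f2 r v (x r')) (c r) (c r')) as [q2 [Hq2 E2]].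
  { intros v Hv. now apply Hf. }
  assert (A1 : Rabs ((f1 q1 (c r') (x r') - f1 r (c r) (x r)) * (r' - r)) <= e / 2 * (al r' - al r)).
  { rewrite Rabs_mult, (Rabs_right (r' - r)) by lra. apply Rmult_le_compat; try lra; [apply Rabs_pos|].
    left. assert (Hq := Rabs_between_le _ _ _ Hq1). apply U1; auto; try lra.
    split; [now apply (in01_between q1 r r') | auto]. }
  assert (A2 : Rabs ((f2 r q2 (x r') - f2 r (c r) (x r)) * (c r' - c r)) <= e / 2 * (L * (al r' - al r))).
  { rewrite Rabs_mult. apply Rmult_le_compat; auto using Rabs_pos.
    left. assert (Hq := Rabs_between_le _ _ _ Hq2). apply U2; auto; try lra.
    - split; [auto|]. split; auto. apply (box_between P q2 (c r) (c r')); auto.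
    - rewrite Rminus_diag, Rabs_R0. lra. }
  (* The increment of [h] is the second order Taylor remainder in [xi]; two mean values, for [h] and
     then for [f3], reduce it to the oscillation of [f33]. *)
  set (h := fun xi => f r (c r) xi - f3 r (c r) (x r) * (xi - x r)
     - / 2 * f33 r (c r) (x r) * (xi - x r) ^ 2).
  assert (A3 : Rabs (h (x r') - h (x r)) <= e * (x r' - x r) ^ 2).
  { destruct (mean_value h (fun xi => f3 r (c r) xi - f3 r (c r) (x r) - f33 r (c r) (x r) * (xi - x r))
      (x r) (x r')) as [q [Hq E]].
    { intros v Hv. assert (Hd3' : is_derive (fun w => f r (c r) w) v (f3 r (c r) v)) by now apply Hf.
      unfold h. apply (is_derive_ext (fun xi => f r (c r) xi - (f3 r (c r) (x r) * (xi - x r)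
        + / 2 * f33 r (c r) (x r) * (xi - x r) ^ 2))); [intros; simpl; ring|].
      replace (f3 r (c r) v - f3 r (c r) (x r) - f33 r (c r) (x r) * (v - x r)) with
        (f3 r (c r) v - (f3 r (c r) (x r) + f33 r (c r) (x r) * (v - x r))) by ring.
      apply (is_derive_minus (V := R_NormedModule)); auto. auto_derive; auto. field. }
    destruct (mean_value (fun xi => f3 r (c r) xi) (fun xi => f33 r (c r) xi) (x r) q) as [q' [Hq' E']].
    { intros v Hv. now apply Hf3. }
    simpl in E'. assert (Hqx := Rabs_between_le _ _ _ Hq). assert (Hqq := Rabs_between_le _ _ _ Hq').
    rewrite E.
    replace (f3 r (c r) q - f3 r (c r) (x r) - f33 r (c r) (x r) * (q - x r)) with
      ((f33 r (c r) q' - f33 r (c r) (x r)) * (q - x r)) by lra.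
    assert (Hbq : Rabs q <= X) by (apply (box_between X q (x r) (x r')); auto).
    assert (Hbq' : Rabs q' <= X) by (apply (box_between X q' (x r) q); auto).
    assert (B : Rabs (f33 r (c r) q' - f33 r (c r) (x r)) <= e).
    { left. apply U3; auto; try (rewrite Rminus_diag, Rabs_R0; lra); [|lra].
      split; auto. }
    rewrite !Rabs_mult. rewrite <- (pow2_abs (x r' - x r)).
    replace (e * Rabs (x r' - x r) ^ 2) with (e * Rabs (x r' - x r) * Rabs (x r' - x r)) by ring.
    apply Rmult_le_compat_r; [apply Rabs_pos|]. apply Rmult_le_compat; auto using Rabs_pos. }
  assert (Hsq : 0 <= (x r' - x r) ^ 2) by apply pow2_ge_0.
  assert (A4 : e / 2 * (al r' - al r) <= eps / 2 * (al r' - al r)) by (apply Rmult_le_compat_r; lra).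
  assert (A5 : e / 2 * (L * (al r' - al r)) <= eps / 2 * (al r' - al r)).
  { rewrite <- Rmult_assoc. apply Rmult_le_compat_r; lra. }
  assert (A6 : e * (x r' - x r) ^ 2 <= eps * (x r' - x r) ^ 2) by (apply Rmult_le_compat_r; lra).
  match goal with |- Rabs ?E0 <= _ => replace E0 with
    ((f1 q1 (c r') (x r') - f1 r (c r) (x r)) * (r' - r) + (f2 r q2 (x r') - f2 r (c r) (x r)) * (c r' - c r)
     + (h (x r') - h (x r))) by (unfold h; simpl in *; lra) end.
  apply Rabs_le_between in A1. apply Rabs_le_between in A2. apply Rabs_le_between in A3.
  apply Rabs_le. lra.
Qed.

(** * The Doss-Sussmann transformation *)

Lemma cont3_fst2 a b c : cont3_at (fun _ b _ => b) a b c.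
Proof. intros eps He. exists eps; auto. Qed.

Lemma cont3_snd a b c : cont3_at (fun _ _ c => c) a b c.
Proof. intros eps He. exists eps; auto. Qed.

Lemma cont01_mult f g : cont01 f -> cont01 g -> cont01 (fun t => f t * g t).
Proof.
  intros Hf Hg.
  apply (cont01_comp3 (fun _ u v => u * v) (fun t => t) f g); auto; [apply cont01_id|].
  intros t Ht. apply cont3_mult; [apply cont3_fst2 | apply cont3_snd].
Qed.

Section Transformation.

Variables (T : nat -> list R) (x qv A alA : R -> R) (b sigma : R -> R -> R) (D : R -> Prop) (M : R).
Variable phi : R -> R -> R -> R.
Hypothesis HT : refining T.
Hypothesis Hx : cont01 x.
Hypothesis Hx0 : x 0 = 0.
Hypothesis Hqv : quad_var T x qv.
Hypothesis HA : cont01 A.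
Hypothesis HalA : dominates alA A.
Hypothesis HalAr : rcont01 alA.
Hypothesis Hb : forall t xi, in01 t -> forall eps, 0 < eps -> exists delta, 0 < delta /\
  forall t' xi', in01 t' -> Rabs (t' - t) < delta -> Rabs (xi' - xi) < delta ->
    Rabs (b t' xi' - b t xi) < eps.
Hypothesis Hb_lip : forall p, 0 < p -> exists L, 0 <= L /\
  forall t xi zeta, in01 t -> - p <= xi <= p -> - p <= zeta <= p ->
    Rabs (b t xi - b t zeta) <= L * Rabs (xi - zeta).
Hypothesis Hb_growth : exists c, 0 <= c /\ forall t xi, in01 t -> Rabs (b t xi) <= c * (1 + Rabs xi).
Hypothesis D_open : open_pred D.
Hypothesis D01 : forall t, in01 t -> D t.
Hypothesis sigma_C2 : C2_2 (fun t _ => D t) sigma.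
Hypothesis M_pos : 0 < M.
Hypothesis sigma_bound : forall t y, D t -> Rabs (d1_2 sigma t y) <= M /\ Rabs (d2_2 sigma t y) <= M.
Hypothesis phi_flow : forall tau xi, D tau ->
  phi tau xi 0 = xi /\ forall t, is_derive (phi tau xi) t (sigma tau (phi tau xi t)).

Let ft := flow_dtau sigma phi.
Let fx := flow_dxi sigma phi.
Let fs := flow_dt sigma phi.
Let fss := flow_dtt sigma phi.

Lemma phi_C1 : has_C1_3 D phi ft fx fs.
Proof. exact (flow_has_C1 D sigma M D_open sigma_C2 M_pos sigma_bound phi phi_flow). Qed.

Lemma fs_C1 : has_C1_3 D fs (flow_dtau_dt sigma phi) (flow_dxi_dt sigma phi) fss.
Proof. exact (flow_dt_has_C1 D sigma M D_open sigma_C2 M_pos sigma_bound phi phi_flow). Qed.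

Lemma coefficients_C1 : exists X1 X2 X3 T1 T2 T3 S1 S2 S3,
  has_C1_3 D fx X1 X2 X3 /\ has_C1_3 D ft T1 T2 T3 /\ has_C1_3 D fss S1 S2 S3.
Proof.
  destruct (flow_second_order D sigma M D_open sigma_C2 M_pos sigma_bound phi phi_flow)
    as [X1 [X2 [X3 [T1 [T2 [T3 [HX HTT]]]]]]].
  destruct (flow_dt_second_order D sigma M D_open sigma_C2 M_pos sigma_bound phi phi_flow)
    as [_ [_ [_ [_ [_ [_ [S1 [S2 [S3 [_ [_ HS]]]]]]]]]]].
  exists X1, X2, X3, T1, T2, T3, S1, S2, S3. auto.
Qed.

Lemma fx_pos s u xi : 0 < fx s u xi.
Proof. apply flow_dxi_pos. Qed.

Lemma fx_inv_C1 : exists I1 I2 I3, has_C1_3 D (fun s u xi => / fx s u xi) I1 I2 I3.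
Proof.
  destruct coefficients_C1 as [X1 [X2 [X3 [_ [_ [_ [_ [_ [_ [HX _]]]]]]]]]].
  do 3 eexists. apply (has_C1_3_comp D Rinv (fun u => - / (u ^ 2)) _ _ _ _ HX).
  intros s u xi _. pose proof (fx_pos s u xi). split.
  - auto_derive; [lra|]. field. lra.
  - apply (ex_derive_continuous (fun u => - / (u ^ 2))). auto_derive.
    assert (0 < fx s u xi * (fx s u xi * 1)) by (apply Rmult_lt_0_compat; lra). lra.
Qed.

Lemma phi_derivatives s u xi : in01 s -> d1_3 phi s u xi = ft s u xi /\ d2_3 phi s u xi = fx s u xi /\
  d3_3 (d3_3 phi) s u xi = fss s u xi.
Proof.
  intros Hs.
  destruct (flow_derivatives D sigma M D_open sigma_C2 M_pos sigma_bound phi phi_flow s u xi (D01 s Hs))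
    as [E1 [E2 [_ E3]]]. auto.
Qed.

Lemma cont01_path f f1 f2 f3 B : has_C1_3 D f f1 f2 f3 -> cont01 B ->
  cont01 (fun s => f s (B s) (x s)).
Proof.
  intros Hf HB. apply (cont01_comp3 f (fun s => s) B x); auto; [apply cont01_id|].
  intros t Ht. now apply Hf, D01.
Qed.

Lemma cont01_b y : cont01 y -> cont01 (fun s => b s (y s)).
Proof.
  intros Hy t Ht eps He. destruct (Hb t (y t) Ht eps He) as [d [Hd H]].
  destruct (Hy t Ht d Hd) as [d' [Hd' H']]. exists (Rmin d d'). split; [now apply Rmin_pos|].
  intros s Hs Hst. pose proof (Rmin_l d d'). pose proof (Rmin_r d d').
  apply H; auto; [lra | apply H'; auto; lra].
Qed.

Let H1 (s u : R) : R := b s (phi s u (x s)) / d2_3 phi s u (x s).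
Let H2 (s u : R) : R := d1_3 phi s u (x s) / d2_3 phi s u (x s).
Let H3 (s u : R) : R := d3_3 (d3_3 phi) s u (x s) / d2_3 phi s u (x s).
Let G2 (s u : R) : R := -1 * H2 s u.
Let G3 (s u : R) : R := - / 2 * H3 s u.

Lemma H_eq s u : in01 s -> H1 s u = b s (phi s u (x s)) * / fx s u (x s) /\
  H2 s u = ft s u (x s) * / fx s u (x s) /\ H3 s u = fss s u (x s) * / fx s u (x s).
Proof.
  intros Hs. unfold H1, H2, H3. destruct (phi_derivatives s u (x s) Hs) as [-> [-> ->]]. auto.
Qed.

Lemma H_cont B : cont01 B -> cont01 (fun s => H1 s (B s)) /\ cont01 (fun s => H2 s (B s)) /\
  cont01 (fun s => H3 s (B s)).
Proof.
  intros HB.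
  destruct coefficients_C1 as [X1 [X2 [X3 [T1 [T2 [T3 [S1 [S2 [S3 [HX [HTT HS]]]]]]]]]]].
  destruct fx_inv_C1 as [I1 [I2 [I3 HI]]].
  assert (HIc := cont01_path _ _ _ _ B HI HB). assert (HTc := cont01_path _ _ _ _ B HTT HB).
  assert (HSc := cont01_path _ _ _ _ B HS HB). assert (Hpc := cont01_path _ _ _ _ B phi_C1 HB).
  assert (Hbc := cont01_b _ Hpc).
  split; [|split].
  - eapply cont01_ext; [|exact (cont01_mult _ _ Hbc HIc)]. intros t Ht. symmetry. now apply H_eq.
  - eapply cont01_ext; [|exact (cont01_mult _ _ HTc HIc)]. intros t Ht. symmetry. now apply H_eq.
  - eapply cont01_ext; [|exact (cont01_mult _ _ HSc HIc)]. intros t Ht. symmetry. now apply H_eq.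
Qed.

Lemma G_cont B : cont01 B -> cont01 (fun s => H1 s (B s)) /\ cont01 (fun s => G2 s (B s)) /\
  cont01 (fun s => G3 s (B s)).
Proof.
  intros HB. destruct (H_cont B HB) as [C1 [C2 C3]]. split; auto. split; now apply cont01_scal.
Qed.

Lemma box_slice_lip X f f1 f2 f3 P : has_C1_3 D f f1 f2 f3 -> (forall t, in01 t -> Rabs (x t) <= X) ->
  exists K, 0 < K /\ forall s u v, in01 s -> Rabs u <= P -> Rabs v <= P ->
    Rabs (f s u (x s) - f s v (x s)) <= K * Rabs (u - v).
Proof.
  intros Hf HX. destruct (box_lipschitz D P X f f1 f2 f3 D01 Hf) as [K [HK H]].
  exists K. split; auto. intros s u v Hs Hu Hv.
  specialize (H s v (x s) s u (x s)). rewrite !Rminus_diag, Rabs_R0 in H.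
  replace (Rabs (u - v)) with (0 + Rabs (u - v) + 0) by ring. apply H; split; auto.
Qed.

Lemma G_lip P : 0 < P -> exists L, 0 < L /\ forall s u v, in01 s -> Rabs u <= P -> Rabs v <= P ->
  Rabs (H1 s u - H1 s v) <= L * Rabs (u - v) /\ Rabs (G2 s u - G2 s v) <= L * Rabs (u - v) /\
  Rabs (G3 s u - G3 s v) <= L * Rabs (u - v).
Proof.
  intros HP. destruct (cont01_bounded x Hx) as [X [HX0 HX]].
  destruct coefficients_C1 as [X1 [X2 [X3 [T1 [T2 [T3 [S1 [S2 [S3 [HXX [HTT HS]]]]]]]]]]].
  destruct fx_inv_C1 as [I1 [I2 [I3 HI]]].
  destruct (box_slice_lip X _ _ _ _ P (has_C1_3_mult D _ _ _ _ _ _ _ _ HTT HI) HX) as [K2 [HK2 B2]].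
  destruct (box_slice_lip X _ _ _ _ P (has_C1_3_mult D _ _ _ _ _ _ _ _ HS HI) HX) as [K3 [HK3 B3]].
  destruct (box_slice_lip X _ _ _ _ P HI HX) as [KI [HKI BI]].
  destruct (box_slice_lip X _ _ _ _ P phi_C1 HX) as [Kp [HKp Bp]].
  destruct (box_bounded D P X (fun s u xi => / fx s u xi) D01) as [KI' [HKI' BI']].
  { intros. now apply HI. }
  destruct (box_bounded D P X phi D01) as [Q [HQ BQ]].
  { intros. now apply phi_C1. }
  destruct (Hb_lip Q HQ) as [Lb [HLb Bb]].
  destruct Hb_growth as [cb [Hcb Bg]].
  set (L1 := Lb * Kp * KI' + cb * (1 + Q) * KI).
  assert (HL1 : 0 <= L1).
  { unfold L1. apply Rplus_le_le_0_compat; repeat apply Rmult_le_pos; lra. }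
  exists (L1 + K2 + K3). split; [lra|]. intros s u v Hs Hu Hv.
  assert (Huv := Rabs_pos (u - v)).
  assert (Hmon : forall L, L <= L1 + K2 + K3 -> L * Rabs (u - v) <= (L1 + K2 + K3) * Rabs (u - v)).
  { intros L HL. apply Rmult_le_compat_r; auto. }
  destruct (H_eq s u Hs) as [U1 [U2 U3]]. destruct (H_eq s v Hs) as [V1 [V2 V3]].
  assert (Hbu : in_box P X s u (x s)) by (split; auto).
  assert (Hbv : in_box P X s v (x s)) by (split; auto).
  split; [|split].
  - rewrite U1, V1.
    replace (_ - _) with ((b s (phi s u (x s)) - b s (phi s v (x s))) * / fx s u (x s)
      + b s (phi s v (x s)) * (/ fx s u (x s) - / fx s v (x s))) by ring.
    apply Rle_trans with (L1 * Rabs (u - v)); [|apply Hmon; lra].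
    assert (C1 : Rabs (b s (phi s u (x s)) - b s (phi s v (x s))) <= Lb * (Kp * Rabs (u - v))).
    { eapply Rle_trans; [apply Bb; auto; apply Rabs_le_between; now apply BQ|].
      apply Rmult_le_compat_l; auto. }
    assert (C2 : Rabs (b s (phi s v (x s))) <= cb * (1 + Q)).
    { eapply Rle_trans; [now apply Bg|]. apply Rmult_le_compat_l; auto. specialize (BQ s v (x s) Hbv). lra. }
    eapply Rle_trans; [apply Rabs_triang|].
    assert (C3 := Rabs_le_prod _ _ _ _ C1 (BI' s u (x s) Hbu)).
    assert (C4 := Rabs_le_prod _ _ _ _ C2 (BI s u v Hs Hu Hv)).
    cbv beta in C3, C4. unfold L1. lra.
  - unfold G2. rewrite U2, V2. rewrite <- Rmult_minus_distr_l, Rabs_mult.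
    replace (Rabs (-1)) with 1 by (rewrite Rabs_left; lra). rewrite Rmult_1_l.
    eapply Rle_trans; [now apply B2|]. apply Hmon. lra.
  - unfold G3. rewrite U3, V3. rewrite <- Rmult_minus_distr_l, Rabs_mult.
    replace (Rabs (- / 2)) with (/ 2) by (rewrite Rabs_left; lra).
    specialize (B3 s u v Hs Hu Hv). cbv beta in B3.
    assert (Hm := Hmon K3 ltac:(lra)).
    assert (Hp := Rabs_pos (fss s u (x s) * / fx s u (x s) - fss s v (x s) * / fx s v (x s))). lra.
Qed.

Lemma fx_inv_bound X s u : in01 s -> Rabs (x s) <= X -> Rabs (/ fx s u (x s)) <= exp (M * X).
Proof.
  intros Hs HX.
  destruct (flow_dxi_bounds D sigma M D_open sigma_C2 M_pos sigma_bound phi phi_flow s u (x s) (D01 s Hs)) as [Hlo _].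
  fold fx in Hlo. pose proof (fx_pos s u (x s)).
  rewrite Rabs_right by (left; now apply Rinv_0_lt_compat).
  apply Rle_trans with (/ exp (- (M * Rabs (x s)))).
  - apply Rinv_le_contravar; [apply exp_pos | exact Hlo].
  - rewrite <- exp_Ropp, Ropp_involutive. apply exp_mono. apply Rmult_le_compat_l; lra.
Qed.

(** Here the bounded derivatives of [sigma] enter: [phi] grows linearly in [u], [/ fx] and [ft] are
    bounded because [x] is, and [fss] is a bounded factor times [sigma] along the flow. *)
Lemma G_growth : exists C, 0 < C /\ forall s u, in01 s ->
  Rabs (H1 s u) <= C * (1 + Rabs u) /\ Rabs (G2 s u) <= C * (1 + Rabs u) /\
  Rabs (G3 s u) <= C * (1 + Rabs u).
Proof.
  destruct (cont01_bounded x Hx) as [X [HX0 HX]].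
  destruct Hb_growth as [cb [Hcb Bg]].
  (* On the degenerate box with [u = xi = 0], [fs] is [sigma s 0], so this bounds [sigma] at the
     origin uniformly in time. *)
  destruct (box_bounded D 0 0 fs D01) as [C0 [HC0 B0]]; [intros; now apply fs_C1|].
  assert (Hs0 : forall s, in01 s -> Rabs (sigma s 0) <= C0).
  { intros s Hs. specialize (B0 s 0 0). unfold fs, flow_dt in B0.
    destruct (phi_flow s 0 (D01 s Hs)) as [E _]. rewrite E in B0. apply B0.
    split; [auto|]. rewrite Rabs_R0. lra. }
  set (e1 := exp (M * X)). set (e2 := exp ((M + 1) * X)).
  assert (He1 : 0 < e1) by apply exp_pos. assert (He2 : 0 < e2) by apply exp_pos.
  set (Kp := (1 + C0) * e2). assert (HKp : 0 < Kp) by (unfold Kp; apply Rmult_lt_0_compat; lra).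
  set (C1 := cb * (1 + Kp) * e1). set (C2 := M * e2 * e1). set (C3 := M * (C0 + M * Kp) * e1).
  assert (HC1 : 0 <= C1) by (unfold C1; repeat apply Rmult_le_pos; lra).
  assert (HC2 : 0 < C2) by (unfold C2; repeat apply Rmult_lt_0_compat; lra).
  assert (HC3 : 0 <= C3).
  { unfold C3. apply Rmult_le_pos; [|lra]. apply Rmult_le_pos; [lra|].
    assert (0 <= M * Kp) by (apply Rmult_le_pos; lra). lra. }
  exists (C1 + C2 + C3). split; [lra|]. intros s u Hs.
  pose proof (Rabs_pos u).
  assert (Hmon : forall C, C <= C1 + C2 + C3 -> C * (1 + Rabs u) <= (C1 + C2 + C3) * (1 + Rabs u)).
  { intros C HC. apply Rmult_le_compat_r; lra. }
  assert (He2' : exp ((M + 1) * Rabs (x s)) <= e2).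
  { apply exp_mono. apply Rmult_le_compat_l; [lra|]. now apply HX. }
  assert (Hphi : Rabs (phi s u (x s)) <= Kp * (1 + Rabs u)).
  { eapply Rle_trans; [apply (flow_growth D sigma M sigma_C2 M_pos sigma_bound phi phi_flow s u (x s) C0); auto|].
    apply Rle_trans with ((Rabs u + C0) * e2); [apply Rmult_le_compat_l; lra|].
    unfold Kp. replace ((1 + C0) * e2 * (1 + Rabs u)) with (((1 + C0) * (1 + Rabs u)) * e2) by ring.
    apply Rmult_le_compat_r; [lra|]. assert (0 <= C0 * Rabs u) by (apply Rmult_le_pos; lra). lra. }
  assert (Hinv := fx_inv_bound X s u Hs (HX s Hs)). fold e1 in Hinv.
  destruct (H_eq s u Hs) as [U1 [U2 U3]]. split; [|split].
  - rewrite U1. apply Rle_trans with (C1 * (1 + Rabs u)); [|apply Hmon; lra].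
    eapply Rle_trans; [apply Rabs_le_prod; [now apply Bg | exact Hinv]|].
    unfold C1. replace (cb * (1 + Kp) * e1 * (1 + Rabs u)) with (cb * ((1 + Kp) * (1 + Rabs u)) * e1) by ring.
    apply Rmult_le_compat_r; [lra|]. apply Rmult_le_compat_l; lra.
  - unfold G2. rewrite U2, Rabs_mult. replace (Rabs (-1)) with 1 by (rewrite Rabs_left; lra).
    rewrite Rmult_1_l. apply Rle_trans with (C2 * (1 + Rabs u)); [|apply Hmon; lra].
    apply Rle_trans with C2.
    + unfold C2. apply Rabs_le_prod; auto. unfold ft.
      eapply Rle_trans; [apply (flow_dtau_bound D sigma M D_open sigma_C2 M_pos sigma_bound phi phi_flow); auto|].
      apply Rmult_le_compat_l; lra.
    + rewrite <- (Rmult_1_r C2) at 1. apply Rmult_le_compat_l; lra.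
  - unfold G3. rewrite U3, Rabs_mult. replace (Rabs (- / 2)) with (/ 2) by (rewrite Rabs_left; lra).
    assert (Hss : Rabs (fss s u (x s) * / fx s u (x s)) <= C3 * (1 + Rabs u)).
    { unfold C3. replace (M * (C0 + M * Kp) * e1 * (1 + Rabs u)) with
        ((M * ((C0 + M * Kp) * (1 + Rabs u))) * e1) by ring.
      apply Rabs_le_prod; auto. unfold fss, flow_dtt. apply Rabs_le_prod.
      - now apply sigma_bound, D01.
      - unfold flow_dt.
        assert (Hl := sigma_lip D sigma M sigma_C2 sigma_bound s (phi s u (x s)) 0 (D01 s Hs)).
        rewrite Rminus_0_r in Hl. specialize (Hs0 s Hs).
        replace (sigma s (phi s u (x s))) with ((sigma s (phi s u (x s)) - sigma s 0) + sigma s 0) by ring.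
        eapply Rle_trans; [apply Rabs_triang|].
        assert (M * Rabs (phi s u (x s)) <= M * (Kp * (1 + Rabs u))) by (apply Rmult_le_compat_l; lra).
        assert (0 <= C0 * Rabs u) by (apply Rmult_le_pos; lra). lra. }
    assert (Hm := Hmon C3 ltac:(lra)). pose proof (Rabs_pos (fss s u (x s) * / fx s u (x s))). lra.
Qed.

(** * The equation for [B] in differential form *)

Let idt (t : R) : R := t.

Lemma dominates_id : dominates idt idt.
Proof. intros s t Hs Hst Ht. unfold idt. rewrite Rabs_right; lra. Qed.

Lemma dominates_qv : dominates qv qv.
Proof.
  intros s t Hs Hst Ht. assert (qv s <= qv t) by (now apply (quad_var_incr T x qv s t HT Hqv)).
  rewrite Rabs_right; lra.
Qed.

Let al0 : R -> R := al123 alA idt qv.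
Let form : (R -> R) -> R -> R -> R := form123 A idt qv H1 G2 G3.

Lemma al0_incr : incr_on 0 1 al0.
Proof. apply (al123_incr A idt qv); auto using dominates_id, dominates_qv. Qed.

Lemma al0_rcont : rcont01 al0.
Proof.
  intros t Ht eps He.
  destruct (HalAr t Ht (eps / 3)) as [d1 [Hd1 B1]]; [lra|].
  destruct (proj2 Hqv t ltac:(unfold in01; lra) (eps / 3)) as [d2 [Hd2 B2]]; [lra|].
  exists (Rmin d1 (Rmin d2 (eps / 3))). split; [repeat apply Rmin_pos; lra|].
  intros s Hs Hst. pose proof (Rmin_l d1 (Rmin d2 (eps / 3))). pose proof (Rmin_r d1 (Rmin d2 (eps / 3))).
  pose proof (Rmin_l d2 (eps / 3)). pose proof (Rmin_r d2 (eps / 3)).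
  specialize (B1 s Hs ltac:(lra)).
  specialize (B2 s ltac:(unfold in01; lra) ltac:(rewrite Rabs_right; lra)).
  apply Rabs_lt_between in B2. unfold al0, al123, idt. lra.
Qed.

Lemma B_integrals B : cont01 B -> exists J1 J2 J3, J1 0 = 0 /\ J2 0 = 0 /\ J3 0 = 0 /\
  (forall t, in01 t -> RS_int (fun s => H1 s (B s)) A 0 t (J1 t) /\
     RS_int (fun s => H2 s (B s)) (fun s => s) 0 t (J2 t) /\
     RS_int (fun s => H3 s (B s)) qv 0 t (J3 t)) /\
  has_differential al0 (form B) (fun t => J1 t - J2 t - / 2 * J3 t).
Proof.
  intros HB. destruct (H_cont B HB) as [C1 [C2 C3]].
  destruct (stieltjes_exists _ A alA C1 HalA) as [J1 [Z1 D1]].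
  destruct (stieltjes_exists _ idt idt C2 dominates_id) as [J2 [Z2 D2]].
  destruct (stieltjes_exists _ qv qv C3 dominates_qv) as [J3 [Z3 D3]].
  exists J1, J2, J3. do 3 (split; auto). split.
  - intros t Ht. split; [|split].
    + assert (E := RS_of_differential _ A alA J1 t C1 HalA D1 Ht). now rewrite Z1, Rminus_0_r in E.
    + assert (E := RS_of_differential _ idt idt J2 t C2 dominates_id D2 Ht). now rewrite Z2, Rminus_0_r in E.
    + assert (E := RS_of_differential _ qv qv J3 t C3 dominates_qv D3 Ht). now rewrite Z3, Rminus_0_r in E.
  - assert (Hparts := fun s t => al123_parts A idt qv alA idt qv HalA dominates_id dominates_qv s t).
    assert (W1 : has_differential al0 (fun s t => H1 s (B s) * (A t - A s)) J1).
    { apply has_differential_weaken with alA; auto. intros s t Hs Hst Ht.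
      destruct (Hparts s t Hs Hst Ht). unfold al0, al123. lra. }
    assert (W2 : has_differential al0 (fun s t => H2 s (B s) * (idt t - idt s)) J2).
    { apply has_differential_weaken with idt; auto. intros s t Hs Hst Ht.
      destruct (Hparts s t Hs Hst Ht). unfold al0, al123. lra. }
    assert (W3 : has_differential al0 (fun s t => H3 s (B s) * (qv t - qv s)) J3).
    { apply has_differential_weaken with qv; auto. intros s t Hs Hst Ht.
      destruct (Hparts s t Hs Hst Ht). unfold al0, al123. lra. }
    eapply has_differential_ext; [| |apply (has_differential_plus _ _ _ _ _
      (has_differential_plus _ _ _ _ _ W1 (has_differential_scal _ _ _ (-1) W2))
      (has_differential_scal _ _ _ (- / 2) W3))].
    + intros s t _ _ _. unfold form, form123, G2, G3. ring.
    + intros t _. cbv beta. ring.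
Qed.

(** Riemann-Stieltjes integrals are unique, so the values in [solves_B] are those constructed in
    [B_integrals]; conversely a function is determined by its differential and its value at 0. *)
Lemma solves_B_iff B z0 : solves_B x A qv b phi z0 B <->
  (cont01 B /\ B 0 = z0 /\ has_differential al0 (form B) B).
Proof.
  split.
  - intros [HB Hs]. destruct (B_integrals B HB) as [J1 [J2 [J3 [Z1 [Z2 [Z3 [HRS HD]]]]]]].
    assert (E : forall t, in01 t -> B t = z0 + (J1 t - J2 t - / 2 * J3 t)).
    { intros t Ht. destruct (Hs t Ht) as [v1 [v2 [v3 [R1 [R2 [R3 E]]]]]].
      destruct (HRS t Ht) as [Q1 [Q2 Q3]]. destruct Ht as [Ht _].
      rewrite E, (RS_unique _ _ _ _ _ _ Ht R1 Q1), (RS_unique _ _ _ _ _ _ Ht R2 Q2),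
        (RS_unique _ _ _ _ _ _ Ht R3 Q3). ring. }
    split; auto. split.
    + rewrite E by (unfold in01; lra). rewrite Z1, Z2, Z3. ring.
    + intros eps He. destruct (HD eps He) as [d [Hd H]]. exists d; split; auto.
      intros s t Hs' Hst Ht Hd'. rewrite !E by (unfold in01; lra).
      specialize (H s t Hs' Hst Ht Hd'). cbv beta in H.
      replace (_ - _ - form B s t) with (J1 t - J2 t - / 2 * J3 t - (J1 s - J2 s - / 2 * J3 s) - form B s t) by ring.
      exact H.
  - intros [HB [H0 HD]]. destruct (B_integrals B HB) as [J1 [J2 [J3 [Z1 [Z2 [Z3 [HRS HD']]]]]]].
    split; auto. intros t Ht. destruct (HRS t Ht) as [Q1 [Q2 Q3]].
    exists (J1 t), (J2 t), (J3 t). do 3 (split; auto).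
    assert (HD2 : has_differential al0 (form B) (fun t => z0 + (J1 t - J2 t - / 2 * J3 t))).
    { intros eps He. destruct (HD' eps He) as [d [Hd H]]. exists d; split; auto.
      intros s u Hs Hsu Hu Hd'. specialize (H s u Hs Hsu Hu Hd'). cbv beta in H.
      replace (_ - _ - form B s u) with (J1 u - J2 u - / 2 * J3 u - (J1 s - J2 s - / 2 * J3 s) - form B s u) by ring.
      exact H. }
    rewrite (has_differential_unique al0 (form B) B _ t Ht HD HD2); [ring|].
    rewrite H0, Z1, Z2, Z3. ring.
Qed.

Lemma B_exists z0 : exists B, B 0 = z0 /\ cont01 B /\ has_differential al0 (form B) B.
Proof.
  apply equation_exists; auto using dominates_id, dominates_qv, cont01_id, G_cont, G_lip, G_growth.
  exact (proj2 Hqv).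
Qed.

Lemma B_unique al B B' :
  (forall s t, 0 <= s -> s <= t -> t <= 1 -> al0 t - al0 s <= al t - al s) ->
  cont01 B -> cont01 B' -> has_differential al (form B) B -> has_differential al (form B') B' ->
  B 0 = B' 0 -> forall t, in01 t -> B t = B' t.
Proof.
  apply equation_unique; auto using dominates_id, dominates_qv, G_lip.
Qed.

Lemma form_identity B s t : in01 s -> fx s (B s) (x s) * form B s t =
  b s (phi s (B s) (x s)) * (A t - A s) - ft s (B s) (x s) * (t - s)
   - / 2 * fss s (B s) (x s) * (qv t - qv s).
Proof.
  intros Hs. unfold form, form123, G2, G3, idt. destruct (H_eq s (B s) Hs) as [-> [-> ->]].
  pose proof (fx_pos s (B s) (x s)). field. lra.
Qed.

Lemma al0_time s t : 0 <= s -> s <= t -> t <= 1 -> t - s <= al0 t - al0 s.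
Proof.
  intros Hs Hst Ht. assert (H := al123_parts A idt qv alA idt qv HalA dominates_id dominates_qv s t Hs Hst Ht).
  unfold al0, al123, idt in *. lra.
Qed.

Lemma B_dominated B : cont01 B -> has_differential al0 (form B) B ->
  exists L, 0 <= L /\ dominates (fun t => L * al0 t) B.
Proof.
  intros HB HD. destruct (G_cont B HB) as [C1 [C2 C3]].
  destruct (cont01_bounded _ C1) as [K1 [HK1 B1]]. destruct (cont01_bounded _ C2) as [K2 [HK2 B2]].
  destruct (cont01_bounded _ C3) as [K3 [HK3 B3]].
  exists (K1 + K2 + K3). split; [lra|]. intros s t Hs Hst Ht. cbv beta. rewrite <- Rmult_minus_distr_l.
  apply (has_differential_bound al0 (form B)); auto. intros u v Hu Huv Hv.
  assert (Hu1 : in01 u) by (unfold in01; lra).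
  specialize (B1 u Hu1). specialize (B2 u Hu1). specialize (B3 u Hu1).
  apply form_bound; auto using dominates_id, dominates_qv; lra.
Qed.

Lemma CBV_of_dominated al f : cont01 f -> dominates al f -> CBV01 f.
Proof. intros Hf Hd. split; auto. now apply dominated_BV with al. Qed.

Lemma drift_integral z : cont01 z -> exists W, W 0 = 0 /\ cont01 W /\
  has_differential al0 (fun s t => b s (z s) * (A t - A s)) W /\
  (forall t, in01 t -> RS_int (fun s => b s (z s)) A 0 t (W t)).
Proof.
  intros Hz. assert (Hbz := cont01_b z Hz).
  destruct (stieltjes_exists _ A alA Hbz HalA) as [W [Z D1]].
  exists W. split; auto. split; [|split].
  - eapply has_differential_cont; [apply (dominates_incr alA A HalA) | | exact D1].
    now apply stieltjes_small.
  - apply has_differential_weaken with alA; auto. intros s t Hs Hst Ht.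
    destruct (al123_parts A idt qv alA idt qv HalA dominates_id dominates_qv s t Hs Hst Ht).
    unfold al0, al123. lra.
  - intros t Ht. assert (E := RS_of_differential _ A alA W t Hbz HalA D1 Ht). now rewrite Z, Rminus_0_r in E.
Qed.

(* The plane [R^2] of parameters is indexed by ['I_2]: the first coordinate is time. *)
Let i0 : fintype.ordinal 2 := @fintype.Ordinal 2 0 eq_refl.
Let i1 : fintype.ordinal 2 := @fintype.Ordinal 2 1 eq_refl.

Lemma ordinal2_cases (i : fintype.ordinal 2) : i = i0 \/ i = i1.
Proof.
  destruct i as [[|[|k]] Hk].
  - left. now apply fintype.ord_inj.
  - right. now apply fintype.ord_inj.
  - discriminate.
Qed.

(** The flow is its own potential: with parameters [(t, B t)], the function [phi] has
    [xi]-derivative [sigma t (z t)] along the path. *)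
Lemma transformed_admissible B : CBV01 B ->
  admissible x (fun t => sigma t (phi t (B t) (x t))).
Proof.
  intros HB.
  assert (Hne : i1 <> i0) by (intros E; discriminate (f_equal (fun i => fintype.nat_of_ord i) E)).
  exists 2%nat, (fun t i => match fintype.nat_of_ord i with O => t | _ => B t end),
    (fun q => D (fst q i0)), (fun q => phi (fst q i0) (fst q i1) (snd q)).
  destruct (has_C1_3_sound D phi _ _ _ phi D_open phi_C1) as [HC1 HD1]; [auto|].
  assert (Hv : forall (g : R -> R -> R -> R) (h : vpt 2 -> R) (q : vpt 2),
    cont3_at g (fst q i0) (fst q i1) (snd q) ->
    (forall q', h q' = g (fst q' i0) (fst q' i1) (snd q')) -> vcont_at h q).
  { intros g h q Hg Hh eps He. destruct (Hg eps He) as [d [Hd H]]. exists d; split; auto.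
    intros q' [Hq1 Hq2]. rewrite !Hh. apply H; auto. }
  assert (Hp0 : forall q : vpt 2, (fun h => phi (vupd (fst q) i0 h i0) (vupd (fst q) i0 h i1) (snd q))
     = (fun h => phi h (fst q i1) (snd q))).
  { intros q. apply functional_extensionality. intros h. now rewrite vupd_same, vupd_other by auto. }
  assert (Hp1 : forall q : vpt 2, (fun h => phi (vupd (fst q) i1 h i0) (vupd (fst q) i1 h i1) (snd q))
     = (fun h => phi (fst q i0) h (snd q))).
  { intros q. apply functional_extensionality. intros h. now rewrite vupd_same, vupd_other by auto. }
  conjs.
  - intros i. destruct (ordinal2_cases i) as [->| ->]; simpl; auto.
    apply CBV_of_dominated with idt; [apply cont01_id | apply dominates_id].
  - intros q Hq. destruct (D_open _ Hq) as [d [Hd H]]. exists d; split; auto.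
    intros q' [Hq1 _]. apply H. apply Hq1.
  - intros t Ht. simpl. now apply D01.
  - intros q Hq. destruct (HC1 _ (fst q i1) (snd q) Hq) as [E1 [E2 [E3 [C0 [C1 [C2 C3]]]]]]. conjs.
    + intros i. destruct (ordinal2_cases i) as [->| ->]; simpl.
      * rewrite Hp0. exact E1.
      * rewrite Hp1. exact E2.
    + exact E3.
    + now apply (Hv phi).
    + intros i. destruct (ordinal2_cases i) as [->| ->].
      * apply (Hv (d1_3 phi)); [exact C1|]. intros q'. unfold vpd. simpl. now rewrite Hp0.
      * apply (Hv (d2_3 phi)); [exact C2|]. intros q'. unfold vpd. simpl. now rewrite Hp1.
    + now apply (Hv (d3_3 phi)).
  - intros a [xi0 Ha] xi Hxi. simpl in *.
    assert (Ed : Derive (fun xi => phi (a i0) (a i1) xi) = fs (a i0) (a i1)).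
    { apply functional_extensionality. intros y. apply is_derive_unique. now apply phi_C1. }
    assert (Edd : Derive (fs (a i0) (a i1)) = fss (a i0) (a i1)).
    { apply functional_extensionality. intros y. apply is_derive_unique. now apply fs_C1. }
    conjs.
    + eexists. now apply phi_C1.
    + rewrite Ed. eexists. now apply fs_C1.
    + rewrite Ed, Edd. apply cont3_slice. now apply fs_C1.
  - intros t Ht. symmetry. unfold vpdxi. simpl. apply is_derive_unique.
    apply phi_C1. now apply D01.
Qed.

Lemma half_fss_cont B : cont01 B -> cont01 (fun s => / 2 * fss s (B s) (x s)).
Proof.
  intros HB. destruct coefficients_C1 as [_ [_ [_ [_ [_ [_ [S1 [S2 [S3 [_ [_ HS]]]]]]]]]]].
  apply cont01_scal. exact (cont01_path _ _ _ _ B HS HB).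
Qed.

(** The sums for the Foellmer integral are what remains of the telescoping sums of [z] once terms
    with known limits are subtracted; their convergence is thus a conclusion. *)
Lemma B_to_solution B z0 : cont01 B -> B 0 = z0 -> has_differential al0 (form B) B ->
  is_solution T x A sigma b z0 (fun t => phi t (B t) (x t)).
Proof.
  intros HB H0 HD. set (z := fun t => phi t (B t) (x t)).
  assert (Hz : cont01 z) by exact (cont01_path _ _ _ _ B phi_C1 HB).
  destruct (B_dominated B HB HD) as [L [HL HLd]].
  destruct (drift_integral z Hz) as [W [W0 [Wc [WD WRS]]]].
  assert (Hz0 : z 0 = z0).
  { unfold z. rewrite Hx0, H0. apply phi_flow. apply D01. unfold in01; lra. }
  split; [exact Hz|]. split.
  { apply transformed_admissible. now apply CBV_of_dominated with (fun t => L * al0 t). }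
  intros t Ht. exists (z t - z0 - W t), (W t). split; [|split; [now apply WRS | cbv beta; fold (z t); ring]].
  set (om := fun r r' => b r (z r) * (A r' - A r)).
  set (wq := fun r r' => / 2 * fss r (B r) (x r) * ((x r' - x r) ^ 2 - (qv r' - qv r))).
  (* By [form_identity], the drift of [B] multiplied by [fx] supplies the term in [A] and cancels
     the time term and the [qv] term of the expansion. What is left is [wq], harmless by
     [quad_var_weighted], and the small error [h]. *)
  set (h := fun r r' => z r' - z r - sigma r (z r) * (x r' - x r) - om r r' - wq r r').
  assert (Lh : is_lim_seq (fun n => sum_le (T n) t h) 0).
  { apply (small_errors_sum T al0 h x qv t HT Hqv al0_incr Ht). intros eps He.
    destruct coefficients_C1 as [X1 [X2 [X3 [_ [_ [_ [_ [_ [_ [HX _]]]]]]]]]].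
    destruct (cont01_bounded _ (cont01_path _ _ _ _ B HX HB)) as [Kx [HKx Bx]].
    destruct (ito_increment D phi ft fx fs _ _ fss al0 x B L D01 phi_C1 fs_C1 Hx HB HL al0_time HLd (eps / 2))
      as [d1 [Hd1 I1]]; [lra|].
    destruct (HD (eps / (2 * Kx))) as [d2 [Hd2 I2]]; [apply Rdiv_lt_0_compat; lra|].
    exists (Rmin d1 d2). split; [now apply Rmin_pos|]. intros r r' Hr Hr' Hrr' Hd.
    specialize (I1 r r' Hr Hr' Hrr' ltac:(eapply Rlt_le_trans; [apply Hd | apply Rmin_l])).
    assert (I2' := I2 r r' (proj1 Hr) ltac:(lra) (proj2 Hr') ltac:(eapply Rlt_le_trans; [apply Hd | apply Rmin_r])).
    assert (I3 := Rabs_le_prod _ _ _ _ (Bx r Hr) I2'). cbv beta in I3.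
    replace (Kx * (eps / (2 * Kx) * (al0 r' - al0 r))) with (eps / 2 * (al0 r' - al0 r)) in I3 by (field; lra).
    assert (Efm := form_identity B r r' Hr).
    set (E0 := fx r (B r) (x r) * (B r' - B r - form B r r')) in *.
    match type of I1 with Rabs ?e <= _ => set (E1 := e) in * end.
    assert (Eh : h r r' = E1 + E0).
    { unfold E0. rewrite Rmult_minus_distr_l, Efm. unfold h, E1, om, wq, z, fs, flow_dt. ring. }
    rewrite Eh.
    assert (0 <= eps / 2 * (x r' - x r) ^ 2) by (apply Rmult_le_pos; [lra | apply pow2_ge_0]).
    eapply Rle_trans; [apply Rabs_triang|]. lra. }
  assert (Lz := telescope_lim T t z HT Ht Hz).
  assert (Lw := sum_differential T al0 om W x qv t HT Hqv al0_incr Ht Wc WD).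
  assert (Lq := quad_var_weighted T x qv _ t HT Hx Hqv (half_fss_cont B HB) Ht).
  cbv beta in Lq.
  unfold follmer_int.
  apply is_lim_seq_ext with (fun n => sum_le (T n) t (fun r r' => z r' - z r) - sum_le (T n) t om
     - sum_le (T n) t wq - sum_le (T n) t h).
  - intros n. rewrite <- !sum_le_minus. apply sum_le_ext. intros r r' _ _. unfold h, z. ring.
  - replace (Finite (z t - z0 - W t)) with (Finite (z t - z 0 - (W t - W 0) - 0 - 0))
      by (f_equal; rewrite Hz0, W0; ring).
    repeat apply is_lim_seq_minus'; auto.
Qed.

(** The initial value has to be read off the equation at [t = 0]: only the cell starting at 0 is
    counted there, so the Foellmer sum is a multiple of an increment of [x] that tends to 0, and
    [W 0 = 0]. *)
Lemma solution_sums z z0 : is_solution T x A sigma b z0 z -> exists W, W 0 = 0 /\ cont01 W /\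
  has_differential al0 (fun s t => b s (z s) * (A t - A s)) W /\ z 0 = z0 /\
  forall t, in01 t -> is_lim_seq (fun n => sum_le (T n) t (fun r r' => sigma r (z r) * (x r' - x r)))
    (z t - z0 - W t).
Proof.
  intros [Hz [_ Hs]]. destruct (drift_integral z Hz) as [W [W0 [Wc [WD WRS]]]].
  assert (Hlim : forall t, in01 t ->
    is_lim_seq (fun n => sum_le (T n) t (fun r r' => sigma r (z r) * (x r' - x r))) (z t - z0 - W t)).
  { intros t Ht. destruct (Hs t Ht) as [v [w [Hv [Hw E]]]].
    rewrite (RS_unique _ _ _ _ _ _ (proj1 Ht) Hw (WRS t Ht)) in E.
    replace (z t - z0 - W t) with v by lra. exact Hv. }
  exists W. do 3 (split; auto). split; auto.
  assert (H01 : in01 0) by (unfold in01; lra).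
  assert (L0 : is_lim_seq (fun n => sum_le (T n) 0 (fun r r' => sigma r (z r) * (x r' - x r)))
     (sigma 0 (z 0) * (x 0 - x 0))).
  { apply is_lim_seq_ext with (fun n => sigma 0 (z 0) * sum_le (T n) 0 (fun r r' => x r' - x r)).
    - intros n. rewrite <- sum_le_scal. apply sum_le_ext. intros r r' Hin Hr.
      destruct (partition01_pair (T n) r r') as [[Hr0 _] _]; auto; [apply HT|].
      now replace r with 0 by lra.
    - apply (is_lim_seq_scal_l _ (sigma 0 (z 0)) (x 0 - x 0)). now apply telescope_lim. }
  assert (L1 := Hlim 0 H01). apply is_lim_seq_unique in L0. apply is_lim_seq_unique in L1.
  rewrite L0 in L1. injection L1. intros E. rewrite W0, Rminus_diag in E. lra.
Qed.

(* Once [c] is Lipschitz with respect to [al], the Ito expansion of [phi] shows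
   that it solves the integral equation. *)
Lemma lipschitz_to_B z z0 c al L : is_solution T x A sigma b z0 z ->
  (forall t, in01 t -> z t = phi t (c t) (x t)) -> cont01 c -> incr_on 0 1 al ->
  (forall s t, 0 <= s -> s <= t -> t <= 1 -> al0 t - al0 s <= al t - al s) ->
  0 <= L -> dominates (fun t => L * al t) c ->
  has_differential (fun t => (1 + L) * al t) (form c) c.
Proof.
  intros Hsol Hzc Hc Hal Hal0 HL HLd.
  destruct (solution_sums z z0 Hsol) as [W [W0 [Wc [WD [Hz0 Hlim]]]]].
  destruct Hsol as [Hz _].
  destruct coefficients_C1 as [X1 [X2 [X3 [T1 [T2 [T3 [S1 [S2 [S3 [HX [HTT HS]]]]]]]]]]].
  assert (Htime : forall s t, 0 <= s -> s <= t -> t <= 1 -> t - s <= al t - al s).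
  { intros s t Hs Hst Ht. assert (B1 := al0_time s t Hs Hst Ht). specialize (Hal0 s t Hs Hst Ht). lra. }
  (* Its increments exceed both those of [al] and those of [L * al], which dominates [c]. *)
  set (al' := fun t => (1 + L) * al t).
  assert (Hal' : forall s t, 0 <= s -> s <= t -> t <= 1 -> 0 <= al t - al s /\
     al t - al s <= al' t - al' s /\ L * al t - L * al s <= al' t - al' s).
  { intros s t Hs Hst Ht. assert (al s <= al t) by (apply Hal; auto). unfold al'.
    assert (0 <= L * (al t - al s)) by (apply Rmult_le_pos; lra). lra. }
  assert (Hparts := fun s t => al123_parts A idt qv alA idt qv HalA dominates_id dominates_qv s t).
  set (q1 := fun s => ft s (c s) (x s)). set (q2 := fun s => fx s (c s) (x s)).
  set (q3 := fun s => / 2 * fss s (c s) (x s)). set (q4 := fun s => -1 * b s (z s)).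
  assert (C1 : cont01 q1) by exact (cont01_path _ _ _ _ c HTT Hc).
  assert (C2 : cont01 q2) by exact (cont01_path _ _ _ _ c HX Hc).
  assert (C3 : cont01 q3) by exact (half_fss_cont c Hc).
  assert (C4 : cont01 q4) by (apply cont01_scal; now apply cont01_b).
  assert (Hint : forall q g be, cont01 q -> cont01 g -> dominates be g ->
    (forall s t, 0 <= s -> s <= t -> t <= 1 -> be t - be s <= al' t - al' s) ->
    exists J, J 0 = 0 /\ cont01 J /\ has_differential al' (fun s t => q s * (g t - g s)) J).
  { intros q g be Hq Hg Hd Hle. destruct (stieltjes_exists q g be Hq Hd) as [J [Z DJ]].
    exists J. split; auto. split.
    - eapply has_differential_cont; [apply (dominates_incr be g Hd) | | exact DJ]. now apply stieltjes_small.
    - now apply has_differential_weaken with be. }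
  destruct (Hint q1 idt idt C1 cont01_id dominates_id) as [J1 [Z1 [K1 D1]]].
  { intros s t Hs Hst Ht. specialize (Htime s t Hs Hst Ht). specialize (Hal' s t Hs Hst Ht). unfold idt. lra. }
  destruct (Hint q2 c (fun t => L * al t) C2 Hc HLd) as [J2 [Z2 [K2 D2]]].
  { intros s t Hs Hst Ht. specialize (Hal' s t Hs Hst Ht). lra. }
  destruct (Hint q3 qv qv C3 (proj2 Hqv) dominates_qv) as [J3 [Z3 [K3 D3]]].
  { intros s t Hs Hst Ht. specialize (Hal' s t Hs Hst Ht). specialize (Hal0 s t Hs Hst Ht).
    specialize (Hparts s t Hs Hst Ht). unfold al0, al123 in Hal0. lra. }
  destruct (Hint q4 A alA C4 HA HalA) as [J4 [Z4 [K4 D4]]].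
  { intros s t Hs Hst Ht. specialize (Hal' s t Hs Hst Ht). specialize (Hal0 s t Hs Hst Ht).
    specialize (Hparts s t Hs Hst Ht). unfold al0, al123 in Hal0. lra. }
  assert (DJ := has_differential_plus _ _ _ _ _ (has_differential_plus _ _ _ _ _ D1 D2)
     (has_differential_plus _ _ _ _ _ D3 D4)).
  set (Om := fun s t => q1 s * (idt t - idt s) + q2 s * (c t - c s) +
     (q3 s * (qv t - qv s) + q4 s * (A t - A s))) in DJ.
  set (J := fun t => J1 t + J2 t + (J3 t + J4 t)) in DJ.
  assert (KJ : cont01 J) by (apply cont01_plus; apply cont01_plus; auto).
  assert (Hal'i : incr_on 0 1 al').
  { intros s t Hs Hst Ht. specialize (Hal' s t Hs Hst Ht). lra. }
  (* [J] integrates the Ito expansion minus the equation. Along the partitions its sums tend to 0 at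
     every [t], so [J] vanishes identically and [Om] itself is [o(d al')]; dividing by [fx] then
     gives the equation for [c]. *)
  assert (HJ0 : forall t, in01 t -> J t = 0).
  { intros t Ht.
    assert (LJ := sum_differential T al' Om J x qv t HT Hqv Hal'i Ht KJ DJ).
    set (om := fun r r' => b r (z r) * (A r' - A r)).
    set (wq := fun r r' => / 2 * fss r (c r) (x r) * ((x r' - x r) ^ 2 - (qv r' - qv r))).
    set (ex := fun r r' => sigma r (z r) * (x r' - x r)).
    set (h := fun r r' => z r' - z r - ex r r' - om r r' - wq r r' - Om r r').
    assert (Lh : is_lim_seq (fun n => sum_le (T n) t h) 0).
    { apply (small_errors_sum T al h x qv t HT Hqv Hal Ht). intros eps He.
      destruct (ito_increment D phi ft fx fs _ _ fss al x c L D01 phi_C1 fs_C1 Hx Hc HL Htime HLd eps He)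
        as [d1 [Hd1 I1]].
      exists d1. split; auto. intros r r' Hr Hr' Hrr' Hd. specialize (I1 r r' Hr Hr' Hrr' Hd).
      match type of I1 with Rabs ?e <= _ => replace (h r r') with e; auto end.
      unfold h, ex, om, wq, Om, q1, q2, q3, q4, idt. rewrite !Hzc by auto. unfold fs, flow_dt. ring. }
    assert (Lz := telescope_lim T t z HT Ht Hz).
    assert (Lw := sum_differential T al0 om W x qv t HT Hqv al0_incr Ht Wc WD).
    assert (Lq := quad_var_weighted T x qv _ t HT Hx Hqv (half_fss_cont c Hc) Ht).
    assert (Lx := Hlim t Ht). fold ex in Lx.
    assert (LO : is_lim_seq (fun n => sum_le (T n) t Om)
      (z t - z 0 - (z t - z0 - W t) - (W t - W 0) - 0 - 0)).
    { apply is_lim_seq_ext with (fun n => sum_le (T n) t (fun r r' => z r' - z r) - sum_le (T n) t ex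
        - sum_le (T n) t om - sum_le (T n) t wq - sum_le (T n) t h).
      - intros n. rewrite <- !sum_le_minus. apply sum_le_ext. intros r r' _ _. unfold h. ring.
      - repeat apply is_lim_seq_minus'; auto. }
    apply is_lim_seq_unique in LJ. apply is_lim_seq_unique in LO. rewrite LJ in LO. injection LO.
    intros E. unfold J in E at 2. rewrite Z1, Z2, Z3, Z4, W0, Hz0 in E. lra. }
  destruct (cont01_bounded x Hx) as [X [HX0 HXb]].
  intros eps He. assert (Hex := exp_pos (M * X)).
  destruct (DJ (eps / exp (M * X))) as [d [Hd H]]; [now apply Rdiv_lt_0_compat|].
  exists d. split; auto. intros s t Hs Hst Ht Hdst. specialize (H s t Hs Hst Ht Hdst).
  assert (Hs1 : in01 s) by (unfold in01; lra). assert (Ht1 : in01 t) by (unfold in01; lra).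
  rewrite !HJ0 in H by auto.
  assert (Hpos := fx_pos s (c s) (x s)).
  assert (Efm := form_identity c s t Hs1).
  assert (EO : 0 - 0 - Om s t = - (fx s (c s) (x s) * (c t - c s - form c s t))).
  { rewrite Rmult_minus_distr_l, Efm. unfold Om, q1, q2, q3, q4, idt. rewrite Hzc by auto. ring. }
  rewrite EO, Rabs_Ropp in H.
  assert (Hi := fx_inv_bound X s (c s) Hs1 (HXb s Hs1)).
  assert (H' := Rabs_le_prod _ _ _ _ Hi H).
  replace (/ fx s (c s) (x s) * (fx s (c s) (x s) * (c t - c s - form c s t)))
    with (c t - c s - form c s t) in H' by (field; lra).
  replace (exp (M * X) * (eps / exp (M * X) * (al' t - al' s))) with (eps * (al' t - al' s)) in H' by (field; lra).
  exact H'.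
Qed.

(** The control is [al0] plus the controls of the components of the parameter path. *)
Lemma control_of_admissible eta : admissible x eta -> exists al K d,
  incr_on 0 1 al /\ rcont01 al /\
  (forall s t, 0 <= s -> s <= t -> t <= 1 -> al0 t - al0 s <= al t - al s) /\
  0 < K /\ 0 < d /\ forall K' t1, K <= K' -> in01 t1 -> chart x eta al K' t1 d.
Proof.
  intros [n [Af [U [f [HAf [HU [HAU [Hf [Hf2 Heta]]]]]]]]].
  destruct (ordinal_list n) as [l Hl].
  set (ali := fun i => proj1_sig (constructive_indefinite_description _ (CBV_dominated _ (HAf i)))).
  assert (Hali : forall i, dominates (ali i) (fun t => Af t i) /\ rcont01 (ali i)).
  { intros i. unfold ali. apply proj2_sig. }
  set (alf := fun t => list_sum (fun i => ali i t) l).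
  destruct (list_sum_control ali l) as [Hinc Hrc].
  { intros i. apply (dominates_incr (ali i) (fun t => Af t i)). apply Hali. }
  { intros i. apply Hali. }
  set (al := fun t => al0 t + alf t).
  destruct (admissible_charts n Af U f l Hl HU Hf Hf2 x eta al ali Hx) as [K [d [HK [Hd H]]]]; auto.
  - intros i. apply HAf.
  - intros i. apply Hali.
  - intros s t Hs Hst Ht. rewrite list_sum_minus. unfold al, alf.
    assert (al0 s <= al0 t) by (apply al0_incr; auto). lra.
  - exists al, K, d. split; [|split; [|split]]; auto.
    + intros s t Hs Hst Ht. unfold al. assert (al0 s <= al0 t) by (apply al0_incr; auto).
      assert (alf s <= alf t) by (apply Hinc; auto). lra.
    + intros t Ht eps He. destruct (al0_rcont t Ht (eps / 2)) as [d1 [Hd1 B1]]; [lra|].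
      destruct (Hrc t Ht (eps / 2)) as [d2 [Hd2 B2]]; [lra|].
      exists (Rmin d1 d2). split; [now apply Rmin_pos|]. intros s Hs Hst.
      specialize (B1 s Hs ltac:(eapply Rlt_le_trans; [apply Hst | apply Rmin_l])).
      specialize (B2 s Hs ltac:(eapply Rlt_le_trans; [apply Hst | apply Rmin_r])).
      unfold al, alf. lra.
    + intros s t Hs Hst Ht. unfold al. assert (alf s <= alf t) by (apply Hinc; auto). lra.
Qed.

(** The path is pulled back by the flow at time [- x t]. The rest verifies the hypotheses of
    [c_lipschitz] from bounds for the flow on a box that contains the paths of [c] and [x]. *)
Lemma solution_transformed z z0 : is_solution T x A sigma b z0 z ->
  exists c al L, cont01 c /\ c 0 = z0 /\ (forall t, in01 t -> z t = phi t (c t) (x t)) /\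
    incr_on 0 1 al /\ (forall s t, 0 <= s -> s <= t -> t <= 1 -> al0 t - al0 s <= al t - al s) /\
    0 <= L /\ dominates (fun t => L * al t) c.
Proof.
  intros Hsol. destruct (solution_sums z z0 Hsol) as [W [W0 [Wc [WD [Hz0 Hlim]]]]].
  destruct Hsol as [Hz [Hadm _]].
  set (c := fun t => phi t (z t) (- x t)).
  assert (Hnx : cont01 (fun t => - x t)).
  { apply cont01_ext with (fun t => -1 * x t); [intros; ring | now apply cont01_scal]. }
  assert (Hc : cont01 c).
  { apply (cont01_comp3 phi (fun t => t) z (fun t => - x t)); auto; [apply cont01_id|].
    intros t Ht. now apply phi_C1, D01. }
  assert (Hzc : forall t, in01 t -> z t = phi t (c t) (x t)).
  { intros t Ht. unfold c.
    rewrite (flow_group D sigma M sigma_C2 M_pos sigma_bound phi phi_flow) by auto.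
    replace (- x t + x t) with 0 by ring. symmetry. now apply phi_flow, D01. }
  assert (Hc0 : c 0 = z0).
  { unfold c. rewrite Hx0, Ropp_0, Hz0. apply phi_flow, D01. unfold in01; lra. }
  destruct (control_of_admissible _ Hadm) as [al [Kc [dc [Hal [Hrc [Hal0 [HKc [Hdc Hch]]]]]]]].
  exists c, al.
  assert (Htime : forall s t, 0 <= s -> s <= t -> t <= 1 -> t - s <= al t - al s).
  { intros s t Hs Hst Ht. assert (B1 := al0_time s t Hs Hst Ht). specialize (Hal0 s t Hs Hst Ht). lra. }
  assert (Hparts := fun s t => al123_parts A idt qv alA idt qv HalA dominates_id dominates_qv s t).
  destruct (cont01_bounded x Hx) as [X [HX0 HXb]]. destruct (cont01_bounded c Hc) as [P [HP0 HPb]].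
  destruct (box_lipschitz D P X phi _ _ _ D01 phi_C1) as [K1 [HK1 B1]].
  destruct (box_lipschitz D P X fs _ _ _ D01 fs_C1) as [K2 [HK2 B2]].
  destruct coefficients_C1 as [X1 [X2 [X3 [_ [_ [_ [_ [_ [_ [HXX _]]]]]]]]]].
  destruct (box_lipschitz D P X fx _ _ _ D01 HXX) as [K3 [HK3 B3]].
  destruct (cont01_bounded _ (cont01_b z Hz)) as [Kb [HKb Bb]].
  set (K := K1 + K2 + Kc + Kb).
  assert (HK : 0 < K) by (unfold K; lra).
  set (k1 := exp (- (M * X))). assert (Hk1 : 0 < k1) by apply exp_pos.
  assert (Hfx : forall s u xi, in_box P X s u xi -> k1 <= fx s u xi).
  { intros s u xi [Hs [_ Hxi]].
    destruct (flow_dxi_bounds D sigma M D_open sigma_C2 M_pos sigma_bound phi phi_flow s u xi (D01 s Hs)) as [Hlo _].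
    eapply Rle_trans; [|apply Hlo]. apply exp_mono.
    assert (M * Rabs xi <= M * X) by (apply Rmult_le_compat_l; lra). lra. }
  assert (HWb : forall s t, 0 <= s -> s <= t -> t <= 1 -> Rabs (W t - W s) <= Kb * (al t - al s)).
  { intros s t Hs Hst Ht.
    apply Rle_trans with (Kb * (al0 t - al0 s)).
    - apply (has_differential_bound al0 (fun s t => b s (z s) * (A t - A s))); auto.
      intros u v Hu Huv Hv. eapply Rle_trans.
      + apply Rabs_le_prod; [apply Bb; unfold in01; lra | apply HalA; auto].
      + apply Rmult_le_compat_l; [lra|]. specialize (Hparts u v Hu Huv Hv). unfold al0, al123. lra.
    - apply Rmult_le_compat_l; [lra | auto]. }
  destruct (c_lipschitz T x qv al c phi fs (fun s => fx s (c s) (x s)) K k1 X P) as [L [HL HLip]]; auto.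
  - intros s t Hs Hst Ht. specialize (Hal0 s t Hs Hst Ht). specialize (Hparts s t Hs Hst Ht).
    unfold al0, al123 in Hal0. lra.
  - intros s s' u u' xi Hs Hs' Hu Hu' Hxi.
    assert (E := B1 s u xi s' u' xi ltac:(split; auto) ltac:(split; auto)).
    rewrite (Rminus_diag xi), Rabs_R0, Rplus_0_r in E. eapply Rle_trans; [apply E|].
    apply Rmult_le_compat_r; [|unfold K; lra]. pose proof (Rabs_pos (s' - s)). pose proof (Rabs_pos (u' - u)). lra.
  - intros s u xi xi' Hs Hu Hxi Hxi'.
    destruct (mean_value (fun v => phi s u v) (fun v => fs s u v) xi xi') as [q [Hq E]].
    { intros v _. now apply phi_C1, D01. }
    simpl in E. rewrite E. rewrite <- Rmult_minus_distr_r, Rabs_mult, <- (pow2_abs (xi' - xi)).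
    replace (K * Rabs (xi' - xi) ^ 2) with (K * Rabs (xi' - xi) * Rabs (xi' - xi)) by ring.
    apply Rmult_le_compat_r; [apply Rabs_pos|].
    assert (E2 := B2 s u xi s u q ltac:(split; auto) ltac:(split; auto; split; auto; now apply (box_between X q xi xi'))).
    rewrite !Rminus_diag, Rabs_R0, !Rplus_0_l in E2. eapply Rle_trans; [apply E2|].
    assert (Hqq := Rabs_between_le _ _ _ Hq).
    apply Rmult_le_compat; try lra; [apply Rabs_pos | unfold K; lra].
  - intros s u u' xi Hs Hu Hu' Hxi.
    destruct (mean_value (fun v => phi s v xi) (fun v => fx s v xi) u u') as [q [Hq E]].
    { intros v _. now apply phi_C1, D01. }
    simpl in E. rewrite E, Rabs_mult. apply Rmult_le_compat_r; [apply Rabs_pos|].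
    assert (Hl := Hfx s q xi ltac:(split; auto; split; auto; now apply (box_between P q u u'))).
    rewrite Rabs_right; lra.
  - intros s s' u u' xi Hs Hs' Hu Hu' Hxi.
    assert (E := B2 s u xi s' u' xi ltac:(split; auto) ltac:(split; auto)).
    rewrite (Rminus_diag xi), Rabs_R0, Rplus_0_r in E. eapply Rle_trans; [apply E|].
    apply Rmult_le_compat_r; [|unfold K; lra]. pose proof (Rabs_pos (s' - s)). pose proof (Rabs_pos (u' - u)). lra.
  - intros s u xi xi' Hs Hu Hxi Hxi'.
    assert (E := B2 s u xi s u xi' ltac:(split; auto) ltac:(split; auto)).
    rewrite !Rminus_diag, Rabs_R0, !Rplus_0_l in E. eapply Rle_trans; [apply E|].
    apply Rmult_le_compat_r; [apply Rabs_pos | unfold K; lra].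
  - intros w Hw. set (e := w / (3 * K3)).
    assert (He : 0 < e) by (unfold e; apply Rdiv_lt_0_compat; lra).
    destruct (cont01_uniform x Hx e He) as [e1 [He1 U1]]. destruct (cont01_uniform c Hc e He) as [e2 [He2 U2]].
    exists (Rmin e (Rmin e1 e2)). split; [repeat apply Rmin_pos; auto|].
    intros s r r' Hs Hr Hr' Hrs Hrs'.
    pose proof (Rmin_l e (Rmin e1 e2)). pose proof (Rmin_r e (Rmin e1 e2)).
    pose proof (Rmin_l e1 e2). pose proof (Rmin_r e1 e2).
    destruct (mean_value (fun v => phi r v (x r')) (fun v => fx r v (x r')) (c r) (c r')) as [q [Hq E]].
    { intros v _. now apply phi_C1, D01. }
    simpl in E. rewrite E, <- Rmult_minus_distr_r, Rabs_mult. apply Rmult_le_compat_r; [apply Rabs_pos|].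
    assert (E2 := B3 s (c s) (x s) r q (x r') ltac:(split; auto)
      ltac:(split; auto; split; auto; apply (box_between P q (c r) (c r')); auto)).
    assert (Hqc : Rabs (q - c s) < e).
    { apply (Rabs_between_dist q (c r) (c r')); auto; apply U2; auto; lra. }
    assert (Hxc : Rabs (x r' - x s) < e) by (apply U1; auto; lra).
    eapply Rle_trans; [apply E2|].
    apply Rle_trans with (K3 * (3 * e)); [apply Rmult_le_compat_l; lra|]. unfold e. right. field. lra.
  - intros s Hs. apply Hfx. split; auto.
  - intros s u xi Hs. now apply phi_C1, D01.
  (* The sums of [kap] are telescoping sums of [z] minus Foellmer sums, hence tend to the drift [W],
     which is Lipschitz relative to [al]. *)
  - intros s t Hs Ht Hst eps He.
    set (kap := fun r r' => phi r' (c r') (x r') - phi r (c r) (x r) - fs r (c r) (x r) * (x r' - x r)).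
    assert (Hk : forall u, in01 u -> is_lim_seq (fun n => sum_le (T n) u kap) (W u)).
    { intros u Hu. apply is_lim_seq_ext with (fun n => sum_le (T n) u (fun r r' => z r' - z r) -
        sum_le (T n) u (fun r r' => sigma r (z r) * (x r' - x r))).
      - intros n. rewrite <- sum_le_minus. apply sum_le_ext. intros r r' Hin _.
        destruct (partition01_pair (T n) r r') as [Hr [Hr' _]]; auto; [apply HT|].
        unfold kap. rewrite !(Hzc r), !(Hzc r') by auto. reflexivity.
      - replace (Finite (W u)) with (Finite (z u - z 0 - (z u - z0 - W u))) by (f_equal; rewrite Hz0; ring).
        apply is_lim_seq_minus'; [now apply telescope_lim | now apply Hlim]. }
    assert (Ls := Hk s Hs). assert (Lt := Hk t Ht).
    apply lim_seq_eps with (eps := eps / 2) in Ls; [|lra]. apply lim_seq_eps with (eps := eps / 2) in Lt; [|lra].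
    destruct Ls as [N1 HN1]. destruct Lt as [N2 HN2]. exists (N1 + N2)%nat. intros n Hn.
    specialize (HN1 n ltac:(lia)). specialize (HN2 n ltac:(lia)).
    assert (E := HWb s t (proj1 Hs) Hst (proj2 Ht)).
    assert (Kb * (al t - al s) <= K * (al t - al s)).
    { apply Rmult_le_compat_r; [|unfold K; lra].
      assert (al s <= al t) by (apply Hal; [apply Hs | auto | apply Ht]). lra. }
    fold kap.
    apply Rabs_lt_between in HN1. apply Rabs_lt_between in HN2. apply Rabs_le_between in E.
    apply Rabs_le. lra.
  - intros t1 Ht1. exists dc. split; auto.
    destruct (Hch K t1 ltac:(unfold K; lra) Ht1) as [x0 [rho [fA [F [Hrho [Hp Hq]]]]]].
    exists x0, rho, fA, F. split; auto. split; auto. intros s Hs Hst.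
    destruct (Hp s Hs Hst) as [P1 [P2 P3]]. split; auto. split; auto.
    rewrite P2, (Hzc s Hs). reflexivity.
  - exists L. do 5 (split; auto). split; auto. intros s t Hs Hst Ht. cbv beta.
    rewrite <- Rmult_minus_distr_l. now apply HLip.
Qed.

Theorem transformation z0 : exists B,
  solves_B x A qv b phi z0 B /\
  (forall B', solves_B x A qv b phi z0 B' -> forall t, in01 t -> B' t = B t) /\
  is_solution T x A sigma b z0 (fun t => phi t (B t) (x t)) /\
  (forall z, is_solution T x A sigma b z0 z -> forall t, in01 t -> z t = phi t (B t) (x t)).
Proof.
  destruct (B_exists z0) as [B [HB0 [HBc HBd]]]. exists B.
  split; [apply solves_B_iff; auto|]. split; [|split].
  - intros B' HB'. apply solves_B_iff in HB'. destruct HB' as [HBc' [HB0' HBd']].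
    apply (B_unique al0 B' B); auto; [intros; lra | congruence].
  - now apply B_to_solution.
  - intros z Hz t Ht.
    destruct (solution_transformed z z0 Hz) as [c [al [L [Hc [Hc0 [Hzc [Hal [Hal0 [HL HLd]]]]]]]]].
    assert (HD := lipschitz_to_B z z0 c al L Hz Hzc Hc Hal Hal0 HL HLd).
    assert (Hle : forall s t, 0 <= s -> s <= t -> t <= 1 ->
      al0 t - al0 s <= (1 + L) * al t - (1 + L) * al s).
    { intros s u Hs Hsu Hu. specialize (Hal0 s u Hs Hsu Hu).
      assert (al s <= al u) by (apply Hal; auto).
      assert (0 <= L * (al u - al s)) by (apply Rmult_le_pos; lra). lra. }
    rewrite (Hzc t Ht). f_equal.
    apply (B_unique (fun t => (1 + L) * al t) c B); auto; [|congruence].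
    now apply has_differential_weaken with al0.
Qed.

End Transformation.

Theorem theorem2p12
  (T : nat -> list R) (x qv A : R -> R) (b sigma : R -> R -> R)
  (alpha beta : Rbar) :
  refining T ->
  cont01 x -> x 0 = 0 ->
  quad_var T x qv ->
  CBV01 A ->
  (* b continuous on [0,1] x R *)
  (forall t xi, in01 t -> forall eps, 0 < eps -> exists delta, 0 < delta /\
     forall t' xi', in01 t' -> Rabs (t' - t) < delta -> Rabs (xi' - xi) < delta ->
       Rabs (b t' xi' - b t xi) < eps) ->
  (* local Lipschitz condition *)
  (forall p, 0 < p -> exists L, 0 <= L /\
     forall t xi zeta, in01 t -> -p <= xi <= p -> -p <= zeta <= p ->
       Rabs (b t xi - b t zeta) <= L * Rabs (xi - zeta)) ->
  (* linear growth condition *)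
  (exists c, 0 <= c /\ forall t xi, in01 t -> Rabs (b t xi) <= c * (1 + Rabs xi)) ->
  (* I = (alpha, beta) is an open interval containing [0,1] *)
  Rbar_lt alpha 0 -> Rbar_lt 1 beta ->
  C2_2 (fun t _ => in_I alpha beta t) sigma ->
  (exists M, forall t xi, in_I alpha beta t ->
     Rabs (d1_2 sigma t xi) <= M /\ Rabs (d2_2 sigma t xi) <= M) ->
  exists phi : R -> R -> R -> R,
    (* (i) phi is the (globally defined, unique) flow *)
    (forall tau xi, in_I alpha beta tau ->
       phi tau xi 0 = xi /\
       (forall t, is_derive (fun u => phi tau xi u) t (sigma tau (phi tau xi t)))) /\
    (forall tau xi (y : R -> R), in_I alpha beta tau ->
       y 0 = xi -> (forall t, is_derive y t (sigma tau (y t))) ->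
       forall t, y t = phi tau xi t) /\
    (* (ii) *)
    C2_3 (fun tau _ _ => in_I alpha beta tau) phi /\
    C2_3 (fun tau _ _ => in_I alpha beta tau) (d3_3 phi) /\
    forall z0 : R,
      (* (iii) *)
      exists B : R -> R,
        solves_B x A qv b phi z0 B /\
        (forall B', solves_B x A qv b phi z0 B' -> forall t, in01 t -> B' t = B t) /\
        (* (iv) *)
        is_solution T x A sigma b z0 (fun t => phi t (B t) (x t)) /\
        (forall z, is_solution T x A sigma b z0 z ->
           forall t, in01 t -> z t = phi t (B t) (x t)).
Proof.
  intros HT Hx Hx0 Hqv HA Hb Hbl Hbg Ha Hbt HC2 [M0 HM0].
  set (D := in_I alpha beta). set (M := Rabs M0 + 1).
  assert (HM : 0 < M) by (unfold M; pose proof (Rabs_pos M0); lra).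
  assert (Hbound : forall t y, D t -> Rabs (d1_2 sigma t y) <= M /\ Rabs (d2_2 sigma t y) <= M).
  { intros t y Ht. destruct (HM0 t y Ht). pose proof (Rle_abs M0). unfold M. lra. }
  assert (HDo : open_pred D).
  { intros t [Ht1 Ht2]. unfold D, in_I.
    assert (H1 : exists d, 0 < d /\ forall t', Rabs (t' - t) < d -> Rbar_lt alpha t').
    { destruct alpha as [a| |]; simpl in *; try tauto.
      - exists (t - a). split; [lra|]. intros t' H. apply Rabs_lt_between in H. lra.
      - exists 1. split; [lra | auto]. }
    assert (H2 : exists d, 0 < d /\ forall t', Rabs (t' - t) < d -> Rbar_lt t' beta).
    { destruct beta as [a| |]; simpl in *; try tauto.
      - exists (a - t). split; [lra|]. intros t' H. apply Rabs_lt_between in H. lra.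
      - exists 1. split; [lra | auto]. }
    destruct H1 as [e1 [He1 B1]]. destruct H2 as [e2 [He2 B2]].
    exists (Rmin e1 e2). split; [now apply Rmin_pos|]. intros t' Ht'.
    pose proof (Rmin_l e1 e2). pose proof (Rmin_r e1 e2). split; [apply B1 | apply B2]; lra. }
  assert (HD01 : forall t, in01 t -> D t).
  { intros t [Ht0 Ht1]. split.
    - apply Rbar_lt_le_trans with 0; auto.
    - apply Rbar_le_lt_trans with 1; auto. }
  destruct (flow_exists D sigma M HC2 HM Hbound) as [phi Hphi].
  exists phi. split; [exact Hphi|]. split.
  { intros tau xi y Ht Hy0 Hy t. apply (flow_unique D sigma M HC2 HM Hbound tau); auto.
    - rewrite Hy0. symmetry. now apply Hphi.
    - now apply Hphi. }
  destruct (flow_C2 D sigma M HDo HC2 HM Hbound phi Hphi) as [F1 F2].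
  split; [exact F1|]. split; [exact F2|].
  intros z0. destruct (CBV_dominated A HA) as [alA [HalA HalAr]].
  exact (transformation T x qv A alA b sigma D M phi HT Hx Hx0 Hqv (proj1 HA) HalA HalAr Hb Hbl Hbg
    HDo HD01 HC2 HM Hbound Hphi z0).
Qed.
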